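(* Let $q,k\ge 1$ be integers, $\psi_\downarrow\in(0,1/q)$, $\psi_\uparrow=1/\psi_\downarrow$, $d_\uparrow>0$, and $\mathfrak g=(q,k,\psi_\downarrow,d_\uparrow)$. There exist $\rho>0$ and $c>0$ depending only on $\mathfrak g$ such that for all $(p,\gamma^* )\in\mathfrak A$, all $d\in[0,d_\uparrow]$ and all integers $n\ge1$, $$\Big|\frac1n I\big(\boldsymbol\sigma^*,\boldsymbol G^*_{\boldsymbol m}(\boldsymbol\sigma^* )\big)-\Big(\frac{d}{k\xi_p}\mathbb E\big[\Lambda(\boldsymbol\psi(\boldsymbol\sigma))\big]-B_\uparrow(d)\Big)\Big|\le c\,n^{-\rho},\qquad(\boldsymbol\psi,\boldsymbol\sigma)\sim p\otimes\gamma^{*\otimes k},$$ where $(\boldsymbol\sigma^*,\boldsymbol m)\sim\gamma^{*\otimes n}\otimes\mathrm{Po}(dn/k)$, $I$ is the mutual information and $B_\uparrow(d)=\sup_{\pi\in\mathcal P^2_{*,\gamma^*}}B_{p,\gamma^*,d}(\pi)$.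
   Context: Notation. $[n]=\{1,\dots,n\}$; $\mathcal P(X)$ is the set of Borel probability measures on $X$; laws on finite sets are identified with their probability mass functions; $\mathrm u(S)$ is the uniform distribution on $S$; $\otimes$ denotes product measures; bold symbols are random; $\Lambda(t)=t\ln t$. Mutual information: $I(\boldsymbol a,\boldsymbol b)=D(\boldsymbol a,\boldsymbol b\|\boldsymbol a\otimes\boldsymbol b)$ is the relative entropy (natural logarithm) of the joint law with respect to the product of the marginal laws. Graphs. A factor graph with $n$ variables and $m$ factors is $G=(v_a,\psi_a)_{a\in[m]}$ with $v_a\in[n]^k$ and $\psi_a\in[\psi_\downarrow,\psi_\uparrow]^{[q]^k}$. For $\sigma\in[q]^n$, $v\in[n]^k$ let $\sigma_v=(\sigma(v_1),\dots,\sigma(v_k))$, and $\psi_G(\sigma)=\prod_{a}\psi_a(\sigma_{v_a})$. Random graphs. Let $p\in\mathcal P([\psi_\downarrow,\psi_\uparrow]^{[q]^k})$. The null model is $\boldsymbol G_m\sim(\mathrm u([n]^k)\otimes p)^{\otimes m}$. For $\sigma\in[q]^n$ the teacher-student model $\boldsymbol G^*_m(\sigma)$ has Radon–Nikodym derivative $G\mapsto\psi_G(\sigma)/\mathbb E[\psi_{\boldsymbol G_m}(\sigma)]$ with respect to $\boldsymbol G_m$. Graphs with random arguments are drawn conditionally on these arguments. Assumptions. For $\psi:[q]^k\to\mathbb R_{\ge0}$, $\gamma,\gamma'\in\mathcal P([q])^k$, $h\in[k]$ let $Z_{\mathrm f}(\psi,\gamma)=\sum_{\tau\in[q]^k}\psi(\tau)\prod_{h'}\gamma_{h'}(\tau_{h'})$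 and $Z_{\mathrm{fm}}(\psi,h,\gamma,\gamma')=\sum_\tau\psi(\tau)\gamma_h(\tau_h)\prod_{h'\ne h}\gamma'_{h'}(\tau_{h'})$. For $\gamma\in\mathcal P([q])$ let $\bar Z_p(\gamma)=\mathbb E[Z_{\mathrm f}(\boldsymbol\psi,(\gamma,\dots,\gamma))]$, $\boldsymbol\psi\sim p$, and $\xi_p=\sup_{\gamma\in\mathcal P([q])}\bar Z_p(\gamma)$. Let $\mathcal P^2_{*,\gamma}$ be the set of $\pi\in\mathcal P(\mathcal P([q]))$ whose mean is $\gamma$. For $\pi_1,\pi_2\in\mathcal P(\mathcal P([q]))$ let $$\nabla_p(\pi_1,\pi_2)=\mathbb E\big[\Lambda(Z_{\mathrm f}(\boldsymbol\psi,\boldsymbol\gamma_1))+(k-1)\Lambda(Z_{\mathrm f}(\boldsymbol\psi,\boldsymbol\gamma_2))-k\Lambda(Z_{\mathrm{fm}}(\boldsymbol\psi,\boldsymbol h,\boldsymbol\gamma_1,\boldsymbol\gamma_2))\big],$$ $(\boldsymbol\psi,\boldsymbol h,\boldsymbol\gamma_1,\boldsymbol\gamma_2)\sim p\otimes\mathrm u([k])\otimes\pi_1^{\otimes k}\otimes\pi_2^{\otimes k}$. Then $\mathfrak A$ is the set of pairs $(p,\gamma^* )\in\mathcal P([\psi_\downarrow,\psi_\uparrow]^{[q]^k})\times\mathcal P([q])$ with $\gamma^*(z)\ge\psi_\downarrow$ for all $z\in[q]$, $\bar Z_p(\gamma^* )=\xi_p$, and $\nabla_p(\pi_1,\pi_2)\ge0$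 for all $\pi_1,\pi_2\in\mathcal P^2_{*,\gamma^*}$. Bethe free entropy. For $d'\in\mathbb Z_{\ge0}$ and sequences $\psi=(\psi_a)$, $h=(h_a)$, $\gamma=(\gamma_{a,h'})$ let $$Z_{\mathrm v}(d',\psi,h,\gamma)=\sum_{\sigma\in[q]}\gamma^*(\sigma)\prod_{a\in[d']}\Big(\sum_{\tau\in[q]^k}\mathbf 1\{\tau_{h_a}=\sigma\}\psi_a(\tau)\prod_{h'\ne h_a}\gamma_{a,h'}(\tau_{h'})\Big).$$ For $\pi\in\mathcal P(\mathcal P([q]))$ let $$B_{p,\gamma^*,d}(\pi)=\mathbb E\big[\xi_p^{-\boldsymbol d}\Lambda(Z_{\mathrm v}(\boldsymbol d,\boldsymbol\psi,\boldsymbol h,\boldsymbol\gamma))\big]-\frac{d(k-1)}{k\xi_p}\mathbb E\big[\Lambda(Z_{\mathrm f}(\boldsymbol\psi_\circ,\boldsymbol\gamma_\circ))\big],$$ where $(\boldsymbol d,\boldsymbol\psi,\boldsymbol h,\boldsymbol\gamma)\sim\mathrm{Po}(d)\otimes(p\otimes\mathrm u([k])\otimes\pi^{\otimes k})^{\otimes\mathbb Z_{>0}}$ and $(\boldsymbol\psi_\circ,\boldsymbol\gamma_\circ)\sim p\otimes\pi^{\otimes k}$. *)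

(* Defs.v *)
From HB Require Import structures.
From mathcomp Require Import all_boot all_order all_algebra.
From mathcomp Require Import all_classical all_reals all_analysis.
From mathcomp Require Import measurable_realfun.

Set Implicit Arguments.
Unset Strict Implicit.
Unset Printing Implicit Defensive.
Import Order.TTheory GRing.Theory Num.Theory.
Import numFieldNormedType.Exports.
Local Open Scope classical_set_scope.
Local Open Scope ring_scope.

(* measurableType requires an inhabited carrier, so the sizes q, k, n >= 1 are
   written q.+1, k.+1, n.+1 throughout. *)

HB.instance Definition _ n := isPointed.Build 'I_n.+1 ord0.
HB.instance Definition _ n := @isMeasurable.Build default_measure_display
  'I_n.+1 discrete_measurable discrete_measurable0
  discrete_measurableC discrete_measurableU.

Lemma measurable_discrete d (T : measurableType d) :
  countable [set: T] -> (forall x : T, measurable [set x]) ->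
  forall A : set T, measurable A.
Proof.
move=> cT mT A; apply: countable_measurable => //.
exact: sub_countable (subset_card_le (@subsetT _ A)) cT.
Qed.

Lemma measurable_set1_tuple d (T : measurableType d) n :
  (forall x : T, measurable [set x]) ->
  forall t : n.-tuple T, measurable [set t].
Proof.
move=> mT t.
rewrite (_ : [set t] = \bigcap_(i in [set: 'I_n])
    ((fun s : n.-tuple T => tnth s i) @^-1` [set tnth t i])).
  apply: fin_bigcap_measurable => // i _.
  by rewrite -[X in measurable X]setTI; exact: measurable_tnth.
apply/seteqP; split => [s -> //|s /= st].
by apply/eq_from_tnth => i; apply: st.
Qed.

Lemma measurable_tuple_ord n m (A : set (m.-tuple 'I_n.+1)) : measurable A.
Proof.
apply: measurable_discrete; first exact: countableP.
exact: measurable_set1_tuple.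
Qed.

Lemma measurable_tuple_ord_nat n m (A : set (m.-tuple 'I_n.+1 * nat)) :
  measurable A.
Proof.
apply: measurable_discrete; first exact: countableP.
move=> [t i]; rewrite (_ : [set _] = [set t] `*` [set i]).
  by apply: measurableX => //; exact: measurable_tuple_ord.
by apply/seteqP; split => [_ -> //|[? ?] /= [-> ->]].
Qed.


HB.instance Definition _ d1 d2 (T1 : measurableType d1)
    (T2 : measurableType d2) :=
  @isMeasurableFun.Build _ _ (T1 * T2)%type T1 fst measurable_fst.
HB.instance Definition _ d1 d2 (T1 : measurableType d1)
    (T2 : measurableType d2) :=
  @isMeasurableFun.Build _ _ (T1 * T2)%type T2 snd measurable_snd.

Definition tcons d (T : measurableType d) n (x : T * n.-tuple T) :
  n.+1.-tuple T := cons_tuple x.1 x.2.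

HB.instance Definition _ d (T : measurableType d) n :=
  @isMeasurableFun.Build _ _ (T * n.-tuple T)%type (n.+1.-tuple T)
    (@tcons d T n) (measurable_cons measurable_fst measurable_snd).

Section laws.
Context {R : realType}.

(* u(S), where S is listed by the nonempty duplicate-free sequence s *)
Definition unif d (T : measurableType d) (s : seq T) : probability T R :=
  mnormalize (msum (fun i => @dirac _ T (nth point s i) R) (size s))
             (@dirac _ T point R).

(* the product law of n independent copies of P *)
Fixpoint iid d (T : measurableType d) (n : nat) (P : probability T R) :
    probability (n.-tuple T) R :=
  if n is m.+1 then distribution (P \x iid m P)%E (@tcons d T m)
  else @dirac _ (0.-tuple T) [tuple] R.

(* The last argument of poisson_prob is a dummy; poisson_prob 0 is dirac 0. *)
Definition Po (r : R) : probability nat R := poisson_prob r 0%N.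

Definition Lambda (t : R) : R := t * ln t.

Definition relative_entropy d (T : measurableType d) (mu nu : probability T R)
    : \bar R :=
  if `[< mu `<< nu >] then
    (\int[mu]_x
      (ln (fine (Radon_Nikodym (charge_of_finite_measure mu) nu x)))%:E)%E
  else +oo%E.

(* I(a, b), as a function of the joint law of (a, b) *)
Definition mutual_information d1 d2 (T1 : measurableType d1)
    (T2 : measurableType d2) (J : probability (T1 * T2)%type R) : \bar R :=
  relative_entropy J (distribution J fst \x distribution J snd)%E.

End laws.

(* [psi_down, psi_up]^([q]^k) for psi_down = lo and psi_up = lo^-1; the
   argument hlo makes this set inhabited and its elements positive. *)
Definition weight (R : realType) (q k : nat) (lo : R)
    (hlo : 0 < lo < q.+1%:R^-1) :=
  {psi : {ffun k.+1.-tuple 'I_q.+1 -> R} |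
    [forall tau, lo <= psi tau <= lo^-1]}.

Section weight.
Context {R : realType} {q k : nat} {lo : R} {hlo : 0 < lo < q.+1%:R^-1}.
Local Notation W := (weight k hlo).

Definition weight_fun (psi : W) : k.+1.-tuple 'I_q.+1 -> R := val psi.

Fact weight_pointP : [forall tau : k.+1.-tuple 'I_q.+1,
  lo <= [ffun=> lo] tau <= lo^-1].
Proof.
apply/forallP => tau; rewrite ffunE lexx /=.
have /andP[lo0 loq] := hlo.
have lo1 : lo <= 1.
  by rewrite (le_trans (ltW loq))// invf_le1 ?ltr0n// ler1n.
by rewrite (le_trans lo1)// -invr1 lef_pV2// posrE.
Qed.

HB.instance Definition _ := Choice.on W.
HB.instance Definition _ := isPointed.Build W
  (@exist {ffun k.+1.-tuple 'I_q.+1 -> R}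
    (fun psi => [forall tau, lo <= psi tau <= lo^-1]) [ffun=> lo]
    weight_pointP).

(* the Borel sigma-algebra, generated by the coordinates *)
Definition weight_measurable : set (set W) :=
  <<s \bigcup_(tau in [set: k.+1.-tuple 'I_q.+1])
        preimage_set_system [set: W] (weight_fun ^~ tau) measurable >>.

HB.instance Definition _ := @isMeasurable.Build default_measure_display W
  weight_measurable (@sigma_algebra0 _ _ _) (@sigma_algebraC _ _)
  (@sigma_algebra_bigcup _ _ _).

Lemma measurable_weight_fun tau :
  measurable_fun [set: W] (weight_fun ^~ tau).
Proof.
move=> _ Y mY; apply: sub_sigma_algebra.
by exists tau => //; exists Y.
Qed.

Lemma weight_fun_bound (psi : W) tau : lo <= weight_fun psi tau <= lo^-1.
Proof. by rewrite /weight_fun; case: psi => psi h /=; exact: (forallP h). Qed.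

Lemma weight_fun_gt0 (psi : W) tau : 0 < weight_fun psi tau.
Proof.
have /andP[lo0 _] := hlo; have /andP[h _] := weight_fun_bound psi tau.
exact: lt_le_trans h.
Qed.

End weight.
Coercion weight_fun : weight >-> Funclass.

Section model.
Context {R : realType} {q k : nat} {lo : R} {hlo : 0 < lo < q.+1%:R^-1}.
Local Notation W := (weight k hlo).
Local Notation PS := (pprobability 'I_q.+1 R).

Definition pmf (gam : PS) (z : 'I_q.+1) : R :=
  fine ((gam : probability 'I_q.+1 R) [set z]).

Section assumptions.
Variable p : probability W R.

Definition Zf (psi : W) (gam : k.+1.-tuple PS) : R :=
  \sum_(tau : k.+1.-tuple 'I_q.+1)
    psi tau * \prod_(h < k.+1) pmf (tnth gam h) (tnth tau h).

Definition Zfm (psi : W) (h : 'I_k.+1) (gam gam' : k.+1.-tuple PS) : R :=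
  \sum_(tau : k.+1.-tuple 'I_q.+1)
    psi tau * pmf (tnth gam h) (tnth tau h) *
    \prod_(h' < k.+1 | h' != h) pmf (tnth gam' h') (tnth tau h').

Definition Zbar (gam : PS) : R :=
  (\int[p]_psi Zf psi (nseq_tuple k.+1 gam))%R.

Definition xi : R := sup (range Zbar).

(* the laws on P([q]) with mean gam *)
Definition mean_eq (gam : PS) : set (probability PS R) :=
  [set pi | forall z, (\int[pi]_x pmf x z)%R = pmf gam z].

Definition nabla (pi1 pi2 : probability PS R) : R :=
  (\int[(p \x unif (enum 'I_k.+1) \x iid k.+1 pi1 \x iid k.+1 pi2)%E]_x
    let: (psi, h, gam1, gam2) := x in
    (Lambda (Zf psi gam1) + (k.+1%:R - 1) * Lambda (Zf psi gam2)
     - k.+1%:R * Lambda (Zfm psi h gam1 gam2)))%R.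

Definition frakA (gams : PS) : Prop :=
  [/\ forall z, lo <= pmf gams z, Zbar gams = xi &
      forall pi1 pi2, mean_eq gams pi1 -> mean_eq gams pi2 ->
        0 <= nabla pi1 pi2].

End assumptions.

Section bethe.
Variables (p : probability W R) (gams : PS) (d : R).

Definition Zv d' (x : d'.-tuple (W * 'I_k.+1 * k.+1.-tuple PS)) : R :=
  \sum_(sigma : 'I_q.+1) pmf gams sigma *
    \prod_(a < d') let: (psi, h, gam) := tnth x a in
      \sum_(tau : k.+1.-tuple 'I_q.+1 | tnth tau h == sigma)
        psi tau * \prod_(h' < k.+1 | h' != h) pmf (tnth gam h') (tnth tau h').

(* Given d = d', Zv only depends on the first d' entries of the i.i.d.
   sequence of triples (psi_a, h_a, gam_a). *)
Definition bethe (pi : probability PS R) : \bar R :=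
  (\int[Po d]_d'
     \int[iid d' (p \x unif (enum 'I_k.+1) \x iid k.+1 pi)%E]_x
       ((xi p ^+ d')^-1 * Lambda (Zv x))%:E
   - (d * (k.+1%:R - 1) / (k.+1%:R * xi p))%:E *
     \int[p \x iid k.+1 pi]_x (Lambda (Zf x.1 x.2))%:E)%E.

Definition bethe_sup : \bar R := ereal_sup [set bethe pi | pi in mean_eq gams].

End bethe.

Section graphs.
Variables (p : probability W R) (n : nat).
Local Notation factor := (k.+1.-tuple 'I_n.+1 * W)%type.

Definition graph := {m : nat & m.-tuple factor}.

HB.instance Definition _ := Choice.on graph.
HB.instance Definition _ := isPointed.Build graph
  (existT (fun m => m.-tuple factor) 0%N [tuple]).

Definition mkgraph m (G : m.-tuple factor) : graph :=
  existT (fun m => m.-tuple factor) m G.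

(* the sigma-algebra of the disjoint union *)
Definition graph_measurable : set (set graph) :=
  [set A | forall m, measurable (@mkgraph m @^-1` A)].

Let graph_measurable0 : graph_measurable set0.
Proof. by move=> m; rewrite preimage_set0. Qed.

Let graph_measurableC A : graph_measurable A -> graph_measurable (~` A).
Proof. by move=> mA m; rewrite -preimage_setC; apply: measurableC; exact: mA. Qed.

Let graph_measurableU (F : (set graph)^nat) :
  (forall i, graph_measurable (F i)) -> graph_measurable (\bigcup_i F i).
Proof.
move=> mF m; rewrite preimage_bigcup.
by apply: bigcup_measurable => i _; exact: mF.
Qed.

HB.instance Definition _ := @isMeasurable.Build default_measure_display graph
  graph_measurable graph_measurable0 graph_measurableC graph_measurableU.

Definition psiG m (G : m.-tuple factor) (sigma : n.+1.-tuple 'I_q.+1) : R :=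
  \prod_(a < m) (tnth G a).2 (map_tuple (tnth sigma) (tnth G a).1).

Definition null_model m : probability (m.-tuple factor) R :=
  iid m (unif (enum {: k.+1.-tuple 'I_n.+1}) \x p)%E.

(* the law of G*_m(sigma), with density psi_G(sigma) / E[psi_{G_m}(sigma)]
   with respect to the null model *)
Definition teacher_student m (sigma : n.+1.-tuple 'I_q.+1) :
    set (m.-tuple factor) -> \bar R :=
  fun A => (\int[null_model m]_(G in A)
    (psiG G sigma / (\int[null_model m]_H psiG H sigma)%R)%:E)%E.

Section teacher_student_probability.
Variables (m : nat) (sigma : n.+1.-tuple 'I_q.+1).

Lemma measurable_psiG : 
  measurable_fun [set: m.-tuple factor] (fun G => psiG G sigma).
Proof.
apply: measurable_prod => a _.
pose f (x : factor) : R := x.2 (map_tuple (tnth sigma) x.1).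
apply: (@measurableT_comp _ _ _ _ _ _ f); last exact: measurable_tnth.
rewrite (_ : f = fun x => \sum_(v : k.+1.-tuple 'I_n.+1)
    (x.1 == v)%:R * x.2 (map_tuple (tnth sigma) v)); last first.
  apply/funext => x; rewrite /f (bigD1 x.1)//= eqxx mul1r big1 ?addr0// => v vx.
  by rewrite eq_sym (negPf vx) mul0r.
apply: measurable_sum => v; apply: measurable_funM.
  apply: (@measurableT_comp _ _ _ _ _ _ (fun u => (u == v)%:R : R)) => //.
  by move=> _ Y _; exact: measurable_tuple_ord.
by apply: (@measurableT_comp _ _ _ _ _ _
  (fun psi : W => psi (map_tuple (tnth sigma) v))) => //;
  exact: measurable_weight_fun.
Qed.

Let lo_gt0 : 0 < lo. Proof. by case/andP: hlo. Qed.

Lemma psiG_bound (G : m.-tuple factor) :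
  lo ^+ m <= psiG G sigma <= lo^-1 ^+ m.
Proof.
rewrite -[m in lo ^+ m]card_ord -[m in lo^-1 ^+ m]card_ord -!prodr_const.
apply/andP; split; apply: ler_prod => a _.
  rewrite ltW//=; by have /andP[] := weight_fun_bound (tnth G a).2
    (map_tuple (tnth sigma) (tnth G a).1).
rewrite ltW ?weight_fun_gt0//=; by have /andP[] :=
  weight_fun_bound (tnth G a).2 (map_tuple (tnth sigma) (tnth G a).1).
Qed.

Lemma psiG_gt0 (G : m.-tuple factor) : 0 < psiG G sigma.
Proof. by apply: prodr_gt0 => a _; exact: weight_fun_gt0. Qed.

Let I := (\int[null_model m]_H (psiG H sigma)%:E)%E.

Let I_bound : ((lo ^+ m)%:E <= I <= (lo^-1 ^+ m)%:E)%E.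
Proof.
have cst_int (c : R) : (\int[null_model m]_H (cst c%:E) H = c%:E)%E.
  by rewrite integral_cst//; move: (@probability_setT _ _ _ (null_model m)) => /= ->; rewrite mule1.
apply/andP; split; rewrite -cst_int; apply: ge0_le_integral => //=.
- by move=> ? _; rewrite lee_fin exprn_ge0// ltW.
- by apply/measurable_EFinP; exact: measurable_psiG.
- by move=> G _; rewrite lee_fin; have /andP[] := psiG_bound G.
- by move=> G _; rewrite lee_fin ltW// psiG_gt0.
- by apply/measurable_EFinP; exact: measurable_psiG.
- by move=> G _; rewrite lee_fin; have /andP[] := psiG_bound G.
Qed.

Let I_fin : I \is a fin_num.
Proof.
have /andP[h1 h2] := I_bound; rewrite ge0_fin_numE ?(le_lt_trans h2) ?ltry//.
by apply: le_trans h1; rewrite lee_fin exprn_ge0// ltW.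
Qed.

Lemma expectation_psiG_gt0 : 0 < (\int[null_model m]_H psiG H sigma)%R.
Proof.
rewrite /Rintegral -/I -lte_fin fineK//; have /andP[h1 _] := I_bound.
by apply: lt_le_trans h1; rewrite lte_fin exprn_gt0.
Qed.

Let den (G : m.-tuple factor) := (psiG G sigma / (\int[null_model m]_H psiG H sigma)%R)%:E.

Let den_ge0 G : (0 <= den G)%E.
Proof.
by rewrite lee_fin divr_ge0 ?ltW ?psiG_gt0 ?expectation_psiG_gt0.
Qed.

Let mden : measurable_fun [set: m.-tuple factor] den.
Proof.
apply/measurable_EFinP; apply: measurable_funM => //; exact: measurable_psiG.
Qed.

Let ts0 : @teacher_student m sigma set0 = 0%E.
Proof. exact: integral_set0. Qed.

Let ts_ge0 A : (0 <= @teacher_student m sigma A)%E.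
Proof. by apply: integral_ge0 => G _; exact: den_ge0. Qed.

Let ts_sigma_additive : semi_sigma_additive (@teacher_student m sigma).
Proof. exact: semi_sigma_additive_nng_induced. Qed.

HB.instance Definition _ := isMeasure.Build _ _ _ (@teacher_student m sigma)
  ts0 ts_ge0 ts_sigma_additive.

Let ts_setT : @teacher_student m sigma setT = 1%E.
Proof.
rewrite /teacher_student; under eq_integral do rewrite mulrC EFinM.
rewrite ge0_integralZl//; last 3 first.
- by apply/measurable_EFinP; exact: measurable_psiG.
- by move=> G _; rewrite lee_fin ltW// psiG_gt0.
- by rewrite lee_fin invr_ge0 ltW// expectation_psiG_gt0.
rewrite -/I -(fineK I_fin) -EFinM mulVf// gt_eqF//.
exact: expectation_psiG_gt0.
Qed.

HB.instance Definition _ :=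
  Measure_isProbability.Build _ _ _ (@teacher_student m sigma) ts_setT.

End teacher_student_probability.

(* the joint law of (x.1, G), where x = (sigma, m) has law
   gams^{\otimes n} \otimes Po(dn/k) and G is the teacher-student graph given x;
   the number of factors is part of the graph *)
Definition joint_law (gams : PS) (d : R) : set (n.+1.-tuple 'I_q.+1 * graph) ->
    \bar R :=
  fun A => (\int[iid n.+1 gams \x Po (d * n.+1%:R / k.+1%:R)]_x
    @teacher_student x.2 x.1 ((fun G => (x.1, mkgraph G)) @^-1` A))%E.

Section joint_law_probability.
Variables (gams : PS) (d : R).

Let measurable_section (A : set (n.+1.-tuple 'I_q.+1 * graph)) sigma m :
  measurable A ->
  measurable ((fun G : m.-tuple factor => (sigma, mkgraph G)) @^-1` A).
Proof.
move=> mA; rewrite -[X in measurable X]setTI.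
suff : measurable_fun [set: m.-tuple factor]
    (fun G => (sigma, mkgraph G) : n.+1.-tuple 'I_q.+1 * graph) by exact.
apply/measurable_fun_pair => //.
by move=> _ Y mY; rewrite setTI; exact: mY.
Qed.

Let jl0 : joint_law gams d set0 = 0%E.
Proof.
by rewrite /joint_law; apply: integral0_eq => x _; rewrite preimage_set0 measure0.
Qed.

Let jl_ge0 A : (0 <= joint_law gams d A)%E.
Proof. by apply: integral_ge0 => x _; exact: measure_ge0. Qed.

Let jl_sigma_additive : semi_sigma_additive (joint_law gams d).
Proof.
move=> F mF tF mUF.
rewrite [X in _ --> X](_ : _ = \sum_(i <oo) joint_law gams d (F i))%E.
  apply/cvg_closeP; split; [exact: is_cvg_nneseries|by rewrite closeE].
rewrite /joint_law -integral_nneseries//; last first.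
  by move=> i _ Y _; exact: measurable_tuple_ord_nat.
apply: eq_integral => x _; rewrite preimage_bigcup.
apply/esym/cvg_lim => //; apply: measure_sigma_additive => [i|].
  exact: measurable_section.
apply/trivIsetP => /= i j _ _ ij; rewrite -preimage_setI.
by move/trivIsetP : tF => /(_ _ _ _ _ ij) ->//; rewrite preimage_set0.
Qed.

HB.instance Definition _ := isMeasure.Build _ _ _ (joint_law gams d)
  jl0 jl_ge0 jl_sigma_additive.

Let jl_setT : joint_law gams d setT = 1%E.
Proof.
rewrite /joint_law (eq_integral (cst 1%E)); last first.
  by move=> x _; rewrite preimage_setT probability_setT.
by rewrite integral_cst//= mul1e probability_setT.
Qed.

HB.instance Definition _ :=
  Measure_isProbability.Build _ _ _ (joint_law gams d) jl_setT.

End joint_law_probability.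

End graphs.
End model.

Arguments joint_law {R q k lo hlo} p n gams d A.

(* Main.v *)
(* The partition function of the graph is a sum of products of factor weights
   over the prior P0, and the mutual information is the mean number of factors
   times the entropy of a single factor, minus Phi = E Lambda (sum_s P0 s prod w).
   Attaching a random factor, or revealing ("pinning") a random spin, acts on
   functionals F of unnormalized weights a : S -> R.  With a Poisson number of
   factors and the compensating weight exp (l (1 - zeta s)), where zeta is the
   mean factor weight, these operators form a semigroup in the rate l and
   preserve the mean of the total mass.  Since zeta depends on s only through
   its type, passing from the teacher-student model to the compensated one costs
   at most the logarithm of the number of types plus l E |1 - zeta|.

   The total correlation of a few random spins telescopes along pinnings, hence
   is small for most numbers of pinned spins; then a few factors attached at
   random see nearly independent spins, and their effect is a Bethe-type
   functional of the marginals.  Moved slightly so that their mean is exactly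
   gamma*, the marginals define a law pi in P^2_{*,gamma*}.  Upper bound: going
   from n to n + 1 vertices changes Phi by the Bethe functional of this pi
   (Aizenman-Sims-Starr).  Lower bound, for any given pi: factors are exchanged
   for one-vertex factors carrying independent messages from pi, and Phi changes
   by nabla (marginals, pi) >= 0 up to errors.  Since gamma* maximizes Zbar, the
   average one-vertex factor has weight xi, which makes all compensations match. *)
Require Import Defs.
From HB Require Import structures.
From mathcomp Require Import all_boot all_order all_algebra.
From mathcomp Require Import all_classical all_reals all_analysis.
From mathcomp Require Import measurable_realfun ring lra.
Set Implicit Arguments.
Unset Strict Implicit.
Unset Printing Implicit Defensive.
Import Order.TTheory GRing.Theory Num.Theory.
Import numFieldNormedType.Exports.
Local Open Scope classical_set_scope.
Local Open Scope ring_scope.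

(** * Integrals against probability laws *)

(** Weights stay unnormalized because [Lambda (x * y) = x * Lambda y + Lambda x * y]: an average of
    [Lambda (mass a)] over random factors already carries the planted probability of these factors,
    so no conditional laws appear. Every operator multiplies the weights by a random vector and
    averages; hence all of them commute and steps can be reordered at will. The compensation
    preserves every linear functional of the weights, not only the total mass. This shapes the error
    analysis: apart from total correlations, errors are kept linear in the mass and in the deviation
    [dev] of the type from gamma*, so they can be evaluated at the prior, where [dev] has mean of
    order n^(-1/2), however many factors and pins precede. It also asks for a form of Pinsker's
    inequality that is linear in the entropy, at the price of a free parameter delta. With T pins
    the error per vertex is of order delta + 1/(delta T) + T n^(-1/2); T = n^(1/4) and delta =
    n^(-1/8) yield the exponent 1/8. Weights are divided by [xi] beforehand, and the resulting ln xi
    terms cancel in the final formula. *)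

Definition Ex d (T : measurableType d) (R : realType) (P : probability T R)
  (f : T -> R) : R := (\int[P]_x f x)%R.

Definition ig d (T : measurableType d) (R : realType) (P : probability T R)
  (f : T -> R) : Prop := P.-integrable setT (EFin \o f).

Section expectation.
Context d (T : measurableType d) (R : realType) (P : probability T R).
Implicit Types f g : T -> R.

Lemma ig_meas f : ig P f -> measurable_fun setT f.
Proof. by move=> /measurable_int/measurable_EFinP. Qed.

Lemma ig_cst c : ig P (fun=> c).
Proof. exact: finite_measure_integrable_cst. Qed.

Lemma igD f g : ig P f -> ig P g -> ig P (fun x => f x + g x).
Proof. by move=> hf hg; apply: eq_integrable (integrableD _ hf hg). Qed.

Lemma igZ c f : ig P f -> ig P (fun x => c * f x).
Proof. by move=> hf; apply: eq_integrable (integrableZl _ c hf). Qed.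

Lemma igN f : ig P f -> ig P (fun x => - f x).
Proof. by move=> /(igZ (-1)); under eq_fun do rewrite mulN1r. Qed.

Lemma igB f g : ig P f -> ig P g -> ig P (fun x => f x - g x).
Proof. by move=> hf /igN; exact: igD. Qed.

Lemma ig_sum I (r : seq I) (F : I -> T -> R) :
  (forall i, ig P (F i)) -> ig P (fun x => \sum_(i <- r) F i x).
Proof.
move=> h; elim: r => [|i r IH].
  by under eq_fun do rewrite big_nil; exact: ig_cst.
by under eq_fun do rewrite big_cons; apply: igD.
Qed.

Lemma ig_le f g : measurable_fun setT f -> ig P g ->
  (forall x, `|f x| <= g x) -> ig P f.
Proof.
move=> mf hg fg; apply: (le_integrable _ _ _ hg) => //; first exact/measurable_EFinP.
by move=> x _ /=; rewrite lee_fin (le_trans (fg x))// ler_norm.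
Qed.

Lemma ig_bounded f c : measurable_fun setT f -> (forall x, `|f x| <= c) -> ig P f.
Proof. by move=> mf fc; apply: ig_le (ig_cst c) fc. Qed.

Lemma ig_norm f : ig P f -> ig P (fun x => `|f x|).
Proof. by move=> h; have := integrable_norm h. Qed.

Lemma Ex_cst c : Ex P (fun=> c) = c.
Proof.
rewrite /Ex Rintegral_cst// [X in fine X](_ : _ = 1%E) ?mulr1//.
exact: probability_setT.
Qed.

Lemma ExD f g : ig P f -> ig P g -> Ex P (fun x => f x + g x) = Ex P f + Ex P g.
Proof. exact: RintegralD. Qed.

Lemma ExZ c f : ig P f -> Ex P (fun x => c * f x) = c * Ex P f.
Proof. by move=> h; rewrite /Ex RintegralZl. Qed.

Lemma ExB f g : ig P f -> ig P g -> Ex P (fun x => f x - g x) = Ex P f - Ex P g.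
Proof. exact: RintegralB. Qed.

Lemma Ex_le f g : ig P f -> ig P g -> (forall x, f x <= g x) -> Ex P f <= Ex P g.
Proof. by move=> hf hg fg; apply: le_Rintegral. Qed.

Lemma Ex_ge0 f : (forall x, 0 <= f x) -> 0 <= Ex P f.
Proof. by move=> h; apply: Rintegral_ge0. Qed.

Lemma Ex_abs f : ig P f -> `|Ex P f| <= Ex P (fun x => `|f x|).
Proof. exact: le_normr_Rintegral. Qed.

Lemma Ex_abs_le f g : ig P f -> ig P g -> (forall x, `|f x| <= g x) ->
  `|Ex P f| <= Ex P g.
Proof.
by move=> hf hg fg; apply: le_trans (Ex_abs hf) _; apply: Ex_le => //; exact: ig_norm.
Qed.

Lemma Ex_sum I (r : seq I) (F : I -> T -> R) : (forall i, ig P (F i)) ->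
  Ex P (fun x => \sum_(i <- r) F i x) = \sum_(i <- r) Ex P (F i).
Proof.
move=> h; elim: r => [|i r IH].
  by under eq_fun do rewrite big_nil; rewrite big_nil Ex_cst.
under eq_fun do rewrite big_cons; rewrite big_cons ExD ?IH//.
exact: ig_sum.
Qed.

Lemma Ex_le_cst f c : ig P f -> (forall x, f x <= c) -> Ex P f <= c.
Proof. by move=> h fc; rewrite -(Ex_cst c); apply: Ex_le => //; exact: ig_cst. Qed.

Lemma Ex_ge_cst f c : ig P f -> (forall x, c <= f x) -> c <= Ex P f.
Proof. by move=> h fc; rewrite -(Ex_cst c); apply: Ex_le => //; exact: ig_cst. Qed.

Lemma EFin_Ex f : ig P f -> (\int[P]_x (f x)%:E)%E = (Ex P f)%:E.
Proof.
move=> h; rewrite /Ex /Rintegral fineK//.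
exact: (integrable_fin_num _ h).
Qed.

End expectation.

Section fubini.
Context d1 d2 (T1 : measurableType d1) (T2 : measurableType d2) (R : realType).
Variables (P1 : probability T1 R) (P2 : probability T2 R).
Implicit Type f : T1 -> T2 -> R.

(** Domination by a product of integrable functions of one variable is the form of Fubini needed for
    unbounded integrands: the growth constant of a random operator multiplies that of a random
    functional. *)
Lemma ig_prod f g h :
  measurable_fun setT (fun z : T1 * T2 => f z.1 z.2) -> ig P1 g -> ig P2 h ->
  (forall x y, `|f x y| <= g x * h y) -> ig (P1 \x P2)%E (fun z => f z.1 z.2).
Proof.
move=> mf hg hh fgh; apply/integrable12ltyP; first exact/measurable_EFinP.
have hg' := ig_norm hg; have hh' := ig_norm hh.
apply: (@le_lt_trans _ _ (\int[P1]_x \int[P2]_y ((`|g x| * `|h y|)%:E))%E).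
  apply: ge0_le_integral => //=.
  - by move=> x _; apply: integral_ge0.
  - apply: (measurable_fun_fubini_tonelli_F (fun z : T1 * T2 => `|(f z.1 z.2)%:E|)%E) => //=.
    by apply/measurable_EFinP; exact: measurableT_comp.
  - apply: (measurable_fun_fubini_tonelli_F (fun z : T1 * T2 => (`|g z.1| * `|h z.2|)%:E)%E) => //=.
    apply/measurable_EFinP; apply: measurable_funM; apply: measurableT_comp => //.
      by apply: measurableT_comp (ig_meas hg) _.
    by apply: measurableT_comp (ig_meas hh) _.
  move=> x _; have mfx : measurable_fun setT (f x).
    exact: (measurableT_comp mf (pair1_measurable x)).
  apply: ge0_le_integral => //=.
  - by apply/measurable_EFinP; exact: measurableT_comp.
  - by apply/measurable_EFinP; apply: measurable_funM => //; exact: ig_meas hh'.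
  - by move=> y _; rewrite lee_fin (le_trans (fgh x y))// -normrM ler_norm.
rewrite (eq_integral (fun x => (`|g x| * Ex P2 (fun y => `|h y|))%:E)).
  rewrite EFin_Ex ?ltry//.
  by under eq_fun do rewrite mulrC; apply: igZ.
move=> x _; rewrite EFin_Ex; last exact: igZ.
by rewrite ExZ.
Qed.

Section dominated.
Variables (f : T1 -> T2 -> R) (g : T1 -> R) (h : T2 -> R).
Hypotheses (mf : measurable_fun setT (fun z : T1 * T2 => f z.1 z.2))
  (hg : ig P1 g) (hh : ig P2 h)
  (fgh : forall x y, `|f x y| <= g x * h y).

Lemma ig_section1 x : ig P2 (f x).
Proof.
apply: ig_le (igZ (g x) hh) _; last exact: fgh.
exact: (measurableT_comp mf (pair1_measurable x)).
Qed.

Lemma ig_section2 y : ig P1 (f^~ y).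
Proof.
apply: ig_le (igZ (h y) hg) _; last by move=> x; rewrite mulrC; exact: fgh.
exact: (measurableT_comp mf (pair2_measurable y)).
Qed.

Lemma ig_Ex2 : ig P1 (fun x => Ex P2 (f x)).
Proof.
have := integrable_fubini_F (ig_prod mf hg hh fgh).
by apply: eq_integrable => // x _ /=; rewrite /fubini_F EFin_Ex//; exact: ig_section1.
Qed.

Lemma Ex_prod1 : Ex (P1 \x P2)%E (fun z => f z.1 z.2) = Ex P1 (fun x => Ex P2 (f x)).
Proof.
apply: EFin_inj; rewrite -EFin_Ex; last exact: ig_prod mf hg hh fgh.
rewrite -(integral12_prod_meas1 (ig_prod mf hg hh fgh)) -EFin_Ex; last exact: ig_Ex2.
by apply: eq_integral => x _; rewrite /fubini_F EFin_Ex//; exact: ig_section1.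
Qed.

Lemma Ex_swap : Ex P1 (fun x => Ex P2 (f x)) = Ex P2 (fun y => Ex P1 (f^~ y)).
Proof.
have hp := ig_prod mf hg hh fgh.
apply: EFin_inj; rewrite -EFin_Ex; last exact: ig_Ex2.
rewrite -EFin_Ex.
  transitivity (\int[P1]_x \int[P2]_y (f x y)%:E)%E.
    by apply: eq_integral => x _; rewrite EFin_Ex//; exact: ig_section1.
  rewrite (Fubini hp).
  by apply: eq_integral => y _; rewrite EFin_Ex//; exact: ig_section2.
have mG := measurable_fubini_G hp.
apply: (ig_le (g := fun y => Ex P1 g * h y)); last 2 first.
- exact: igZ.
- move=> y; rewrite mulrC -ExZ//; apply: Ex_abs_le.
  + exact: ig_section2.
  + exact: igZ.
  + by move=> x; rewrite mulrC.
apply/measurable_EFinP; apply: eq_measurable_fun mG => y _.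
by rewrite /fubini_G /= EFin_Ex//; exact: ig_section2.
Qed.

End dominated.

(** Tonelli makes the integrals of the positive and the negative part measurable in x; [fine] of
    their difference is then measurable, also where that difference is infinite. *)
Lemma measurable_Ex f : measurable_fun setT (fun z : T1 * T2 => f z.1 z.2) ->
  measurable_fun setT (fun x => Ex P2 (f x)).
Proof.
move=> mf; apply: measurableT_comp => //.
under eq_fun do rewrite integralE.
apply: emeasurable_funB.
- have h := @measurable_fun_fubini_tonelli_F _ _ _ _ _ P2
    ((EFin \o (fun z : T1 * T2 => f z.1 z.2))^\+)%E.
  have hm : measurable_fun setT (EFin \o (fun z : T1 * T2 => f z.1 z.2))^\+%E.
    by apply: measurable_funepos; exact/measurable_EFinP.
  have {}h := h hm (fun z => funepos_ge0 _ z).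
  by apply: eq_measurable_fun h => x _; apply: eq_integral => y _; rewrite !funeposE.
- have h := @measurable_fun_fubini_tonelli_F _ _ _ _ _ P2
    ((EFin \o (fun z : T1 * T2 => f z.1 z.2))^\-)%E.
  have hm : measurable_fun setT (EFin \o (fun z : T1 * T2 => f z.1 z.2))^\-%E.
    by apply: measurable_funeneg; exact/measurable_EFinP.
  have {}h := h hm (fun z => funeneg_ge0 _ z).
  by apply: eq_measurable_fun h => x _; apply: eq_integral => y _; rewrite !funenegE.
Qed.

End fubini.

Section transfer.
Context d (T : measurableType d) (R : realType).

Lemma Ex_map d' (T' : measurableType d') (P : probability T R)
    (X : {RV P >-> T'}) (f : T' -> R) : measurable_fun setT f ->
  (forall x, 0 <= f x) \/ ig P (f \o X) ->
  Ex (distribution P X) f = Ex P (f \o X).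
Proof.
move=> mf [f0|hf]; rewrite /Ex /Rintegral; congr fine.
  by rewrite ge0_integral_distribution//; exact/measurable_EFinP.
rewrite integral_distribution//; first exact/measurable_EFinP.
Qed.

Lemma Ex_dirac (x : T) (f : T -> R) : measurable_fun setT f ->
  Ex (@dirac _ T x R) f = f x.
Proof.
move=> mf; rewrite /Ex /Rintegral integral_dirac//; last exact/measurable_EFinP.
by rewrite diracT mul1e.
Qed.

Lemma mnormalizeE (mu : {measure set T -> \bar R}) (c : R) (P : probability T R) A :
  mu setT = c%:E -> c != 0 -> mnormalize mu P A = (mu A * c^-1%:E)%E.
Proof. by move=> mc c0; rewrite /mnormalize mc eqe (negPf c0). Qed.

Lemma Ex_unif (s : seq T) (f : T -> R) : measurable_fun setT f -> s != [::] ->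
  Ex (unif s) f = (size s)%:R^-1 * \sum_(x <- s) f x.
Proof.
move=> mf s0.
have Hge0 (g : T -> R) : measurable_fun setT g -> (forall x, 0 <= g x) ->
    (\int[unif s]_x (g x)%:E = ((size s)%:R^-1 * \sum_(x <- s) g x)%:E)%E.
  move=> mg g0; have mg' : measurable_fun setT (EFin \o g) by exact/measurable_EFinP.
  have sz : (0 < size s)%N by rewrite lt0n size_eq0.
  have i0 : 0 <= (size s)%:R^-1 :> R by rewrite invr_ge0.
  have muT : msum (fun i => @dirac _ T (nth point s i) R) (size s) setT
      = (size s)%:R%:E.
    rewrite /msum/= (eq_bigr (fun=> 1%E)); last by move=> i _; rewrite diracT.
    by rewrite sumEFin sumr_const card_ord.
  transitivity (\int[mscale (NngNum i0)
      (msum (fun i => @dirac _ T (nth point s i) R) (size s))]_x (g x)%:E)%E.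
    apply: eq_measure_integral => A mA _.
    have c0 : (size s)%:R != 0 :> R by rewrite pnatr_eq0 eqn0Ngt sz.
    apply: etrans (mnormalizeE _ A muT c0) _.
    by rewrite /mscale /= muleC.
  rewrite ge0_integral_mscale//; last by move=> x _; rewrite lee_fin.
  rewrite ge0_integral_measure_sum//; last by move=> x _; rewrite lee_fin.
  rewrite (eq_bigr (fun i : 'I_(size s) => (g (nth point s i))%:E)); last first.
    by move=> i _; rewrite integral_dirac// diracT mul1e.
  by rewrite sumEFin -EFinM (big_nth point) big_mkord.
have I (g : T -> R) : measurable_fun setT g -> (forall x, 0 <= g x) -> ig (unif s) g.
  move=> mg g0; apply/integrableP; split; first exact/measurable_EFinP.
  rewrite (eq_integral (fun x => (g x)%:E)); last by move=> x _ /=; rewrite ger0_norm.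
  by rewrite Hge0// ltry.
have mp : measurable_fun setT (fun x => Num.max (f x) 0) by exact: measurable_maxr.
have mn : measurable_fun setT (fun x => Num.max (- f x) 0).
  by apply: measurable_maxr => //; exact: measurableT_comp.
have E x : f x = Num.max (f x) 0 - Num.max (- f x) 0.
  case: (leP 0 (f x)) => h.
    by rewrite (@max_r _ _ (- f x)) ?subr0// oppr_le0.
  by rewrite (@max_l _ _ (- f x)) ?oppr_ge0 ?ltW// sub0r opprK.
have -> : f = (fun x => Num.max (f x) 0 - Num.max (- f x) 0) by apply/funext.
rewrite ExB; try (apply: I => // x; by rewrite le_max lexx orbT).
rewrite /Ex /Rintegral !Hge0//; try (move=> x; by rewrite le_max lexx orbT).
by rewrite /= -mulrBr -sumrB.
Qed.

End transfer.
Arguments measurable_Ex {d1 d2 T1 T2 R} P2 f _.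
#[global] Opaque Ex.

(** Bounded measurable functions are integrable for every law and closed under sums, products,
    [Lambda] and partial integration, which disposes of the side conditions whenever the number of
    factors is fixed. *)
Definition bm d (T : measurableType d) (R : realType) (f : T -> R) : Prop :=
  measurable_fun setT f /\ exists c, forall x, `|f x| <= c.

(** * The function t ln t *)

Section lambda.
Context {R : realType}.
Local Notation Lam := (@Lambda R).

Lemma Lambda0 : Lam 0 = 0. Proof. by rewrite /Lambda mul0r. Qed.

Lemma Lambda1 : Lam 1 = 0. Proof. by rewrite /Lambda ln1 mulr0. Qed.

Lemma ln_le_sub1 (x : R) : 0 < x -> ln x <= x - 1.
Proof.
move=> x0; have := @expR_ge1Dx R (ln x); rewrite lnK//; lra.
Qed.

Lemma ln_abs_le (x : R) : 0 < x -> `|ln x| <= x + x^-1.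
Proof.
move=> x0; have h1 := ln_le_sub1 x0.
have xi : 0 < x^-1 by rewrite invr_gt0.
have := ln_le_sub1 xi; rewrite lnV// => h2.
by rewrite ler_norml; apply/andP; split; lra.
Qed.

Lemma LambdaM (x y : R) : 0 < x -> 0 <= y -> Lam (x * y) = x * Lam y + Lam x * y.
Proof.
move=> x0; rewrite le_eqVlt => /predU1P[<-|y0]; first by rewrite !(mulr0,Lambda0) addr0.
by rewrite /Lambda lnM//; ring.
Qed.

(** [ln] is 0 off the positive half-line, so all real t are covered. This bound is the origin of the
    quadratic growth condition [grow]. *)
Lemma Lambda_bound (t : R) : `|Lam t| <= 1 + t ^+ 2.
Proof.
have [t0|t0] := leP t 0.
  by rewrite /Lambda ln0// mulr0 normr0 addr_ge0// sqr_ge0.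
rewrite /Lambda normrM gtr0_norm//.
have := ln_abs_le t0; rewrite -(ler_pM2l t0) mulrDr mulfV ?gt_eqF// addrC expr2.
by [].
Qed.

Lemma measurable_Lambda : measurable_fun setT Lam.
Proof. by apply: measurable_funM => //; exact: measurable_ln. Qed.

Lemma Lambda_ge (t : R) : 0 <= t -> t - 1 <= Lam t.
Proof.
rewrite le_eqVlt => /predU1P[<-|t0]; first by rewrite Lambda0; lra.
have ti : 0 < t^-1 by rewrite invr_gt0.
have := ln_le_sub1 ti; rewrite lnV// -(ler_pM2l t0) mulrN mulrBr mulfV ?gt_eqF//.
by rewrite /Lambda; lra.
Qed.

(** A mean value estimate without derivatives: for x <= y the difference is
    [(y - x) * ln y + x * (ln y - ln x)], and the second part is at most y - x by
    [ln u <= u - 1]. *)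
Lemma Lambda_lip (l h x y : R) : 0 < l -> l <= x <= h -> l <= y <= h ->
  `|Lam x - Lam y| <= (1 + h + l^-1) * `|x - y|.
Proof.
move=> l0; wlog xy : x y / x <= y => [H hx hy|].
  case/orP: (le_total x y) => xy; first exact: H.
  by rewrite distrC (distrC x); apply: H.
move=> /andP[lx xh] /andP[ly yh].
have x0 : 0 < x by lra. have y0 : 0 < y by lra.
have lnx : `|ln x| <= h + l^-1.
  have := ln_abs_le x0; have : x^-1 <= l^-1 by rewrite lef_pV2// posrE.
  by lra.
have lny : `|ln y| <= h + l^-1.
  have := ln_abs_le y0; have : y^-1 <= l^-1 by rewrite lef_pV2// posrE.
  by lra.
have yx0 : 0 < y / x by rewrite divr_gt0.
have xy0 : 0 < x / y by rewrite divr_gt0.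
have h1 : x * (ln y - ln x) <= y - x.
  have := ln_le_sub1 yx0; rewrite ln_div ?posrE// -(ler_pM2l x0) => /le_trans; apply.
  by rewrite mulrBr mulrCA mulfV ?gt_eqF// !mulr1.
have h2 : 0 <= ln y - ln x by rewrite subr_ge0 ler_ln ?posrE.
rewrite distrC (distrC x) /Lambda (ger0_norm (x := y - x)) ?subr_ge0//.
have -> : y * ln y - x * ln x = (y - x) * ln y + x * (ln y - ln x) by ring.
apply: le_trans (ler_normD _ _) _.
rewrite normrM ger0_norm ?subr_ge0// (ger0_norm (x := x * _)); last by rewrite mulr_ge0// ltW.
have : (y - x) * `|ln y| <= (y - x) * (h + l^-1) by rewrite ler_wpM2l// subr_ge0.
by nra.
Qed.

(** The gap between the two sides is the total mass times the Shannon entropy of the normalized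
    weights. *)
Lemma Lambda_sum_le (I : finType) (x : I -> R) : (forall i, 0 <= x i) ->
  \sum_i Lam (x i) <= Lam (\sum_i x i).
Proof.
move=> x0; rewrite {2}/Lambda mulr_suml; apply: ler_sum => i _.
have := x0 i; rewrite le_eqVlt => /predU1P[<-|xi0]; first by rewrite Lambda0 mul0r.
have le : x i <= \sum_i x i.
  by rewrite (bigD1 i)//= lerDl sumr_ge0.
rewrite /Lambda; apply: ler_wpM2l; first exact: ltW.
by rewrite ler_ln ?posrE//; lra.
Qed.

(** The entropy is at most the logarithm of the number of atoms. This is Gibbs' inequality against
    the uniform law: after collecting terms, the i-th summand is at least x i - A / #|I|, and these
    lower bounds add up to 0. *)
Lemma Lambda_sum_ge (I : finType) (x : I -> R) : (forall i, 0 <= x i) ->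
  Lam (\sum_i x i) <= \sum_i Lam (x i) + ln #|I|%:R * \sum_i x i.
Proof.
move=> x0; set A := \sum_i x i.
have A0 : 0 <= A by exact: sumr_ge0.
have [A_0|A1] := eqVneq A 0.
  rewrite A_0 Lambda0 mulr0 addr0 big1// => i _.
  have : x i <= 0 by rewrite -A_0 /A (bigD1 i)//= lerDl sumr_ge0.
  by move=> h; have -> : x i = 0 by [apply/eqP; rewrite eq_le h x0]; rewrite Lambda0.
have Agt : 0 < A by rewrite lt_neqAle eq_sym A1.
have I0 : (0 < #|I|)%N.
  rewrite lt0n; apply/negP => /eqP/card0_eq h; move: A1; rewrite /A big1 ?eqxx// => i _.
  by have := h i; rewrite inE.
have N0 : 0 < #|I|%:R :> R by rewrite ltr0n.
rewrite -subr_ge0.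
have -> : \sum_i Lam (x i) + ln #|I|%:R * A - Lam A =
    \sum_i (Lam (x i) - x i * ln (A / #|I|%:R)).
  rewrite sumrB -mulr_suml -/A ln_div ?posrE// /Lambda; ring.
have c0 : 0 < A / #|I|%:R by rewrite divr_gt0.
apply: le_trans (_ : \sum_i (x i - A / #|I|%:R) <= _).
  rewrite sumrB sumr_const -/A -[_ *+ _]mulr_natr divfK ?subrr// gt_eqF//.
apply: ler_sum => i _.
have := x0 i; rewrite le_eqVlt => /predU1P[<-|xi0]; first by rewrite Lambda0 mul0r; lra.
have cn0 : A / #|I|%:R != 0 by rewrite gt_eqF.
have h := ler_wpM2r (ltW c0) (Lambda_ge (divr_ge0 (x0 i) (ltW c0))).
have -> : x i - A / #|I|%:R = (x i / (A / #|I|%:R) - 1) * (A / #|I|%:R).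
  by rewrite mulrBl mul1r divfK.
apply: le_trans h _; rewrite /Lambda mulrAC divfK// -mulrBr.
by rewrite [ln (x i / _)]ln_div ?posrE.
Qed.

End lambda.

Section bm.
Context d (T : measurableType d) (R : realType).
Implicit Types f g : T -> R.

Lemma bm_ig (P : probability T R) f : bm f -> ig P f.
Proof. by move=> [mf [c fc]]; exact: ig_bounded fc. Qed.

Lemma bm_cst (c : R) : bm (fun _ : T => c).
Proof. by split=> //; exists `|c|. Qed.

Lemma bmD f g : bm f -> bm g -> bm (fun x => f x + g x).
Proof.
move=> [mf [c hc]] [mg [e he]]; split; first exact: measurable_funD.
by exists (c + e) => x; rewrite (le_trans (ler_normD _ _))// lerD.
Qed.

Lemma bmM f g : bm f -> bm g -> bm (fun x => f x * g x).
Proof.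
move=> [mf [c hc]] [mg [e he]]; split; first exact: measurable_funM.
by exists (c * e) => x; rewrite normrM ler_pM.
Qed.

Lemma bmZ (c : R) f : bm f -> bm (fun x => c * f x).
Proof. by move=> h; apply: bmM => //; exact: bm_cst. Qed.

Lemma bmN f : bm f -> bm (fun x => - f x).
Proof. by move=> /(bmZ (-1)); under eq_fun do rewrite mulN1r. Qed.

Lemma bmB f g : bm f -> bm g -> bm (fun x => f x - g x).
Proof. by move=> hf /bmN; exact: bmD. Qed.

Lemma bm_sum I (r : seq I) (p : pred I) (F : I -> T -> R) : (forall i, bm (F i)) ->
  bm (fun x => \sum_(i <- r | p i) F i x).
Proof.
move=> h; elim: r => [|i r IH]; first by under eq_fun do rewrite big_nil; exact: bm_cst.
under eq_fun do rewrite big_cons; case: (p i) => //; exact: bmD.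
Qed.

Lemma bm_prod I (r : seq I) (p : pred I) (F : I -> T -> R) : (forall i, bm (F i)) ->
  bm (fun x => \prod_(i <- r | p i) F i x).
Proof.
move=> h; elim: r => [|i r IH]; first by under eq_fun do rewrite big_nil; exact: bm_cst.
under eq_fun do rewrite big_cons; case: (p i) => //; exact: bmM.
Qed.

Lemma bm_Lambda f : bm f -> bm (fun x => Lambda (f x)).
Proof.
move=> [mf [c hc]]; split; first exact: measurableT_comp measurable_Lambda mf.
exists (1 + c ^+ 2) => x; apply: le_trans (Lambda_bound _) _.
rewrite lerD2l -(real_normK (num_real (f x))) lerXn2r// nnegrE//.
exact: le_trans (hc x).
Qed.

Lemma bm_comp d' (T' : measurableType d') (h : T' -> T) f :
  measurable_fun setT h -> bm f -> bm (fun x => f (h x)).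
Proof.
move=> mh [mf [c hc]]; split; first exact: measurableT_comp mf mh.
by exists c => x.
Qed.

End bm.

Section bm_fubini.
Context d1 d2 (T1 : measurableType d1) (T2 : measurableType d2) (R : realType).
Variables (P1 : probability T1 R) (P2 : probability T2 R) (f : T1 -> T2 -> R).
Hypothesis hf : bm (fun z : T1 * T2 => f z.1 z.2).

Lemma bm_sec1 x : bm (f x).
Proof.
have [mf [c hc]] := hf; split; last by exists c => y; exact: (hc (x, y)).
exact: (measurableT_comp mf (pair1_measurable x)).
Qed.

Lemma bm_Ex : bm (fun x => Ex P2 (f x)).
Proof.
have [mf [c hc]] := hf; split; first exact: measurable_Ex.
exists c => x; rewrite -(Ex_cst P2 c); apply: Ex_abs_le.
- by apply: bm_ig; exact: bm_sec1.
- exact: ig_cst.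
- by move=> y; exact: (hc (x, y)).
Qed.

Lemma Ex_prod_bm : Ex (P1 \x P2)%E (fun z => f z.1 z.2) = Ex P1 (fun x => Ex P2 (f x)).
Proof.
have [mf [c hc]] := hf.
apply: (Ex_prod1 mf (ig_cst P1 c) (ig_cst P2 1)) => x y.
by rewrite mulr1; exact: (hc (x, y)).
Qed.

Lemma Ex_swap_bm : Ex P1 (fun x => Ex P2 (f x)) = Ex P2 (fun y => Ex P1 (f^~ y)).
Proof.
have [mf [c hc]] := hf.
apply: (Ex_swap mf (ig_cst P1 c) (ig_cst P2 1)) => x y.
by rewrite mulr1; exact: (hc (x, y)).
Qed.

End bm_fubini.

(** * Independent copies *)

Section iid.
Context d (T : measurableType d) (R : realType) (P : probability T R).

Lemma measurable_tcons n : measurable_fun setT (@tcons d T n).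
Proof. exact: (measurable_cons measurable_fst measurable_snd). Qed.

Lemma bm_tcons n (f : n.+1.-tuple T -> R) : bm f ->
  bm (fun z : T * n.-tuple T => f (cons_tuple z.1 z.2)).
Proof. by move=> hf; apply: (bm_comp (@measurable_tcons n) hf). Qed.

Lemma bm_tnth n (i : 'I_n) (f : T -> R) : bm f -> bm (fun t : n.-tuple T => f (tnth t i)).
Proof. by apply: bm_comp; exact: measurable_tnth. Qed.

Lemma Ex_iid0 (f : 0.-tuple T -> R) : measurable_fun setT f ->
  Ex (iid 0 P) f = f [tuple].
Proof. by move=> mf; rewrite Ex_dirac. Qed.

Lemma Ex_iidS n (f : n.+1.-tuple T -> R) : bm f ->
  Ex (iid n.+1 P) f = Ex P (fun x => Ex (iid n P) (fun t => f (cons_tuple x t))).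
Proof.
move=> hf; rewrite /= Ex_map; [|exact: hf.1|]; last first.
  by right; apply: bm_ig; exact: bm_tcons hf.
exact: (Ex_prod_bm _ _ (f := fun x t => f (cons_tuple x t)) (bm_tcons hf)).
Qed.

End iid.

(** * Poisson laws *)

Section poisson.
Context {R : realType}.
Implicit Types (l : R) (x : nat -> R).

(* Poisson weights; unlike poisson_pmf, also meaningful at rate 0. *)
Definition pw l (k : nat) : R := l ^+ k / k`!%:R * expR (- l).

Lemma pw_ge0 l k : 0 <= l -> 0 <= pw l k.
Proof. by move=> l0; rewrite /pw mulr_ge0 ?expR_ge0// divr_ge0// exprn_ge0. Qed.

Lemma Po_set1 l k : 0 <= l -> (Po l [set k] = (pw l k)%:E)%E.
Proof.
rewrite le_eqVlt /Po /= /poisson_prob => /predU1P[<-|l0].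
  rewrite ltxx diracE /pw oppr0 expR0 mulr1 expr0n.
  have [->|k0] := eqVneq k 0%N; first by rewrite mem_set// fact0 divr1.
  by rewrite memNset ?mul0r//= => h; move: k0; rewrite h eqxx.
by rewrite l0 esum_set1 ?lee_fin ?poisson_pmf_ge0// /poisson_pmf l0 /pw.
Qed.

Lemma measurable_nat d (U : measurableType d) (x : nat -> U) : measurable_fun setT x.
Proof. by move=> _ Y _; exact: (I : measurable (_ : set nat)). Qed.

Lemma ge0_integral_Po l (x : nat -> \bar R) : 0 <= l -> (forall k, (0 <= x k)%E) ->
  (\int[Po l]_k x k = \sum_(k <oo) ((pw l k)%:E * x k))%E.
Proof.
move=> l0 x0.
have -> : [set: nat] = \bigcup_k [set k] by apply/seteqP; split => // k _; exists k.
rewrite ge0_integral_bigcup//=; last first.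
  by apply/trivIsetP => i j _ _ ij; apply/seteqP; split => // k [/= -> h]; move: ij; rewrite h eqxx.
apply: eq_eseriesr => k _.
rewrite (eq_integral (cst (x k))); last by move=> i; rewrite inE /= => ->.
by rewrite integral_cst// muleC; congr (_ * _)%E; exact: Po_set1.
Qed.

#[global] Opaque Po.

Lemma pw_tilt l b k : 0 <= l -> 0 <= b -> pw l k * b ^+ k = expR (l * (b - 1)) * pw (l * b) k.
Proof.
move=> l0 b0; rewrite /pw exprMn.
have -> : - l = l * (b - 1) - l * b by ring.
by rewrite expRD; ring.
Qed.

Lemma ge0_integral_Po_tilt l b (x : nat -> \bar R) : 0 <= l -> 0 <= b ->
  (forall k, (0 <= x k)%E) ->
  (\int[Po l]_k ((b ^+ k)%:E * x k) = (expR (l * (b - 1)))%:E * \int[Po (l * b)]_k x k)%E.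
Proof.
move=> l0 b0 x0; rewrite !ge0_integral_Po ?mulr_ge0//; last first.
  by move=> k; rewrite mule_ge0// lee_fin exprn_ge0.
rewrite -nneseriesZl/=; last first.
  by move=> k _; rewrite mule_ge0// lee_fin pw_ge0// mulr_ge0.
by apply: eq_eseriesr => k _; rewrite !muleA -!EFinM pw_tilt.
Qed.

Lemma integral_Po_pow l b : 0 <= l -> 0 <= b ->
  (\int[Po l]_k (b ^+ k)%:E = (expR (l * (b - 1)))%:E)%E.
Proof.
move=> l0 b0; have := @ge0_integral_Po_tilt l b (fun=> 1%E) l0 b0 (fun=> @lee01 _).
under eq_integral do rewrite mule1.
move=> ->; rewrite integral_cst// mul1e.
rewrite [X in (_ * X)%E](_ : _ = 1%E) ?mule1//; exact: probability_setT.
Qed.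

(** Exponentially bounded sequences: integrable for every Poisson law, and closed under sums,
    products and shifts. They replace bounded functions once the number of factors is random. *)
Definition eg x : Prop := exists c b, [/\ 0 <= c, 0 <= b & forall k, `|x k| <= c * b ^+ k].

Lemma ig_pow l b : 0 <= l -> 0 <= b -> ig (Po l) (fun k => b ^+ k).
Proof.
move=> l0 b0; apply/integrableP; split; first exact: measurable_nat.
rewrite (eq_integral (fun k => (b ^+ k)%:E)); last first.
  by move=> k _ /=; rewrite ger0_norm ?exprn_ge0.
by rewrite integral_Po_pow// ltry.
Qed.

Lemma ig_eg l x : 0 <= l -> eg x -> ig (Po l) x.
Proof.
move=> l0 [c [b [c0 b0 h]]]; apply: (ig_le (g := fun k => c * b ^+ k)) => //; last by apply: igZ; exact: ig_pow.
Qed.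

Lemma eg_le x (c b : R) : (forall k, `|x k| <= c * b ^+ k) -> eg x.
Proof.
move=> h; exists `|c|, `|b|; split => // k; apply: le_trans (h k) _.
by rewrite -normrX -normrM ler_norm.
Qed.

Lemma eg_cst (c : R) : eg (fun=> c).
Proof. by apply: (@eg_le _ `|c| 1) => k; rewrite expr1n mulr1. Qed.

Lemma eg_pow (b : R) : eg (fun k => b ^+ k).
Proof. by apply: (@eg_le _ 1 `|b|) => k; rewrite normrX mul1r. Qed.

Lemma eg_dom x y : (forall k, `|x k| <= y k) -> eg y -> eg x.
Proof.
move=> h [c [b [c0 b0 hy]]]; exists c, b; split => // k.
by apply: le_trans (h k) (le_trans (ler_norm _) (hy k)).
Qed.

Lemma egD x y : eg x -> eg y -> eg (fun k => x k + y k).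
Proof.
move=> [c [b [c0 b0 h]]] [c' [b' [c0' b0' h']]].
apply: (@eg_le _ (c + c') (Num.max b b')) => k.
apply: le_trans (ler_normD _ _) _; rewrite mulrDl lerD//.
  by apply: le_trans (h k) _; rewrite ler_wpM2l// lerXn2r// ?nnegrE// le_max ?lexx ?b0.
by apply: le_trans (h' k) _; rewrite ler_wpM2l// lerXn2r// ?nnegrE// le_max ?lexx ?b0 ?orbT.
Qed.

Lemma egM x y : eg x -> eg y -> eg (fun k => x k * y k).
Proof.
move=> [c [b [c0 b0 h]]] [c' [b' [c0' b0' h']]].
apply: (@eg_le _ (c * c') (b * b')) => k.
by rewrite normrM exprMn mulrACA ler_pM.
Qed.

Lemma egZ (a : R) x : eg x -> eg (fun k => a * x k).
Proof. by move=> h; apply: egM => //; exact: eg_cst. Qed.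

Lemma egB x y : eg x -> eg y -> eg (fun k => x k - y k).
Proof.
by move=> hx hy; apply: egD => //; under eq_fun do rewrite -mulN1r; exact: egZ.
Qed.

Lemma eg_shift x n : eg x -> eg (fun k => x (k + n)%N).
Proof.
move=> [c [b [c0 b0 h]]]; apply: (@eg_le _ (c * b ^+ n) b) => k.
by apply: le_trans (h _) _; rewrite exprD; lra.
Qed.

Lemma eg_nat : eg (fun k => k%:R).
Proof.
apply: (@eg_le _ 1 2) => k; rewrite mul1r ger0_norm//.
by rewrite -natrX ler_nat ltnW// ltn_expl.
Qed.

Lemma Ex_Po_ge0 l x : 0 <= l -> (forall k, 0 <= x k) -> eg x ->
  ((Ex (Po l) x)%:E = \sum_(k <oo) (pw l k * x k)%:E)%E.
Proof.
move=> l0 x0 hx; rewrite -EFin_Ex; last exact: ig_eg.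
by rewrite ge0_integral_Po// => k; rewrite lee_fin.
Qed.

Lemma Ex_Po_pow l b : 0 <= l -> 0 <= b -> Ex (Po l) (fun k => b ^+ k) = expR (l * (b - 1)).
Proof.
move=> l0 b0; apply: EFin_inj; rewrite -EFin_Ex ?integral_Po_pow//.
exact: ig_pow.
Qed.

(** Identities proved for nonnegative sequences by rearranging series extend to all of [eg], since x
    is the difference of two nonnegative members of the class. *)
Lemma eg_pos x : eg x -> exists c b, [/\ 0 <= c, 0 <= b & forall k, 0 <= x k + c * b ^+ k].
Proof.
move=> [c [b [c0 b0 h]]]; exists c, b; split => // k.
by have := h k; rewrite ler_norml => /andP[]; lra.
Qed.

(** A factor b per event tilts Po(l) into Po(l b). The main use is [type_class], where a constant
    mean factor weight amounts to a change of rate. *)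
Lemma Ex_Po_tilt l b x : 0 <= l -> 0 <= b -> eg x ->
  Ex (Po l) (fun k => b ^+ k * x k) = expR (l * (b - 1)) * Ex (Po (l * b)) x.
Proof.
move=> l0 b0 hx; have lb0 : 0 <= l * b by rewrite mulr_ge0.
have H y : (forall k, 0 <= y k) -> eg y ->
    Ex (Po l) (fun k => b ^+ k * y k) = expR (l * (b - 1)) * Ex (Po (l * b)) y.
  move=> y0 hy; apply: EFin_inj.
  apply: etrans (esym (EFin_Ex (ig_eg l0 (egM (eg_pow b) hy)))) _.
  apply: etrans (congr1 (fun z => (expR (l * (b - 1)))%:E * z)%E (EFin_Ex (ig_eg lb0 hy))).
  have := @ge0_integral_Po_tilt l b (EFin \o y) l0 b0 y0.
  by under eq_integral do rewrite -EFinM.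
have [c [d [c0 d0 hpos]]] := eg_pos hx.
have hp : eg (fun k => c * d ^+ k) by apply: egZ; exact: eg_pow.
have -> : x = (fun k => (x k + c * d ^+ k) - c * d ^+ k) by apply/funext => k; rewrite addrK.
have hxp := egD hx hp.
have hb := eg_pow b.
rewrite ExB; [|exact: ig_eg..].
under eq_fun do rewrite mulrBr.
rewrite ExB; [|by apply: ig_eg => //; exact: egM..].
by rewrite !H// ?mulrBr// => k; rewrite mulr_ge0// exprn_ge0.
Qed.

(** The size-bias identity. It collapses m equal contributions of m independent factors into l times
    the contribution of one. *)
Lemma Ex_Po_stein l x : 0 <= l -> eg x ->
  Ex (Po l) (fun k => k%:R * x k.-1) = l * Ex (Po l) x.
Proof.
move=> l0.
have egp y : eg y -> eg (fun k => k%:R * y k.-1).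
  move=> [c [b [c0 b0 h]]]; apply: egM; first exact: eg_nat.
  apply: (@eg_le _ c (1 + b)) => k; apply: le_trans (h _) _; rewrite ler_wpM2l//.
  apply: le_trans (_ : (1 + b) ^+ k.-1 <= _).
    by rewrite lerXn2r// ?nnegrE ?addr_ge0// lerDr.
  by rewrite ler_weXn2l// ?lerDl// leq_pred.
have H y : (forall k, 0 <= y k) -> eg y -> Ex (Po l) (fun k => k%:R * y k.-1) = l * Ex (Po l) y.
  move=> y0 hy; apply: EFin_inj; rewrite [RHS]EFinM Ex_Po_ge0//; last 2 first.
  - by move=> k; rewrite mulr_ge0.
  - exact: egp.
  rewrite Ex_Po_ge0// nneseries_recl//; last first.
    by move=> k _; rewrite lee_fin mulr_ge0 ?pw_ge0// mulr_ge0.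
  rewrite mul0r mulr0 add0e -nneseriesZl/=; last first.
    by move=> k _; rewrite lee_fin mulr_ge0// pw_ge0.
  rewrite -(@nneseries_addn _ _ 1)//=; last first.
    by move=> k; rewrite lee_fin mulr_ge0 ?pw_ge0// mulr_ge0.
  apply: eq_eseriesr => k _; rewrite addn1 /= -EFinM; congr (_%:E).
  rewrite /pw factS natrM exprS.
  have k0 : k.+1%:R != 0 :> R by rewrite pnatr_eq0.
  have f0 : k`!%:R != 0 :> R by rewrite pnatr_eq0 -lt0n fact_gt0.
  by move: (k.+1%:R) (k`!%:R) k0 f0 => u v k0 f0; field; rewrite k0 f0.
move=> hx; have [c [d [c0 d0 hpos]]] := eg_pos hx.
have hp : eg (fun k => c * d ^+ k) by apply: egZ; exact: eg_pow.
have -> : x = (fun k => (x k + c * d ^+ k) - c * d ^+ k) by apply/funext => k; rewrite addrK.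
have hxp := egD hx hp.
rewrite [in RHS]ExB; [|exact: ig_eg..].
under eq_fun do rewrite mulrBr.
rewrite ExB; [|exact: ig_eg l0 (egp _ hxp)|exact: ig_eg l0 (egp _ hp)].
by rewrite (H (fun k => x k + c * d ^+ k))// (H (fun k => c * d ^+ k)) ?mulrBr// => k; rewrite mulr_ge0// exprn_ge0.
Qed.

Lemma Ex_Po_nat l : 0 <= l -> Ex (Po l) (fun k => k%:R) = l.
Proof.
move=> l0; have := Ex_Po_stein l0 (eg_cst 1); rewrite Ex_cst mulr1.
by under eq_fun do rewrite mulr1.
Qed.

Lemma nneseries_diag (g : nat -> nat -> \bar R) : (forall i j, (0 <= g i j)%E) ->
  (\sum_(m <oo) \sum_(i < m.+1) g i (m - i)%N = \sum_(i <oo) \sum_(j <oo) g i j)%E.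
Proof.
move=> g0.
transitivity (\sum_(m <oo) \sum_(i <oo) (if (i <= m)%N then g i (m - i)%N else 0))%E.
  apply: eq_eseriesr => m _.
  rewrite (nneseries_split 0 m.+1)//; last by move=> k _; case: ifP.
  rewrite add0n big_mkord [X in (_ + X)%E]eseries0 ?adde0//.
    by apply: eq_bigr => i _; rewrite -ltnS ltn_ord.
  by move=> k /= mk _; rewrite leqNgt mk.
rewrite nneseries_interchange//; last by move=> m i; case: ifP.
apply: eq_eseriesr => i _.
rewrite (nneseries_split 0 i)//; last by move=> k _; case: ifP.
rewrite add0n big_mkord big1 ?add0e; last by move=> j _; rewrite leqNgt ltn_ord.
rewrite -[LHS](@nneseries_addn _ _ i)/=; last by move=> k; case: ifP.
by apply: eq_eseriesr => j _; rewrite leq_addl addnK.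
Qed.

(** Poisson thinning: colouring m events independently with probabilities a and b gives independent
    Poisson numbers of each colour. *)
Lemma Ex_Po_split l (a b : R) (y : nat -> nat -> R) (c h : R) :
  0 <= l -> 0 <= a -> 0 <= b -> a + b = 1 -> 0 <= h ->
  (forall i j, `|y i j| <= c * h ^+ (i + j)) ->
  Ex (Po l) (fun m => \sum_(i < m.+1) ('C(m, i))%:R * a ^+ i * b ^+ (m - i) * y i (m - i)%N) =
  Ex (Po (a * l)) (fun i => Ex (Po (b * l)) (y i)).
Proof.
move=> l0 a0 b0 ab h0 hy.
have al0 : 0 <= a * l by rewrite mulr_ge0.
have bl0 : 0 <= b * l by rewrite mulr_ge0.
pose S (y : nat -> nat -> R) m := \sum_(i < m.+1) ('C(m, i))%:R * a ^+ i * b ^+ (m - i) * y i (m - i)%N.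
have bnd (z : nat -> nat -> R) : (forall i j, `|z i j| <= `|c| * h ^+ (i + j)) ->
    [/\ eg (S z), forall i, eg (z i) & eg (fun i => Ex (Po (b * l)) (z i))].
  move=> hz; split.
  - apply: (@eg_le _ `|c| h) => m; apply: le_trans (ler_norm_sum _ _ _) _.
    apply: le_trans (_ : \sum_(i < m.+1) ('C(m, i))%:R * a ^+ i * b ^+ (m - i) * (`|c| * h ^+ m) <= _).
      apply: ler_sum => i _; rewrite normrM ger0_norm; last by rewrite !mulr_ge0// exprn_ge0.
      rewrite ler_wpM2l//; first by rewrite !mulr_ge0// exprn_ge0.
      by apply: le_trans (hz _ _) _; rewrite subnKC// -ltnS ltn_ord.
    rewrite -mulr_suml (_ : \sum_(i < _) _ = 1) ?mul1r//.
    transitivity ((b + a) ^+ m); last by rewrite addrC ab expr1n.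
    by rewrite exprDn; apply: eq_bigr => i _; rewrite -mulr_natl; ring.
  - by move=> i; apply: (@eg_le _ (`|c| * h ^+ i) h) => k; rewrite -mulrA -exprD.
  - apply: (@eg_le _ (`|c| * expR (b * l * (h - 1))) h) => i.
    rewrite mulrAC -Ex_Po_pow// -ExZ; last exact: ig_pow.
    apply: Ex_abs_le.
    + apply: ig_eg => //; by apply: (@eg_le _ (`|c| * h ^+ i) h) => k; rewrite -mulrA -exprD.
    + by apply: igZ; exact: ig_pow.
    + by move=> k; rewrite -mulrA -exprD.
have H (z : nat -> nat -> R) : (forall i j, 0 <= z i j) -> (forall i j, `|z i j| <= `|c| * h ^+ (i + j)) ->
    Ex (Po l) (S z) = Ex (Po (a * l)) (fun i => Ex (Po (b * l)) (z i)).
  move=> z0 hz; have [e1 e2 e3] := bnd _ hz.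
  have S0 m : 0 <= S z m by apply: sumr_ge0 => i _; rewrite !mulr_ge0// exprn_ge0.
  have E0 i : 0 <= Ex (Po (b * l)) (z i) by exact: Ex_ge0.
  apply: EFin_inj; apply: etrans (Ex_Po_ge0 l0 S0 e1) _.
  apply: etrans (esym (Ex_Po_ge0 al0 E0 e3)).
  transitivity (\sum_(i <oo) \sum_(j <oo) (pw (a * l) i * pw (b * l) j * z i j)%:E)%E.
    rewrite -nneseries_diag; last by move=> i j; rewrite lee_fin; apply: mulr_ge0 => //; apply: mulr_ge0; exact: pw_ge0.
    apply: eq_eseriesr => m _; rewrite sumEFin /S mulr_sumr; congr (_%:E).
    apply: eq_bigr => i _; have im : (i <= m)%N by rewrite -ltnS ltn_ord.
    rewrite mulrA; congr (_ * _).
    rewrite /pw !exprMn -(bin_fact im) natrM.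
    rewrite -{1}(subnKC im) exprD.
    have -> : - l = - (a * l) - (b * l) by rewrite -opprD -mulrDl ab mul1r.
    rewrite expRD.
    have f1 : i`!%:R != 0 :> R by rewrite pnatr_eq0 -lt0n fact_gt0.
    have f2 : (m - i)`!%:R != 0 :> R by rewrite pnatr_eq0 -lt0n fact_gt0.
    have f3 : 'C(m, i)%:R != 0 :> R by rewrite pnatr_eq0 -lt0n bin_gt0.
    rewrite natrM; move: (i`!%:R) ((m - i)`!%:R) ('C(m, i)%:R) f1 f2 f3 => u v w f1 f2 f3.
    by field; rewrite f1 f2 f3.
  apply: eq_eseriesr => i _; rewrite [RHS]EFinM [in RHS]Ex_Po_ge0// -nneseriesZl//; last first.
    by move=> j _; rewrite lee_fin mulr_ge0// pw_ge0.
  by apply: eq_eseriesr => j _; rewrite -[RHS]EFinM; congr (_%:E); ring.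
(* A signed y is reduced to the nonnegative case through the majorant p: both p and (y + p) / 2 are
   nonnegative and obey the same bound, and the identity is linear in y. *)
pose p i j := `|c| * h ^+ (i + j).
have p0 i j : 0 <= p i j by rewrite mulr_ge0// exprn_ge0.
have hp i j : `|p i j| <= `|c| * h ^+ (i + j) by rewrite ger0_norm.
have hy' i j : `|y i j| <= `|c| * h ^+ (i + j).
  by apply: le_trans (hy i j) _; rewrite ler_wpM2r ?exprn_ge0// ler_norm.
have [e1 e2 e3] := bnd _ hy'; have [f1 f2 f3] := bnd _ hp.
have yp0 i j : 0 <= (y i j + p i j) / 2.
  by have := hy' i j; rewrite ler_norml => /andP[]; rewrite /p; lra.
have hyp i j : `|(y i j + p i j) / 2| <= `|c| * h ^+ (i + j).
  by rewrite ger0_norm//; have := hy' i j; rewrite ler_norml => /andP[]; rewrite /p; lra.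
have := H _ yp0 hyp; have Hp := H _ p0 hp.
have -> : S (fun i j => (y i j + p i j) / 2) = (fun m => 2^-1 * (S y m + S p m)).
  apply/funext => m; rewrite /S -big_split mulr_sumr; apply: eq_bigr => i _ /=; ring.
have -> : (fun i => Ex (Po (b * l)) (fun j => (y i j + p i j) / 2)) =
   (fun i => 2^-1 * (Ex (Po (b * l)) (y i) + Ex (Po (b * l)) (p i))).
  apply/funext => i; under eq_fun do rewrite mulrC.
  have i1 := ig_eg bl0 (e2 i); have i2 := ig_eg bl0 (f2 i).
  by rewrite (ExZ _ (igD i1 i2)) (ExD i1 i2).
rewrite !ExZ; [|by apply: igD; exact: ig_eg..].
rewrite !ExD; [|exact: ig_eg..].
rewrite Hp => E; apply: (addIr (Ex (Po (a * l)) (fun i => Ex (Po (b * l)) (p i)))).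
have h2 : 2^-1 != 0 :> R by rewrite invr_eq0 pnatr_eq0.
exact: (mulfI h2).
Qed.

Lemma Ex_Po_split_rates l (a b : R) (y : nat -> nat -> R) (c h l1 l2 : R) :
  0 <= l -> 0 <= a -> 0 <= b -> a + b = 1 -> 0 <= h ->
  (forall i j, `|y i j| <= c * h ^+ (i + j)) -> a * l = l1 -> b * l = l2 ->
  Ex (Po l) (fun m => \sum_(i < m.+1) ('C(m, i))%:R * a ^+ i * b ^+ (m - i) * y i (m - i)%N) =
  Ex (Po l1) (fun i => Ex (Po l2) (y i)).
Proof. by move=> l0 a0 b0 ab h0 hy <- <-; apply: Ex_Po_split hy. Qed.

Lemma Ex_Po_add (l1 l2 : R) x : 0 <= l1 -> 0 <= l2 -> eg x ->
  Ex (Po (l1 + l2)) x = Ex (Po l1) (fun i => Ex (Po l2) (fun j => x (i + j)%N)).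
Proof.
move=> l10 l20 [c [b [c0 b0 h]]].
(* The thinning proportions l1 / (l1 + l2) are meaningless at total rate 0. There the law is a point
   mass at 0, as tilting with b = 0 shows: [0 ^+ k] selects the value at 0. *)
have [s0|s0] := eqVneq (l1 + l2) 0.
  have -> : l1 = 0 by lra. have -> : l2 = 0 by lra.
  have E y : eg y -> Ex (Po 0) y = y 0%N.
    move=> hy; have hb := @Ex_Po_tilt 0 0 y (lexx 0) (lexx 0) hy.
    have hz : eg (fun k => y 0%N * 0 ^+ k) by apply: egZ; exact: eg_pow.
    rewrite mul0r mul0r expR0 mul1r in hb; rewrite -hb.
    rewrite (_ : (fun k => 0 ^+ k * y k) = (fun k => y 0%N * 0 ^+ k)); last first.
      by apply/funext => -[|k]; rewrite ?expr0 ?mul1r ?mulr1// exprS !mul0r mulr0.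
    rewrite ExZ ?Ex_Po_pow//; last exact: ig_pow.
    by rewrite mul0r expR0 mulr1.
  rewrite addr0 !E//.
  - by exists c, b.
  - apply: (@eg_dom _ (fun i => `|x i|)); last by exists c, b; split => // k; rewrite normr_id.
    move=> i; rewrite E ?addn0//; under eq_fun do rewrite addnC.
    by apply: eg_shift; exists c, b.
  - by exists c, b.
have sp : 0 < l1 + l2 by rewrite lt_neqAle eq_sym s0 addr_ge0.
have p1 : 0 <= l1 / (l1 + l2) by rewrite divr_ge0// ltW.
have p2 : 0 <= l2 / (l1 + l2) by rewrite divr_ge0// ltW.
have p12 : l1 / (l1 + l2) + l2 / (l1 + l2) = 1 by rewrite -mulrDl divff.
have E1 : l1 / (l1 + l2) * (l1 + l2) = l1 by rewrite divfK.
have E2 : l2 / (l1 + l2) * (l1 + l2) = l2 by rewrite divfK.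
apply: etrans (Ex_Po_split_rates (ltW sp) p1 p2 p12 b0 (fun i j => h (i + j)%N) E1 E2).
congr Ex; apply/funext => m.
rewrite (eq_bigr (fun i : 'I_m.+1 => 'C(m, i)%:R * (l1 / (l1 + l2)) ^+ i * (l2 / (l1 + l2)) ^+ (m - i) * x m)); last first.
  by move=> i _; rewrite subnKC// -ltnS ltn_ord.
rewrite -mulr_suml (_ : \sum_(i < _) _ = 1) ?mul1r//.
transitivity ((l2 / (l1 + l2) + l1 / (l1 + l2)) ^+ m); last first.
  by rewrite -mulrDl addrC divff// expr1n.
by rewrite exprDn; apply: eq_bigr => i _; rewrite -mulr_natl; ring.
Qed.

(** Coupling: the larger Poisson variable is the smaller one plus an independent Poisson variable of
    mean |l1 - l2|, and each additional event changes x by at most L. *)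
Lemma Ex_Po_lip (l1 l2 L : R) x : 0 <= l1 -> 0 <= l2 -> eg x ->
  (forall k, `|x k.+1 - x k| <= L) ->
  `|Ex (Po l1) x - Ex (Po l2) x| <= L * `|l1 - l2|.
Proof.
wlog l12 : l1 l2 / l2 <= l1 => [H|l10 l20 hx hL].
  case/orP: (le_total l1 l2) => le ? ? ? ?; last exact: H.
  by rewrite distrC (distrC l1); exact: H.
have d0 : 0 <= l1 - l2 by rewrite subr_ge0.
rewrite (ger0_norm d0) -{1}(subrKC l2 l1) Ex_Po_add//.
have L0 : 0 <= L := le_trans (normr_ge0 _) (hL 0%N).
have hij i j : `|x (i + j)%N - x i| <= L * j%:R.
  elim: j => [|j IH]; first by rewrite addn0 subrr normr0 mulr0.
  rewrite addnS -(subrKA (x (i + j)%N)) -natr1 mulrDr mulr1 addrC.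
  by apply: le_trans (ler_normD _ _) _; rewrite lerD.
have hsh i : eg (fun j => x (i + j)%N).
  by under eq_fun do rewrite addnC; exact: eg_shift.
have hxi i : Ex (Po (l1 - l2)) (fun j => x (i + j)%N) - x i =
   Ex (Po (l1 - l2)) (fun j => x (i + j)%N - x i).
  by rewrite ExB ?Ex_cst//; [exact: ig_eg|exact: ig_cst].
have hbd i : `|Ex (Po (l1 - l2)) (fun j => x (i + j)%N) - x i| <= L * (l1 - l2).
  rewrite hxi -{2}(Ex_Po_nat d0) -ExZ; last by apply: ig_eg => //; exact: eg_nat.
  apply: Ex_abs_le => //.
  - by apply: ig_eg => //; apply: egB => //; exact: eg_cst.
  - by apply: ig_eg => //; apply: egZ; exact: eg_nat.
have he : eg (fun i => Ex (Po (l1 - l2)) (fun j => x (i + j)%N)).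
  apply: (@eg_dom _ (fun i => L * (l1 - l2) + `|x i|)).
    move=> i; have := hbd i; rewrite -[X in `|X| <= _ -> _]/(_ - _).
    have := ler_normD (Ex (Po (l1 - l2)) (fun j => x (i + j)%N) - x i) (x i).
    by rewrite subrK; lra.
  apply: egD; first exact: eg_cst.
  by case: hx => c [b [c0 b0 h]]; exists c, b; split => // k; rewrite normr_id.
rewrite -ExB; [|exact: ig_eg..].
rewrite -(Ex_cst (Po l2) (L * (l1 - l2))); apply: Ex_abs_le.
- by apply: ig_eg => //; exact: egB.
- exact: ig_cst.
- exact: hbd.
Qed.

End poisson.

(** * Operators on functionals of unnormalized weights *)

Section ops.
Context {R : realType} {S : finType}.
Notation vec := (S -> R).
Implicit Types (a b w c : vec) (F G : vec -> R).

Definition nn a := forall s, 0 <= a s.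
Definition mass a : R := \sum_s a s.
Definition amul a w : vec := fun s => a s * w s.
Definition ell c a : R := \sum_s c s * a s.

Lemma nn_amul a w : nn a -> nn w -> nn (amul a w).
Proof. by move=> a0 w0 s; rewrite mulr_ge0. Qed.

Lemma mass_ge0 a : nn a -> 0 <= mass a.
Proof. by move=> a0; apply: sumr_ge0. Qed.

Lemma amulAC a b c : amul (amul a b) c = amul (amul a c) b.
Proof. by apply/funext => s; rewrite /amul mulrAC. Qed.

Lemma amulA a b c : amul a (amul b c) = amul (amul a b) c.
Proof. by apply/funext => s; rewrite /amul mulrA. Qed.

Lemma mass_amul_le a w D : nn a -> (forall s, w s <= D) -> mass (amul a w) <= D * mass a.
Proof.
by move=> a0 wD; rewrite /mass mulr_sumr; apply: ler_sum => s _; rewrite /amul mulrC ler_wpM2r.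
Qed.

(** The space of weight vectors carries no sigma-algebra here; measurability is tested along all
    parametrizations with measurable coordinates. *)
Definition mfam d (T : measurableType d) (F : T -> vec -> R) : Prop :=
  forall d' (Z : measurableType d') (g : Z -> T) (f : Z -> vec),
    measurable_fun setT g -> (forall s, measurable_fun setT (fun z => f z s)) ->
    measurable_fun setT (fun z => F (g z) (f z)).

(** Quadratic growth accommodates [Lambda (mass a)] and is stable, up to the constant, under
    multiplication of the weights by a bounded vector. *)
Definition grow (C : R) F : Prop := forall a, nn a -> `|F a| <= C * (1 + mass a) ^+ 2.

Definition mfun F := mfam (fun _ : unit => F).

Definition good F : Prop := mfun F /\ exists C, grow C F.

Definition gfam d (T : measurableType d) (P : probability T R) (F : T -> vec -> R) : Prop :=
  mfam F /\ exists C : T -> R, [/\ ig P C, forall t, 0 <= C t & forall t, grow (C t) (F t)].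

(** Abstracts operators of the form F, a |-> E[F(a w)] with a random multiplier w, keeping only
    properties that survive composition, finite sums and Poisson mixtures: positivity, linearity, a
    growth factor B, commutation with a fixed multiplier ([op_shift]) and with averages of
    functionals ([op_int]). *)
Record isop (M : (vec -> R) -> vec -> R) (B : R) : Prop := IsOp {
  op_ge0 : 0 <= B;
  op_mfam : forall d (T : measurableType d) (F : T -> vec -> R),
    mfam F -> mfam (fun t => M (F t));
  op_grow : forall F C, mfun F -> grow C F -> grow (B * C) (M F);
  op_lin : forall F G k, good F -> good G -> forall a, nn a ->
    M (fun b => F b + k * G b) a = M F a + k * M G a;
  op_le : forall F G, good F -> good G -> (forall a, nn a -> F a <= G a) ->
    forall a, nn a -> M F a <= M G a;
  op_shift : forall F w a, M (fun b => F (amul b w)) a = M F (amul a w);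
  op_int : forall d (T : measurableType d) (P : probability T R) (F : T -> vec -> R),
    gfam P F -> forall a, nn a ->
    M (fun b => Ex P (fun t => F t b)) a = Ex P (fun t => M (F t) a) }.

(** A mixture of multiplications commutes with every operator, by [op_shift] and [op_int]. Commuting
    with all operators, rather than with a given one, is what passes through iteration and
    mixing. *)
Definition central (M : (vec -> R) -> vec -> R) := forall N B, isop N B ->
  forall F, good F -> forall a, nn a -> N (M F) a = M (N F) a.

Lemma growW C C' F : C <= C' -> grow C F -> grow C' F.
Proof.
move=> CC h a a0; apply: le_trans (h a a0) _; rewrite ler_wpM2r//.
by rewrite exprn_ge0// addr_ge0// mass_ge0.
Qed.

Lemma good_grow F : good F -> exists2 C, 0 <= C & grow C F.
Proof. by move=> [_ [C h]]; exists `|C|; rewrite ?normr_ge0//; apply: growW h; rewrite ler_norm. Qed.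

Lemma mfun_mfam d (T : measurableType d) F : mfun F -> mfam (fun _ : T => F).
Proof. by move=> h d' Z g f mg mf; apply: (h d' Z (fun=> tt) f). Qed.

Lemma mfam_fun d (T : measurableType d) (F : T -> vec -> R) t : mfam F -> mfun (F t).
Proof. by move=> h d' Z g f mg mf; apply: (h d' Z (fun=> t) f). Qed.

Lemma op_good M B F : isop M B -> good F -> good (M F).
Proof.
move=> hM [mF [C h]]; split; first exact: (op_mfam hM).
by exists (B * C); apply: op_grow.
Qed.

Lemma op_gfam d (T : measurableType d) (P : probability T R) (F : T -> vec -> R) M B :
  isop M B -> gfam P F -> gfam P (fun t => M (F t)).
Proof.
move=> hM [mF [C [iC C0 h]]]; split; first exact: op_mfam hM _ _ _ mF.
exists (fun t => B * C t); split.
- exact: igZ.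
- by move=> t; rewrite mulr_ge0// (op_ge0 hM).
- by move=> t; apply: (op_grow hM) => //; exact: mfam_fun.
Qed.

Lemma gfam_ig d (T : measurableType d) (P : probability T R) (F : T -> vec -> R) a :
  gfam P F -> nn a -> ig P (fun t => F t a).
Proof.
move=> [mF [C [iC C0 h]]] a0.
apply: (ig_le (g := fun t => (1 + mass a) ^+ 2 * C t)).
- by apply: (mF _ _ id (fun=> a)).
- exact: igZ.
- by move=> t; rewrite mulrC; exact: h.
Qed.

Lemma good_cst (k : R) : good (fun=> k).
Proof.
split; first by move=> d' Z g f mg mf; exact: measurable_cst.
by exists `|k| => a a0; rewrite ler_peMr// exprn_ege1// lerDl mass_ge0.
Qed.

Lemma goodD F G : good F -> good G -> good (fun a => F a + G a).
Proof.
move=> [mF [C h]] [mG [C' h']]; split.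
  by move=> d' Z g f mg mf; apply: measurable_funD; [exact: (mF _ _ g)|exact: (mG _ _ g)].
exists (C + C') => a a0; rewrite mulrDl; apply: le_trans (ler_normD _ _) _.
by rewrite lerD ?h ?h'.
Qed.

Lemma goodZ (k : R) F : good F -> good (fun a => k * F a).
Proof.
move=> [mF [C h]]; split.
  by move=> d' Z g f mg mf; apply: measurable_funM => //; exact: (mF _ _ g).
by exists (`|k| * C) => a a0; rewrite normrM -mulrA ler_wpM2l// h.
Qed.

Lemma goodB F G : good F -> good G -> good (fun a => F a - G a).
Proof.
move=> hF hG; under eq_fun do rewrite -mulN1r.
by apply: goodD => //; exact: goodZ.
Qed.

Lemma good_sum (I : Type) (r : seq I) (F : I -> vec -> R) :
  (forall i, good (F i)) -> good (fun a => \sum_(i <- r) F i a).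
Proof.
move=> h; elim: r => [|i r IH].
  by under eq_fun do rewrite big_nil; exact: good_cst.
by under eq_fun do rewrite big_cons; apply: goodD.
Qed.

Lemma mass_le_sqr a : nn a -> mass a <= (1 + mass a) ^+ 2.
Proof. by move=> /mass_ge0; nra. Qed.

Lemma good_ell c : good (ell c).
Proof.
split.
  by move=> d' Z g f mg mf; apply: measurable_sum => s; exact: measurable_funM.
exists (\sum_s `|c s|) => a a0.
apply: le_trans (ler_norm_sum _ _ _) _; rewrite mulr_suml; apply: ler_sum => s _.
rewrite normrM ler_wpM2l//.
apply: le_trans (_ : mass a <= _); last exact: mass_le_sqr.
by rewrite ger0_norm// /mass (bigD1 s)//= lerDl sumr_ge0.
Qed.

Lemma mass_ell : mass = ell (fun=> 1).
Proof. by apply/funext => a; apply: eq_bigr => s _; rewrite mul1r. Qed.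

Lemma good_mass : good mass.
Proof. by rewrite mass_ell; exact: good_ell. Qed.

Lemma op_ext M B F G : isop M B -> good F -> good G ->
  (forall a, nn a -> F a = G a) -> forall a, nn a -> M F a = M G a.
Proof.
move=> hM gF gG FG a a0; apply/eqP; rewrite eq_le !(op_le hM)// => b b0.
  by rewrite FG.
by rewrite FG.
Qed.

Lemma op_Z M B F k a : isop M B -> good F -> nn a -> M (fun b => k * F b) a = k * M F a.
Proof.
move=> hM gF a0; have := op_lin hM k (good_cst 0) gF a0.
under eq_fun do rewrite add0r.
move=> ->; have := op_lin hM 0 (good_cst 0) (good_cst 0) a0.
(* Linearity at F = G = 0 with coefficient 1 reads [M 0 = M 0 + M 0], so the zero functional is
   mapped to 0. *)
by rewrite mul0r addr0 mul0r => h; have := op_lin hM 1 (good_cst 0) (good_cst 0) a0;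
  rewrite mulr0 addr0 mul1r => h2; lra.
Qed.

Lemma op_D M B F G a : isop M B -> good F -> good G -> nn a ->
  M (fun b => F b + G b) a = M F a + M G a.
Proof.
move=> hM gF gG a0; have := op_lin hM 1 gF gG a0; rewrite mul1r => <-.
by under [in RHS]eq_fun do rewrite mul1r.
Qed.

Lemma op_B M B F G a : isop M B -> good F -> good G -> nn a ->
  M (fun b => F b - G b) a = M F a - M G a.
Proof.
move=> hM gF gG a0; have := op_lin hM (-1) gF gG a0; rewrite mulN1r => <-.
by under [in RHS]eq_fun do rewrite mulN1r.
Qed.

Lemma op_sum M B (I : Type) (r : seq I) (F : I -> vec -> R) a : isop M B ->
  (forall i, good (F i)) -> nn a ->
  M (fun b => \sum_(i <- r) F i b) a = \sum_(i <- r) M (F i) a.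
Proof.
move=> hM h a0; elim: r => [|i r IH].
  under eq_fun do rewrite big_nil; rewrite big_nil.
  have := op_Z 0 hM (good_cst 0) a0; by rewrite !mul0r.
under eq_fun do rewrite big_cons; rewrite big_cons -IH.
by rewrite (op_D hM)//; exact: good_sum.
Qed.

Lemma isop_id : isop id 1.
Proof.
split => //.
by move=> F C mF h; rewrite mul1r.
Qed.

(** The growth factor is the square of D since growth is quadratic in the mass; 1 <= D gives
    [1 + D * mass a <= D * (1 + mass a)]. *)
Lemma isop_shift w D : nn w -> (forall s, w s <= D) -> 1 <= D ->
  isop (fun F a => F (amul a w)) (D ^+ 2).
Proof.
move=> w0 wD D1; split.
- by rewrite exprn_ge0//; lra.
- move=> d T F mF d' Z g f mg mf; apply: (mF _ _ g (fun z => amul (f z) w)) => // s.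
  exact: measurable_funM.
- move=> F C mF h a a0; apply: le_trans (h _ (nn_amul a0 w0)) _.
  rewrite [_ * C]mulrC -mulrA; apply: ler_wpM2l.
    (* The growth bound at any nonnegative vector forces C to be nonnegative. *)
    have := h _ (nn_amul (a := fun=> 0) (w := w) (fun=> lexx _) w0).
    by move=> /(le_trans (normr_ge0 _)); rewrite pmulr_lge0// exprn_gt0//
      (lt_le_trans ltr01)// lerDl mass_ge0//; apply: nn_amul.
  rewrite -exprMn lerXn2r ?nnegrE//.
  + by rewrite addr_ge0// mass_ge0//; apply: nn_amul.
  + by rewrite mulr_ge0 ?addr_ge0 ?mass_ge0//; lra.
  + by rewrite mulrDr mulr1 lerD//; exact: mass_amul_le.
- by [].
- by move=> F G gF gG h a a0; apply: h; exact: nn_amul.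
- by move=> F v a; rewrite amulAC.
- by [].
Qed.

Lemma central_shift w : central (fun F a => F (amul a w)).
Proof. by move=> N B hN F gF a a0; rewrite (op_shift hN). Qed.

Lemma good_Ex d (T : measurableType d) (P : probability T R) (F : T -> vec -> R) :
  gfam P F -> good (fun b => Ex P (fun t => F t b)).
Proof.
move=> gF; have [mF [C [iC C0 h]]] := gF; split.
  move=> d' Z g f mg mf; apply: (measurable_Ex P (fun z t => F t (f z))).
  apply: (mF _ _ snd (fun z => f z.1)) => // s.
  exact: measurableT_comp (mf s) _.
exists (Ex P C) => b b0; rewrite mulrC -ExZ//; apply: Ex_abs_le.
- exact: gfam_ig.
- exact: igZ.
- by move=> t; rewrite mulrC h.
Qed.

Lemma isop_comp M1 M2 B1 B2 : isop M1 B1 -> isop M2 B2 ->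
  isop (fun F => M1 (M2 F)) (B1 * B2).
Proof.
move=> h1 h2; split.
- by rewrite mulr_ge0// ?(op_ge0 h1)// (op_ge0 h2).
- by move=> d T F mF; apply: (op_mfam h1); exact: (op_mfam h2).
- move=> F C mF h; rewrite -mulrA; apply: (op_grow h1); first exact: (op_mfam h2).
  exact: (op_grow h2).
- move=> F G k gF gG a a0.
  have g2F := op_good h2 gF; have g2G := op_good h2 gG.
  rewrite -(op_lin h1)//; apply: (op_ext h1) => //.
  + by apply: (op_good h2); apply: goodD => //; exact: goodZ.
  + by apply: goodD => //; exact: goodZ.
  + by move=> b b0; rewrite (op_lin h2).
- move=> F G gF gG h a a0; apply: (op_le h1) => //; [exact: op_good h2 _..|].
  exact: (op_le h2).
- move=> F w a.
  rewrite -(op_shift h1); congr (M1 _ a); apply/funext => b; exact: (op_shift h2).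
- move=> d T P F gF a a0.
  rewrite -(op_int h1 (op_gfam h2 gF))//; apply: (op_ext h1) => //.
  + by apply: (op_good h2); exact: good_Ex gF.
  + exact: good_Ex (op_gfam h2 gF).
  + by move=> b b0; exact: (op_int h2).
Qed.

Lemma central_comp M1 M2 B1 B2 : isop M1 B1 -> isop M2 B2 ->
  central M1 -> central M2 -> central (fun F => M1 (M2 F)).
Proof.
move=> h1 h2 c1 c2 N B hN F gF a a0.
rewrite (c1 _ _ hN)//; last exact: op_good h2 gF.
apply: (op_ext h1) => //.
- by apply: (op_good hN); exact: (op_good h2).
- by apply: (op_good h2); exact: (op_good hN).
- by move=> b b0; exact: (c2 _ _ hN).
Qed.

Lemma isop_iter M B n : isop M B -> isop (iter n M) (B ^+ n).
Proof.
move=> h; elim: n => [|n IH]; first by rewrite expr0; exact: isop_id.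
by rewrite exprS; apply: (isop_comp h IH).
Qed.

Lemma central_iter M B n : isop M B -> central M -> central (iter n M).
Proof.
move=> h c; elim: n => [|n IH]; first by [].
exact: (central_comp h (isop_iter n h) c IH).
Qed.

Section mix.
Context d (O : measurableType d) (Q : probability O R).
Variables (M : O -> (vec -> R) -> vec -> R) (B : O -> R).
Hypotheses (hM : forall o, isop (M o) (B o)) (iB : ig Q B)
  (mM : forall d' (T : measurableType d') (F : T -> vec -> R), mfam F ->
    mfam (fun z : O * T => M z.1 (F z.2))).

Lemma mix_gfam F : good F -> gfam Q (fun o => M o F).
Proof.
move=> gF; have [C C0 h] := good_grow gF; split.
  move=> d' Z g f mg mf; apply: (mM (mfun_mfam (T := unit) gF.1) (g := fun z => (g z, tt))) => //.
  exact: measurable_fun_pair.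
exists (fun o => B o * C); split.
- by under eq_fun do rewrite mulrC; exact: igZ.
- by move=> o; rewrite mulr_ge0// (op_ge0 (hM o)).
- by move=> o; apply: (op_grow (hM o)) => //; exact: gF.1.
Qed.

(** Growth factors average under mixing. An integrable rather than bounded B is what a Poisson
    number of factors requires, as each factor multiplies the growth by a constant. *)
Lemma isop_mix : isop (fun F a => Ex Q (fun o => M o F a)) (Ex Q B).
Proof.
split.
- by apply: Ex_ge0 => o; exact: op_ge0 (hM o).
- move=> d' T F mF d'' Z g f mg mf.
  apply: (measurable_Ex Q (fun z o => M o (F (g z)) (f z))).
  apply: (mM mF (g := fun z : Z * O => (z.2, g z.1)) (f := fun z => f z.1)).
    apply: measurable_fun_pair => //; exact: measurableT_comp mg _.
  by move=> s; exact: measurableT_comp (mf s) _.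
- move=> F C mF h a a0.
  have gF : good F by split => //; exists C.
  rewrite -mulrA mulrC -ExZ//.
  under [X in _ <= Ex Q X]eq_fun do rewrite mulrC.
  apply: Ex_abs_le.
  + exact: gfam_ig (mix_gfam _) a0.
  + by under eq_fun do rewrite mulrC; apply: igZ.
  + by move=> o; rewrite mulrA; apply: (op_grow (hM o)).
- move=> F G k gF gG a a0.
  under eq_fun do rewrite (op_lin (hM _))//.
  have i1 := gfam_ig (mix_gfam gF) a0; have i2 := gfam_ig (mix_gfam gG) a0.
  by rewrite (ExD i1 (igZ k i2)) ExZ.
- move=> F G gF gG h a a0; apply: Ex_le.
  + exact: gfam_ig (mix_gfam _) a0.
  + exact: gfam_ig (mix_gfam _) a0.
  + by move=> o; apply: (op_le (hM o)).
- by move=> F w a; congr Ex; apply/funext => o; exact: op_shift (hM o) _ _ _.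
- move=> d' T P F gF a a0.
  under eq_fun do rewrite (op_int (hM _) gF)//.
  have [mF [C [iC C0 h]]] := gF.
  apply: (Ex_swap (g := fun o => B o * (1 + mass a) ^+ 2) (h := C)) => //.
  + by apply: (mM mF (g := id) (f := fun=> a)).
  + by under eq_fun do rewrite mulrC; exact: igZ.
  + move=> o t; rewrite mulrAC; apply: (op_grow (hM o)) => //.
    exact: mfam_fun.
Qed.

Lemma central_mix : (forall o, central (M o)) -> central (fun F a => Ex Q (fun o => M o F a)).
Proof.
move=> cM N B' hN F gF a a0.
rewrite (op_int hN (mix_gfam gF))//; congr Ex; apply/funext => o.
exact: (cM o _ _ hN).
Qed.

End mix.

Lemma isop_sum (I : Type) (r : seq I) (k : I -> R) (M : I -> (vec -> R) -> vec -> R) (B : I -> R) :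
  (forall i, 0 <= k i) -> (forall i, isop (M i) (B i)) ->
  isop (fun F a => \sum_(i <- r) k i * M i F a) (\sum_(i <- r) k i * B i).
Proof.
move=> k0 hM; split.
- by apply: sumr_ge0 => i _; rewrite mulr_ge0// (op_ge0 (hM i)).
- move=> d T F mF d' Z g f mg mf; apply: measurable_sum => i.
  by apply: measurable_funM => //; exact: (op_mfam (hM i) mF).
- move=> F C mF h a a0; apply: le_trans (ler_norm_sum _ _ _) _.
  rewrite -mulrA mulr_suml; apply: ler_sum => i _.
  rewrite normrM ger0_norm// -mulrA ler_wpM2l// mulrA.
  exact: (op_grow (hM i)).
- move=> F G l gF gG a a0; rewrite mulr_sumr -big_split; apply: eq_bigr => i _ /=.
  by rewrite (op_lin (hM i))//; ring.
- by move=> F G gF gG h a a0; apply: ler_sum => i _; rewrite ler_wpM2l//; exact: (op_le (hM i)).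
- by move=> F w a; apply: eq_bigr => i _; rewrite (op_shift (hM i)).
- move=> d T P F gF a a0; rewrite Ex_sum; last first.
    by move=> i; apply: igZ; exact: (gfam_ig (op_gfam (hM i) gF)).
  apply: eq_bigr => i _; rewrite (op_int (hM i) gF)// ExZ//.
  exact: (gfam_ig (op_gfam (hM i) gF)).
Qed.

Lemma central_sum (I : Type) (r : seq I) (k : I -> R) (M : I -> (vec -> R) -> vec -> R) (B : I -> R) :
  (forall i, isop (M i) (B i)) -> (forall i, central (M i)) ->
  central (fun F a => \sum_(i <- r) k i * M i F a).
Proof.
move=> hM cM N B' hN F gF a a0.
rewrite (op_sum _ hN)//; last by move=> i; apply: goodZ; exact: op_good (hM i) gF.
apply: eq_bigr => i _; rewrite (op_Z _ hN)//; last exact: op_good (hM i) gF.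
by rewrite (cM i _ _ hN).
Qed.

End ops.

Lemma measurable_fun_nat d (Z : measurableType d) (R : realType) (h : nat -> Z -> R)
    (g : Z -> nat) : (forall m, measurable_fun setT (h m)) -> measurable_fun setT g ->
  measurable_fun setT (fun z => h (g z) z).
Proof.
move=> mh mg _ Y mY; rewrite setTI.
rewrite (_ : _ @^-1` Y = \bigcup_m (g @^-1` [set m] `&` h m @^-1` Y)); last first.
  by apply/seteqP; split => [z Yz|z [m _ [/= -> ]]] //; exists (g z).
apply: bigcupT_measurable => m; apply: measurableI.
  by rewrite -[X in measurable X]setTI; exact: mg.
by rewrite -[X in measurable X]setTI; exact: mh.
Qed.

(** * Attaching factors, Poisson mixtures and pinning *)

Section channels.
Context {R : realType} {S : finType}.
Notation vec := (S -> R).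
Implicit Types (a b w c : vec) (F G : vec -> R).

(** Preservation of all linear functionals, not just of the mass: the configuration keeps its prior
    law on average, so any error that is linear in the weights can be evaluated before M is
    applied. *)
Definition mp (M : (vec -> R) -> vec -> R) :=
  forall c a, nn a -> M (ell c) a = ell c a.

Lemma mp_mass M a : mp M -> nn a -> M mass a = mass a.
Proof. by move=> hM a0; rewrite !mass_ell hM. Qed.

Lemma mp_comp M1 M2 B1 B2 : isop M1 B1 -> isop M2 B2 -> mp M1 -> mp M2 ->
  mp (fun F => M1 (M2 F)).
Proof.
move=> h1 h2 m1 m2 c a a0; rewrite -[RHS]m1//; apply: (op_ext h1) => //.
- by apply: (op_good h2); exact: good_ell.
- exact: good_ell.
- by move=> b b0; exact: m2.
Qed.

Lemma mp_iter M B n : isop M B -> mp M -> mp (iter n M).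
Proof.
by move=> h hm; elim: n => [|n IH] //; exact: (mp_comp h (isop_iter n h) hm IH).
Qed.

Definition F0 a : R := Lambda (mass a).

Lemma good_F0 : good F0.
Proof.
split.
  move=> d' Z g f mg mf; apply: measurableT_comp; first exact: measurable_Lambda.
  exact: measurable_sum.
exists 1 => a a0; rewrite mul1r; apply: le_trans (Lambda_bound _) _.
by have := mass_ge0 a0; nra.
Qed.

Section chan.
Context d (X : measurableType d) (P : probability X R) (w : X -> vec) (D : R).
Hypotheses (mw : forall s, measurable_fun setT (fun x => w x s))
  (w0 : forall x s, 0 <= w x s) (wD : forall x s, w x s <= D) (D1 : 1 <= D).

Definition chan F a : R := Ex P (fun x => F (amul a (w x))).

Let hshift x := isop_shift (w0 x) (wD x) D1.

Let mM d' (T : measurableType d') (F : T -> vec -> R) : mfam F ->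
  mfam (fun z : X * T => fun a => F z.2 (amul a (w z.1))).
Proof.
move=> mF d'' Z g f mg mf; apply: (mF _ _ (fun z => (g z).2) (fun z => amul (f z) (w (g z).1))).
  exact: measurableT_comp mg.
move=> s; apply: measurable_funM; first exact: mf.
by apply: measurableT_comp (mw s) _; exact: measurableT_comp mg.
Qed.

Lemma isop_chan : isop chan (D ^+ 2).
Proof. by have := isop_mix hshift (ig_cst P _) mM; rewrite Ex_cst. Qed.

Lemma central_chan : central chan.
Proof. exact: (central_mix hshift (ig_cst P _) mM (fun x => @central_shift _ _ (w x))). Qed.

Lemma bm_w s : bm (fun x => w x s).
Proof. by split => //; exists D => x; rewrite ger0_norm. Qed.

Lemma chan_ell c a : chan (ell c) a = ell c (amul a (fun s => Ex P (fun x => w x s))).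
Proof.
have h s : bm (fun x => c s * a s * w x s) by apply: bmZ; exact: bm_w.
rewrite /chan /ell /amul.
under eq_fun => x do under eq_bigr do rewrite mulrA.
rewrite Ex_sum; last by move=> s; exact: bm_ig.
by apply: eq_bigr => s _; rewrite ExZ ?mulrA//; apply: bm_ig; exact: bm_w.
Qed.

End chan.

Section pois.
Variables (K : (vec -> R) -> vec -> R) (B : R).
Hypothesis hK : isop K B.

Definition pois c l F a : R := Ex (Po l) (fun m => iter m K F (amul a c)).

Section isop.
Variables (c : vec) (D l : R).
Hypotheses (c0 : nn c) (cD : forall s, c s <= D) (D1 : 1 <= D) (l0 : 0 <= l).

Let hM m : isop (fun F a => iter m K F (amul a c)) (D ^+ 2 * B ^+ m).
Proof. exact: (isop_comp (isop_shift c0 cD D1) (isop_iter m hK)). Qed.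

Let iB : ig (Po l) (fun m => D ^+ 2 * B ^+ m).
Proof. by apply: igZ; apply: ig_pow => //; exact: op_ge0 hK. Qed.

Let mM d' (T : measurableType d') (F : T -> vec -> R) : mfam F ->
  mfam (fun z : nat * T => fun a => iter z.1 K (F z.2) (amul a c)).
Proof.
move=> mF d'' Z g f mg mf.
apply: (measurable_fun_nat (h := fun m z => iter m K (F (g z).2) (amul (f z) c)) (g := fun z => (g z).1)).
  move=> m; apply: (op_mfam (isop_iter m hK) mF (g := fun z => (g z).2) (f := fun z => amul (f z) c)).
    exact: measurableT_comp mg.
  by move=> s; exact: measurable_funM.
exact: measurableT_comp mg.
Qed.

Lemma isop_pois : isop (pois c l) (D ^+ 2 * expR (l * (B - 1))).
Proof.
have := isop_mix hM iB mM; rewrite ExZ; last by apply: ig_pow => //; exact: op_ge0 hK.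
by rewrite Ex_Po_pow//; exact: op_ge0 hK.
Qed.

Lemma central_pois : central K -> central (pois c l).
Proof.
move=> cK; apply: (central_mix hM iB mM) => m.
exact: (central_comp (isop_shift c0 cD D1) (isop_iter m hK) (@central_shift _ _ c) (central_iter m hK cK)).
Qed.

Lemma pois_gfam F : good F -> gfam (Po l) (fun m a => iter m K F (amul a c)).
Proof. exact: (mix_gfam hM iB mM). Qed.

End isop.

Lemma iter_ell (z : vec) c m a : (forall c a, nn a -> K (ell c) a = ell c (amul a z)) -> nn z -> nn a ->
  iter m K (ell c) a = ell c (amul a (fun s => z s ^+ m)).
Proof.
move=> hz z0; elim: m a => [|m IH] a a0.
  by congr ell; apply/funext => s; rewrite /amul expr0 mulr1.
have E (b : vec) : ell c (amul b (fun s => z s ^+ m)) = ell (amul c (fun s => z s ^+ m)) b.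
  by apply: eq_bigr => s _; rewrite /amul; ring.
rewrite iterS (op_ext hK (G := ell (amul c (fun s => z s ^+ m))))//.
- rewrite hz//; apply: eq_bigr => s _; rewrite /amul exprS; ring.
- by apply: (op_good (isop_iter m hK)); exact: good_ell.
- exact: good_ell.
- by move=> b b0; rewrite IH// E.
Qed.

(** On linear functionals m factors act as [z s ^+ m]; the Poisson mean [expR (l * (z s - 1))] is
    cancelled by the compensating weight. *)
Lemma mp_pois (z : vec) l : (forall c a, nn a -> K (ell c) a = ell c (amul a z)) -> nn z ->
  0 <= l -> mp (pois (fun s => expR (l * (1 - z s))) l).
Proof.
move=> hz z0 l0 c a a0; rewrite /pois.
have ae0 : nn (amul a (fun s => expR (l * (1 - z s)))).
  by apply: nn_amul => // s; exact: expR_ge0.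
under eq_fun do rewrite (iter_ell _ _ hz z0 ae0).
rewrite /ell Ex_sum; last first.
  move=> s; apply: (eq_ind _ (ig (Po l)) (igZ (c s * a s * expR (l * (1 - z s))) (ig_pow l0 (z0 s)))).
  by apply/funext => m; rewrite /amul; ring.
apply: eq_bigr => s _; rewrite /amul.
under eq_fun do rewrite !mulrA.
rewrite ExZ ?Ex_Po_pow//; last exact: ig_pow.
rewrite -mulrA -expRD.
have -> : l * (1 - z s) + l * (z s - 1) = 0 by ring.
by rewrite expR0 mulr1.
Qed.

End pois.

Section split.
Variables (K1 K2 : (vec -> R) -> vec -> R) (B1 B2 : R).
Hypotheses (h1 : isop K1 B1) (h2 : isop K2 B2) (c1 : central K1).

Lemma pascal_sum (z : nat -> nat -> R) m :
  \sum_(i < m.+2) 'C(m.+1, i)%:R * z i (m.+1 - i)%N =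
  \sum_(i < m.+1) 'C(m, i)%:R * (z i.+1 (m - i)%N + z i (m - i).+1).
Proof.
under [RHS]eq_bigr do rewrite mulrDr; rewrite big_split/=.
rewrite big_ord_recl/= bin0 subn0 mul1r.
under eq_bigr => i _ do rewrite /bump/= add1n binS natrD mulrDl subSS.
rewrite big_split/= addrCA addrA addrC; congr (_ + _).
rewrite addrC [X in _ + X]big_ord_recr/= bin_small// mul0r addr0.
rewrite [in RHS]big_ord_recl/= bin0 mul1r subn0; congr (_ + _).
apply: eq_bigr => i _; rewrite /bump/= add1n; congr (_ * z _ _).
by rewrite subnSK.
Qed.

(** The binomial theorem for commuting operators; centrality of K1 moves its applications to the
    outside. *)
Lemma iter_binomial (p r : R) F m a : good F -> nn a ->
  iter m (fun F a => p * K1 F a + r * K2 F a) F a =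
  \sum_(i < m.+1) 'C(m, i)%:R * p ^+ i * r ^+ (m - i) * iter i K1 (iter (m - i) K2 F) a.
Proof.
move=> gF; elim: m a => [|m IH] a a0.
  by rewrite big_ord_recl big_ord0 bin0 subnn !expr0 /= !mulr1 mul1r addr0.
pose z i j := p ^+ i * r ^+ j * iter i K1 (iter j K2 F) a.
transitivity (\sum_(i < m.+2) 'C(m.+1, i)%:R * z i (m.+1 - i)%N); last first.
  by apply: eq_bigr => i _; rewrite /z !mulrA.
have g i j : good (iter i K1 (iter j K2 F)).
  by apply: (op_good (isop_iter i h1)); exact: (op_good (isop_iter j h2)).
have gS : good (fun b => \sum_(i < m.+1) 'C(m, i)%:R * p ^+ i * r ^+ (m - i) * iter i K1 (iter (m - i) K2 F) b).
  by apply: good_sum => i; exact: goodZ.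
have [Bm gm] : exists B, isop (iter m (fun F a => p * K1 F a + r * K2 F a)) B \/ True by exists 0; right.
have gI : good (iter m (fun F a => p * K1 F a + r * K2 F a) F).
  elim: (m) => [//|n IHn] /=.
  by apply: goodD; apply: goodZ; [exact: op_good h1 IHn|exact: op_good h2 IHn].
rewrite pascal_sum iterS.
rewrite (op_ext h1 gI gS IH a0) (op_ext h2 gI gS IH a0).
rewrite (op_sum _ h1)//; last by move=> i; exact: goodZ.
rewrite (op_sum _ h2)//; last by move=> i; exact: goodZ.
rewrite !mulr_sumr -big_split; apply: eq_bigr => i _ /=.
rewrite (op_Z _ h1)// (op_Z _ h2)//.
have gj : good (iter (m - i) K2 F) := op_good (isop_iter _ h2) gF.
rewrite (central_iter i h1 c1 h2 gj a0) /z !exprS /=; ring.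
Qed.

(** Thinning at the level of operators: a Poisson stage whose factors have two kinds is the
    composition of two independent Poisson stages, provided that the compensating weights
    multiply. *)
Lemma pois_split (p r l l1 l2 : R) e1 e2 e F a D : 0 <= l -> 0 <= p -> 0 <= r -> p + r = 1 ->
  p * l = l1 -> r * l = l2 -> e = amul e1 e2 ->
  nn e1 -> nn e2 -> (forall s, e2 s <= D) -> 1 <= D -> good F -> nn a ->
  pois (fun F a => p * K1 F a + r * K2 F a) e l F a = pois K1 e1 l1 (pois K2 e2 l2 F) a.
Proof.
move=> l0 p0 r0 pr pl1 rl2 -> e10 e20 e2D D1 gF a0.
have l10 : 0 <= l1 by rewrite -pl1 mulr_ge0.
have l20 : 0 <= l2 by rewrite -rl2 mulr_ge0.
have ae0 : nn (amul a (amul e1 e2)) by apply: nn_amul => //; exact: nn_amul.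
rewrite /pois; under eq_fun do rewrite iter_binomial//.
have [C C0 hC] := good_grow gF.
have B10 := op_ge0 h1; have B20 := op_ge0 h2.
pose h := Num.max B1 B2.
have h0 : 0 <= h by rewrite le_max B10.
rewrite (Ex_Po_split_rates (c := C * (1 + mass (amul a (amul e1 e2))) ^+ 2) (h := h)
  (y := fun i j => iter i K1 (iter j K2 F) (amul a (amul e1 e2))) l0 p0 r0 pr h0 _ pl1 rl2).
  congr Ex; apply/funext => m.
  have := op_int (isop_iter m h1) (pois_gfam h2 e20 e2D D1 l20 gF) (nn_amul a0 e10).
  move=> ->; congr Ex; apply/funext => j.
  by rewrite (op_shift (isop_iter m h1)) amulA.
move=> i j.
have gj : good (iter j K2 F) := op_good (isop_iter _ h2) gF.
apply: le_trans (op_grow (isop_iter i h1) gj.1 (op_grow (isop_iter j h2) gF.1 hC) ae0) _.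
set M := (1 + mass _) ^+ 2.
have m0 : 0 <= C * M by rewrite mulr_ge0// sqr_ge0.
have -> : B1 ^+ i * (B2 ^+ j * C) * M = C * M * (B1 ^+ i * B2 ^+ j) by ring.
rewrite ler_wpM2l// exprD.
by apply: ler_pM; rewrite ?exprn_ge0// lerXn2r// ?nnegrE// le_max lexx ?orbT.
Qed.

End split.

Section pins.
Context {V Q : finType} (sp : V -> S -> Q).
Hypothesis V0 : (0 < #|V|)%N.

Definition ind (i : V) (z : Q) : vec := fun s => (sp i s == z)%:R.

Definition pin F a : R := \sum_(x : V * Q) #|V|%:R^-1 * F (amul a (ind x.1 x.2)).

Let Vn0 : #|V|%:R != 0 :> R. Proof. by rewrite pnatr_eq0 -lt0n. Qed.

Lemma ind_ge0 i z : nn (ind i z). Proof. by move=> s; exact: ler0n. Qed.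

Lemma ind_le1 i z s : ind i z s <= 1. Proof. by rewrite /ind; case: eqP. Qed.

Lemma isop_pin : isop pin #|Q|%:R.
Proof.
have k0 : 0 <= #|V|%:R^-1 :> R by rewrite invr_ge0.
have := isop_sum (index_enum _) (fun x : V * Q => k0)
  (fun x => isop_shift (@ind_ge0 x.1 x.2) (@ind_le1 x.1 x.2) (lexx 1)).
rewrite (_ : \sum_(_ <- _) _ = #|Q|%:R)//.
by rewrite expr1n mulr1 sumr_const card_prod mulrnA -[_ *+ #|V|]mulr_natr mulVf.
Qed.

Lemma central_pin : central pin.
Proof.
apply: (@central_sum _ _ _ (index_enum _) (fun=> _) _ (fun=> 1 ^+ 2)) => x; last exact: central_shift.
exact: isop_shift (@ind_ge0 x.1 x.2) (@ind_le1 x.1 x.2) (lexx 1).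
Qed.

Lemma sum_ind i s : \sum_z ind i z s = 1.
Proof.
rewrite (bigD1 (sp i s))//= /ind eqxx big1 ?addr0// => z.
by rewrite eq_sym => /negPf ->.
Qed.

Lemma pin_pair F a : pin F a = #|V|%:R^-1 * \sum_i \sum_z F (amul a (ind i z)).
Proof. by rewrite /pin pair_bigA mulr_sumr. Qed.

Lemma ell_ind c a i : \sum_z ell c (amul a (ind i z)) = ell c a.
Proof.
rewrite exchange_big; apply: eq_bigr => s _ /=.
by rewrite -mulr_sumr -mulr_sumr sum_ind mulr1.
Qed.

Lemma mp_pin : mp pin.
Proof.
move=> c a a0; rewrite pin_pair; under eq_bigr do rewrite ell_ind.
by rewrite sumr_const -[ell c a *+ _]mulr_natl mulrA mulVf ?mul1r.
Qed.

(** The difference is the mass times the mean entropy of a random spin under the normalized weights,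
    hence between 0 and the maximal entropy. *)
Lemma F0_pin a : nn a -> 0 <= F0 a - pin F0 a <= ln #|Q|%:R * mass a.
Proof.
move=> a0.
have m i : \sum_z mass (amul a (ind i z)) = mass a by rewrite mass_ell ell_ind.
have E : F0 a = #|V|%:R^-1 * \sum_(i : V) F0 a.
  by rewrite sumr_const -[F0 a *+ _]mulr_natl mulrA mulVf ?mul1r.
rewrite E pin_pair -mulrBr -sumrB.
have b (i : V) : 0 <= F0 a - \sum_z F0 (amul a (ind i z)) <= ln #|Q|%:R * mass a.
  have h0 z : 0 <= mass (amul a (ind i z)) by apply: mass_ge0; apply: nn_amul => //; exact: ind_ge0.
  have := Lambda_sum_le h0; have := Lambda_sum_ge h0; rewrite m /F0.
  by lra.
apply/andP; split.
  by rewrite mulr_ge0 ?invr_ge0// sumr_ge0// => i _; case/andP: (b i).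
rewrite ler_pdivrMl ?ltr0n//.
apply: le_trans (_ : \sum_(i : V) ln #|Q|%:R * mass a <= _).
  by apply: ler_sum => i _; case/andP: (b i).
by rewrite sumr_const -[_ *+ _]mulr_natl.
Qed.

(* the average over N random sites of the total correlation *)
Definition TC N a : R := iter N pin F0 a - F0 a - N%:R * (pin F0 a - F0 a).

Lemma good_iter_pin N F : good F -> good (iter N pin F).
Proof. by move=> gF; exact: op_good (isop_iter N isop_pin) gF. Qed.

Lemma good_TC N : good (TC N).
Proof.
have g1 := good_iter_pin N good_F0; have g2 := op_good isop_pin good_F0.
by apply: goodB; [exact: goodB good_F0|apply: goodZ; exact: goodB good_F0].
Qed.

(** Shifting the summation window by one changes the sum only at its two ends, whatever T is. *)
Lemma sum_shift_bound (D : nat -> R) L T j : (forall t, 0 <= D t <= L) ->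
  \sum_(t < T) (D t - D (t + j)%N) <= j%:R * L.
Proof.
move=> hD; elim: j => [|j IH].
  by rewrite big1 ?mul0r// => t _; rewrite addn0 subrr.
rewrite -natr1 mulrDl mul1r.
have -> : \sum_(t < T) (D t - D (t + j.+1)%N) =
    \sum_(t < T) (D t - D (t + j)%N) + \sum_(t < T) (D (t + j)%N - D (t.+1 + j)%N).
  by rewrite -big_split; apply: eq_bigr => t _ /=; rewrite addnS addSn; ring.
rewrite lerD//.
rewrite -(big_mkord xpredT (fun t => D (t + j)%N - D (t.+1 + j)%N)).
rewrite (eq_bigr (fun t => - (D (t.+1 + j)%N - D (t + j)%N))); last by move=> t _; rewrite opprB.
rewrite sumrN (telescope_sumr (fun t => D (t + j)%N))// opprB.
by have := hD (0 + j)%N; have := hD (T + j)%N; lra.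
Qed.

(** With phi t the value of [F0] after t pins, the decrements phi t - phi (t + 1) are entropies of
    one further spin and lie in [0, L]. The total correlation after t pins is a sum of differences
    of such decrements at t and t + j, so the sum over t telescopes. The bound does not depend on T:
    for most t the total correlation is O(1/T). *)
Lemma TC_sum (M : (vec -> R) -> vec -> R) B N T a : isop M B -> mp M -> nn a ->
  \sum_(t < T) M (iter t pin (TC N)) a <= (N * N)%:R * (ln #|Q|%:R * mass a).
Proof.
move=> hM mM a0; pose phi t := M (iter t pin F0) a.
pose L := ln #|Q|%:R * mass a.
have gi t := good_iter_pin t good_F0.
have hD t : 0 <= phi t - phi t.+1 <= L.
  have hI := isop_iter t isop_pin.
  have -> : phi t - phi t.+1 = M (iter t pin (fun b => F0 b - pin F0 b)) a.
    rewrite /phi -(op_B hM)//; apply: (op_ext hM) => //.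
    - by apply: goodB; [exact: gi|exact: (gi t.+1)].
    - apply: (op_good hI); apply: goodB; [exact: good_F0|exact: (gi 1%N)].
    - move=> b b0; rewrite (op_B hI)//; [|exact: good_F0|exact: (gi 1%N)].
      by rewrite -iterSr.
  have hMI := isop_comp hM hI; have mMI := mp_comp hM hI mM (mp_iter t isop_pin mp_pin).
  have gd : good (fun b => F0 b - pin F0 b) by apply: goodB; [exact: good_F0|exact: (gi 1%N)].
  apply/andP; split.
    have := op_le hMI (good_ell (fun=> 0)) gd.
    move=> /(_ _ a a0); rewrite mMI// (_ : ell _ a = 0); last by rewrite /ell big1// => s _; rewrite mul0r.
    apply=> b b0; rewrite (_ : ell _ b = 0); last by rewrite /ell big1// => s _; rewrite mul0r.
    by have /andP[] := F0_pin b0.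
  have := op_le hMI gd (good_ell (fun=> ln #|Q|%:R)) .
  have E b : ell (fun=> ln #|Q|%:R) b = ln #|Q|%:R * mass b by rewrite /ell -mulr_sumr.
  move=> /(_ _ a a0); rewrite mMI// E; apply=> b b0; rewrite E.
  by have /andP[] := F0_pin b0.
have E t : M (iter t pin (TC N)) a = \sum_(j < N) ((phi t - phi t.+1) - (phi (t + j)%N - phi (t + j).+1)).
  have hI := isop_iter t isop_pin.
  have hMI := isop_comp hM hI.
  rewrite sumrB sumr_const card_ord.
  have -> : \sum_(j < N) (phi (t + j)%N - phi (t + j).+1) = phi t - phi (t + N)%N.
    rewrite -(big_mkord xpredT (fun j => phi (t + j)%N - phi (t + j).+1)).
    rewrite (eq_bigr (fun j => - (phi (t + j.+1)%N - phi (t + j)%N))); last by move=> j _; rewrite opprB addnS.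
    by rewrite sumrN (telescope_sumr (fun j => phi (t + j)%N))// opprB addn0.
  have g1 := good_F0; have g2 : good (pin F0) := gi 1%N; have g3 := gi N.
  rewrite /TC (op_B hMI); [|exact: goodB|by apply: goodZ; exact: goodB|done].
  rewrite (op_B hMI)// (op_Z _ hMI)//; last exact: goodB.
  rewrite (op_B hMI)// -/(phi t) -iterSr -iterD -/(phi t.+1) -/(phi (t + N)%N) -mulr_natl.
  ring.
under eq_bigr do rewrite E.
rewrite exchange_big /=.
apply: le_trans (_ : \sum_(j < N) N%:R * L <= _); last first.
  by rewrite sumr_const card_ord -[_ *+ _]mulr_natl mulrA natrM.
apply: ler_sum => j _.
have L0 : 0 <= L by have := hD 0%N; lra.
apply: le_trans (sum_shift_bound (D := fun t => phi t - phi t.+1) T j hD) _.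
by rewrite ler_wpM2r// ler_nat ltnW.
Qed.

End pins.
End channels.

(** * Decoupling of pinned spins *)

Section tuples.
Context {R : realType} (T : finType).

Lemma sum_tuple0 (f : 0.-tuple T -> R) : \sum_t f t = f [tuple].
Proof. by rewrite (big_pred1 [tuple])// => t; apply/esym/eqP; exact: tuple0. Qed.

Lemma sum_tupleS n (f : n.+1.-tuple T -> R) :
  \sum_t f t = \sum_x \sum_(t : n.-tuple T) f (cons_tuple x t).
Proof.
rewrite pair_bigA (reindex (fun p : T * n.-tuple T => cons_tuple p.1 p.2))//=.
apply: onW_bij; exists (fun t => (thead t, behead_tuple t)).
  by move=> [x t]; congr (_, _); apply: val_inj.
by move=> t; rewrite [RHS]tuple_eta; apply: val_inj.
Qed.

Lemma tnth_cons0 (U : Type) n (x : U) (t : n.-tuple U) : tnth (cons_tuple x t) ord0 = x.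
Proof. by []. Qed.

Lemma tnth_consS (U : Type) n (x : U) (t : n.-tuple U) (j : 'I_n) :
  tnth (cons_tuple x t) (lift ord0 j) = tnth t j.
Proof. by rewrite !(tnth_nth x). Qed.

Lemma sum_tuple_prod n (F : 'I_n -> T -> R) :
  \sum_(t : n.-tuple T) \prod_j F j (tnth t j) = \prod_j \sum_x F j x.
Proof.
elim: n F => [|n IH] F; first by rewrite sum_tuple0 !big_ord0.
rewrite sum_tupleS big_ord_recl mulr_suml; apply: eq_bigr => x _.
rewrite -IH mulr_sumr; apply: eq_bigr => t _; rewrite big_ord_recl; congr (_ * _).
by apply: eq_bigr => j _; rewrite tnth_consS.
Qed.

Lemma sum_tuple_tnth n (g : T -> R) (j : 'I_n) (c : R) : \sum_(x : T) c = 1 ->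
  \sum_(t : n.-tuple T) c ^+ n * g (tnth t j) = \sum_x c * g x.
Proof.
move=> hc; transitivity (\sum_(t : n.-tuple T) \prod_i (c * if i == j then g (tnth t i) else 1)).
  apply: eq_bigr => t _; rewrite big_split/= prodr_const card_ord; congr (_ * _).
  by rewrite -big_mkcond big_pred1_eq.
rewrite (sum_tuple_prod (fun i x => c * if i == j then g x else 1)).
rewrite (bigD1 j)//= eqxx [X in _ * X]big1 ?mulr1// => i /negPf ij.
by under eq_bigr do rewrite ij mulr1.
Qed.

End tuples.

Section decouple.
Context {R : realType}.

(** Pointwise Pinsker by way of the Hellinger distance: [(Num.sqrt t - 1) ^+ 2] is at most
    [Lambda t - t + 1], and 2 u <= d + u^2 / d replaces the square root by an affine bound. *)
Lemma abs_le_entropy (t d : R) : 0 <= t -> 0 < d <= 1 ->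
  `|t - 1| <= d + 2 / d * (Lambda t - t + 1).
Proof.
move=> t0 /andP[d0 d1].
have hs : (Num.sqrt t - 1) ^+ 2 <= Lambda t - t + 1.
  move: t0; rewrite le_eqVlt => /predU1P[<-|t0]; first by rewrite sqrtr0 Lambda0; lra.
  have s0 : 0 < Num.sqrt t by rewrite sqrtr_gt0.
  have ss : Num.sqrt t ^+ 2 = t by rewrite sqr_sqrtr// ltW.
  have si : 0 < (Num.sqrt t)^-1 by rewrite invr_gt0.
  have := ln_le_sub1 si; rewrite lnV// => h.
  have h2 : Num.sqrt t * (1 - ln (Num.sqrt t)) <= 1.
    have sn : Num.sqrt t != 0 by rewrite gt_eqF.
    by rewrite -[leRHS](mulfV sn) ler_pM2l//; lra.
  have lnt : ln t = 2 * ln (Num.sqrt t) by rewrite -{1}ss lnXn// mulr_natl.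
  rewrite /Lambda lnt.
  set s := Num.sqrt t in h2 s0 ss *; set L := ln s in h2 *.
  rewrite -ss; nra.
set s := Num.sqrt t in hs; have s0 : 0 <= s by exact: sqrtr_ge0.
have ss : t = s ^+ 2 by rewrite sqr_sqrtr.
have abs : `|t - 1| <= `|s - 1| * (`|s - 1| + 2).
  have -> : t - 1 = (s - 1) * (s + 1) by rewrite ss; ring.
  rewrite normrM ler_wpM2l// (ger0_norm (x := s + 1)); last lra.
  by have := ler_norm (s - 1); lra.
set u := `|s - 1| in abs; have u0 : 0 <= u by exact: normr_ge0.
have uu : u ^+ 2 = (s - 1) ^+ 2 by rewrite real_normK ?num_real.
rewrite -uu in hs.
have di : 1 <= d^-1 by rewrite invf_ge1.
have h3 : 2 * u <= d + u ^+ 2 / d.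
  have := sqr_ge0 (d - u); rewrite -(ler_pM2r (x := d^-1)) ?invr_gt0// mul0r => h.
  have e : (d - u) ^+ 2 / d = d - 2 * u + u ^+ 2 / d by field; rewrite gt_eqF.
  by rewrite e in h; lra.
have h4 : u ^+ 2 <= u ^+ 2 / d by rewrite ler_peMr// sqr_ge0.
have h5 : u ^+ 2 / d <= (Lambda t - t + 1) / d by rewrite ler_pM2r// invr_gt0.
apply: le_trans abs _; rewrite mulrDr -expr2; rewrite mulrAC; lra.
Qed.

(** Optimizing over d would give Pinsker's square root. The affine form is kept since the relative
    entropy is averaged later, over sites and over pins, with d fixed. *)
Lemma dist_le_KL (I : finType) (p r : I -> R) (A d : R) :
  (forall i, 0 <= p i) -> (forall i, 0 <= r i) -> (forall i, r i = 0 -> p i = 0) ->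
  \sum_i p i = A -> \sum_i r i = A -> 0 < d <= 1 ->
  \sum_i `|p i - r i| <= d * A + 2 / d * \sum_i p i * (ln (p i) - ln (r i)).
Proof.
move=> p0 r0 pr pA rA hd.
have -> : d * A + 2 / d * \sum_i p i * (ln (p i) - ln (r i)) =
    \sum_i (d * r i + 2 / d * (p i * (ln (p i) - ln (r i)) - p i + r i)).
  rewrite big_split/= -!mulr_sumr; congr (_ + _ * _); first by rewrite -rA mulr_sumr.
  by rewrite big_split/= sumrB pA rA; ring.
apply: ler_sum => i _.
have := r0 i; rewrite le_eqVlt => /predU1P[ri0|ri0].
  have p_0 : p i = 0 by exact: pr.
  by rewrite p_0 -ri0 subrr normr0 le_eqVlt; apply/orP; left; apply/eqP; ring.
have t0 : 0 <= p i / r i by rewrite divr_ge0// ltW.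
have rn : r i != 0 by rewrite gt_eqF.
have h := ler_wpM2l (ltW ri0) (abs_le_entropy t0 hd).
have -> : `|p i - r i| = r i * `|p i / r i - 1|.
  by rewrite -[X in X * `|_|](gtr0_norm ri0) -normrM mulrBr mulr1 mulrCA mulfV// mulr1.
apply: le_trans h _.
have := p0 i; rewrite le_eqVlt => /predU1P[<-|pi0].
  by rewrite !mul0r Lambda0 le_eqVlt; apply/orP; left; apply/eqP; ring.
have dn : d != 0 by case/andP: hd => d0 _; rewrite gt_eqF.
rewrite /Lambda ln_div ?posrE// le_eqVlt; apply/orP; left; apply/eqP.
by field; rewrite rn dn.
Qed.

End decouple.

(** * Joint laws of random spins against products of marginals *)

Section superspin.
Context {R : realType} {S V Q : finType} (sp : V -> S -> Q).
Hypothesis V0 : (0 < #|V|)%N.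
Notation vec := (S -> R).
Implicit Types (a : vec).

Definition spt r (i : r.-tuple V) (s : S) : r.-tuple Q := map_tuple (fun v => sp v s) i.

Lemma spt_cons r v (i : r.-tuple V) s : spt (cons_tuple v i) s = cons_tuple (sp v s) (spt i s).
Proof. exact: val_inj. Qed.

Lemma ind_spt_cons r v (i : r.-tuple V) z (t : r.-tuple Q) s :
  ind (R:=R) (@spt _) (cons_tuple v i) (cons_tuple z t) s = ind sp v z s * ind (@spt _) i t s.
Proof.
rewrite /ind spt_cons -natrM mulnb; congr (_%:R).
Qed.

(** The entries of a uniform r-tuple of sites are independent and uniform, repetitions included, so
    pinning the tuple is pinning r times. *)
Lemma pin_spt r (F : vec -> R) a : pin (@spt r) F a = iter r (pin sp) F a.
Proof.
elim: r a => [|r IH] a.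
  rewrite pin_pair card_tuple expn0 invr1 mul1r sum_tuple0 sum_tuple0 /=; congr F.
  by apply/funext => s; rewrite /amul /ind (_ : _ == _) ?mulr1//; apply/eqP; exact: val_inj.
rewrite iterS !pin_pair sum_tupleS card_tuple expnS natrM invfM -mulrA; congr (_ * _).
rewrite mulr_sumr; apply: eq_bigr => v _.
under [in RHS]eq_bigr do rewrite -IH pin_pair card_tuple.
rewrite -mulr_sumr; congr (_ * _); rewrite [RHS]exchange_big /=.
apply: eq_bigr => i _; rewrite sum_tupleS; apply: eq_bigr => z _; apply: eq_bigr => t _.
by congr F; apply/funext => s; rewrite /amul ind_spt_cons mulrA.
Qed.

Lemma iter_pin_spt r m (F : vec -> R) a : iter m (pin (@spt r)) F a = iter (m * r) (pin sp) F a.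
Proof.
rewrite mulnC; elim: m a => [|m IH] a; first by rewrite muln0.
rewrite iterS pin_spt mulnS iterD; congr (iter r _ _ a); exact/funext.
Qed.

Section fixed.
Variables (a : vec) (a0 : nn a) (A0 : 0 < mass a).
Let A := mass a.

Definition mu v z : R := mass (amul a (ind sp v z)) / A.

Definition rho r (i : r.-tuple V) (t : r.-tuple Q) : R := \prod_h mu (tnth i h) (tnth t h).

Lemma mu_ge0 v z : 0 <= mu v z.
Proof. by rewrite divr_ge0 ?mass_ge0//; apply: nn_amul => //; exact: ind_ge0. Qed.

Lemma sum_mu v : \sum_z mu v z = 1.
Proof.
rewrite -mulr_suml; have := ell_ind sp (fun=> 1) a v.
by rewrite -mass_ell => ->; rewrite mulfV// gt_eqF.
Qed.

Lemma rho_ge0 r (i : r.-tuple V) t : 0 <= rho i t.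
Proof. by apply: prodr_ge0 => h _; exact: mu_ge0. Qed.

Lemma sum_rho r (i : r.-tuple V) : \sum_t rho i t = 1.
Proof.
rewrite /rho (sum_tuple_prod (fun h z => mu (tnth i h) z)).
by rewrite big1// => h _; exact: sum_mu.
Qed.

Section index.
Variables (m r : nat) (i : 'I_m -> r.-tuple V).

Definition spj (s : S) : m.-tuple (r.-tuple Q) := [tuple spt (i j) s | j < m].

Definition joint (t : m.-tuple (r.-tuple Q)) : R := \sum_s a s * (spj s == t)%:R.

(** The mass times the relative entropy of the m r spins with respect to the product of the
    single-site marginals ([KL_joint]), written through [F0] so that its average over random sites
    is the total correlation [TC]. *)
Definition KL : R := \sum_t Lambda (joint t) - F0 a -
  \sum_j \sum_h (\sum_z F0 (amul a (ind sp (tnth (i j) h) z)) - F0 a).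

Lemma joint_sum (f : m.-tuple (r.-tuple Q) -> R) :
  \sum_t joint t * f t = \sum_s a s * f (spj s).
Proof.
rewrite /joint; under eq_bigr do rewrite mulr_suml.
rewrite exchange_big; apply: eq_bigr => s _ /=.
rewrite (bigD1 (spj s))//= eqxx mulr1 big1 ?addr0// => t.
by rewrite eq_sym => /negPf ->; rewrite mulr0 mul0r.
Qed.

Lemma joint_ge0 t : 0 <= joint t.
Proof. by apply: sumr_ge0 => s _; rewrite mulr_ge0. Qed.

Lemma mu_gt0 s v : 0 < a s -> 0 < mu v (sp v s).
Proof.
move=> as0; rewrite divr_gt0//; apply: lt_le_trans as0 _.
rewrite /mass (bigD1 s)//= {1}/amul /ind eqxx mulr1 lerDl sumr_ge0// => s' _.
by rewrite /amul mulr_ge0.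
Qed.

Definition refj (t : m.-tuple (r.-tuple Q)) : R := A * \prod_j rho (i j) (tnth t j).

Lemma refj_spj s : 0 < a s -> ln (refj (spj s)) =
  ln A + \sum_j \sum_h ln (mu (tnth (i j) h) (sp (tnth (i j) h) s)).
Proof.
move=> as0.
have p0 j h : 0 < mu (tnth (i j) h) (tnth (tnth (spj s) j) h).
  by rewrite tnth_mktuple tnth_map; exact: mu_gt0.
have q0 j : 0 < rho (i j) (tnth (spj s) j) by apply: prodr_gt0 => h _; exact: p0.
have lnprod (I : finType) (f : I -> R) : (forall k, 0 < f k) -> ln (\prod_k f k) = \sum_k ln (f k).
  move=> f0; have [_ ->//] : 0 < \prod_k f k /\ ln (\prod_k f k) = \sum_k ln (f k).
  elim/big_rec2 : _ => [|k x y _ [y0 yx]]; first by rewrite ln1.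
  by rewrite mulr_gt0// lnM ?posrE// yx.
rewrite /refj lnM ?posrE//; last by apply: prodr_gt0 => j _; exact: q0.
rewrite lnprod//; congr (_ + _); apply: eq_bigr => j _.
rewrite /rho lnprod//; apply: eq_bigr => h _.
by rewrite tnth_mktuple tnth_map.
Qed.

Lemma KL_joint : KL = \sum_t joint t * (ln (joint t) - ln (refj t)).
Proof.
rewrite /KL; under [RHS]eq_bigr do rewrite mulrBr.
rewrite sumrB -addrA; congr (_ + _); rewrite -opprD; congr (- _).
rewrite (joint_sum (fun t => ln (refj t))).
transitivity (\sum_s a s * (ln A + \sum_j \sum_h ln (mu (tnth (i j) h) (sp (tnth (i j) h) s)))); last first.
  apply: eq_bigr => s _; have := a0 s; rewrite le_eqVlt => /predU1P[<-|as0].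
    by rewrite !mul0r.
  by rewrite refj_spj.
under [RHS]eq_bigr do rewrite mulrDr mulr_sumr.
rewrite big_split /= -mulr_suml -/(mass a); congr (_ + _).
rewrite [RHS]exchange_big; apply: eq_bigr => j _ /=.
under [RHS]eq_bigr do rewrite mulr_sumr.
rewrite [RHS]exchange_big; apply: eq_bigr => h _ /=; set v := tnth _ _.
have E z : F0 (amul a (ind sp v z)) = ln A * mass (amul a (ind sp v z)) + mass (amul a (ind sp v z)) * ln (mu v z).
  rewrite /F0 /mu; have := mass_ge0 (nn_amul a0 (@ind_ge0 R _ _ _ sp v z)).
  rewrite le_eqVlt => /predU1P[<-|p0]; first by rewrite Lambda0 mulr0 mul0r addr0.
  by rewrite /Lambda ln_div ?posrE// /A; ring.
under eq_bigr do rewrite E.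
rewrite big_split /= -mulr_sumr.
have := ell_ind sp (fun=> 1) a v; rewrite -mass_ell => ->.
rewrite /F0 /Lambda -/A mulrC [X in X - _]addrC addrK.
transitivity (\sum_z \sum_s a s * (ind sp v z s * ln (mu v z))).
  by apply: eq_bigr => z _; rewrite /mass mulr_suml; apply: eq_bigr => s _; rewrite /amul mulrA.
rewrite exchange_big; apply: eq_bigr => s _ /=; rewrite -mulr_sumr; congr (_ * _).
rewrite (bigD1 (sp v s))//= /ind eqxx mul1r big1 ?addr0// => z.
by rewrite eq_sym => /negPf ->; rewrite mul0r.
Qed.

Lemma decouple (f : m.-tuple (r.-tuple Q) -> R) (M d : R) :
  (forall t, `|f t| <= M) -> 0 < d <= 1 ->
  `|\sum_s a s * f (spj s) - A * \sum_t (\prod_j rho (i j) (tnth t j)) * f t| <=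
  M * (d * A + 2 / d * KL).
Proof.
move=> fM hd; rewrite -joint_sum mulr_sumr -sumrB.
apply: le_trans (ler_norm_sum _ _ _) _.
apply: le_trans (_ : M * \sum_t `|joint t - refj t| <= _); last first.
  have M0 : 0 <= M.
    have [s _] : exists s, 0 < a s.
      apply: contrapT => /forallNP h; move: A0; rewrite /mass big1 ?ltxx// => s _.
      by apply/eqP; rewrite eq_le a0 andbT leNgt; apply/negP; exact: h.
    exact: le_trans (normr_ge0 _) (fM (spj s)).
  rewrite ler_wpM2l// KL_joint; apply: dist_le_KL => //.
  - exact: joint_ge0.
  - move=> t; apply: mulr_ge0; first exact: ltW.
    by apply: prodr_ge0 => j _; exact: rho_ge0.
  - move=> t /eqP; rewrite /refj mulf_eq0 gt_eqF//= => /eqP h.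
    rewrite /joint big1// => s _; have [E|] := eqVneq (spj s) t; last by rewrite mulr0.
    have := a0 s; rewrite le_eqVlt => /predU1P[<-|as0]; first by rewrite mul0r.
    have : 0 < \prod_j rho (i j) (tnth t j).
      apply: prodr_gt0 => j _; apply: prodr_gt0 => k _.
      by rewrite -E tnth_mktuple tnth_map; exact: mu_gt0.
    by rewrite h ltxx.
  - have := joint_sum (fun=> 1); under eq_bigr do rewrite mulr1.
    by under [X in _ = X -> _]eq_bigr do rewrite mulr1.
  - rewrite /refj -mulr_sumr (sum_tuple_prod (fun j t => rho (i j) t)) big1 ?mulr1// => j _.
    exact: sum_rho.
rewrite mulr_sumr; apply: ler_sum => t _.
have -> : joint t * f t - A * (\prod_j rho (i j) (tnth t j) * f t) = f t * (joint t - refj t).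
  by rewrite /refj; ring.
by rewrite normrM ler_wpM2r.
Qed.

End index.
End fixed.
End superspin.

Section iidlemmas.
Context d (X : measurableType d) (R : realType) (P : probability X R).

Lemma bm_iid_Ex m (f : m.+1.-tuple X -> R) : bm f ->
  bm (fun x => Ex (iid m P) (fun t => f (cons_tuple x t))).
Proof. by move=> hf; apply: (bm_Ex _ (f := fun x t => f (cons_tuple x t))); exact: bm_tcons. Qed.

Lemma Ex_iid_tnth m (j : 'I_m) (f : X -> R) : bm f ->
  Ex (iid m P) (fun x => f (tnth x j)) = Ex P f.
Proof.
move=> hf; elim: m j => [[]//|m IH] j.
rewrite Ex_iidS; last exact: bm_tnth.
case: (unliftP ord0 j) => [k ->|->].
  by under eq_fun => x do under eq_fun do rewrite tnth_consS; rewrite Ex_cst IH.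
congr Ex; apply/funext => x.
by rewrite (_ : (fun t => _) = (fun=> f x)) ?Ex_cst//; apply/funext.
Qed.

Lemma Ex_iid_prod m (f : X -> R) : bm f ->
  Ex (iid m P) (fun x => \prod_j f (tnth x j)) = Ex P f ^+ m.
Proof.
move=> hf; elim: m => [|m IH].
  by rewrite Ex_iid0 ?big_ord0//; under eq_fun do rewrite big_ord0; exact: measurable_cst.
rewrite Ex_iidS; last by apply: bm_prod => j; exact: bm_tnth.
rewrite exprS -IH mulrC -ExZ; last exact: bm_ig.
congr Ex; apply/funext => x; rewrite mulrC -ExZ; last first.
  by apply: bm_ig; apply: bm_prod => j; exact: bm_tnth.
congr Ex; apply/funext => t; rewrite big_ord_recl; congr (_ * _).
by apply: eq_bigr => j _; rewrite tnth_consS.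
Qed.

(** [Lambda] obeys a product rule, so a product of m independent factors contributes m equal terms,
    one for each factor that [Lambda] hits. *)
Lemma Ex_iid_Lambda m (f : X -> R) : bm f -> (forall x, 0 < f x) ->
  Ex (iid m P) (fun x => Lambda (\prod_j f (tnth x j))) =
  m%:R * (Ex P (fun x => Lambda (f x)) * Ex P f ^+ m.-1).
Proof.
move=> hf f0; elim: m => [|m IH].
  rewrite Ex_iid0 ?big_ord0 ?Lambda1 ?mul0r//.
  by under eq_fun do rewrite big_ord0; exact: measurable_cst.
have hp : bm (fun t : m.-tuple X => \prod_j f (tnth t j)) by apply: bm_prod => j; exact: bm_tnth.
rewrite Ex_iidS; last by apply: bm_Lambda; apply: bm_prod => j; exact: bm_tnth.
have hL := bm_Lambda hp; have hl := bm_Lambda hf.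
have E x : Ex (iid m P) (fun t => Lambda (\prod_j f (tnth (cons_tuple x t) j))) =
    Ex P f ^+ m * Lambda (f x) + Ex (iid m P) (fun t => Lambda (\prod_j f (tnth t j))) * f x.
  rewrite (_ : (fun t => _) = (fun t : m.-tuple X =>
      Lambda (f x) * \prod_j f (tnth t j) + f x * Lambda (\prod_j f (tnth t j)))).
    rewrite (ExD (bm_ig _ (bmZ _ hp)) (bm_ig _ (bmZ _ hL))) (ExZ _ (bm_ig _ hp)) (ExZ _ (bm_ig _ hL)).
    by rewrite Ex_iid_prod// mulrC [f x * _]mulrC.
  apply/funext => t; rewrite big_ord_recl (eq_bigr (fun j => f (tnth t j))).
    have p0 : 0 <= \prod_j f (tnth t j) by apply: prodr_ge0 => j _; exact: ltW.
    exact: etrans (LambdaM (f0 x) p0) (addrC _ _).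
  by move=> j _; rewrite tnth_consS.
under eq_fun do rewrite E.
rewrite (ExD (bm_ig _ (bmZ _ hl)) (bm_ig _ (bmZ _ hf))) (ExZ _ (bm_ig _ hl)) (ExZ _ (bm_ig _ hf)).
rewrite IH /=; case: m {IH hp hL E} => [|m]; first by rewrite !expr0; ring.
by rewrite -[m.+2%:R]natr1 exprS /=; ring.
Qed.

Lemma iter_chan (S : finType) (w : X -> S -> R) D m (F : (S -> R) -> R) a :
  (forall s, measurable_fun setT (fun x => w x s)) -> (forall x s, 0 <= w x s) ->
  (forall x s, w x s <= D) -> 1 <= D -> good F -> nn a ->
  bm (fun x : m.-tuple X => F (amul a (fun s => \prod_j w (tnth x j) s))) /\
  iter m (chan P w) F a = Ex (iid m P) (fun x => F (amul a (fun s => \prod_j w (tnth x j) s))).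
Proof.
move=> mw w0 wD D1 gF a0.
have hb k : bm (fun x : k.-tuple X => F (amul a (fun s => \prod_j w (tnth x j) s))).
  have hw s : bm (fun x => w x s) by split => //; exists D => x; rewrite ger0_norm.
  have hp s : bm (fun x : k.-tuple X => \prod_j w (tnth x j) s).
    by apply: bm_prod => j; exact: (bm_tnth j (hw s)).
  split.
    apply: (gF.1 _ _ (fun=> tt) (fun x : k.-tuple X => amul a (fun s => \prod_j w (tnth x j) s))) => // s.
    by apply: measurable_funM => //; case: (hp s).
  have [C C0 hC] := good_grow gF.
  exists (C * (1 + D ^+ k * mass a) ^+ 2) => x.
  have pw0 s : 0 <= \prod_(j < k) w (tnth x j) s by apply: prodr_ge0.
  apply: le_trans (hC _ (nn_amul a0 pw0)) _; rewrite ler_wpM2l// lerXn2r ?nnegrE//.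
  - by rewrite addr_ge0// mass_ge0//; exact: nn_amul.
  - by rewrite addr_ge0// mulr_ge0 ?mass_ge0// exprn_ge0//; lra.
  - rewrite lerD2l; apply: mass_amul_le => // s.
    rewrite -[k in D ^+ k]card_ord -prodr_const; apply: ler_prod => j _.
    by rewrite w0 wD.
split; first exact: hb.
elim: m a a0 hb => [|m IH] a a0 hb.
  rewrite Ex_iid0 /=; last exact: (hb 0%N).1.
  by congr F; apply/funext => s; rewrite /amul big_ord0 mulr1.
rewrite Ex_iidS; last exact: hb.
rewrite iterS {1}/chan; congr Ex; apply/funext => x.
have ax0 : nn (amul a (w x)) by exact: nn_amul.
rewrite IH//; last first.
  move=> k; have [h1 [c h2]] := hb k.+1; split; last first.
    exists c => t; have := h2 (cons_tuple x t).
    rewrite (_ : amul a _ = amul (amul a (w x)) (fun s => \prod_j w (tnth t j) s))//.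
    apply/funext => s; rewrite /amul big_ord_recl mulrA; congr (_ * _).
    by apply: eq_bigr => j _; rewrite tnth_consS.
  apply: (gF.1 _ _ (fun=> tt) (fun t : k.-tuple X => amul (amul a (w x)) (fun s => \prod_j w (tnth t j) s))) => // s.
  apply: measurable_funM => //; apply: measurable_prod => j _.
  by apply: measurableT_comp (mw s) _; exact: measurable_tnth.
congr Ex; apply/funext => t; congr F; apply/funext => s.
rewrite /amul big_ord_recl mulrA; congr (_ * _).
by apply: eq_bigr => j _; rewrite tnth_consS.
Qed.

End iidlemmas.

Section site.
Context {R : realType} (n r : nat) d (Y : measurableType d) (nu : probability Y R).
Local Notation VT := (r.-tuple 'I_n.+1).

Definition site : probability (VT * Y)%type R := (unif (enum {: VT}) \x nu)%E.

Lemma bm_site (f : VT -> Y -> R) : (forall i, bm (f i)) -> bm (fun z : VT * Y => f z.1 z.2).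
Proof.
move=> hf.
have -> : (fun z : VT * Y => f z.1 z.2) = (fun z => \sum_i (z.1 == i)%:R * f i z.2).
  apply/funext => z; rewrite (bigD1 z.1)//= eqxx mul1r big1 ?addr0// => i.
  by rewrite eq_sym => /negPf ->; rewrite mul0r.
apply: bm_sum => i; apply: bmM; last exact: (bm_comp measurable_snd (hf i)).
apply: (bm_comp (f := fun u : VT => (u == i)%:R : R) measurable_fst).
split; first by move=> _ Z _; exact: measurable_tuple_ord.
by exists 1 => x; case: eqP => _; rewrite ?normr1// normr0.
Qed.

Lemma enum_neq0 (T : finType) (x : T) : enum T != [::].
Proof. by apply/eqP => h; have := mem_enum T x; rewrite h. Qed.

Lemma Ex_site (f : VT -> Y -> R) : (forall i, bm (f i)) ->
  Ex site (fun z => f z.1 z.2) = #|{: VT}|%:R^-1 * \sum_i Ex nu (f i).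
Proof.
move=> hf; rewrite (Ex_prod_bm _ _ (bm_site hf)) Ex_unif.
- by rewrite -cardE big_enum.
- by move=> _ Z _; exact: measurable_tuple_ord.
- exact: (enum_neq0 (nseq_tuple r ord0)).
Qed.

End site.

(** * A Poisson number of factors at nearly independent spins *)

Section eval.
Context {R : realType} {n r : nat} {d : measure_display} {Y : measurableType d}.
Variables (nu : probability Y R) (S Q N : finType) (sp : 'I_n.+1 -> S -> Q).
Local Notation VT := (r.-tuple 'I_n.+1).
Local Notation X := (VT * Y)%type.
Local Notation P := (site n r nu).
Local Notation vec := (S -> R).
Variables (gam : N -> R) (om : Y -> N -> r.-tuple Q -> R) (D : R).
Hypotheses (gam0 : forall s, 0 <= gam s) (gam1 : \sum_s gam s = 1)
  (mom : forall s t, measurable_fun setT (fun y => om y s t))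
  (omD : forall y s t, D^-1 <= om y s t <= D) (D1 : 1 <= D).

Let D0 : 0 < D. Proof. by apply: lt_le_trans D1. Qed.
Let Di0 : 0 < D^-1. Proof. by rewrite invr_gt0. Qed.

Let om0 y s t : 0 < om y s t.
Proof. by have /andP[h _] := omD y s t; apply: lt_le_trans h. Qed.

Let bm_om s t : bm (fun y => om y s t).
Proof.
split => //; exists D => y; have /andP[_ h] := omD y s t.
by rewrite gtr0_norm.
Qed.

Let V0 : (0 < #|'I_n.+1|)%N. Proof. by rewrite card_ord. Qed.

Section vector.
Variables (a : vec) (a0 : nn a) (A0 : 0 < mass a).
Local Notation A := (mass a).
Local Notation rho := (rho sp a).

Definition dec1 (x : X) (s : N) : R := \sum_t om x.2 s t * rho x.1 t.

(** The idealized relative mass when all spins are independent with their own marginals. N indexes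
    an additional spin with prior gam: the new vertex in [eval_once], a single point in [eval_UF],
    where factors join the existing graph. *)
Definition vdec m (x : m.-tuple X) : R := \sum_s gam s * \prod_j dec1 (tnth x j) s.

Lemma bm_dec1 s : bm (fun x => dec1 x s).
Proof.
apply: bm_sum => t; apply: (bm_site (f := fun i y => om y s t * rho i t)) => i.
by apply: bmM; [exact: bm_om|exact: bm_cst].
Qed.

Lemma bm_vdec m : bm (@vdec m).
Proof.
apply: bm_sum => s; apply: bmZ; apply: bm_prod => j.
exact: (bm_tnth j (bm_dec1 s)).
Qed.

Lemma conv_bounds (I : finType) (w f : I -> R) (l h : R) : (forall i, 0 <= w i) ->
  \sum_i w i = 1 -> (forall i, l <= f i <= h) -> l <= \sum_i w i * f i <= h.
Proof.
move=> w0 w1 lh; rewrite -[l]mul1r -{1}w1 -[h]mul1r -w1 !mulr_suml.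
by apply/andP; split; apply: ler_sum => i _; rewrite ler_wpM2l//; case/andP: (lh i).
Qed.

Lemma dec1_bounds x s : D^-1 <= dec1 x s <= D.
Proof.
rewrite /dec1; under eq_bigr do rewrite mulrC.
by apply: conv_bounds => [t||t]; [exact: rho_ge0|exact: sum_rho|].
Qed.

Lemma prod_bounds m (f : 'I_m -> R) : (forall j, D^-1 <= f j <= D) ->
  D^-1 ^+ m <= \prod_j f j <= D ^+ m.
Proof.
move=> h; have E (c : R) : c ^+ m = \prod_(j < m) c by rewrite prodr_const card_ord.
rewrite (E D^-1) (E D).
apply/andP; split; apply: ler_prod => j _.
  by rewrite ltW//=; case/andP: (h j).
by have /andP[h1 h2] := h j; rewrite h2 andbT (le_trans _ h1)// ltW.
Qed.

Lemma vdec_bounds m (x : m.-tuple X) : D^-1 ^+ m <= vdec x <= D ^+ m.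
Proof. by apply: conv_bounds => // s; apply: prod_bounds => j; exact: dec1_bounds. Qed.

(** Summing [Lambda] over the joint atoms of the spins at random sites is iterated pinning of [F0],
    and every single-site term averages to [pin sp F0 a - F0 a]. *)
Lemma Ex_KL m : bm (fun x : m.-tuple X => KL sp a (fun j => (tnth x j).1)) /\
  Ex (iid m P) (fun x : m.-tuple X => KL sp a (fun j => (tnth x j).1)) = TC sp (m * r) a.
Proof.
pose H m (x : m.-tuple X) (b : vec) := \sum_t Lambda (joint sp b (fun j => (tnth x j).1) t).
have bmi (s : S) (t : r.-tuple Q) : bm (fun x : X => (ind (R := R) (@spt S _ Q sp r) x.1 t s)).
  by apply: (bm_site (f := fun i y => ind (@spt S _ Q sp r) i t s)) => i; exact: bm_cst.
have jE m' (x : m'.-tuple X) (b : vec) t : joint sp b (fun j => (tnth x j).1) t =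
    mass (amul b (fun s => \prod_j ind (@spt S _ Q sp r) (tnth x j).1 (tnth t j) s)).
  apply: eq_bigr => s _; congr (_ * _).
  have [E|NE] := eqVneq.
    by rewrite big1// => j _; rewrite /ind -E tnth_mktuple eqxx.
  have [j hj] : exists j, spt sp (tnth x j).1 s != tnth t j.
    apply: contrapT => /forallNP h; case/eqP: NE; apply/eq_from_tnth => j.
    by rewrite tnth_mktuple; apply/eqP; apply: contrapT => /negP; exact: h.
  by rewrite (bigD1 j)//= /ind (negPf hj) mul0r.
have bH m' b : bm (fun x : m'.-tuple X => H m' x b).
  apply: bm_sum => t; apply: bm_Lambda; under eq_fun do rewrite jE.
  apply: bm_sum => s; apply: bmZ; apply: bm_prod => j; exact: (bm_tnth j (bmi s _)).
have EH m' b : nn b -> Ex (iid m' P) (fun x => H m' x b) = iter m' (pin (@spt S _ Q sp r)) F0 b.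
  elim: m' b => [|m' IH] b b0.
    rewrite Ex_iid0; last by case: (bH 0%N b).
    rewrite /H sum_tuple0 jE /=; congr Lambda; congr mass; apply/funext => s.
    by rewrite /amul big_ord0 mulr1.
  rewrite Ex_iidS; last exact: bH.
  have HS x t : H m'.+1 (cons_tuple x t) b = \sum_z H m' t (amul b (ind (@spt S _ Q sp r) x.1 z)).
    rewrite /H sum_tupleS; apply: eq_bigr => z _; apply: eq_bigr => u _.
    rewrite !jE; congr Lambda; congr mass; apply/funext => s.
    rewrite /amul big_ord_recl mulrA; congr (_ * _).
    by apply: eq_bigr => j _; rewrite !tnth_consS.
  transitivity (Ex P (fun x => \sum_z iter m' (pin (@spt S _ Q sp r)) F0 (amul b (ind (@spt S _ Q sp r) x.1 z)))).
    congr Ex; apply/funext => x; under eq_fun do rewrite HS.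
    rewrite Ex_sum; last by move=> z; apply: bm_ig; exact: bH.
    by apply: eq_bigr => z _; rewrite IH//; apply: nn_amul => //; exact: ind_ge0.
  rewrite (Ex_site nu (f := fun i y => \sum_z iter m' (pin (@spt S _ Q sp r)) F0 (amul b (ind (@spt S _ Q sp r) i z)))); last by move=> i; exact: bm_cst.
  rewrite iterS pin_pair; congr (_ * _); apply: eq_bigr => i _; exact: Ex_cst.
pose g v := \sum_z F0 (amul a (ind sp v z)) - F0 a.
have bg : bm (fun x : X => \sum_h g (tnth x.1 h)).
  by apply: (bm_site (f := fun i y => \sum_h g (tnth i h))) => i; exact: bm_cst.
have Eg : Ex P (fun x : X => \sum_h g (tnth x.1 h)) = r%:R * (pin sp F0 a - F0 a).
  rewrite (Ex_site nu (f := fun i y => \sum_h g (tnth i h))); last by move=> i; exact: bm_cst.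
  under eq_bigr do rewrite Ex_cst.
  rewrite exchange_big mulr_sumr /=.
  have hc : \sum_(x : 'I_n.+1) (#|'I_n.+1|%:R^-1 : R) = 1.
    by rewrite sumr_const -[_ *+ _]mulr_natr mulVf// card_ord pnatr_eq0.
  transitivity (\sum_(h < r) (pin sp F0 a - F0 a)); last by rewrite sumr_const card_ord mulr_natl.
  apply: eq_bigr => h _; rewrite card_tuple natrX -exprVn mulr_sumr.
  rewrite (sum_tuple_tnth g h hc) -mulr_sumr /g sumrB mulrBr -pin_pair; congr (_ - _).
  by rewrite sumr_const -[F0 a *+ _]mulr_natl mulrA mulVf ?mul1r// card_ord pnatr_eq0.
have bG : bm (fun x : m.-tuple X => \sum_j \sum_h g (tnth (tnth x j).1 h)).
  by apply: bm_sum => j; exact: (bm_tnth j bg).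
have bHF : bm (fun x : m.-tuple X => H m x a - F0 a) by apply: bmB => //; exact: bm_cst.
split; first exact: bmB.
rewrite (ExB (bm_ig _ bHF) (bm_ig _ bG)) (ExB (bm_ig _ (bH m a)) (ig_cst _ _)) Ex_cst EH// iter_pin_spt//.
rewrite Ex_sum; last by move=> j; apply: bm_ig; exact: (bm_tnth j bg).
rewrite (eq_bigr (fun=> r%:R * (pin sp F0 a - F0 a))); last first.
  by move=> j _; rewrite -Eg; exact: (Ex_iid_tnth P j bg).
by rewrite sumr_const card_ord /TC natrM -mulrA -[_ *+ m]mulr_natl.
Qed.

Section compensated.
Variables (e : S -> N -> R) (kap : S -> R).
Hypotheses (eD : forall s u, D^-1 <= e s u <= D) (eK : forall s u, `|e s u - 1| <= kap s).

Definition mx m (x : m.-tuple X) : R :=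
  \sum_s a s * \sum_u gam u * (e s u * \prod_j om (tnth x j).2 u (spt sp (tnth x j).1 s)).

Lemma bm_mx m : bm (@mx m).
Proof.
apply: bm_sum => s; apply: bmZ; apply: bm_sum => u; apply: bmZ; apply: bmZ.
apply: bm_prod => j.
by apply: (bm_tnth j (bm_site (f := fun i y => om y u (spt sp i s)) _)) => i; exact: bm_om.
Qed.

Lemma eom_bounds m (x : m.-tuple X) s u :
  D^-1 ^+ m.+1 <= e s u * \prod_j om (tnth x j).2 u (spt sp (tnth x j).1 s) <= D ^+ m.+1.
Proof.
have /andP[h1 h2] := eD s u.
have /andP[h3 h4] := prod_bounds (fun j => omD (tnth x j).2 u (spt sp (tnth x j).1 s)).
have p0 : 0 <= D^-1 ^+ m by rewrite exprn_ge0// ltW.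
rewrite !exprS; apply/andP; split; apply: ler_pM => //.
- exact: ltW.
- by apply: le_trans h1; exact: ltW.
- exact: le_trans h3.
Qed.

Lemma mx_bounds m (x : m.-tuple X) : A * D^-1 ^+ m.+1 <= mx x <= A * D ^+ m.+1.
Proof.
rewrite /mx /mass !mulr_suml.
have h s : D^-1 ^+ m.+1 <= \sum_u gam u * (e s u * \prod_j om (tnth x j).2 u (spt sp (tnth x j).1 s)) <= D ^+ m.+1.
  by apply: conv_bounds => // u; exact: eom_bounds.
by apply/andP; split; apply: ler_sum => s _; rewrite ler_wpM2l//; case/andP: (h s).
Qed.

(** After division by A this compares [Lambda] at the true and at the idealized relative mass. Two
    replacements are paid for: the compensating weight by 1, at the cost kap, and the joint law of
    the spins by the product of marginals, through [decouple]. *)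
Lemma eval_pt m (x : m.-tuple X) (dl : R) : 0 < dl <= 1 ->
  `|Lambda (mx x) - (A * Lambda (vdec x) + Lambda A / A * mx x)| <=
  3 * D ^+ (2 * m).+1 * (ell kap a + dl * A + 2 / dl * KL sp a (fun j => (tnth x j).1)).
Proof.
move=> hd; have An : A != 0 by rewrite gt_eqF.
pose u := mx x / A.
have uE : mx x = A * u by rewrite /u mulrCA mulfV// mulr1.
have /andP[b1 b2] := mx_bounds x.
have ub : D^-1 ^+ m.+1 <= u <= D ^+ m.+1.
  by rewrite -(ler_pM2l A0) -(ler_pM2l A0 u) -uE b1.
have /andP[v1 v2] := vdec_bounds x.
have vb : D^-1 ^+ m.+1 <= vdec x <= D ^+ m.+1.
  apply/andP; split; [apply: le_trans v1|apply: le_trans v2 _].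
    rewrite exprS; apply: ler_piMl; first by rewrite exprn_ge0// ltW.
    by rewrite invf_le1.
  by rewrite exprS ler_peMl// exprn_ge0// ltW.
have l0 : 0 < D^-1 ^+ m.+1 by rewrite exprn_gt0.
have u0 : 0 <= u by case/andP: ub => h _; apply: le_trans h; exact: ltW.
rewrite {1}uE LambdaM//.
have -> : A * Lambda u + Lambda A * u - (A * Lambda (vdec x) + Lambda A / A * mx x) = A * (Lambda u - Lambda (vdec x)).
  by rewrite uE [Lambda A / A * _]mulrA divfK//; ring.
rewrite normrM gtr0_norm//.
have Dm1 : 1 <= D ^+ m.+1 by rewrite exprn_ege1.
have lip := Lambda_lip l0 ub vb.
(* Both arguments lie between [D^-1 ^+ m.+1] and [D ^+ m.+1], so [1 + h + l^-1] is at most three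
   times the upper end. A further [D ^+ m] comes from the bound on the product of m factors. *)
have lip2 : `|Lambda u - Lambda (vdec x)| <= 3 * D ^+ m.+1 * `|u - vdec x|.
  by apply: le_trans lip _; rewrite ler_wpM2r// exprVn invrK; lra.
have -> : 3 * D ^+ (2 * m).+1 = 3 * D ^+ m.+1 * D ^+ m.
  by rewrite -mulrA -exprD addSn addnn mul2n.
rewrite -mulrA; apply: le_trans (_ : A * (3 * D ^+ m.+1 * `|u - vdec x|) <= _).
  by rewrite ler_wpM2l// ltW.
rewrite mulrCA ler_wpM2l//; first by rewrite mulr_ge0// (le_trans ler01).
rewrite -[X in X * `|_|](gtr0_norm A0) -normrM mulrBr -uE.
pose f (t : m.-tuple (r.-tuple Q)) := \sum_u gam u * \prod_j om (tnth x j).2 u (tnth t j).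
have vE : A * vdec x = A * \sum_t (\prod_j rho (tnth x j).1 (tnth t j)) * f t.
  congr (_ * _); rewrite /f; under [RHS]eq_bigr do rewrite mulr_sumr.
  rewrite exchange_big; apply: eq_bigr => s _ /=.
  rewrite /dec1 -(sum_tuple_prod (fun j t => om (tnth x j).2 s t * rho (tnth x j).1 t)) mulr_sumr.
  by apply: eq_bigr => t _; rewrite big_split /=; ring.
have fM t : `|f t| <= D ^+ m.
  have /andP[f1 f2] : D^-1 ^+ m <= f t <= D ^+ m.
    by apply: conv_bounds => // s; apply: prod_bounds => j.
  by rewrite ger0_norm// (le_trans _ f1)// exprn_ge0// ltW.
have dc := decouple sp a0 A0 (fun j => (tnth x j).1) fM hd.
rewrite -vE in dc.
set m0 := \sum_s a s * f _ in dc.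
have dm : `|mx x - m0| <= D ^+ m * ell kap a.
  rewrite /mx /m0 -sumrB; apply: le_trans (ler_norm_sum _ _ _) _.
  rewrite /ell mulr_sumr; apply: ler_sum => s _.
  rewrite -mulrBr normrM ger0_norm//.
  rewrite [leRHS](_ : _ = a s * (D ^+ m * kap s)); last by ring.
  rewrite ler_wpM2l//.
  rewrite /f -sumrB.
  rewrite (eq_bigr (fun u => gam u * ((e s u - 1) * \prod_j om (tnth x j).2 u (spt sp (tnth x j).1 s)))); last first.
    move=> v _.
    have -> : \prod_j om (tnth x j).2 v (tnth (spj sp (fun j => (tnth x j).1) s) j) =
        \prod_j om (tnth x j).2 v (spt sp (tnth x j).1 s).
      by apply: eq_bigr => j _; rewrite tnth_mktuple.
    ring.
  apply: le_trans (ler_norm_sum _ _ _) _.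
  rewrite -[D ^+ m * _]mul1r -[X in _ <= X * _]gam1 mulr_suml; apply: ler_sum => v _.
  rewrite normrM ger0_norm// ler_wpM2l// normrM mulrC; apply: ler_pM => //.
  have /andP[h3 h4] := prod_bounds (fun j => omD (tnth x j).2 v (spt sp (tnth x j).1 s)).
  by rewrite ger0_norm// (le_trans _ h3)// exprn_ge0// ltW.
have := ler_normD (mx x - m0) (m0 - A * vdec x); rewrite subrKA.
by move=> h; apply: le_trans h _; rewrite -addrA mulrDr lerD.
Qed.

Lemma eval_m m (dl : R) : 0 < dl <= 1 ->
  `|Ex (iid m P) (fun x => Lambda (mx x)) -
    (A * Ex (iid m P) (fun x => Lambda (@vdec m x)) + Lambda A / A * Ex (iid m P) (@mx m))| <=
  3 * D ^+ (2 * m).+1 * (ell kap a + dl * A + 2 / dl * TC sp (m * r) a).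
Proof.
move=> hd; have [bKL EKL] := Ex_KL m.
have bl := bm_Lambda (@bm_mx m); have bv := bm_Lambda (@bm_vdec m); have bx := @bm_mx m.
rewrite -(ExZ _ (bm_ig _ bv)) -(ExZ _ (bm_ig _ bx)) -(ExD (bm_ig _ (bmZ _ bv)) (bm_ig _ (bmZ _ bx))).
have bs := bmD (bmZ A bv) (bmZ (Lambda A / A) bx).
rewrite -(ExB (bm_ig _ bl) (bm_ig _ bs)) -EKL.
have b2 := bmZ (2 / dl) bKL.
rewrite -(ExZ _ (bm_ig _ bKL)) -{1}(Ex_cst (iid m P) (ell kap a + dl * A)).
rewrite -(ExD (ig_cst _ _) (bm_ig _ b2)).
have b3 := bmD (bm_cst _ (ell kap a + dl * A)) b2.
rewrite -(ExZ _ (bm_ig _ b3)).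
apply: Ex_abs_le; [exact: bm_ig (bmB bl bs)|exact: bm_ig (bmZ _ b3)|].
by move=> x; exact: eval_pt.
Qed.

Lemma eg_TC l : eg (fun m => TC sp (m * l) a).
Proof.
have gF : grow (S := S) (R := R) 1 F0.
  move=> b b0; rewrite mul1r; apply: le_trans (Lambda_bound _) _.
  by have := mass_ge0 b0; nra.
have hp k : `|iter k (pin sp) F0 a| <= #|Q|%:R ^+ k * (1 + mass a) ^+ 2.
  have := op_grow (isop_iter k (isop_pin sp V0)) (good_F0 (S := S)).1 gF a0.
  by rewrite mulr1.
apply: egB; first apply: egB.
- apply: (@eg_le _ _ ((1 + mass a) ^+ 2) (#|Q|%:R ^+ l)) => m.
  by rewrite -exprM mulrC [(l * m)%N]mulnC; exact: hp.
- exact: eg_cst.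
- apply: egM; last exact: eg_cst.
  by under eq_fun do rewrite natrM; apply: egM; [exact: eg_nat|exact: eg_cst].
Qed.

Let eg_of (b c : R) (f : nat -> R) : 0 <= c -> (forall m, `|f m| <= 1 + (c * D ^+ m.+1) ^+ 2) -> eg f.
Proof.
move=> c0 h; apply: eg_dom h _; apply: egD; first exact: eg_cst.
apply: (@eg_le _ _ (c ^+ 2 * D ^+ 2) (D ^+ 2)) => m.
rewrite ger0_norm ?sqr_ge0// exprMn -mulrA -exprM -exprD -exprM.
by rewrite mulnC mulnS.
Qed.

Lemma eg_Lmx : eg (fun m => Ex (iid m P) (fun x => Lambda (@mx m x))).
Proof.
apply: (eg_of 0 (ltW A0)) => m; rewrite -(Ex_cst (iid m P) (1 + _)).
apply: Ex_abs_le; [exact: bm_ig (bm_Lambda (@bm_mx m))|exact: ig_cst|move=> x].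
apply: le_trans (Lambda_bound _) _; rewrite lerD2l.
have /andP[h1 h2] := mx_bounds x; rewrite lerXn2r// nnegrE.
  by apply: le_trans h1; rewrite mulr_ge0 ?exprn_ge0// ltW.
by rewrite mulr_ge0 ?exprn_ge0// ltW.
Qed.

Lemma eg_Lvdec : eg (fun m => Ex (iid m P) (fun x => Lambda (@vdec m x))).
Proof.
apply: (eg_of 0 ler01) => m; rewrite -(Ex_cst (iid m P) (1 + _)).
apply: Ex_abs_le; [exact: bm_ig (bm_Lambda (bm_vdec m))|exact: ig_cst|move=> x].
apply: le_trans (Lambda_bound _) _; rewrite lerD2l mul1r.
have /andP[h1 h2] := vdec_bounds x; rewrite lerXn2r ?nnegrE//.
- by apply: le_trans h1; rewrite exprn_ge0// ltW.
- by rewrite exprn_ge0// ltW.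
- by apply: le_trans h2 _; rewrite exprS ler_peMl// exprn_ge0// ltW.
Qed.

Lemma eg_mx : eg (fun m => Ex (iid m P) (@mx m)).
Proof.
apply: (@eg_le _ _ (A * D) D) => m; rewrite -(Ex_cst (iid m P) (_ * D ^+ m)).
apply: Ex_abs_le; [exact: bm_ig (@bm_mx m)|exact: ig_cst|move=> x].
have /andP[h1 h2] := mx_bounds x; rewrite ger0_norm -?mulrA -?exprS//.
by apply: le_trans h1; rewrite mulr_ge0 ?exprn_ge0// ltW.
Qed.

(** The term of [eval_m] that is linear in [mx] becomes exactly [Lambda A]: its mean is A by the
    hypothesis, which holds for compensated stages. *)
Lemma eval_pois (l dl : R) : 0 <= l -> 0 < dl <= 1 ->
  Ex (Po l) (fun m => Ex (iid m P) (@mx m)) = A ->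
  `|Ex (Po l) (fun m => Ex (iid m P) (fun x => Lambda (@mx m x))) -
    (A * Ex (Po l) (fun m => Ex (iid m P) (fun x => Lambda (@vdec m x))) + Lambda A)| <=
  3 * D * expR (l * (D ^+ 2 - 1)) * (ell kap a + dl * A) +
  2 / dl * Ex (Po l) (fun m => 3 * D * (D ^+ 2) ^+ m * TC sp (m * r) a).
Proof.
move=> l0 hd hA.
have An : A != 0 by rewrite gt_eqF.
have eL := eg_Lmx; have ev := eg_Lvdec; have ex := eg_mx.
have -> : Lambda A = Lambda A / A * A by rewrite divfK.
rewrite -{4}hA.
rewrite -(ExZ _ (ig_eg l0 ev)) -(ExZ _ (ig_eg l0 ex)).
rewrite -(ExD (ig_eg l0 (egZ A ev)) (ig_eg l0 (egZ _ ex))).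
rewrite -(ExB (ig_eg l0 eL) (ig_eg l0 (egD (egZ A ev) (egZ _ ex)))).
have eT : eg (fun m => 3 * D * (D ^+ 2) ^+ m * TC sp (m * r) a).
  by apply: egM; [apply: egZ; exact: eg_pow|exact: eg_TC].
have eP : eg (fun m => (3 * D * (ell kap a + dl * A)) * (D ^+ 2) ^+ m) by apply: egZ; exact: eg_pow.
rewrite (_ : _ * (ell kap a + dl * A) = Ex (Po l) (fun m => (3 * D * (ell kap a + dl * A)) * (D ^+ 2) ^+ m)); last first.
  rewrite ExZ; last by apply: ig_eg => //; exact: eg_pow.
  by rewrite Ex_Po_pow ?sqr_ge0//; ring.
rewrite -(ExZ _ (ig_eg l0 eT)) -(ExD (ig_eg l0 eP) (ig_eg l0 (egZ _ eT))).
apply: Ex_abs_le.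
- exact: ig_eg l0 (egB eL (egD (egZ A ev) (egZ _ ex))).
- exact: ig_eg l0 (egD eP (egZ _ eT)).
- move=> m; apply: le_trans (eval_m m hd) _.
  rewrite le_eqVlt; apply/orP; left; apply/eqP.
  by rewrite exprS exprM; ring.
Qed.

End compensated.
End vector.
End eval.

(** * The compensated Poisson model *)

Section expR_bounds.
Context {R : realType}.

Lemma expR_sub1_le (x : R) : `|expR x - 1| <= `|x| * expR `|x|.
Proof.
have up (y : R) : 0 <= y -> expR y - 1 <= y * expR y.
  move=> y0; have := @expR_ge1Dx R (- y); rewrite expRN => h.
  have e0 := expR_gt0 y.
  have : expR y * (1 - y) <= expR y / expR y by rewrite ler_pM2l.
  by rewrite divff ?gt_eqF//; lra.
have [x0|x0] := leP 0 x.
  have e1 : 1 <= expR x by rewrite -expR0 ler_expR.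
  by rewrite (ger0_norm x0) ger0_norm ?subr_ge0// up.
have e1 : expR x <= 1 by rewrite -expR0 ler_expR ltW.
have nx : 0 < - x by rewrite oppr_gt0.
rewrite ler0_norm ?subr_le0// ltr0_norm// opprB.
have := @expR_ge1Dx R x; have : 1 <= expR (- x) by rewrite -expR0 ler_expR ltW.
by nra.
Qed.

Lemma expR_bounds (x c : R) : `|x| <= c -> (expR c)^-1 <= expR x <= expR c.
Proof. by rewrite -expRN !ler_expR ler_norml. Qed.

End expR_bounds.

Section compensated_poisson.
Context {R : realType} {S : finType} {d : measure_display} {X : measurableType d}.
Variables (P : probability X R) (w : X -> S -> R) (D : R).
Hypotheses (mw : forall s, measurable_fun setT (fun x => w x s))
  (wD : forall x s, D^-1 <= w x s <= D) (D1 : 1 <= D).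
Local Notation vec := (S -> R).

Let D0 : 0 < D. Proof. by apply: lt_le_trans D1. Qed.

Lemma gadget_gt0 x s : 0 < w x s.
Proof. by have /andP[h _] := wD x s; apply: lt_le_trans h; rewrite invr_gt0. Qed.

Let w0 x s : 0 <= w x s. Proof. by apply: ltW; exact: gadget_gt0. Qed.
Let wU x s : w x s <= D. Proof. by have /andP[] := wD x s. Qed.

Definition wmean (s : S) : R := Ex P (fun x => w x s).

Lemma bm_gadget s : bm (fun x => w x s).
Proof. exact: (bm_w mw w0 wU). Qed.

Lemma wmean_bounds s : D^-1 <= wmean s <= D.
Proof.
apply/andP; split.
  by apply: Ex_ge_cst => [|x]; [exact: bm_ig (bm_gadget _)|case/andP: (wD x s)].
by apply: Ex_le_cst => [|x]; [exact: bm_ig (bm_gadget _)|case/andP: (wD x s)].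
Qed.

Lemma wmean_ge0 : nn wmean.
Proof. by move=> s; have /andP[h _] := wmean_bounds s; apply: le_trans h; rewrite invr_ge0 ltW. Qed.

Definition comp (l : R) (s : S) : R := expR (l * (1 - wmean s)).

Definition UP (l : R) := pois (chan P w) (comp l) l.

Lemma comp_ge0 l : nn (comp l). Proof. by move=> s; exact: expR_ge0. Qed.

Lemma wmean_sub1 s : `|1 - wmean s| <= D.
Proof.
have /andP[h1 h2] := wmean_bounds s; have := wmean_ge0 s.
by rewrite ler_norml; move: D1 => ?; lra.
Qed.

Lemma comp_le l L s : 0 <= l <= L -> (expR (L * D))^-1 <= comp l s <= expR (L * D).
Proof.
move=> /andP[l0 lL]; apply: expR_bounds; rewrite normrM ger0_norm//.
by apply: ler_pM => //; exact: wmean_sub1.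
Qed.

Lemma comp_le1 l s : 0 <= l -> comp l s <= expR (l * D).
Proof.
move=> l0; have h : 0 <= l <= l by rewrite l0 lexx.
by have /andP[] := comp_le s h.
Qed.

Lemma expRLD_ge1 L : 0 <= L -> 1 <= expR (L * D).
Proof. by move=> L0; rewrite -expR0 ler_expR mulr_ge0// ltW. Qed.

Let isopK : isop (chan P w) (D ^+ 2) := isop_chan P mw w0 wU D1.
Let centralK : central (chan P w) := central_chan P mw w0 wU D1.

Lemma isop_UP l : 0 <= l -> exists B, isop (UP l) B.
Proof.
move=> l0; eexists; apply: (isop_pois isopK (comp_ge0 l) (D := expR (l * D))) => //.
  by move=> s; exact: comp_le1.
exact: expRLD_ge1.
Qed.

Lemma central_UP l : 0 <= l -> central (UP l).
Proof.
move=> l0; apply: (central_pois isopK (comp_ge0 l) (D := expR (l * D))) => //.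
- by move=> s; exact: comp_le1.
- exact: expRLD_ge1.
Qed.

Lemma mp_UP l : 0 <= l -> mp (UP l).
Proof.
move=> l0; apply: (mp_pois isopK _ wmean_ge0 l0) => c a _.
exact: (chan_ell P mw w0 wU c a).
Qed.

Lemma UP_iid l F a : good F -> nn a ->
  UP l F a = Ex (Po l) (fun m => Ex (iid m P) (fun x =>
    F (amul (amul a (comp l)) (fun s => \prod_j w (tnth x j) s)))).
Proof.
move=> gF a0; rewrite /UP /pois; congr Ex; apply/funext => m.
by have [_] := iter_chan P m mw w0 wU D1 gF (nn_amul a0 (comp_ge0 l)).
Qed.

(** [pois_split] with two equal kinds of factors: the exponent of the compensating weight is linear
    in the rate, so the weights multiply. *)
Lemma UP_semigroup l1 l2 F a : 0 <= l1 -> 0 <= l2 -> good F -> nn a ->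
  UP (l1 + l2) F a = UP l1 (UP l2 F) a.
Proof.
move=> l10 l20 gF a0.
have [s0|s0] := boolP (l1 + l2 == 0).
  move: s0; rewrite (paddr_eq0 l10 l20) => /andP[/eqP -> /eqP ->]; move: gF => /= gF.
  have E G b : good G -> nn b -> UP 0 G b = G b.
    move=> gG b0; have c1 : comp 0 = fun=> 1 by apply/funext => s; rewrite /comp mul0r expR0.
    rewrite /UP /pois c1.
    have -> : amul b (fun=> 1) = b by apply/funext => s; rewrite /amul mulr1.
    have ge : eg (fun m => iter m (chan P w) G b).
      have [C C0 hC] := good_grow gG.
      apply: (@eg_le _ _ (C * (1 + mass b) ^+ 2) (D ^+ 2)) => m.
      apply: le_trans (op_grow (isop_iter m isopK) gG.1 hC b0) _.
      by rewrite mulrAC mulrC mulrAC -mulrA mulrC.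
    have := @Ex_Po_tilt _ 0 0 _ (lexx 0) (lexx 0) ge; rewrite !mul0r expR0 mul1r => <-.
    rewrite (_ : (fun m => _) = (fun m => G b * 0 ^+ m)); last first.
      by apply/funext => -[|m]; rewrite ?expr0 ?mul1r ?mulr1// exprS !mul0r mulr0.
    rewrite ExZ ?Ex_Po_pow//; last exact: ig_pow.
    by rewrite mul0r expR0 mulr1.
  have [B hB] := isop_UP (lexx 0).
  by rewrite addr0 !E//; exact: op_good hB gF.
have sp : 0 < l1 + l2 by rewrite lt_neqAle eq_sym s0 addr_ge0.
have s0' : l1 + l2 != 0 by exact: s0.
have p1 : 0 <= l1 / (l1 + l2) by apply: divr_ge0 => //; exact: ltW.
have p2 : 0 <= l2 / (l1 + l2) by apply: divr_ge0 => //; exact: ltW.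
have p12 : l1 / (l1 + l2) + l2 / (l1 + l2) = 1 by rewrite -mulrDl divff.
have q1 : l1 / (l1 + l2) * (l1 + l2) = l1 by rewrite divfK.
have q2 : l2 / (l1 + l2) * (l1 + l2) = l2 by rewrite divfK.
have eE : comp (l1 + l2) = amul (comp l1) (comp l2).
  by apply/funext => s; rewrite /amul /comp -expRD mulrDl.
have cD s : comp l2 s <= expR (l2 * D) by exact: comp_le1.
have h := pois_split isopK isopK centralK (ltW sp) p1 p2 p12 q1 q2 eE
  (comp_ge0 l1) (comp_ge0 l2) cD (expRLD_ge1 l20) gF a0.
apply: etrans h; rewrite /UP; congr (pois _ _ _ _ _).
by apply/funext => G; apply/funext => b; rewrite -mulrDl p12 mul1r.
Qed.

Let prod_w m (x : m.-tuple X) s : D^-1 ^+ m <= \prod_j w (tnth x j) s <= D ^+ m.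
Proof. by apply: prod_bounds => // j; exact: wD. Qed.

Lemma good_UP l F : 0 <= l -> good F -> good (UP l F).
Proof. by move=> l0 gF; have [B hB] := isop_UP l0; exact: op_good hB gF. Qed.

Definition cP L : R := D + D ^+ 2 * expR (L * D) ^+ 2.

(* Convexity of Lambda gives the lower bound. *)
Lemma UP_F0 l L a : 0 <= l <= L -> nn a -> F0 a <= UP l F0 a <= F0 a + l * cP L * mass a.
Proof.
move=> lL a0; have /andP[l0 lL'] := lL.
have L0 : 0 <= L by apply: le_trans lL'.
have e0 := comp_ge0 l; have e1 := fun s => comp_le1 s l0; have e2 := expRLD_ge1 l0.
have gam := pois_gfam isopK e0 e1 e2 l0 (good_mass (R := R) (S := S)).
have ga0 := pois_gfam isopK e0 e1 e2 l0 (good_F0 (R := R) (S := S)).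
have im := gfam_ig gam a0; have i0 := gfam_ig ga0 a0.
have mm : UP l (@mass R S) a = mass a by apply: mp_mass => //; exact: mp_UP.
move: im i0 mm; rewrite /UP /pois.
set g := fun m => iter m _ _ _; set h := fun m => iter m _ _ _; move=> ig0 ih mm.
pose M m (x : m.-tuple X) : R := mass (amul (amul a (comp l)) (fun s => \prod_j w (tnth x j) s)).
have hg m : bm (@M m) /\ g m = Ex (iid m P) (@M m).
  by have := iter_chan P m mw w0 wU D1 (good_mass (R := R) (S := S)) (nn_amul a0 e0).
have hh m : bm (fun x => Lambda (@M m x)) /\ h m = Ex (iid m P) (fun x => Lambda (@M m x)).
  by have := iter_chan P m mw w0 wU D1 (good_F0 (R := R) (S := S)) (nn_amul a0 e0).
have M0 m (x : m.-tuple X) : 0 <= M m x.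
  apply: mass_ge0; apply: nn_amul; first exact: nn_amul.
  by move=> s; apply: prodr_ge0 => j _; exact: w0.
have MU m (x : m.-tuple X) : M m x <= mass a * (expR (l * D) * D ^+ m).
  rewrite /M /mass mulr_suml; apply: ler_sum => s _; rewrite /amul -mulrA ler_wpM2l//.
  have /andP[_ hp] := prod_w x s; apply: ler_pM => //; apply: prodr_ge0 => j _; exact: w0.
set A := mass a in mm MU *.
have [A0|A0] := eqVneq A 0.
  have Mz m (x : m.-tuple X) : M m x = 0.
    by apply/eqP; rewrite eq_le M0 andbT; have := MU m x; rewrite A0 mul0r.
  have -> : Ex (Po l) h = 0.
    rewrite (_ : h = fun=> 0) ?Ex_cst//; apply/funext => m; rewrite (hh m).2.
    by under eq_fun do rewrite Mz Lambda0; rewrite Ex_cst.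
  by rewrite /F0 -/A A0 Lambda0 mulr0 addr0 lexx.
have Ap : 0 < A by rewrite lt_neqAle eq_sym A0 mass_ge0.
have Ai : 0 < A^-1 by rewrite invr_gt0.
have ME m (x : m.-tuple X) : M m x = A * (M m x / A) by rewrite mulrC divfK.
rewrite /F0 -/A; set c := Lambda A / A.
have cA : c * A = Lambda A by rewrite divfK.
(* The tangent of [Lambda] at A. As the mean of g is A, averaging the left-hand side gives exactly
   [Lambda A]. *)
have lowm m : - A + (1 + c) * g m <= h m.
  rewrite (hg m).2 (hh m).2 -(ExZ _ (bm_ig (iid m P) (hg m).1)) -(Ex_cst (iid m P) (- A)) -ExD.
  - apply: Ex_le => [| |x]; [|exact: bm_ig (hh m).1|].
      by apply: bm_ig; apply: bmD; [exact: bm_cst|apply: bmZ; exact: (hg m).1].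
    rewrite [in leRHS]ME LambdaM//; last by apply: divr_ge0 => //; exact: ltW.
    have y0 : 0 <= M m x / A by apply: divr_ge0 => //; exact: ltW.
    have := ler_wpM2l (ltW Ap) (Lambda_ge y0); rewrite mulrBr -ME mulr1 => hA.
    have -> : Lambda A * (M m x / A) = c * M m x by rewrite /c; ring.
    by lra.
  - exact: ig_cst.
  - by apply: bm_ig; apply: bmZ; exact: (hg m).1.
have D00 := ltW D0.
(* The relative mass is at most [expR (l * D) * D ^+ m], so its logarithm is at most l D + m D. The
   power is written with [m.-1] for [Ex_Po_stein], which then extracts the factor l of the claimed
   bound. *)
have upm m : h m <= (c + l * D) * g m + A * (D * expR (l * D) * (m%:R * (D * D ^+ m.-1))).
  have -> : m%:R * (D * D ^+ m.-1) = m%:R * D ^+ m.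
    by case: m => [|m]; rewrite ?mul0r// -exprS.
  have gm : g m <= A * (expR (l * D) * D ^+ m).
    by rewrite (hg m).2; apply: Ex_le_cst => [|x]; [exact: bm_ig (hg m).1|exact: MU].
  apply: le_trans (_ : (c + l * D + m%:R * D) * g m <= _); last first.
    rewrite [leLHS]mulrDl lerD2l; apply: le_trans (ler_wpM2l _ gm) _.
      by rewrite mulr_ge0.
    by rewrite le_eqVlt; apply/orP; left; apply/eqP; ring.
  rewrite (hg m).2 (hh m).2 -(ExZ _ (bm_ig (iid m P) (hg m).1)).
  apply: Ex_le => [| |x]; [exact: bm_ig (hh m).1|by apply: bm_ig; apply: bmZ; exact: (hg m).1|].
  have y0 : 0 <= M m x / A by apply: divr_ge0 => //; exact: ltW.
  rewrite [in leLHS]ME LambdaM//.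
  have -> : Lambda A * (M m x / A) = c * M m x by rewrite /c; ring.
  rewrite addrC -addrA mulrDl lerD2l /Lambda mulrA -ME mulrC; apply: ler_wpM2r => //.
  have [z0|z0] := leP (M m x / A) 0; first by rewrite ln0// addr_ge0// mulr_ge0.
  have Dm : 0 < D ^+ m by rewrite exprn_gt0.
  have : ln (M m x / A) <= ln (expR (l * D) * D ^+ m).
    rewrite ler_ln ?posrE// ?mulr_gt0 ?expR_gt0//.
    by rewrite ler_pdivrMr// mulrC; exact: MU.
  have -> : ln (expR (l * D) * D ^+ m) = l * D + ln D *+ m.
    by rewrite lnM ?posrE ?expR_gt0// expRK lnXn.
  move=> hl; apply: le_trans hl _.
  rewrite lerD2l -(mulr_natl (ln D)) ler_wpM2l//; have := ln_le_sub1 D0; lra.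
have igm : ig (Po l) (fun m => m%:R * (D * D ^+ m.-1)).
  apply: ig_eg => //; apply: egM; first exact: eg_nat.
  apply: egZ; apply: (@eg_le _ _ 1 D) => m; rewrite mul1r ger0_norm ?exprn_ge0//.
  by apply: ler_weXn2l => //; exact: leq_pred.
apply/andP; split.
  have : Ex (Po l) (fun m => - A + (1 + c) * g m) <= Ex (Po l) h.
    by apply: Ex_le => //; apply: igD; [exact: ig_cst|exact: igZ].
  rewrite (ExD (ig_cst _ _) (igZ _ ig0)) (ExZ _ ig0) Ex_cst mm mulrDl mul1r cA => h1.
  by apply: le_trans h1; rewrite addKr.
have : Ex (Po l) h <= Ex (Po l) (fun m => (c + l * D) * g m + A * (D * expR (l * D) * (m%:R * (D * D ^+ m.-1)))).
  by apply: Ex_le => //; apply: igD; [exact: igZ|apply: igZ; exact: igZ].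
move=> h1; apply: le_trans h1 _.
rewrite (ExD (igZ _ ig0) (igZ _ (igZ _ igm))) (ExZ _ ig0) (ExZ _ (igZ _ igm)) (ExZ _ igm) mm.
rewrite (Ex_Po_stein (x := fun m => D * D ^+ m) l0); last by apply: egZ; exact: eg_pow.
rewrite (ExZ _ (ig_pow l0 D00)) (Ex_Po_pow l0 D00) mulrDl cA -addrA lerD2l.
have elL : expR (l * D) <= expR (L * D) by rewrite ler_expR ler_wpM2r.
have elL1 : expR (l * (D - 1)) <= expR (L * D).
  by apply: le_trans elL; rewrite ler_expR ler_wpM2l// lerBlDr lerDl.
have -> : l * D * A + A * (D * expR (l * D) * (l * (D * expR (l * (D - 1))))) =
  l * (D + D ^+ 2 * (expR (l * D) * expR (l * (D - 1)))) * A by ring.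
rewrite ler_wpM2r ?(ltW Ap)// ler_wpM2l// lerD2l ler_wpM2l ?sqr_ge0//.
by rewrite expr2; apply: ler_pM => //; exact: expR_ge0.
Qed.

End compensated_poisson.

Section products.
Context {R : realType} {Q : finType}.

Definition dist1 (f g : Q -> R) : R := \sum_z `|f z - g z|.

Lemma dist1_ge0 f g : 0 <= dist1 f g.
Proof. exact: sumr_ge0. Qed.

(** Coordinates are exchanged one at a time, each at the cost of its own distance. *)
Lemma prod_dist m (f g : 'I_m -> Q -> R) : (forall h z, 0 <= f h z) -> (forall h z, 0 <= g h z) ->
  (forall h, \sum_z f h z = 1) -> (forall h, \sum_z g h z = 1) ->
  \sum_(t : m.-tuple Q) `|\prod_h f h (tnth t h) - \prod_h g h (tnth t h)| <= \sum_h dist1 (f h) (g h).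
Proof.
elim: m f g => [|m IH] f g f0 g0 f1 g1; first by rewrite sum_tuple0 !big_ord0 subrr normr0.
rewrite sum_tupleS [leRHS]big_ord_recl.
pose f' h := f (lift ord0 h); pose g' h := g (lift ord0 h).
have fs : \sum_(t : m.-tuple Q) \prod_h f' h (tnth t h) = 1.
  by rewrite (sum_tuple_prod f') big1// => h _; exact: f1.
apply: le_trans (_ : \sum_x \sum_(t : m.-tuple Q) (`|f ord0 x - g ord0 x| * \prod_h f' h (tnth t h) +
   g ord0 x * `|\prod_h f' h (tnth t h) - \prod_h g' h (tnth t h)|) <= _).
  apply: ler_sum => x _; apply: ler_sum => t _; rewrite !big_ord_recl !tnth_cons0.
  rewrite (eq_bigr (fun h => f' h (tnth t h))); last by move=> h _; rewrite tnth_consS.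
  rewrite [X in _ - _ * X](eq_bigr (fun h => g' h (tnth t h))); last by move=> h _; rewrite tnth_consS.
  set a := \prod_h f' _ _; set b := \prod_h g' _ _.
  have -> : f ord0 x * a - g ord0 x * b = (f ord0 x - g ord0 x) * a + g ord0 x * (a - b) by ring.
  apply: le_trans (ler_normD _ _) _; rewrite !normrM.
  by rewrite (ger0_norm (x := a)) ?(ger0_norm (x := g ord0 x))// prodr_ge0// => h _; exact: f0.
under eq_bigr do rewrite big_split/= -!mulr_sumr fs mulr1.
rewrite big_split/= -mulr_suml g1 mul1r; apply: lerD => //.
by apply: (IH f' g') => h; [exact: f0|exact: g0|exact: f1|exact: g1].
Qed.

End products.

(** * The factor model on n.+1 vertices and its types *)

Section model.
Context {R : realType} {k : nat} {Q : finType} {d : measure_display} {Y : measurableType d}.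
Local Notation K := k.+1.
Variables (p : probability Y R) (phi : Y -> K.-tuple Q -> R) (D : R) (gam : Q -> R).
Hypotheses (mphi : forall t, measurable_fun setT (fun y => phi y t))
  (phiD : forall y t, D^-1 <= phi y t <= D) (D1 : 1 <= D)
  (gam0 : forall z, 0 <= gam z) (gam1 : \sum_z gam z = 1).

Let D0 : 0 < D. Proof. by apply: lt_le_trans D1. Qed.
Let phi0 y t : 0 < phi y t.
Proof. by have /andP[h _] := phiD y t; apply: lt_le_trans h; rewrite invr_gt0. Qed.

Lemma bm_phi t : bm (fun y => phi y t).
Proof. by split => //; exists D => y; have /andP[_ h] := phiD y t; rewrite gtr0_norm. Qed.

Definition Zb (g : Q -> R) : R := Ex p (fun y => \sum_t phi y t * \prod_h g (tnth t h)).

Lemma bm_Zb (g : Q -> R) : bm (fun y => \sum_t phi y t * \prod_h g (tnth t h)).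
Proof. by apply: bm_sum => t; apply: bmM; [exact: bm_phi|exact: bm_cst]. Qed.

Lemma Zb_lip (f g : Q -> R) : (forall z, 0 <= f z) -> (forall z, 0 <= g z) ->
  \sum_z f z = 1 -> \sum_z g z = 1 -> `|Zb f - Zb g| <= D * K%:R * dist1 f g.
Proof.
move=> f0 g0 f1 g1; rewrite /Zb -ExB; [|exact: bm_ig (bm_Zb _)..].
rewrite -(Ex_cst p (D * _ * _)); apply: Ex_abs_le; [exact: bm_ig (bmB (bm_Zb _) (bm_Zb _))|exact: ig_cst|].
move=> y; rewrite -sumrB; apply: le_trans (ler_norm_sum _ _ _) _.
apply: le_trans (_ : D * \sum_(t : K.-tuple Q) `|\prod_h f (tnth t h) - \prod_h g (tnth t h)| <= _).
  rewrite mulr_sumr; apply: ler_sum => t _; rewrite -mulrBr normrM gtr0_norm// ler_wpM2r//.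
  by have /andP[] := phiD y t.
rewrite -mulrA; apply: ler_wpM2l; first exact: ltW.
apply: le_trans (prod_dist (f := fun=> f) (g := fun=> g) _ _ _ _) _ => //.
by rewrite sumr_const card_ord -[X in X <= _]mulr_natl.
Qed.

Lemma Zb_bounds (g : Q -> R) : (forall z, 0 <= g z) -> \sum_z g z = 1 -> D^-1 <= Zb g <= D.
Proof.
move=> g0 g1.
have s1 : \sum_(t : K.-tuple Q) \prod_h g (tnth t h) = 1 by rewrite (sum_tuple_prod (fun=> g)) big1.
have h y : D^-1 <= \sum_t phi y t * \prod_h g (tnth t h) <= D.
  under eq_bigr do rewrite mulrC.
  by apply: conv_bounds => // t; exact: prodr_ge0.
apply/andP; split.
  by apply: Ex_ge_cst => [|y]; [exact: bm_ig (bm_Zb _)|case/andP: (h y)].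
by apply: Ex_le_cst => [|y]; [exact: bm_ig (bm_Zb _)|case/andP: (h y)].
Qed.

Section size.
Variable n : nat.
Local Notation S := (n.+1.-tuple Q).
Definition spin (i : 'I_n.+1) (s : S) : Q := tnth s i.

Definition emp (s : S) (z : Q) : R := n.+1%:R^-1 * \sum_i (tnth s i == z)%:R.

Lemma emp_ge0 s z : 0 <= emp s z.
Proof. by rewrite mulr_ge0 ?invr_ge0// sumr_ge0. Qed.

Lemma sum_emp s : \sum_z emp s z = 1.
Proof.
rewrite -mulr_sumr exchange_big /= (eq_bigr (fun=> 1)).
  by rewrite sumr_const card_ord mulVf// pnatr_eq0.
move=> i _; rewrite (bigD1 (tnth s i))//= eqxx big1 ?addr0// => z.
by rewrite eq_sym => /negPf ->.
Qed.

(** The spins at a uniform tuple of vertices are independent draws from the empirical law. Hence the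
    mean factor weight depends on the configuration only through its type. *)
Lemma avg_spt m (f : m.-tuple Q -> R) s :
  #|{: m.-tuple 'I_n.+1}|%:R^-1 * \sum_(i : m.-tuple 'I_n.+1) f (spt spin i s) =
  \sum_t f t * \prod_h emp s (tnth t h).
Proof.
rewrite card_tuple card_ord natrX -exprVn.
transitivity (\sum_t f t * \sum_(i : m.-tuple 'I_n.+1) \prod_h (n.+1%:R^-1 * (tnth s (tnth i h) == tnth t h)%:R)); last first.
  apply: eq_bigr => t _; congr (_ * _).
  rewrite (sum_tuple_prod (fun h x => n.+1%:R^-1 * (tnth s x == tnth t h)%:R)).
  by apply: eq_bigr => h _; rewrite -mulr_sumr.
under [RHS]eq_bigr do rewrite mulr_sumr.
rewrite [RHS]exchange_big mulr_sumr; apply: eq_bigr => i _ /=.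
rewrite (bigD1 (spt spin i s))//= [X in _ + X]big1 ?addr0.
  rewrite (eq_bigr (fun=> n.+1%:R^-1)); last by move=> h _; rewrite tnth_map eqxx mulr1.
  by rewrite prodr_const card_ord mulrC.
move=> t ht; have [h hh] : exists h, tnth (spt spin i s) h != tnth t h.
  apply: contrapT => /forallNP H; case/eqP: ht; apply/eq_from_tnth => h.
  by apply/esym/eqP; apply: contrapT => /negP; exact: H.
have hF : (tnth s (tnth i h) == tnth t h) = false by apply: negbTE; move: hh; rewrite tnth_map.
by rewrite (bigD1 h)//= hF !(mulr0, mul0r).
Qed.

Definition wF (x : K.-tuple 'I_n.+1 * Y) (s : S) : R := phi x.2 (spt spin x.1 s).

Lemma bm_wF s : bm (fun x => wF x s).
Proof. by apply: (bm_site (f := fun i y => phi y (spt spin i s))) => i; exact: bm_phi. Qed.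

Lemma wF_ge0 x s : 0 <= wF x s. Proof. by apply: ltW; exact: phi0. Qed.

Definition zeta (s : S) : R := Zb (emp s).

Lemma Ex_wF s : Ex (site n K p) (fun x => wF x s) = zeta s.
Proof.
rewrite (Ex_site p (f := fun i y => phi y (spt spin i s))); last by move=> i; exact: bm_phi.
rewrite (avg_spt (fun t => Ex p (fun y => phi y t))) /zeta /Zb Ex_sum; last first.
  by move=> t; apply: bm_ig; apply: bmM; [exact: bm_phi|exact: bm_cst].
apply: eq_bigr => t _; rewrite mulrC.
have h := ExZ (\prod_h emp s (tnth t h)) (bm_ig p (bm_phi t)).
by apply: etrans (esym h) _; congr Ex; apply/funext => y; rewrite mulrC.
Qed.

Definition UF (l : R) := UP (site n K p) wF l.

Definition dev (s : S) : R := dist1 (emp s) gam.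

Definition P0 (s : S) : R := \prod_i gam (tnth s i).

Lemma P0_ge0 : nn P0. Proof. by move=> s; apply: prodr_ge0. Qed.

Lemma mass_P0 : mass P0 = 1.
Proof. by rewrite /mass /P0 (sum_tuple_prod (fun=> gam)) big1. Qed.

Lemma P0_tnth2 (f g : Q -> R) (i j : 'I_n.+1) : i != j ->
  \sum_s P0 s * (f (tnth s i) * g (tnth s j)) = (\sum_z gam z * f z) * (\sum_z gam z * g z).
Proof.
move=> ij; have ji : (j == i) = false by rewrite eq_sym (negPf ij).
transitivity (\sum_(s : S) \prod_l (gam (tnth s l) * (if l == i then f (tnth s l) else if l == j then g (tnth s l) else 1))).
  apply: eq_bigr => s _; rewrite big_split/=; congr (_ * _).
  rewrite (bigD1 i)//= eqxx (bigD1 j)/=; last by rewrite eq_sym.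
  rewrite ji eqxx [X in _ * (_ * X)]big1 ?mulr1// => l /andP[/negPf -> /negPf ->].
  by [].
rewrite (sum_tuple_prod (fun l x => gam x * (if l == i then f x else if l == j then g x else 1))).
rewrite (bigD1 i)//= eqxx (bigD1 j)/=; last by rewrite eq_sym.
rewrite ji eqxx [X in _ * (_ * X)]big1 ?mulr1// => l /andP[/negPf li /negPf lj].
by rewrite li lj; under eq_bigr do rewrite mulr1.
Qed.

Lemma P0_tnth (f : Q -> R) (i : 'I_n.+1) : \sum_s P0 s * f (tnth s i) = \sum_z gam z * f z.
Proof.
transitivity (\sum_(s : S) \prod_l (gam (tnth s l) * (if l == i then f (tnth s l) else 1))).
  apply: eq_bigr => s _; rewrite big_split/=; congr (_ * _).
  by rewrite (bigD1 i)//= eqxx big1 ?mulr1// => l /negPf ->.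
rewrite (sum_tuple_prod (fun l x => gam x * (if l == i then f x else 1))).
rewrite (bigD1 i)//= eqxx [X in _ * X]big1 ?mulr1// => l /negPf li.
by rewrite li; under eq_bigr do rewrite mulr1.
Qed.

Lemma emp_var z : \sum_s P0 s * (emp s z - gam z) ^+ 2 <= n.+1%:R^-1.
Proof.
have n0 : n.+1%:R != 0 :> R by rewrite pnatr_eq0.
pose f (u : Q) : R := (u == z)%:R - gam z.
have fE s : emp s z - gam z = n.+1%:R^-1 * \sum_i f (tnth s i).
  rewrite /f sumrB sumr_const card_ord /emp mulrBr; congr (_ - _).
  by rewrite -(mulr_natl (gam z) n.+1) mulrA mulVf// mul1r.
have f_mean : \sum_u gam u * f u = 0.
  rewrite /f; under eq_bigr do rewrite mulrBr; rewrite sumrB -mulr_suml gam1 mul1r.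
  by rewrite (bigD1 z)//= eqxx mulr1 big1 ?addr0 ?subrr// => u /negPf ->; rewrite mulr0.
have gz1 : 0 <= gam z <= 1.
  by rewrite gam0 -gam1 (bigD1 z)//= lerDl sumr_ge0.
have f_sq : \sum_u gam u * (f u * f u) <= 1.
  rewrite -gam1; apply: ler_sum => u _; rewrite ler_piMr//.
  by rewrite /f; move: gz1 => /andP[? ?]; case: eqP => _ /=; nra.
under eq_bigr do rewrite fE exprMn mulrCA.
rewrite -mulr_sumr.
have -> : \sum_s P0 s * (\sum_i f (tnth s i)) ^+ 2 = \sum_i \sum_j \sum_s P0 s * (f (tnth s i) * f (tnth s j)).
  transitivity (\sum_s \sum_i \sum_j P0 s * (f (tnth s i) * f (tnth s j))).
    apply: eq_bigr => s _; rewrite expr2 mulr_suml mulr_sumr; apply: eq_bigr => i _.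
    by rewrite mulr_sumr mulr_sumr.
  by rewrite exchange_big; apply: eq_bigr => i _; exact: exchange_big.
apply: le_trans (_ : n.+1%:R^-1 ^+ 2 * \sum_(i < n.+1) 1 <= _).
  rewrite ler_wpM2l ?sqr_ge0//; apply: ler_sum => i _.
  rewrite (bigD1 i)//= [X in _ + X]big1 ?addr0.
    by rewrite (P0_tnth (fun u => f u * f u)).
  by move=> j ji; rewrite P0_tnth2 1?eq_sym// f_mean mul0r.
by rewrite sumr_const card_ord expr2 -mulrA mulVf ?mulr1.
Qed.

(** The variance bound [emp_var] with y <= y^2 / (2 r) + r / 2 at r = (n + 1)^(-1/2), in place of
    the Cauchy-Schwarz inequality. *)
Lemma ell_dev_P0 : ell dev P0 <= #|Q|%:R * n.+1%:R `^ (- 2^-1).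
Proof.
have n0 : 0 < n.+1%:R :> R by rewrite ltr0n.
set r := n.+1%:R `^ (- 2^-1).
have r0 : 0 < r by rewrite powR_gt0.
have rr : r * r = n.+1%:R^-1.
  rewrite /r -powRD; last by apply/implyP => _; rewrite gt_eqF.
  have -> : - 2^-1 - 2^-1 = - 1 :> R by field.
  by rewrite powR_inv1 ?ltW.
have h z : \sum_s P0 s * `|emp s z - gam z| <= r.
  apply: le_trans (_ : \sum_s P0 s * ((emp s z - gam z) ^+ 2 / (2 * r) + r / 2) <= _).
    apply: ler_sum => s _; rewrite ler_wpM2l ?P0_ge0//.
    set x := emp s z - gam z; have xx : x ^+ 2 = `|x| ^+ 2 by rewrite real_normK ?num_real.
    rewrite xx; have := sqr_ge0 (`|x| - r); move: `|x| => y h.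
    have : 0 <= (y - r) ^+ 2 / (2 * r) by rewrite divr_ge0// mulr_ge0// ltW.
    have -> : (y - r) ^+ 2 / (2 * r) = y ^+ 2 / (2 * r) + r / 2 - y by field; rewrite gt_eqF.
    by lra.
  under eq_bigr do rewrite mulrDr mulrA.
  rewrite big_split/= -!mulr_suml -/(mass P0) mass_P0 mul1r.
  have := emp_var z; rewrite -rr => hv.
  have : (\sum_s P0 s * (emp s z - gam z) ^+ 2) / (2 * r) <= r * r / (2 * r).
    by rewrite ler_pM2r// invr_gt0 mulr_gt0.
  have -> : r * r / (2 * r) = r / 2 by field; rewrite gt_eqF.
  by lra.
rewrite /ell /dev /dist1; under eq_bigr do rewrite mulr_suml.
rewrite exchange_big /=; apply: le_trans (_ : \sum_(z : Q) r <= _).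
  by apply: ler_sum => z _; under eq_bigr do rewrite mulrC; exact: h.
by rewrite sumr_const mulr_natl.
Qed.

End size.
End model.

(** * Total correlations seen by a Poisson number of factors *)

Section tcpois.
Context {R : realType} {S Q : finType} {n : nat} (sp : 'I_n.+1 -> S -> Q).
Variables (D L : R).
Hypotheses (D1 : 1 <= D).

Let D0 : 0 <= D. Proof. by apply: le_trans D1. Qed.

Definition TCP (l : R) (r : nat) (a : S -> R) : R :=
  Ex (Po l) (fun m => 3 * D * (D ^+ 2) ^+ m * TC sp (m * r) a).

Definition cT (r : nat) : R := 3 * D * (r * r)%:R * expR (L * (4 * D ^+ 2)).

Let V0 : (0 < #|'I_n.+1|)%N. Proof. by rewrite card_ord. Qed.
Let q := #|Q|%:R : R.
Let cTC N := q ^+ N * 1 + 1 + N%:R * (q * 1 + 1).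

Lemma TC_grow N : grow (cTC N) (TC (R := R) sp N).
Proof.
have gF : grow (S := S) (R := R) 1 F0.
  move=> b b0; rewrite mul1r; apply: le_trans (Lambda_bound _) _.
  by have := mass_ge0 b0; nra.
move=> a a0.
have h1 := op_grow (isop_iter N (isop_pin sp V0)) (good_F0 (S := S)).1 gF a0.
have h2 := op_grow (isop_pin sp V0) (good_F0 (S := S)).1 gF a0.
have h3 := gF _ a0.
rewrite /TC /cTC -/q in h1 h2 *; set x := iter _ _ _ _ in h1 *; set y := pin _ _ _ in h2 *.
have N0 : 0 <= N%:R :> R by [].
apply: le_trans (ler_normB _ _) _; rewrite mulrDl; apply: lerD.
  apply: le_trans (ler_normB _ _) _; rewrite [leRHS]mulrDl; exact: lerD.
rewrite normrM ger0_norm// -mulrA ler_wpM2l//.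
by apply: le_trans (ler_normB _ _) _; rewrite [leRHS]mulrDl; exact: lerD.
Qed.

Lemma TCP_gfam l r : 0 <= l -> gfam (Po l) (fun m a => 3 * D * (D ^+ 2) ^+ m * TC (R := R) sp (m * r) a).
Proof.
move=> l0; split.
  move=> d' Z g f mg mf.
  apply: (measurable_fun_nat (h := fun m z => 3 * D * (D ^+ 2) ^+ m * TC sp (m * r) (f z)) (g := g)) => // m.
  have [h _] := goodZ (3 * D * (D ^+ 2) ^+ m) (good_TC (R := R) sp V0 (m * r)).
  by apply: (h _ _ (fun=> tt)) => //.
exists (fun m => 3 * D * (D ^+ 2) ^+ m * cTC (m * r)).
have q0 : 0 <= q by [].
have c0 m : 0 <= 3 * D * (D ^+ 2) ^+ m by rewrite !mulr_ge0// exprn_ge0// sqr_ge0.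
split.
- apply: ig_eg => //; apply: egM; first by apply: egZ; exact: eg_pow.
  rewrite /cTC; apply: egD; first apply: egD.
  + under eq_fun do rewrite mulr1 mulnC exprM; exact: eg_pow.
  + exact: eg_cst.
  + apply: egM; last exact: eg_cst.
    by under eq_fun do rewrite natrM; apply: egM; [exact: eg_nat|exact: eg_cst].
- move=> m; rewrite mulr_ge0// /cTC addr_ge0//; first by rewrite addr_ge0// mulr1 exprn_ge0.
  by rewrite mulr_ge0// addr_ge0// mulr1.
- move=> m a a0; rewrite normrM (ger0_norm (c0 m)) -[leRHS]mulrA; apply: ler_wpM2l => //; exact: TC_grow.
Qed.

Lemma good_TCP l r : 0 <= l -> good (TCP l r).
Proof. by move=> l0; apply: good_Ex; exact: TCP_gfam. Qed.

Lemma cT_ge0 r : 0 <= cT r.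
Proof. by rewrite !mulr_ge0// expR_ge0. Qed.

(** [TCP] is the total correlation term of [eval_pois]. Summed over the number of pins it is bounded
    uniformly in T, since [TC_sum] applies for each number m of factors; the bound grows
    quadratically in m, and Poisson laws integrate it against [(D ^+ 2) ^+ m]. *)
Lemma TCP_sum l r (M : ((S -> R) -> R) -> (S -> R) -> R) B T a : 0 <= l <= L -> isop M B -> mp M -> nn a ->
  \sum_(t < T) M (iter t (pin sp) (TCP l r)) a <= cT r * (ln q * mass a).
Proof.
move=> /andP[l0 lL] hM mM a0.
have gf := TCP_gfam r l0.
have c0 m : 0 <= 3 * D * (D ^+ 2) ^+ m by rewrite !mulr_ge0// exprn_ge0// sqr_ge0.
pose h (t : 'I_T) m := M (iter t (pin sp) (fun b => 3 * D * (D ^+ 2) ^+ m * TC sp (m * r) b)) a.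
have hB t := isop_comp hM (isop_iter t (isop_pin (R := R) sp V0)).
have E1 (t : 'I_T) : M (iter t (pin sp) (TCP l r)) a = Ex (Po l) (h t) by have := op_int (hB t) gf a0.
have ih (t : 'I_T) : ig (Po l) (h t) by exact: gfam_ig (op_gfam (hB t) gf) a0.
under eq_bigr do rewrite E1.
rewrite -(Ex_sum _ ih).
have qA : 0 <= ln q * mass a.
  have [z0|z0] := leqP #|Q| 1.
    rewrite /q; case: #|Q| z0 => [|[|//]] _; first by rewrite ln0// mul0r.
    by rewrite ln1 mul0r.
  by rewrite mulr_ge0 ?mass_ge0// ln_ge0// ler1n ltnW.
have qb : 0 <= (4 * D ^+ 2) by rewrite mulr_ge0// sqr_ge0.
apply: le_trans (_ : Ex (Po l) (fun m => 3 * D * (r * r)%:R * (ln q * mass a) * (4 * D ^+ 2) ^+ m) <= _); last first.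
  rewrite (ExZ _ (ig_pow l0 qb)) (Ex_Po_pow l0 qb) /cT.
  have -> : 3 * D * (r * r)%:R * expR (L * (4 * D ^+ 2)) * (ln q * mass a) =
    3 * D * (r * r)%:R * (ln q * mass a) * expR (L * (4 * D ^+ 2)) by ring.
  apply: ler_wpM2l; first by rewrite mulr_ge0// !mulr_ge0.
  rewrite ler_expR; apply: le_trans (_ : L * (4 * D ^+ 2 - 1) <= _).
    by apply: ler_wpM2r => //; move: D1 => ?; nra.
  by rewrite ler_wpM2l// ?(le_trans l0)// lerBlDr lerDl.
apply: Ex_le => [| |m]; [exact: ig_sum|exact: igZ (ig_pow l0 qb)|].
have -> : \sum_(t < T) h t m = 3 * D * (D ^+ 2) ^+ m * \sum_(t < T) M (iter t (pin sp) (TC sp (m * r))) a.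
  rewrite mulr_sumr; apply: eq_bigr => t _.
  exact: (op_Z _ (hB t) (good_TC (R := R) sp V0 (m * r)) a0).
apply: le_trans (ler_wpM2l (c0 m) (TC_sum sp V0 (m * r) T hM mM a0)) _.
(* The square of m is absorbed into the exponential, whence the 4 in [cT]. *)
have m4 : (m * m)%:R <= 4 ^+ m :> R.
  rewrite -natrX ler_nat; elim: (m) => [//|j IH]; rewrite expnS.
  case: j IH => [//|j] IH; apply: leq_trans (leq_mul (leqnn 4) IH).
  rewrite (_ : 4 * (j.+1 * j.+1) = 2 * j.+1 * (2 * j.+1))%N; last by rewrite mulnACA.
  by apply: leq_mul; rewrite mul2n -addnn addSn ltnS leq_addl.
have -> : 3 * D * (D ^+ 2) ^+ m * ((m * r * (m * r))%:R * (ln q * mass a)) =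
  3 * D * (D ^+ 2) ^+ m * (r * r)%:R * (ln q * mass a) * (m * m)%:R by rewrite !natrM; ring.
rewrite [(4 * _) ^+ m]exprMn.
have -> : 3 * D * (r * r)%:R * (ln q * mass a) * (4 ^+ m * (D ^+ 2) ^+ m) =
   3 * D * (D ^+ 2) ^+ m * (r * r)%:R * (ln q * mass a) * 4 ^+ m by ring.
by apply: ler_wpM2l => //; rewrite mulr_ge0// mulr_ge0.
Qed.

Lemma TCP_ge0_0 l r : 0 <= l -> TCP l r (fun=> 0) = 0.
Proof.
move=> l0; rewrite /TCP (_ : (fun m => _) = fun=> 0) ?Ex_cst//; apply/funext => m.
suff z N : iter N (pin sp) F0 (fun=> 0 : R) = 0.
  have z1 : pin sp F0 (fun=> 0 : R) = 0 by exact: (z 1%N).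
  by rewrite /TC z z1 /F0 /mass big1// Lambda0 !subrr mulr0 subr0 mulr0.
elim: N => [|N IH] /=; first by rewrite /F0 /mass big1// Lambda0.
rewrite /pin big1// => x _; rewrite (_ : amul _ _ = fun=> 0) ?IH ?mulr0//.
by apply/funext => s; rewrite /amul mul0r.
Qed.

End tcpois.

(** [op_shift] with the multiplier 0: at the zero vector M sees [F0] only through [F0 (amul b 0)],
    which vanishes for all b. It settles the case of weights of mass 0, where marginals are
    meaningless. *)
Lemma isop_zero (R : realType) (S : finType) (M : ((S -> R) -> R) -> (S -> R) -> R) B :
  isop M B -> M F0 (fun=> 0) = 0.
Proof.
move=> hM; have n0 : nn (fun _ : S => 0 : R) by [].
have zz : amul (fun _ : S => 0 : R) (fun=> 0) = fun=> 0 by apply/funext => s; rewrite /amul mulr0.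
have := op_shift hM F0 (fun=> 0) (fun=> 0); rewrite zz => <-.
have -> : (fun b : S -> R => F0 (amul b (fun=> 0))) = (fun b => 0 * mass b).
  apply/funext => b; rewrite /F0 (_ : amul _ _ = fun=> 0); last by apply/funext => s; rewrite /amul mulr0.
  by rewrite /mass big1// Lambda0 mul0r.
by rewrite (op_Z 0 hM (good_mass (R := R) (S := S)) n0) mul0r.
Qed.

Lemma mass0_eq (R : realType) (S : finType) (a : S -> R) : nn a -> mass a = 0 -> a = fun=> 0.
Proof.
move=> a0 A0; apply/funext => s; apply: le_anti; rewrite a0 andbT -A0 /mass (bigD1 s)//= lerDl.
exact: sumr_ge0.
Qed.

(** * Value of the factors attached to an existing graph *)

Section evaluation.
Context {R : realType} {k : nat} {Q : finType} {d : measure_display} {Y : measurableType d}.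
Local Notation K := k.+1.
Variables (p : probability Y R) (phi : Y -> K.-tuple Q -> R) (D : R) (gam : Q -> R).
Hypotheses (mphi : forall t, measurable_fun setT (fun y => phi y t))
  (phiD : forall y t, D^-1 <= phi y t <= D) (D1 : 1 <= D)
  (gam0 : forall z, 0 <= gam z) (gam1 : \sum_z gam z = 1) (Zgam : Zb p phi gam = 1).
Variables (n : nat) (l L : R).
Hypothesis lL : 0 <= l <= L.
Local Notation S := (n.+1.-tuple Q).
Local Notation sp := (@spin Q n).

Let D0 : 0 < D. Proof. by apply: lt_le_trans D1. Qed.
Let l0 : 0 <= l. Proof. by case/andP: lL. Qed.
Let lL' : l <= L. Proof. by case/andP: lL. Qed.
Let L0 : 0 <= L. Proof. exact: le_trans lL'. Qed.

(** D enlarged so that the compensating weights at rates up to L satisfy the same two-sided bounds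
    as the factors. *)
Definition DL := D * expR (L * D).

Let eL1 : 1 <= expR (L * D). Proof. exact: (expRLD_ge1 D1 L0). Qed.

Lemma D_le_DL : D <= DL.
Proof. by rewrite /DL ler_peMr// ltW. Qed.

Lemma DL_ge1 : 1 <= DL.
Proof. exact: le_trans D1 D_le_DL. Qed.

Definition amean (a : S -> R) (z : Q) : R := (\sum_s a s * emp s z) / mass a.

Definition dF (a : S -> R) := dec1 sp (fun y (_ : unit) => phi y) a.

Definition xF (a : S -> R) : R := Ex (site n K p) (fun x => Lambda (dF a x tt)).

(** The first summand collects the errors of [eval_pois], with the compensating weight controlled by
    [dev]; the second pays for replacing the mean relative weight of a factor by 1. *)
Definition cU : R := 3 * DL * expR (L * DL ^+ 2) * (1 + L * expR (L * D) * (D * K%:R)) +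
  L * (1 + D ^+ 2) * (L * expR (L * D) * (D * K%:R)).

Lemma cU_ge0 : 0 <= cU.
Proof.
have := le_trans ler01 DL_ge1; have := L0; have := ltW D0; rewrite /cU => h1 h2 h3.
by rewrite addr_ge0// !(mulr_ge0, addr_ge0, expR_ge0, sqr_ge0).
Qed.

Let E0 : 0 < DL. Proof. exact: lt_le_trans DL_ge1. Qed.

Let phiE y (u : unit) t : DL^-1 <= phi y t <= DL.
Proof.
have /andP[h1 h2] := phiD y t; apply/andP; split; last exact: le_trans D_le_DL.
by apply: le_trans h1; rewrite lef_pV2 ?posrE//; exact: D_le_DL.
Qed.

Lemma dF_bounds a x u : nn a -> 0 < mass a -> D^-1 <= dF a x u <= D.
Proof. by move=> a0 A0; apply: dec1_bounds. Qed.

Lemma bm_dF a u : bm (fun x => dF a x u).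
Proof. exact: (bm_dec1 sp (fun=> mphi) (fun y _ => phiD y) D1 a u). Qed.

Lemma xF_bound a : nn a -> 0 < mass a -> `|xF a| <= 1 + D ^+ 2.
Proof.
move=> a0 A0; rewrite -(Ex_cst (site n K p) (1 + D ^+ 2)); apply: Ex_abs_le.
- by apply: bm_ig; apply: bm_Lambda; exact: bm_dF.
- exact: ig_cst.
move=> x; apply: le_trans (Lambda_bound _) _; rewrite lerD2l.
have /andP[h1 h2] := dF_bounds x tt a0 A0.
by rewrite ler_sqr ?nnegrE ?(ltW D0)//; apply: le_trans h1; rewrite invr_ge0 ltW.
Qed.

Lemma amean_ge0 a z : nn a -> 0 <= amean a z.
Proof.
move=> a0; apply: divr_ge0; last exact: mass_ge0; apply: sumr_ge0 => s _.
by rewrite mulr_ge0// emp_ge0.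
Qed.

Lemma sum_amean a : 0 < mass a -> \sum_z amean a z = 1.
Proof.
move=> A0; rewrite -mulr_suml exchange_big /=.
under eq_bigr do rewrite -mulr_sumr sum_emp mulr1.
by rewrite divff// gt_eqF.
Qed.

Lemma amean_mu a z : amean a z = n.+1%:R^-1 * \sum_v mu sp a v z.
Proof.
rewrite /amean /mu -mulr_suml mulrA; congr (_ / _).
under eq_bigr do rewrite /emp mulrCA mulr_sumr.
by rewrite -mulr_sumr exchange_big; congr (_ * _).
Qed.

Lemma dist_amean a : nn a -> 0 < mass a -> mass a * dist1 (amean a) gam <= ell (@dev R Q gam n) a.
Proof.
move=> a0 A0; rewrite /dist1 mulr_sumr /ell /dev /dist1.
under [leRHS]eq_bigr do rewrite mulr_suml.
rewrite [leRHS]exchange_big; apply: ler_sum => z _ /=.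
have -> : mass a * `|amean a z - gam z| = `|\sum_s a s * (emp s z - gam z)|.
  rewrite -{1}(gtr0_norm A0) -normrM mulrBr /amean mulrC divfK ?gt_eqF// /mass mulr_suml -sumrB.
  by under eq_bigr do rewrite -mulrBr.
apply: le_trans (ler_norm_sum _ _ _) _; apply: ler_sum => s _.
by rewrite normrM ger0_norm// mulrC.
Qed.

Lemma Ex_dF a : nn a -> 0 < mass a -> Ex (site n K p) (fun x => dF a x tt) = Zb p phi (amean a).
Proof.
move=> a0 A0; rewrite /dF /dec1.
pose f (i : K.-tuple 'I_n.+1) y := \sum_t phi y t * rho sp a i t.
have hf i : bm (f i) by apply: bm_sum => t; apply: bmM; [exact: bm_phi|exact: bm_cst].
rewrite (Ex_site p hf) card_tuple card_ord /Zb /f.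
have E (c : K.-tuple Q -> R) : Ex p (fun y => \sum_t phi y t * c t) = \sum_t Ex p (fun y => phi y t) * c t.
  rewrite Ex_sum; last by move=> t; apply: bm_ig; apply: bmM; [exact: (bm_phi mphi phiD D1)|exact: bm_cst].
  apply: eq_bigr => t _; have h := ExZ (c t) (bm_ig p (bm_phi mphi phiD D1 t)).
  by rewrite mulrC -h; congr Ex; apply/funext => y; rewrite mulrC.
rewrite E; under eq_bigr do rewrite E.
rewrite exchange_big mulr_sumr; apply: eq_bigr => t _ /=.
rewrite -mulr_sumr mulrCA; congr (_ * _).
rewrite /rho (sum_tuple_prod (fun h v => mu sp a v (tnth t h))).
rewrite natrX -exprVn -[X in _ ^+ X]card_ord -prodr_const -big_split /=.
by apply: eq_bigr => h _; rewrite amean_mu.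
Qed.

Local Notation wf := (@wF R k Q d Y phi n).

(** [eval_pois] with a one-point N, where the idealized mass is a product over the factors.
    [Ex_iid_Lambda] and [Ex_Po_stein] turn its mean into [l * xF a * expR (l * (yb - 1))], with yb
    the mean weight at the averaged marginal; as [Zb] is Lipschitz and equals 1 at gam, yb is close
    to 1. *)
Lemma eval_UF (a : S -> R) (dl : R) : nn a -> 0 < mass a -> 0 < dl <= 1 ->
  `|UF p phi l F0 a - (mass a * (l * xF a) + Lambda (mass a))| <=
   cU * (ell (@dev R Q gam n) a + dl * mass a) + 2 / dl * TCP sp DL l K a.
Proof.
move=> a0 A0 dl01; have D00 := ltW D0; have E00 := ltW E0.
have mwF s : measurable_fun setT (fun x => wf x s) := (bm_wF mphi phiD D1 s).1.
have wFD x s : D^-1 <= wf x s <= D by exact: phiD.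
have dev0 (s : S) : 0 <= dev gam s by exact: dist1_ge0.
have zD s : `|1 - wmean (site n K p) wf s| <= D * K%:R * dev gam s.
  rewrite distrC /wmean (Ex_wF p mphi phiD D1) -[X in `|_ - X|]Zgam.
  by apply: (Zb_lip p mphi phiD D1) => //; [exact: emp_ge0|exact: sum_emp].
pose kap (s : S) := L * expR (L * D) * (D * K%:R) * dev gam s.
pose e (s : S) (u : unit) := comp (site n K p) wf l s.
have eK s u : `|e s u - 1| <= kap s.
  apply: le_trans (expR_sub1_le _) _; rewrite normrM ger0_norm//.
  have h1 := zD s; have h2 := wmean_sub1 (site n K p) mwF wFD D1 s.
  set z := `|1 - _| in h1 h2 *.
  have z0 : 0 <= z by exact: normr_ge0.
  have -> : kap s = L * (D * K%:R * dev gam s) * expR (L * D) by rewrite /kap; ring.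
  apply: ler_pM; [by rewrite mulr_ge0|exact: expR_ge0|by apply: ler_pM|].
  by rewrite ler_expR; apply: ler_pM.
have eE s u : DL^-1 <= e s u <= DL.
  have eL : expR (L * D) <= DL by rewrite /DL ler_peMl// expR_ge0.
  have /andP[h1 h2] := comp_le (site n K p) mwF wFD D1 s lL.
  apply/andP; split; last exact: le_trans eL.
  by apply: le_trans h1; rewrite lef_pV2 ?posrE ?expR_gt0.
have g1 : \sum_(u : unit) (1 : R) = 1 by rewrite sumr_const card_unit.
have mxE m (x : m.-tuple _) : mx sp (fun=> 1) (fun y (_ : unit) => phi y) a e x =
    mass (amul (amul a (comp (site n K p) wf l)) (fun s => \prod_j wf (tnth x j) s)).
  apply: eq_bigr => s _; rewrite (bigD1 tt)//= [X in _ + X]big1 ?addr0; last by case.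
  by rewrite /amul mul1r mulrA.
have mom : forall (s : unit) t, measurable_fun setT (fun y => phi y t) by [].
have mA : Ex (Po l) (fun m => Ex (iid m (site n K p)) (mx sp (fun=> 1) (fun y (_ : unit) => phi y) a e (m := m))) = mass a.
  have h := mp_mass (mp_UP (site n K p) mwF wFD D1 l0) a0.
  apply: etrans h; apply: etrans (esym (UP_iid (site n K p) mwF wFD D1 l (good_mass (R := R) (S := S)) a0)).
  by congr Ex; apply/funext => m; congr Ex; apply/funext => x; exact: mxE.
have UE : UF p phi l F0 a = Ex (Po l) (fun m => Ex (iid m (site n K p)) (fun x =>
    Lambda (mx sp (fun=> 1) (fun y (_ : unit) => phi y) a e x))).
  apply: etrans (UP_iid (site n K p) mwF wFD D1 l (good_F0 (R := R) (S := S)) a0) _.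
  by congr Ex; apply/funext => m; congr Ex; apply/funext => x; rewrite mxE.
have hev := eval_pois (nu := p) (sp := sp) (fun _ : unit => ler01) g1 mom phiE DL_ge1 a0 A0 eE eK l0 dl01 mA.
rewrite -UE in hev.
set ev := Ex (Po l) (fun m => Ex (iid m (site n K p)) (fun x => Lambda (vdec _ _ _ _ _))) in hev.
set yb := Ex (site n K p) (fun x => dF a x tt).
have dF0 x : 0 < dF a x tt.
  by have /andP[h _] := dF_bounds x tt a0 A0; apply: lt_le_trans h; rewrite invr_gt0.
have evE : ev = l * (xF a * expR (l * (yb - 1))).
  have yb0 : 0 <= yb by apply: Ex_ge0 => x; exact: ltW.
  transitivity (Ex (Po l) (fun m => m%:R * (xF a * yb ^+ m.-1))).
    congr Ex; apply/funext => m; rewrite -(Ex_iid_Lambda (site n K p) m (bm_dF a tt) dF0).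
    by congr Ex; apply/funext => x; rewrite /vdec (bigD1 tt)//= [X in _ + X]big1 ?addr0 ?mul1r//; case.
  rewrite (Ex_Po_stein (x := fun m => xF a * yb ^+ m) l0); last by apply: egZ; exact: eg_pow.
  by rewrite (ExZ _ (ig_pow l0 yb0)) (Ex_Po_pow l0 yb0).
have ybE : `|yb - 1| <= D * K%:R * dist1 (amean a) gam.
  rewrite /yb Ex_dF// -[X in `|_ - X|]Zgam; apply: (Zb_lip p mphi phiD D1) => //.
  - by move=> z; exact: amean_ge0.
  - exact: sum_amean.
have ybD : `|yb - 1| <= D.
  have : D^-1 <= yb <= D.
    by rewrite /yb Ex_dF//; apply: (Zb_bounds p mphi phiD D1) => [z|]; [exact: amean_ge0|exact: sum_amean].
  have : 0 < D^-1 by rewrite invr_gt0.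
  by move=> h1 /andP[h2 h3]; rewrite ler_norml; move: D1 => ?; lra.
have h2 : `|mass a * ev - mass a * (l * xF a)| <= L * (1 + D ^+ 2) * (L * expR (L * D) * (D * K%:R)) * ell (@dev R Q gam n) a.
  have -> : mass a * ev - mass a * (l * xF a) = l * xF a * (mass a * (expR (l * (yb - 1)) - 1)).
    by rewrite evE; ring.
  rewrite !normrM (ger0_norm l0) (gtr0_norm A0).
  have -> : L * (1 + D ^+ 2) * (L * expR (L * D) * (D * K%:R)) * ell (@dev R Q gam n) a =
    L * (1 + D ^+ 2) * (L * expR (L * D) * (D * K%:R) * ell (@dev R Q gam n) a) by ring.
  apply: ler_pM; [by rewrite mulr_ge0|by rewrite mulr_ge0// (ltW A0)| |].
    by apply: ler_pM => //; exact: xF_bound.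
  apply: le_trans (_ : mass a * (L * (D * K%:R * dist1 (amean a) gam) * expR (L * D)) <= _).
    rewrite ler_wpM2l ?(ltW A0)//; apply: le_trans (expR_sub1_le _) _.
    rewrite normrM (ger0_norm l0).
    apply: ler_pM; [by rewrite mulr_ge0|exact: expR_ge0|by apply: ler_pM|].
    by rewrite ler_expR; apply: ler_pM.
  have -> : mass a * (L * (D * K%:R * dist1 (amean a) gam) * expR (L * D)) =
    L * expR (L * D) * (D * K%:R) * (mass a * dist1 (amean a) gam) by ring.
  by apply: ler_wpM2l; [rewrite !mulr_ge0 ?expR_ge0|exact: dist_amean].
have ek : ell kap a = L * expR (L * D) * (D * K%:R) * ell (@dev R Q gam n) a.
  by rewrite /ell mulr_sumr; apply: eq_bigr => s _; rewrite /kap -!mulrA.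
rewrite ek in hev.
have ed0 : 0 <= ell (@dev R Q gam n) a by apply: sumr_ge0 => s _; rewrite mulr_ge0.
clear ek; set ed := ell (@dev R Q gam n) a in ed0 h2 hev *.
set tc := 2 / dl * _ in hev; have -> : 2 / dl * TCP sp DL l K a = tc by [].
clearbody tc.
have dA : 0 <= dl * mass a by case/andP: dl01 => h _; rewrite mulr_ge0 ?ltW.
have h3 : 3 * DL * expR (l * (DL ^+ 2 - 1)) * (L * expR (L * D) * (D * K%:R) * ed + dl * mass a) <=
   3 * DL * expR (L * DL ^+ 2) * (1 + L * expR (L * D) * (D * K%:R)) * (ed + dl * mass a).
  rewrite -[leRHS]mulrA; apply: ler_pM.
  - by rewrite !mulr_ge0// expR_ge0.
  - by apply: addr_ge0 => //; rewrite !mulr_ge0// expR_ge0.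
  - apply: ler_wpM2l; first by rewrite mulr_ge0.
    rewrite ler_expR; apply: le_trans (_ : L * (DL ^+ 2 - 1) <= _).
      by apply: ler_wpM2r => //; have := DL_ge1; nra.
    by rewrite ler_wpM2l// lerBlDr lerDl.
  set c := L * _ * _; have c0 : 0 <= c by rewrite /c !mulr_ge0// expR_ge0.
  by have := mulr_ge0 c0 dA; have := mulr_ge0 c0 ed0; lra.
have h4 : L * (1 + D ^+ 2) * (L * expR (L * D) * (D * K%:R)) * ed <=
    L * (1 + D ^+ 2) * (L * expR (L * D) * (D * K%:R)) * (ed + dl * mass a).
  apply: ler_wpM2l; last by rewrite lerDl.
  by rewrite !(mulr_ge0, addr_ge0, expR_ge0, sqr_ge0).
have := ler_normD (UF p phi l F0 a - (mass a * ev + Lambda (mass a))) (mass a * ev - mass a * (l * xF a)).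
rewrite /cU mulrDl; move: hev h2 h3 h4; set u := UF _ _ _ _ _; set v := mass a * ev; set w := mass a * (l * _).
have -> : u - (v + Lambda (mass a)) + (v - w) = u - (w + Lambda (mass a)) by ring.
by clearbody u v w; move=> ? ? ? ? ?; lra.
Qed.

End evaluation.

(** * Adding a vertex *)

Lemma bm_fin {R : realType} d (Z : measurableType d) (I : finType) (e : Z -> I) (f : I -> Z -> R) :
  (forall i, measurable_fun setT (fun z => (e z == i)%:R : R)) -> (forall i, bm (f i)) ->
  bm (fun z => f (e z) z).
Proof.
move=> me hf; have -> : (fun z => f (e z) z) = (fun z => \sum_i (e z == i)%:R * f i z).
  apply/funext => z; rewrite (bigD1 (e z))//= eqxx mul1r big1 ?addr0// => i.
  by rewrite eq_sym => /negPf ->; rewrite mul0r.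
apply: bm_sum => i; apply: bmM => //; split => //.
by exists 1 => x; case: eqP => _; rewrite ?normr1// normr0.
Qed.

Section unif_products.
Context {R : realType} {d : measure_display} {Y : measurableType d} (nu : probability Y R).

Lemma Ex_unif_tuple n r (s : seq (r.-tuple 'I_n.+1)) (f : r.-tuple 'I_n.+1 -> Y -> R) :
  s != [::] -> (forall i, bm (f i)) ->
  Ex (unif s \x nu)%E (fun z => f z.1 z.2) = (size s)%:R^-1 * \sum_(i <- s) Ex nu (f i).
Proof.
move=> s0 hf; rewrite (Ex_prod_bm _ _ (bm_site hf)) Ex_unif//.
by move=> _ Z _; exact: measurable_tuple_ord.
Qed.

Lemma bm_prod_ord k (f : 'I_k.+1 -> Y -> R) : (forall h, bm (f h)) ->
  bm (fun z : Y * 'I_k.+1 => f z.2 z.1).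
Proof.
move=> hf; apply: (@bm_fin R _ (Y * 'I_k.+1)%type _ snd (fun h z => f h z.1)) => h.
  by apply: (@measurableT_comp _ _ _ _ _ _ (fun u : 'I_k.+1 => (u == h)%:R : R)).
exact: (bm_comp measurable_fst (hf h)).
Qed.

Lemma Ex_prod_ord k (f : 'I_k.+1 -> Y -> R) : (forall h, bm (f h)) ->
  Ex (nu \x unif (enum 'I_k.+1))%E (fun z => f z.2 z.1) = k.+1%:R^-1 * \sum_h Ex nu (f h).
Proof.
move=> hf; have hb := bm_prod_ord hf.
rewrite (Ex_prod_bm (f := fun y h => f h y) _ _ hb) (Ex_swap_bm (f := fun y h => f h y) _ _ hb).
rewrite Ex_unif//; last exact: (enum_neq0 (ord0 : 'I_k.+1)).
by rewrite size_enum_ord big_enum.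
Qed.

End unif_products.

(** * Vertex tuples according to their incidences with the new vertex *)

Section patterns.
Context {R : realType} {n : nat}.
Local Notation V := 'I_n.+1.
Local Notation V' := 'I_n.+2.

Definition place m (b : m.-tuple bool) (j : m.-tuple V) : m.-tuple V' :=
  [tuple if tnth b h then ord0 else lift ord0 (tnth j h) | h < m].

Definition patt m (i : m.-tuple V') : m.-tuple bool := map_tuple (fun v => v == ord0) i.

(** [place] forgets the entry of j at each position occupied by the new vertex, so every tuple
    arises n + 1 times per such position; the product of inverses corrects this. *)
Lemma sum_pattern m (b : m.-tuple bool) (g : m.-tuple V' -> R) :
  \sum_i (patt i == b)%:R * g i =
  (\prod_h (if tnth b h then n.+1%:R^-1 else 1)) * \sum_j g (place b j).
Proof.
elim: m b g => [|m IH] b g.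
  rewrite !sum_tuple0 big_ord0; have -> : (patt [tuple] == b) by apply/eqP; apply: eq_from_tnth => -[].
  by congr (_ * g _); apply: eq_from_tnth => -[].
case/tupleP: b => c b0; have -> : [tuple of c :: b0] = cons_tuple c b0 by exact: val_inj.
move: b0 => b.
have E v i : (patt (cons_tuple v i) == cons_tuple c b) = ((v == ord0) == c) && (patt i == b).
  apply/eqP/andP => [h|[/eqP h1 /eqP h2]].
    split; apply/eqP; first by have := congr1 (fun t => tnth t ord0) h; rewrite tnth_map !tnth_cons0.
    apply: eq_from_tnth => x; have := congr1 (fun t => tnth t (lift ord0 x)) h.
    by rewrite !tnth_map !tnth_consS.
  apply: val_inj => /=; rewrite h1; congr (_ :: _); exact: (congr1 val h2).
rewrite [LHS]sum_tupleS [\prod_(h < m.+1) _]big_ord_recl tnth_cons0.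
under eq_bigr do under eq_bigr do rewrite E.
under [in RHS]eq_bigr do rewrite tnth_consS.
have S0 v : \sum_(i : m.-tuple V') (((v == ord0) == c) && (patt i == b))%:R * g (cons_tuple v i) =
   ((v == ord0) == c)%:R * ((\prod_h (if tnth b h then n.+1%:R^-1 else 1)) *
      \sum_j g (cons_tuple v (place b j))).
  rewrite -(IH b (fun i => g (cons_tuple v i))) mulr_sumr; apply: eq_bigr => i _.
  by rewrite mulrA -natrM mulnb.
under eq_bigr do rewrite S0.
have PL v j : place (cons_tuple c b) (cons_tuple v j) = cons_tuple (if c then ord0 else lift ord0 v) (place b j).
  apply: eq_from_tnth => x; rewrite tnth_mktuple; case: (unliftP ord0 x) => [y|] ->.
    by rewrite !tnth_consS tnth_mktuple.
  by rewrite !tnth_cons0.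
rewrite [in RHS]sum_tupleS big_ord_recl.
under [\sum_x \sum_t g (place _ _)]eq_bigr do under eq_bigr do rewrite PL.
set P := \prod_h _; case: c {E S0 PL} => /=.
  rewrite mul1r [X in _ + X]big1 ?addr0; last by move=> v _; rewrite mul0r.
  rewrite sumr_const card_ord; move: (\sum_j _) => x.
  by rewrite -(mulr_natl x n.+1) mulrACA mulVf ?mul1r// pnatr_eq0.
rewrite mul0r add0r mul1r mulr_sumr; apply: eq_bigr => v _.
by rewrite mul1r.
Qed.

Definition ilift m (j : m.-tuple V) : m.-tuple V' := map_tuple (lift ord0) j.
Definition ionce m (h : 'I_m) (j : m.-tuple V) : m.-tuple V' :=
  [tuple if h' == h then ord0 else lift ord0 (tnth j h') | h' < m].

Definition bnone m : m.-tuple bool := [tuple false | h < m].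
Definition bone m (h : 'I_m) : m.-tuple bool := [tuple h' == h | h' < m].

(** Neither pattern leaves exactly the tuples that meet the new vertex at least twice. *)
Definition multi m : {set m.-tuple V'} :=
  [set i | (patt i != bnone m) && [forall h, patt i != bone h]].

Lemma sum_split_patterns m (g : m.-tuple V' -> R) :
  \sum_i g i = \sum_j g (ilift j) + n.+1%:R^-1 * \sum_h \sum_j g (ionce h j) +
    \sum_(i in multi m) g i.
Proof.
have -> : \sum_i g i = \sum_i ((patt i == bnone m)%:R * g i + \sum_h (patt i == bone h)%:R * g i +
    (i \in multi m)%:R * g i).
  apply: eq_bigr => i _; rewrite inE.
  have [p0|p0] := eqVneq (patt i) (bnone m).
    rewrite big1 ?addr0 ?mul1r ?mul0r ?addr0// => h _; rewrite p0.
    suff /negPf -> : bnone m != bone h by rewrite mul0r.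
    by apply/eqP => /(congr1 (fun t => tnth t h)); rewrite !tnth_mktuple eqxx.
  rewrite mul0r add0r /=; case: (pickP (fun h => patt i == bone h)) => [h /eqP ph|ph].
    rewrite (bigD1 h)//= ph eqxx mul1r big1 ?addr0.
      case: forallP => [/(_ h)|_]; first by rewrite eqxx.
      by rewrite mul0r addr0.
    move=> h' hh'; suff /negPf -> : bone h != bone h' by rewrite mul0r.
    apply/eqP => /(congr1 (fun t => tnth t h')); rewrite !tnth_mktuple eqxx => /eqP e.
    by rewrite e eqxx in hh'.
  rewrite big1 => [|h _]; last by rewrite ph mul0r.
  have -> : [forall h, patt i != bone h] by apply/forallP => h; rewrite ph.
  by rewrite add0r mul1r.
rewrite !big_split/=; congr (_ + _ + _).
- rewrite sum_pattern big1 ?mul1r; last by move=> h _; rewrite tnth_mktuple.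
  apply: eq_bigr => j _; congr g; apply: eq_from_tnth => h.
  by rewrite /ilift !(tnth_mktuple, tnth_map).
- rewrite exchange_big mulr_sumr; apply: eq_bigr => h _ /=.
  rewrite sum_pattern (bigD1 h)//= tnth_mktuple eqxx big1 ?mulr1; last first.
    by move=> h' /negPf hh; rewrite tnth_mktuple hh.
  congr (_ * _); apply: eq_bigr => j _; congr g; apply: eq_from_tnth => h'.
  by rewrite !tnth_mktuple.
- by rewrite [RHS]big_mkcond; apply: eq_bigr => i _; case: ifP => _; rewrite ?mul1r// mul0r.
Qed.

End patterns.

Section rates.
Context {R : realType}.
Implicit Types (x : R) (m : nat).

Lemma bern1 x m : 0 <= x <= 1 -> 1 - m%:R * x <= (1 - x) ^+ m.
Proof.
move=> /andP[x0 x1]; elim: m => [|m IH]; first by rewrite mul0r subr0 expr0.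
have y0 : 0 <= 1 - x by rewrite subr_ge0.
have := ler_wpM2l y0 IH; rewrite exprS -natr1.
have : 0 <= m%:R * x * x by rewrite !mulr_ge0.
by lra.
Qed.

Lemma bern2 x m : 0 <= x <= 1 -> (1 - x) ^+ m <= 1 - m%:R * x + m%:R ^+ 2 * x ^+ 2.
Proof.
move=> /andP[x0 x1]; elim: m => [|m IH]; first by rewrite expr0; lra.
have y0 : 0 <= 1 - x by rewrite subr_ge0.
have := ler_wpM2l y0 IH; rewrite exprS -natr1.
have h1 : 0 <= m%:R :> R by [].
have : 0 <= m%:R ^+ 2 * x ^+ 3 by rewrite mulr_ge0// exprn_ge0.
have : 0 <= m%:R * x ^+ 2 by rewrite mulr_ge0// exprn_ge0.
have : 0 <= x ^+ 2 by rewrite exprn_ge0.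
rewrite !exprS !expr0; nra.
Qed.

End rates.

(** * Factors of the graph enlarged by one vertex *)

Section growth.
Context {R : realType} {k : nat} {Q : finType} {d : measure_display} {Y : measurableType d}.
Local Notation K := k.+1.
Variables (p : probability Y R) (phi : Y -> K.-tuple Q -> R) (D : R) (gam : Q -> R).
Hypotheses (mphi : forall t, measurable_fun setT (fun y => phi y t))
  (phiD : forall y t, D^-1 <= phi y t <= D) (D1 : 1 <= D)
  (gam0 : forall z, 0 <= gam z) (gam1 : \sum_z gam z = 1).
Variable n : nat.
Local Notation S := (n.+1.-tuple Q).
Local Notation S' := (n.+2.-tuple Q).
Local Notation V := (K.-tuple 'I_n.+1).
Local Notation V' := (K.-tuple 'I_n.+2).

Let D0 : 0 < D. Proof. by apply: lt_le_trans D1. Qed.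

Definition tl (s : S') : S := [tuple tnth s (lift ord0 i) | i < n.+1].

Definition tset (h : 'I_K) (u : Q) (t : K.-tuple Q) : K.-tuple Q :=
  [tuple if h' == h then u else tnth t h' | h' < K].

Definition ext (a : S -> R) (s : S') : R := gam (tnth s ord0) * a (tl s).

Definition win (x : V * Y) (s : S') : R := wF phi x (tl s).
Definition wonce (x : V * (Y * 'I_K)) (s : S') : R :=
  phi x.2.1 (tset x.2.2 (tnth s ord0) (spt (@spin Q n) x.1 (tl s))).

Definition Pin : probability (V * Y)%type R := site n K p.
Definition Ponce : probability (V * (Y * 'I_K))%type R := site n K (p \x unif (enum 'I_K))%E.
Definition Pmulti : probability (V' * Y)%type R := (unif (enum (multi (n := n) K)) \x p)%E.
Local Notation wmul := (@wF R k Q d Y phi n.+1).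

Definition xn : R := n.+2%:R^-1.
(** [al], [be1] and [be2] are the probabilities that a uniform tuple of the enlarged graph meets the
    new vertex never, exactly once, and more than once. *)
Definition al : R := (1 - xn) ^+ K.
Definition be1 : R := K%:R * xn * (1 - xn) ^+ k.
Definition be2 : R := 1 - al - be1.

Lemma xn01 : 0 < xn <= 2^-1.
Proof. by rewrite invr_gt0 ltr0n /= lef_pV2 ?posrE ?ltr0n// ler_nat. Qed.

Lemma xnE : 1 - xn = n.+1%:R / n.+2%:R.
Proof.
have h : n.+2%:R = n.+1%:R + 1 :> R by rewrite natr1.
have : n.+2%:R != 0 :> R by rewrite pnatr_eq0.
by rewrite /xn h; move: (n.+1%:R) => u u0; field.
Qed.

Lemma card_multi : (#|multi (n := n) K|%:R : R) = n.+2%:R ^+ K * be2.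
Proof.
have n2 : n.+2%:R != 0 :> R by rewrite pnatr_eq0.
have n1 : n.+1%:R != 0 :> R by rewrite pnatr_eq0.
have := sum_split_patterns (n := n) (m := K) (fun=> 1 : R).
rewrite !sumr_const !card_tuple !card_ord.
rewrite !natrX -[X in _ + _ * X + _]mulr_natl => h; have -> : #|multi (n := n) K|%:R = n.+2%:R ^+ K - n.+1%:R ^+ K - n.+1%:R^-1 * (K%:R * n.+1%:R ^+ K) :> R.
  by rewrite h; ring.
rewrite /be2 /al /be1 xnE !mulrBr mulr1 expr_div_n.
rewrite [n.+2%:R ^+ K * (n.+1%:R ^+ K / _)]mulrCA divff ?expf_neq0// mulr1; congr (_ - _ - _).
rewrite expr_div_n /xn !exprS; move: n1 n2; move: (n.+1%:R : R) (n.+2%:R : R) (K%:R : R) => u v w u0 v0.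
by field; rewrite u0 v0 expf_neq0.
Qed.

Lemma be2_ge0 : 0 <= be2.
Proof.
have := ler0n R #|multi (n := n) K|; rewrite card_multi pmulr_rge0// exprn_gt0// ltr0n.
Qed.

Let f_bm (f : V' -> Y -> R) := forall i, bm (f i).

Lemma site_decomp (f : V' -> Y -> R) : f_bm f ->
  Ex (site n.+1 K p) (fun x => f x.1 x.2) =
  al * Ex Pin (fun x => f (ilift x.1) x.2) +
  be1 * Ex Ponce (fun x => f (ionce x.2.2 x.1) x.2.1) +
  be2 * Ex Pmulti (fun x => f x.1 x.2).
Proof.
move=> hf.
have n2 : n.+2%:R != 0 :> R by rewrite pnatr_eq0.
have n1 : n.+1%:R != 0 :> R by rewrite pnatr_eq0.
rewrite (Ex_site p hf) (sum_split_patterns (fun i => Ex p (f i))) !mulrDr card_tuple card_ord natrX.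
congr (_ + _ + _).
- rewrite (Ex_site (f := fun i y => f (ilift i) y) p)// card_tuple card_ord natrX mulrA; congr (_ * _).
  rewrite /al xnE expr_div_n; move: n1 n2; move: (n.+1%:R : R) (n.+2%:R : R) => u v u0 v0.
  by field; rewrite !expf_neq0.
- have hb (j : V) : bm (fun z : Y * 'I_K => f (ionce z.2 j) z.1).
    by apply: (bm_prod_ord (f := fun h y => f (ionce h j) y)).
  rewrite (Ex_site (f := fun j z => f (ionce z.2 j) z.1) _ hb) card_tuple card_ord natrX.
  under [in RHS]eq_bigr do rewrite (Ex_prod_ord (f := fun h y => f (ionce h _) y) p)//.
  rewrite -mulr_sumr [in RHS]exchange_big !mulrA; congr (_ * _).
  have K0 : K%:R != 0 :> R by rewrite pnatr_eq0.
  rewrite /be1 xnE expr_div_n /xn !exprS; move: K0 n1 n2; move: (n.+1%:R : R) (n.+2%:R : R) (K%:R : R) => u v w u0 v0 w0.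
  by field; rewrite ?u0 ?v0 ?w0 ?expf_neq0.
(* For K = 1 no tuple meets the new vertex twice. [unif] of the empty list is then a default point
   mass, but its coefficient [be2] is 0. *)
- have [M0|M0] := eqVneq #|multi (n := n) K| 0%N.
    have /eqP := card_multi; rewrite M0 eq_sym mulf_eq0 expf_eq0 (negPf n2) andbF => /eqP ->.
    by rewrite mul0r (cards0_eq M0) big_set0 mulr0.
  rewrite (Ex_unif_tuple p (f := f))//; last by rewrite -size_eq0 -cardE.
  rewrite -cardE card_multi big_enum /= mulrA; congr (_ * _).
  have b0 : be2 != 0.
    apply: contra_neq M0 => b0; have := card_multi; rewrite b0 mulr0 => /eqP.
    by rewrite pnatr_eq0 => /eqP.
  by field; rewrite b0 expf_neq0.
Qed.

Lemma spt_ilift (j : V) (s : S') : spt (@spin Q n.+1) (ilift j) s = spt (@spin Q n) j (tl s).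
Proof. by apply: eq_from_tnth => h; rewrite !tnth_map /spin tnth_mktuple. Qed.

Lemma spt_ionce h (j : V) (s : S') :
  spt (@spin Q n.+1) (ionce h j) s = tset h (tnth s ord0) (spt (@spin Q n) j (tl s)).
Proof.
apply: eq_from_tnth => h'; rewrite tnth_map /ionce /tset !tnth_mktuple.
by case: ifP => _; rewrite /spin// tnth_map /spin tnth_mktuple.
Qed.

Let mon (t : 'I_K * K.-tuple Q) (u : Q) : True. Proof. by []. Qed.

Lemma mwin s : measurable_fun setT (fun x => win x s).
Proof. exact: (bm_wF mphi phiD D1 (tl s)).1. Qed.

Lemma bm_once (g : 'I_K -> V -> K.-tuple Q) : bm (fun x : V * (Y * 'I_K) => phi x.2.1 (g x.2.2 x.1)).
Proof.
apply: (bm_site (f := fun i y => phi y.1 (g y.2 i))) => i.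
by apply: (bm_prod_ord (f := fun h y => phi y (g h i))) => h; exact: (bm_phi mphi phiD D1).
Qed.

Lemma mwonce s : measurable_fun setT (fun x => wonce x s).
Proof. exact: (bm_once (fun h j => tset h (tnth s ord0) (spt (@spin Q n) j (tl s)))).1. Qed.

Lemma mwmul s : measurable_fun setT (fun x => wmul x s).
Proof. exact: (bm_wF mphi phiD D1 s).1. Qed.

Lemma winD x s : D^-1 <= win x s <= D. Proof. exact: phiD. Qed.
Lemma wonceD x s : D^-1 <= wonce x s <= D. Proof. exact: phiD. Qed.
Lemma wmulD x s : D^-1 <= wmul x s <= D. Proof. exact: phiD. Qed.

Definition Uin := UP Pin win.
Definition Uonce := UP Ponce wonce.
Definition Umul := UP Pmulti wmul.

Lemma chan_decomp F a : good F -> nn a ->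
  chan (site n.+1 K p) wmul F a =
  al * chan Pin win F a + be1 * chan Ponce wonce F a + be2 * chan Pmulti wmul F a.
Proof.
move=> gF a0.
pose f (i : V') (y : Y) := F (amul a (fun s => phi y (spt (@spin Q n.+1) i s))).
have hf : f_bm f.
  move=> i; have mw s : measurable_fun setT (fun y => phi y (spt (@spin Q n.+1) i s)) by exact: mphi.
  split; first by apply: (gF.1 _ _ (fun=> tt)) => // s; apply: measurable_funM.
  have [C C0 hC] := good_grow gF; exists (C * (1 + D * mass a) ^+ 2) => y.
  have w0 s : 0 <= phi y (spt (@spin Q n.+1) i s).
    by have /andP[h _] := phiD y (spt (@spin Q n.+1) i s); apply: le_trans h; rewrite invr_ge0 ltW.
  have n0 : nn (amul a (fun s => phi y (spt (@spin Q n.+1) i s))) by exact: nn_amul.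
  apply: le_trans (hC _ n0) _; apply: ler_wpM2l => //.
  have h0 := mass_ge0 n0; have h1 : mass (amul a (fun s => phi y (spt (@spin Q n.+1) i s))) <= D * mass a.
    by apply: mass_amul_le => // s; case/andP: (phiD y (spt (@spin Q n.+1) i s)).
  by rewrite ler_sqr ?nnegrE ?addr_ge0// ?mulr_ge0 ?mass_ge0// ?(ltW D0)// lerD2l.
apply: etrans (site_decomp hf) _; rewrite /f; congr (_ * _ + _ * _ + _).
- congr Ex; apply/funext => x; congr (F (amul a _)); apply/funext => s.
  by rewrite spt_ilift.
- congr Ex; apply/funext => x; congr (F (amul a _)); apply/funext => s.
  by rewrite spt_ionce.
Qed.

Lemma wmean_decomp s :
  wmean (site n.+1 K p) wmul s = al * wmean Pin win s + be1 * wmean Ponce wonce s + be2 * wmean Pmulti wmul s.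
Proof.
have hf : f_bm (fun i y => phi y (spt (@spin Q n.+1) i s)) by move=> i; exact: (bm_phi mphi phiD D1).
apply: etrans (site_decomp hf) _; congr (_ * _ + _ * _ + _).
- by congr Ex; apply/funext => x; rewrite spt_ilift.
- by congr Ex; apply/funext => x; rewrite spt_ionce.
Qed.

Lemma al_lt1 : 0 <= al < 1.
Proof.
have /andP[h1 h2] := xn01; rewrite /al exprn_ge0/=; last by lra.
by rewrite exprn_ilt1//; lra.
Qed.

Lemma be1_ge0 : 0 <= be1.
Proof. by have /andP[h1 h2] := xn01; rewrite !mulr_ge0// ?(ltW h1)// exprn_ge0//; lra. Qed.

Let b1n : 0 < 1 - al. Proof. by have /andP[_ h] := al_lt1; lra. Qed.
Let iin := isop_chan Pin mwin (fun x s => ltW (gadget_gt0 winD D1 x s)) (fun x s => (andP (winD x s)).2) D1.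
Let cin := central_chan Pin mwin (fun x s => ltW (gadget_gt0 winD D1 x s)) (fun x s => (andP (winD x s)).2) D1.
Let ionc := isop_chan Ponce mwonce (fun x s => ltW (gadget_gt0 wonceD D1 x s)) (fun x s => (andP (wonceD x s)).2) D1.
Let conc := central_chan Ponce mwonce (fun x s => ltW (gadget_gt0 wonceD D1 x s)) (fun x s => (andP (wonceD x s)).2) D1.
Let imul := isop_chan Pmulti mwmul (fun x s => ltW (gadget_gt0 wmulD D1 x s)) (fun x s => (andP (wmulD x s)).2) D1.
Let iful := isop_chan (site n.+1 K p) mwmul (fun x s => ltW (gadget_gt0 wmulD D1 x s)) (fun x s => (andP (wmulD x s)).2) D1.

Let r1 := be1 / (1 - al).
Let r2 := be2 / (1 - al).
Let K2 (F : (S' -> R) -> R) a := r1 * chan Ponce wonce F a + r2 * chan Pmulti wmul F a.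

Let r10 : 0 <= r1. Proof. by apply: divr_ge0; [exact: be1_ge0|exact: ltW]. Qed.
Let r20 : 0 <= r2. Proof. by apply: divr_ge0; [exact: be2_ge0|exact: ltW]. Qed.
Let r12 : r1 + r2 = 1.
Proof. by rewrite /r1 /r2 -mulrDl /be2; move: b1n => ?; rewrite (_ : be1 + _ = 1 - al) ?divff ?gt_eqF//; ring. Qed.

Let iK2 : exists B, isop K2 B.
Proof.
have h : forall b : bool, isop (if b then chan Ponce wonce else chan Pmulti wmul) (D ^+ 2) by case.
have k0 (b : bool) : 0 <= (if b then r1 else r2) by case: b.
have := isop_sum [:: true; false] k0 h.
set M := fun _ _ => _; set B := \sum_(i <- _) _ => hM; exists B.
rewrite (_ : K2 = M)//; apply/funext => F; apply/funext => a.
by rewrite /M /K2 !big_cons big_nil addr0.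
Qed.

(** [pois_split] is applied twice: old factors against the rest, then single against multiple
    incidences, with proportions renormalized by 1 - al. The compensating weights multiply because
    the mean weights add up ([wmean_decomp]). *)
Lemma UF_decomp l F a : 0 <= l -> good F -> nn a ->
  UF p phi l F a = Uin (al * l) (Uonce (be1 * l) (Umul (be2 * l) F)) a.
Proof.
move=> l0 gF a0; have [B2 hK2] := iK2; have /andP[al0 al1] := al_lt1.
have b10 := ltW b1n.
have l1 : 0 <= (1 - al) * l by rewrite mulr_ge0.
have l2 : 0 <= be1 * l by rewrite mulr_ge0// be1_ge0.
have l3 : 0 <= be2 * l by rewrite mulr_ge0// be2_ge0.
have l4 : 0 <= al * l by rewrite mulr_ge0.
pose e2 := amul (comp Ponce wonce (be1 * l)) (comp Pmulti wmul (be2 * l)).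
have e20 : nn e2 by apply: nn_amul; exact: comp_ge0.
have e2D s : e2 s <= expR (be1 * l * D) * expR (be2 * l * D).
  apply: ler_pM; [exact: comp_ge0|exact: comp_ge0| |].
    exact: (comp_le1 Ponce mwonce wonceD D1 s l2).
  exact: (comp_le1 Pmulti mwmul wmulD D1 s l3).
have E2 : 1 <= expR (be1 * l * D) * expR (be2 * l * D).
  by rewrite -[leLHS]mulr1; apply: ler_pM => //; exact: expRLD_ge1 D1 _ _.
have e3D s := comp_le1 Pmulti mwmul wmulD D1 s l3.
have eE : comp (site n.+1 K p) wmul l = amul (comp Pin win (al * l)) e2.
  apply/funext => s; rewrite /amul /e2 /amul /comp -!expRD; congr expR.
  by rewrite wmean_decomp /be2; ring.
have p1 : al + (1 - al) = 1 by ring.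
have q1 : r1 * ((1 - al) * l) = be1 * l by rewrite mulrA divfK// gt_eqF.
have q2 : r2 * ((1 - al) * l) = be2 * l by rewrite mulrA divfK// gt_eqF.
have S1 := pois_split iin hK2 cin l0 al0 b10 p1 erefl erefl eE (comp_ge0 _ _ _) e20 e2D E2 gF a0.
have S2 b : nn b -> pois K2 e2 ((1 - al) * l) F b = Uonce (be1 * l) (Umul (be2 * l) F) b.
  move=> b0; exact: (pois_split ionc imul conc l1 r10 r20 r12 q1 q2 erefl
    (comp_ge0 _ _ _) (comp_ge0 _ _ _) e3D (expRLD_ge1 D1 l3) gF b0).
have [Bi hi] := isop_UP Pin mwin winD D1 l4.
have gp := isop_pois hK2 e20 e2D E2 l1.
have gU : good (Uonce (be1 * l) (Umul (be2 * l) F)).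
  exact: (good_UP Ponce mwonce wonceD D1 l2 (good_UP Pmulti mwmul wmulD D1 l3 gF)).
apply: etrans (op_ext hi (op_good gp gF) gU S2 a0); apply: etrans _ S1.
rewrite /UF /UP /pois; congr Ex; apply/funext => m.
pose K3 (F : (S' -> R) -> R) a := al * chan Pin win F a + (1 - al) * K2 F a.
have [B3 hK3] : exists B, isop K3 B.
  have h (b : bool) : isop (if b then chan Pin win else K2) (if b then D ^+ 2 else B2) by case: b.
  have k0 (b : bool) : 0 <= (if b then al else 1 - al) by case: b.
  have := isop_sum [:: true; false] k0 h.
  set M := fun _ _ => _; set B := \sum_(i <- _) _ => hM; exists B.
  rewrite (_ : K3 = M)//; apply/funext => G; apply/funext => b.
  by rewrite /M /K3 !big_cons big_nil addr0.
(* The decomposition of one factor is an identity on good functionals and nonnegative weights only,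
   so it is carried through the iterates by induction. *)
have E3 G b : good G -> nn b -> chan (site n.+1 K p) wmul G b = K3 G b.
  move=> gG b0; rewrite chan_decomp// /K3 /K2 -addrA; congr (_ + _).
  have r1E : (1 - al) * r1 = be1 by rewrite mulrC divfK// gt_eqF.
  have r2E : (1 - al) * r2 = be2 by rewrite mulrC divfK// gt_eqF.
  by rewrite mulrDr (mulrA _ r1) (mulrA _ r2) r1E r2E.
have := nn_amul a0 (comp_ge0 (site n.+1 K p) wmul l).
set b := amul _ _; move: b; elim: m => [//|m IH] b b0; rewrite !iterS.
have gm := op_good (isop_iter m iful) gF; have gm3 := op_good (isop_iter m hK3) gF.
by rewrite (E3 _ _ gm b0); exact: op_ext hK3 gm gm3 IH b b0.
Qed.

Lemma nn_ext a : nn a -> nn (ext a). Proof. by move=> a0 s; apply: mulr_ge0. Qed.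

Lemma tl_cons z (s : S) : tl (cons_tuple z s) = s.
Proof. by apply: eq_from_tnth => i; rewrite tnth_mktuple tnth_consS. Qed.

Lemma mass_ext a : mass (ext a) = mass a.
Proof.
rewrite /mass sum_tupleS exchange_big; apply: eq_bigr => s _ /=.
under eq_bigr do rewrite /ext tnth_cons0 tl_cons.
by rewrite -mulr_suml gam1 mul1r.
Qed.

Lemma good_ext G : good G -> good (fun a => G (ext a)).
Proof.
move=> gG; split.
  move=> d' Z g f mg mf; apply: (gG.1 _ _ (fun=> tt)) => // s.
  by apply: measurable_funM.
have [C C0 hC] := good_grow gG; exists C => a a0.
by rewrite -mass_ext; apply: hC; exact: nn_ext.
Qed.

Lemma ext_P0 : ext (P0 gam (n := n)) = P0 gam (n := n.+1).
Proof.
apply/funext => s; rewrite /ext /P0 [RHS]big_ord_recl; congr *%R.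
by apply: eq_bigr => i _; rewrite tnth_mktuple.
Qed.

(** Factors that avoid the new vertex do not see its spin, so they act on the old weights before the
    extension. *)
Lemma Uin_ext l G a : Uin l G (ext a) = UF p phi l (fun b => G (ext b)) a.
Proof.
rewrite /Uin /UF /UP /pois; congr Ex; apply/funext => m.
have amulE b w : amul (ext b) (fun s => w (tl s)) = ext (amul b w).
  by apply/funext => s; rewrite /amul /ext mulrA.
have -> : amul (ext a) (comp Pin win l) = ext (amul a (comp (site n K p) (@wF R k Q d Y phi n) l)).
  exact: amulE.
move: (amul a _); elim: m => [//|m IH] b; rewrite !iterS /chan; congr Ex; apply/funext => x.
by rewrite -IH -amulE.
Qed.

Definition spin' (i : 'I_n.+1) (s : S') : Q := spin i (tl s).

Lemma pin_ext G a : pin spin' G (ext a) = pin (@spin Q n) (fun b => G (ext b)) a.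
Proof.
apply: eq_bigr => x _; congr (_ * G _); apply/funext => s.
by rewrite /amul /ext mulrA.
Qed.

Lemma iter_pin_ext t G a : iter t (pin spin') G (ext a) = iter t (pin (@spin Q n)) (fun b => G (ext b)) a.
Proof.
elim: t a => [//|t IH] a; rewrite !iterS pin_ext; congr (pin _ _ a).
by apply/funext => b; exact: IH.
Qed.

Lemma pin_split F a :
  pin (@spin Q n.+1) F a = (1 - xn) * pin spin' F a + xn * pin (fun (_ : unit) s => tnth s ord0) F a.
Proof.
rewrite !pin_pair !card_ord card_unit big_ord_recl mulrDr addrC; congr (_ + _).
  rewrite xnE mulrA; congr (_ * _).
    by rewrite mulrAC divff ?mul1r// pnatr_eq0.
  apply: eq_bigr => i _; apply: eq_bigr => z _; congr (F (amul a _)); apply/funext => s.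
  by rewrite /ind /spin' /spin tnth_mktuple.
by rewrite invr1 mul1r /xn (bigD1 tt)//= [X in _ + X]big1 ?addr0//; case.
Qed.

End growth.

Section near.
Context {R : realType} {S : finType}.
Implicit Types (F G : (S -> R) -> R) (a : S -> R).

(** How errors propagate: a bound proportional to the mass passes through any positive operator that
    preserves the mass, without loss in the constant. *)
Lemma op_near M B F G (c : R) a : isop M B -> mp M -> good F -> good G ->
  (forall b, nn b -> `|F b - G b| <= c * mass b) -> nn a -> `|M F a - M G a| <= c * mass a.
Proof.
move=> hM mM gF gG h a0.
have gm := good_mass (R := R) (S := S).
have h1 := op_le hM gF (goodD gG (goodZ c gm)) _ a0.
have h2 := op_le hM gG (goodD gF (goodZ c gm)) _ a0.
rewrite (op_D hM gG (goodZ c gm) a0) (op_Z c hM gm a0) (mp_mass mM a0) in h1.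
rewrite (op_D hM gF (goodZ c gm) a0) (op_Z c hM gm a0) (mp_mass mM a0) in h2.
rewrite ler_distl; apply/andP; split.
  by rewrite lerBlDr; apply: h2 => b b0; have := h b b0; rewrite ler_distl; lra.
by apply: h1 => b b0; have := h b b0; rewrite ler_distl; lra.
Qed.

Lemma norm_between (x y c : R) : x <= y <= x + c -> `|y - x| <= c.
Proof. by move=> /andP[h1 h2]; rewrite ger0_norm ?subr_ge0// lerBlDl. Qed.

Lemma norm_chain (a b c e f g h i x c1 c2 c3 : R) : `|a - b| <= c1 -> b = c -> `|c - e| <= c2 ->
  e = f -> g = h -> `|i - h| <= c3 -> x = f - i -> `|a - g - x| <= c1 + c2 + c3.
Proof.
move=> h1 bc h2 ef gh h3 xE; rewrite -bc in h2; rewrite gh xE -ef.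
have -> : a - h - (e - i) = (a - b) + (b - e) + (i - h) by ring.
by apply: le_trans (ler_normD _ _) _; apply: lerD => //; apply: le_trans (ler_normD _ _) _; exact: lerD.
Qed.

Lemma near_trans F G H (c1 c2 : R) a : `|F a - G a| <= c1 -> `|G a - H a| <= c2 ->
  `|F a - H a| <= c1 + c2.
Proof. by move=> h1 h2; apply: le_trans (ler_distD (G a) _ _) (lerD h1 h2). Qed.

End near.

(** * From n.+1 to n.+2 vertices *)

Section step.
Context {R : realType} {k : nat} {Q : finType} {d : measure_display} {Y : measurableType d}.
Local Notation K := k.+1.
Variables (p : probability Y R) (phi : Y -> K.-tuple Q -> R) (D : R) (gam : Q -> R).
Hypotheses (mphi : forall t, measurable_fun setT (fun y => phi y t))
  (phiD : forall y t, D^-1 <= phi y t <= D) (D1 : 1 <= D)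
  (gam0 : forall z, 0 <= gam z) (gam1 : \sum_z gam z = 1).
Variable n : nat.
Local Notation S := (n.+1.-tuple Q).
Local Notation S' := (n.+2.-tuple Q).
Local Notation x := (@xn R n).
Local Notation lnq := (ln (#|Q|%:R : R)).

Let V0 : (0 < #|'I_n.+1|)%N. Proof. by rewrite card_ord. Qed.
Let V0' : (0 < #|'I_n.+2|)%N. Proof. by rewrite card_ord. Qed.
Let x0 : 0 < x. Proof. by have /andP[] := @xn01 R n. Qed.
Let x1 : 0 <= x <= 1. Proof. by have /andP[h1 h2] := @xn01 R n; rewrite ltW//=; lra. Qed.

(** Each pin selects the new vertex with probability [xn]; selecting an old vertex instead changes
    [F0] by at most the entropy of one spin. *)
Lemma pin_near (t : nat) a : nn a ->
  `|iter t (pin (@spin Q n.+1)) F0 a - iter t (pin (@spin' Q n)) F0 a| <= t%:R * (x * lnq) * mass a.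
Proof.
have i1 := isop_pin (R := R) (@spin Q n.+1) V0'; have i2 := isop_pin (R := R) (@spin' Q n) V0.
have U0 : (0 < #|{: unit}|)%N by rewrite card_unit.
have gF := good_F0 (R := R) (S := S').
have m1 : mp (R := R) (pin (@spin Q n.+1)) by exact: mp_pin.
have m2 : mp (R := R) (pin (@spin' Q n)) by exact: mp_pin.
elim: t a => [|t IH] a a0; first by rewrite !mul0r subrr normr0.
rewrite iterSr iterS.
have g1 := op_good i2 gF; have g2 := op_good i1 gF.
have gt1 := op_good (isop_iter t i1) gF; have gt2 := op_good (isop_iter t i2) gF.
have -> : t.+1%:R * (x * lnq) * mass a = x * lnq * mass a + t%:R * (x * lnq) * mass a.
  by rewrite -natr1; ring.
apply: (near_trans (G := fun b => iter t (pin (@spin Q n.+1)) (pin (@spin' Q n) F0) b)).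
  apply: (op_near (isop_iter t i1) (mp_iter t i1 m1) g2 g1) => // b b0.
  rewrite pin_split.
  have h1 := F0_pin (@spin' Q n) V0 b0; have h2 := F0_pin (fun (_ : unit) (s : S') => tnth s ord0) U0 b0.
  move: h1 h2; set u := pin _ _ _; set v := pin _ _ _ => h1 h2.
  have -> : (1 - x) * u + x * v - u = x * (v - u) by ring.
  rewrite normrM gtr0_norm// -mulrA; apply: ler_wpM2l; first exact: ltW.
  by rewrite ler_norml; lra.
have c1 := central_pin (@spin' Q n) (isop_iter t i1) gF a0.
rewrite c1.
exact: (op_near i2 m2 gt1 gt2 IH a0).
Qed.

Definition Phi (dd : R) (t : nat) : R :=
  UF p phi (dd * n.+1%:R / K%:R) (iter t (pin (@spin Q n)) F0) (P0 gam (n := n)).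

(** Convertible to [Phi] at the next size; the separate name serves while n is fixed in the
    section. *)
Definition Phi' (dd : R) (t : nat) : R :=
  UF p phi (dd * n.+2%:R / K%:R) (iter t (pin (@spin Q n.+1)) F0) (P0 gam (n := n.+1)).

(** The new vertex receives factors at rate about dd while the total rate grows only by dd / K.
    Hence the old graph loses factors at rate about dd - dd / K = dd k / K, the rate of the
    subtracted term. *)
Definition Gstep (dd : R) (a : S -> R) : R :=
  @Uonce R k Q d Y p phi n dd F0 (ext gam a) - UF p phi (dd * k%:R / K%:R) F0 a.

Let be1L (dd : R) : @be1 R k n * (dd * n.+2%:R / K%:R) = dd * (1 - x) ^+ k.
Proof.
have h2 : n.+2%:R != 0 :> R by rewrite pnatr_eq0.
have h3 : K%:R != 0 :> R by rewrite pnatr_eq0.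
rewrite /be1 /xn; move: h2 h3; move: (n.+2%:R : R) (K%:R : R) => u v u0 v0; move: (_ ^+ k) => w.
by field; rewrite u0 v0.
Qed.

Let be2L (dd : R) : 0 <= dd -> @be2 R k n * (dd * n.+2%:R / K%:R) <= dd * k%:R * x.
Proof.
move=> d0; have h2 : n.+2%:R != 0 :> R by rewrite pnatr_eq0.
have h3 : K%:R != 0 :> R by rewrite pnatr_eq0.
have xn : x * n.+2%:R = 1 by rewrite /xn mulVf.
apply: le_trans (_ : K%:R * k%:R * x ^+ 2 * (dd * n.+2%:R / K%:R) <= _).
  apply: ler_wpM2r; first by rewrite divr_ge0// mulr_ge0.
  rewrite /be2 /al /be1; have := bern1 k x1; have := bern1 K x1.
  move: (_ ^+ k) (_ ^+ K) => u v h1 h4.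
  have : K%:R * x * (1 - k%:R * x) <= K%:R * x * u by apply: ler_wpM2l => //; rewrite mulr_ge0// ltW.
  by lra.
rewrite le_eqVlt; apply/orP; left; apply/eqP.
transitivity (dd * k%:R * x * (x * n.+2%:R) * (K%:R / K%:R)); first by ring.
by rewrite xn divff// !mulr1.
Qed.

(** Bernoulli bounds of first and second order on [(1 - x) ^+ k]: the rate actually lost by the old
    graph is nonnegative and falls short of dd k / K by O(1/n). *)
Let l3E (dd : R) : 0 <= dd ->
  0 <= dd * k%:R / K%:R - (dd * n.+1%:R / K%:R - @al R k n * (dd * n.+2%:R / K%:R)) <= dd * k%:R * x /\
  0 <= dd * n.+1%:R / K%:R - @al R k n * (dd * n.+2%:R / K%:R).
Proof.
move=> d0; have h2 : n.+2%:R != 0 :> R by rewrite pnatr_eq0.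
have h3 : K%:R != 0 :> R by rewrite pnatr_eq0.
have n1 : n.+1%:R = n.+2%:R * (1 - x) :> R by rewrite xnE mulrC divfK.
have xn : n.+2%:R * x = 1 by rewrite /xn divff.
have e1 : dd * n.+1%:R / K%:R - @al R k n * (dd * n.+2%:R / K%:R) = dd / K%:R * (n.+1%:R * (1 - (1 - x) ^+ k)).
  by rewrite /al exprS n1; ring.
have e2 : dd * k%:R / K%:R - (dd * n.+1%:R / K%:R - @al R k n * (dd * n.+2%:R / K%:R)) =
   dd / K%:R * (k%:R - n.+1%:R * (1 - (1 - x) ^+ k)) by rewrite e1; ring.
have c0 : 0 <= dd / K%:R by rewrite divr_ge0.
rewrite e2 e1; have b1 := bern1 k x1; have b2 := bern2 k x1.
have le1 : (1 - x) ^+ k <= 1 by rewrite exprn_ile1//; have /andP[] := x1; lra.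
have n0 : 0 <= n.+1%:R :> R by [].
have hx : n.+1%:R * x = 1 - x by rewrite n1 mulrAC xn mul1r.
split; last by rewrite mulr_ge0// mulr_ge0// subr_ge0.
move: b1 b2 le1; move: (_ ^+ k) => u b1 b2 le1.
have q1 : n.+1%:R * (1 - u) <= n.+1%:R * (k%:R * x) by apply: ler_wpM2l => //; lra.
have q2 : n.+1%:R * (k%:R * x - k%:R ^+ 2 * x ^+ 2) <= n.+1%:R * (1 - u) by apply: ler_wpM2l => //; lra.
have q3 : n.+1%:R * (k%:R * x) = k%:R * (1 - x) by rewrite mulrCA hx.
have q4 : n.+1%:R * (k%:R * x - k%:R ^+ 2 * x ^+ 2) = (1 - x) * (k%:R - k%:R ^+ 2 * x).
  by rewrite -hx; ring.
have kx : 0 <= k%:R * x by rewrite mulr_ge0// ltW.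
have kx2 : 0 <= k%:R ^+ 2 * x ^+ 2 by rewrite mulr_ge0// sqr_ge0.
apply/andP; split; first by rewrite mulr_ge0//; lra.
apply: le_trans (_ : dd / K%:R * ((k%:R + k%:R ^+ 2) * x) <= _).
  by apply: ler_wpM2l => //; rewrite q4 in q2; lra.
rewrite le_eqVlt; apply/orP; left; apply/eqP.
transitivity (dd * k%:R * x * (K%:R / K%:R)); last by rewrite divff// mulr1.
by rewrite -[K%:R]natr1; ring.
Qed.

(** Both sizes share the stage of old factors at rate l0. The larger system goes on with single
    incidences at rate l1, close to dd, and multiple ones at rate l2 = O(1/n); the smaller one with
    old factors at rate l3, close to l4. Commutation moves these extra stages inside the pins, and
    [UP_F0] bounds the cost of each rate correction by its size. *)
Lemma step_decomp (dd L : R) t : 0 <= dd -> dd * K%:R <= L ->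
  `|Phi' dd t - Phi dd t -
    UF p phi (@al R k n * (dd * n.+2%:R / K%:R)) (iter t (pin (@spin Q n)) (Gstep dd)) (P0 gam (n := n))|
  <= (t%:R * lnq + 3 * (dd * k%:R) * cP D L) * x.
Proof.
move=> d0 dL.
have k0 : 0 <= k%:R :> R by [].
have K1 : (1 : R) <= K%:R by rewrite ler1n.
have dkL : dd * k%:R <= L.
  by apply: le_trans dL; apply: ler_wpM2l => //; rewrite ler_nat.
have LL0 : 0 <= dd * n.+2%:R / K%:R by rewrite divr_ge0// mulr_ge0.
have lA0 : 0 <= dd * n.+1%:R / K%:R by rewrite divr_ge0// mulr_ge0.
have [/andP[r3 r3x] l30] := l3E d0; have := be2L d0; have := be1L dd.
set LL := dd * n.+2%:R / K%:R in LL0 r3 r3x l30 *.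
set l0 := @al R k n * LL in r3 r3x l30 *; set l1 := @be1 R k n * LL; set l2 := @be2 R k n * LL => l1E l2x.
set lA := dd * n.+1%:R / K%:R in lA0 r3 r3x l30 *.
set l3 := lA - l0 in r3 r3x l30 *; set l4 := dd * k%:R / K%:R in r3 r3x *.
have l00 : 0 <= l0 by apply: mulr_ge0 => //; have /andP[] := @al_lt1 R k n.
have l10 : 0 <= l1 by apply: mulr_ge0 => //; exact: be1_ge0.
have l20 : 0 <= l2 by apply: mulr_ge0 => //; exact: be2_ge0.
have dkx : dd * k%:R * x <= dd * k%:R.
  by rewrite ler_piMr ?mulr_ge0//; case/andP: x1.
have l2L : 0 <= l2 <= L by rewrite l20/=; apply: le_trans dkL; apply: le_trans dkx.
have bx : 0 <= dd - l1 <= dd * k%:R * x.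
  rewrite l1E; have := bern1 k x1; have : (1 - x) ^+ k <= 1 by rewrite exprn_ile1//; have /andP[] := x1; lra.
  move: (_ ^+ k) => u h1 h2; apply/andP; split; first by rewrite -{1}[dd]mulr1 -mulrBr mulr_ge0// subr_ge0.
  by have := ler_wpM2l d0 h2; lra.
have dl1L : 0 <= dd - l1 <= L.
  by case/andP: bx => -> h /=; apply: le_trans h _; apply: le_trans dkx dkL.
have l43L : 0 <= l4 - l3 <= L by rewrite r3/=; apply: le_trans r3x _; apply: le_trans dkx dkL.
have gF := good_F0 (R := R) (S := S'); have gFn := good_F0 (R := R) (S := S).
have mwi := mwin mphi phiD D1 (n := n); have wiD := winD phiD (n := n).
have mwo := mwonce mphi phiD D1 (n := n); have woD := wonceD phiD (n := n).
have mwm := mwmul mphi phiD D1 (n := n); have wmD := wmulD phiD (n := n).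
have mwf : forall s, measurable_fun setT (fun y => @wF R k Q d Y phi n y s) by move=> s; exact: (bm_wF mphi phiD D1 s).1.
have wfD : forall y s, D^-1 <= @wF R k Q d Y phi n y s <= D by move=> y s; exact: phiD.
set UI := @Uin R k Q d Y p phi n l0.
set UO := @Uonce R k Q d Y p phi n.
set UM := @Umul R k Q d Y p phi n l2.
have [BI iI] := isop_UP (Pin p n) mwi wiD D1 l00.
have [BO iO] := isop_UP (Ponce p n) mwo woD D1 l10.
have [BM iM] := isop_UP (Pmulti p n) mwm wmD D1 l20.
have mI := mp_UP (Pin p n) mwi wiD D1 l00.
have mO := mp_UP (Ponce p n) mwo woD D1 l10.
have mM := mp_UP (Pmulti p n) mwm wmD D1 l20.
have ip := isop_pin (R := R) (@spin' Q n) V0.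
have ip' := isop_pin (R := R) (@spin Q n.+1) V0'.
have mpp : mp (R := R) (pin (@spin' Q n)) by exact: mp_pin.
have iOM := isop_comp iO iM; have mOM := mp_comp iO iM mO mM.
have iOM' := isop_comp iI iOM; have mOM' := mp_comp iI iOM mI mOM.
have gt' := op_good (isop_iter t ip') gF; have gt := op_good (isop_iter t ip) gF.
pose P' := P0 gam (n := n.+1); have P'0 : nn P' by exact: P0_ge0.
have mP' : mass P' = 1 by exact: mass_P0.
have P00 : nn (P0 gam (n := n)) by exact: P0_ge0.
have cpos : 0 <= cP D L by rewrite addr_ge0 ?mulr_ge0 ?sqr_ge0// (le_trans ler01).
have s1 : `|Phi' dd t - UI (UO l1 (UM (iter t (pin (@spin' Q n)) F0))) P'| <= t%:R * (x * lnq).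
  rewrite /Phi' (UF_decomp p mphi phiD D1 LL0 gt' P'0).
  have := op_near iOM' mOM' gt' gt _ P'0 (c := t%:R * (x * lnq)); rewrite mP' mulr1.
  by apply => b b0; exact: pin_near.
have cit := central_iter t ip (central_pin (@spin' Q n)).
have gOMF := op_good iOM gF.
have s2 : UI (UO l1 (UM (iter t (pin (@spin' Q n)) F0))) P' =
    UI (iter t (pin (@spin' Q n)) (UO l1 (UM F0))) P'.
  exact: (op_ext iI (op_good iOM gt) (op_good (isop_iter t ip) gOMF) (cit _ _ iOM _ gF) P'0).
have Opos : 0 <= dd - l1 by case/andP: dl1L.
have gO := good_UP (Ponce p n) mwo woD D1 d0 gF.
have crO b : nn b -> `|UO l1 (UM F0) b - UO dd F0 b| <= 2 * (dd * k%:R * cP D L * x) * mass b.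
  move=> b0; have mb := mass_ge0 b0.
  have cx : 0 <= cP D L * mass b by rewrite mulr_ge0.
  have gMF := op_good iM gF.
  apply: le_trans (near_trans (G := UO l1 F0) (c1 := l2 * cP D L * mass b) (c2 := (dd - l1) * cP D L * mass b) _ _) _.
  - apply: (op_near iO mO gMF gF _ b0) => e e0.
  exact: (norm_between (UP_F0 (Pmulti p n) mwm wmD D1 l2L e0)).
  - have gd := good_UP (Ponce p n) mwo woD D1 Opos gF.
    have -> : UO dd F0 b = UO l1 (UO (dd - l1) F0) b.
      by have := UP_semigroup (Ponce p n) mwo woD D1 l10 Opos gF b0; rewrite addrC subrK.
    apply: (op_near iO mO gF gd _ b0) => e e0.
    rewrite distrC; exact: (norm_between (UP_F0 (Ponce p n) mwo woD D1 dl1L e0)).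
  - have /andP[_ bx2] := bx.
    have -> : 2 * (dd * k%:R * cP D L * x) * mass b =
      dd * k%:R * x * (cP D L * mass b) + dd * k%:R * x * (cP D L * mass b) by ring.
    by rewrite -!(mulrA _ (cP D L)); apply: lerD; apply: ler_wpM2r.
have iIt := isop_comp iI (isop_iter t ip); have mIt := mp_comp iI (isop_iter t ip) mI (mp_iter t ip mpp).
have s3 : `|UI (iter t (pin (@spin' Q n)) (UO l1 (UM F0))) P' - UI (iter t (pin (@spin' Q n)) (UO dd F0)) P'|
   <= 2 * (dd * k%:R * cP D L * x).
  by have := op_near iIt mIt gOMF gO crO P'0; rewrite mP' mulr1.
have s4 : UI (iter t (pin (@spin' Q n)) (UO dd F0)) P' =
   UF p phi l0 (iter t (pin (@spin Q n)) (fun a => UO dd F0 (ext gam a))) (P0 gam (n := n)).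
  rewrite /P' -ext_P0 /UI Uin_ext; congr (UF _ _ _ _ _); apply/funext => b.
  exact: iter_pin_ext.
have [BF iF] := isop_UP (site n K p) mwf wfD D1 l00.
have mF := mp_UP (site n K p) mwf wfD D1 l00.
have [B3 i3] := isop_UP (site n K p) mwf wfD D1 l30.
have m3 := mp_UP (site n K p) mwf wfD D1 l30.
have ipn := isop_pin (R := R) (@spin Q n) V0.
have mpn : mp (R := R) (pin (@spin Q n)) by exact: mp_pin.
have gtn := op_good (isop_iter t ipn) gFn.
have citn := central_iter t ipn (central_pin (@spin Q n)).
have g3 := op_good i3 gFn.
have l03 : l0 + l3 = lA by rewrite /l3 addrC subrK.
have e35 b : nn b -> UF p phi l3 (iter t (pin (@spin Q n)) F0) b = iter t (pin (@spin Q n)) (UF p phi l3 F0) b.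
  by move=> b0; exact: (citn _ _ i3 _ gFn b b0).
have s5 : Phi dd t = UF p phi l0 (iter t (pin (@spin Q n)) (UF p phi l3 F0)) (P0 gam (n := n)).
  have -> : Phi dd t = UF p phi (l0 + l3) (iter t (pin (@spin Q n)) F0) (P0 gam (n := n)).
    transitivity (UF p phi lA (iter t (pin (@spin Q n)) F0) (P0 gam (n := n))); first exact: erefl.
    exact: (f_equal (fun z => UF p phi z (iter t (pin (@spin Q n)) F0) (P0 gam (n := n))) (esym l03)).
  apply: etrans (UP_semigroup (site n K p) mwf wfD D1 l00 l30 gtn P00) _.
  exact: (op_ext iF (op_good i3 gtn) (op_good (isop_iter t ipn) g3) e35 P00).
have l40 : 0 <= l4 by exact: (divr_ge0 (mulr_ge0 d0 k0) (ler0n _ _)).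
have g4 := good_UP (site n K p) mwf wfD D1 l40 gFn.
have iFt := isop_comp iF (isop_iter t ipn); have mFt := mp_comp iF (isop_iter t ipn) mF (mp_iter t ipn mpn).
have l34 : l3 + (l4 - l3) = l4 by rewrite addrC subrK.
have crF (b : S -> R) : nn b -> `|UF p phi l4 F0 b - UF p phi l3 F0 b| <= dd * k%:R * cP D L * x * mass b.
  move=> b0; have mb := mass_ge0 b0.
  have cx : 0 <= cP D L * mass b by rewrite mulr_ge0.
  have gd := good_UP (site n K p) mwf wfD D1 r3 gFn.
  have -> : UF p phi l4 F0 b = UF p phi l3 (UF p phi (l4 - l3) F0) b.
    apply: etrans (f_equal (fun z => UF p phi z F0 b) (esym l34)) _.
    exact: (UP_semigroup (site n K p) mwf wfD D1 l30 r3 gFn b0).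
  apply: le_trans (_ : (l4 - l3) * cP D L * mass b <= _); last first.
    have -> : dd * k%:R * cP D L * x * mass b = dd * k%:R * x * (cP D L * mass b) by ring.
    by rewrite -(mulrA _ (cP D L)); apply: ler_wpM2r.
  apply: (op_near i3 m3 gd gFn _ b0) => e e0.
  exact: (norm_between (UP_F0 (site n K p) mwf wfD D1 l43L e0)).
have s6 := op_near iFt mFt g4 g3 crF P00.
have gE := good_ext gam0 gam1 gO.
have s7 : UF p phi l0 (iter t (pin (@spin Q n)) (Gstep dd)) (P0 gam (n := n)) =
   UF p phi l0 (iter t (pin (@spin Q n)) (fun a => UO dd F0 (ext gam a))) (P0 gam (n := n)) -
   UF p phi l0 (iter t (pin (@spin Q n)) (UF p phi l4 F0)) (P0 gam (n := n)).
  exact: (op_B iFt gE g4 P00).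
apply: le_trans (norm_chain s1 s2 s3 s4 s5 s6 s7) _.
have m1 : mass (P0 gam (n := n)) = 1 := mass_P0 gam1 n.
rewrite m1; move: (cP D L) (@xn R n) (lnq) (t%:R : R) => c y z w; clear.
by rewrite le_eqVlt; apply/orP; left; apply/eqP; ring.
Qed.

End step.

(** * Factors incident to the new vertex *)

Section once.
Context {R : realType} {k : nat} {Q : finType} {d : measure_display} {Y : measurableType d}.
Local Notation K := k.+1.
Variables (p : probability Y R) (phi : Y -> K.-tuple Q -> R) (D : R) (gam : Q -> R).
Hypotheses (mphi : forall t, measurable_fun setT (fun y => phi y t))
  (phiD : forall y t, D^-1 <= phi y t <= D) (D1 : 1 <= D)
  (gam0 : forall z, 0 <= gam z) (gam1 : \sum_z gam z = 1).

(** The first-order condition for gam to maximize [Zb] with value 1 (see [stationary_max]): a factor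
    with one random slot set to u and the others drawn from gam has mean 1. It keeps the
    compensation of these factors near 1 for every value of the new spin. *)
Definition stationary := forall u : Q,
  K%:R^-1 * \sum_h Zb p (fun y t => phi y (tset h u t)) gam = 1.

Hypothesis stat : stationary.
Variable n : nat.
Local Notation S := (n.+1.-tuple Q).
Local Notation S' := (n.+2.-tuple Q).
Local Notation sp := (@spin Q n).
Local Notation wo := (@wonce R k Q d Y phi n).

Let D0 : 0 < D. Proof. by apply: lt_le_trans D1. Qed.

Definition omO (z : Y * 'I_K) (u : Q) (t : K.-tuple Q) : R := phi z.1 (tset z.2 u t).

Definition uF (l : R) (a : S -> R) : R :=
  Ex (Po l) (fun m => Ex (iid m (Ponce p n)) (fun x => Lambda (vdec sp gam omO a x))).

Lemma wmean_once (s' : S') :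
  wmean (Ponce p n) wo s' =
  K%:R^-1 * \sum_h zeta p (fun y t => phi y (tset h (tnth s' ord0) t)) (tl s').
Proof.
pose g (h : 'I_K) (j : K.-tuple 'I_n.+1) := tset h (tnth s' ord0) (spt sp j (tl s')).
have hb j : bm (fun z : Y * 'I_K => phi z.1 (g z.2 j)).
  by apply: (bm_prod_ord (f := fun h y => phi y (g h j))) => h; exact: (bm_phi mphi phiD D1).
rewrite /wmean /Ponce (Ex_site (f := fun j z => phi z.1 (g z.2 j)) _ hb).
have E j : Ex (p \x unif (enum 'I_K))%E (fun z : Y * 'I_K => phi z.1 (g z.2 j)) =
    K%:R^-1 * \sum_h Ex p (fun y => phi y (g h j)).
  by apply: (Ex_prod_ord p (f := fun h y => phi y (g h j))) => h; exact: (bm_phi mphi phiD D1).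
rewrite (eq_bigr _ (fun j _ => E j)) -mulr_sumr mulrCA; congr (_ * _).
rewrite exchange_big mulr_sumr; apply: eq_bigr => h _ /=.
pose ph y t := phi y (tset h (tnth s' ord0) t).
rewrite -(Ex_wF (phi := ph) p (fun t => mphi _) (fun y t => phiD y _) D1).
rewrite (Ex_site (f := fun j y => ph y (spt sp j (tl s'))) p)// => j.
exact: (bm_phi mphi phiD D1).
Qed.

Variables (l L : R).
Hypothesis lL : 0 <= l <= L.
Let l0 : 0 <= l. Proof. by case/andP: lL. Qed.
Let lL' : l <= L. Proof. by case/andP: lL. Qed.
Let L0 : 0 <= L. Proof. exact: le_trans lL'. Qed.

(** [eval_pois] with N the values of the new spin. By [stat] the mean weight given this spin
    deviates from 1 by at most a multiple of [dev] of the old configuration. *)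
Lemma eval_once (a : S -> R) (dl : R) : nn a -> 0 < mass a -> 0 < dl <= 1 ->
  `|@Uonce R k Q d Y p phi n l F0 (ext gam a) - (mass a * uF l a + Lambda (mass a))| <=
   cU (k := k) D L * (ell (@dev R Q gam n) a + dl * mass a) + 2 / dl * TCP sp (DL D L) l K a.
Proof.
move=> a0 A0 dl01; have D00 := ltW D0.
have eL1 : 1 <= expR (L * D) := expRLD_ge1 D1 L0.
have DD := D_le_DL D1 lL; have D1' := DL_ge1 D1 lL.
have E0 : 0 < DL D L by apply: lt_le_trans D1'.
have mwO s : measurable_fun setT (fun x => wo x s) := mwonce mphi phiD D1 s.
have wOD x s : D^-1 <= wo x s <= D by exact: phiD.
have dev0 (s : S) : 0 <= dev gam s by exact: dist1_ge0.
pose e (s : S) (u : Q) := comp (Ponce p n) wo l (cons_tuple u s).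
have zD (s : S) u : `|1 - wmean (Ponce p n) wo (cons_tuple u s)| <= D * K%:R * dev gam s.
  rewrite wmean_once tl_cons tnth_cons0 -[X in `|X - _|](stat u) -mulrBr -sumrB.
  rewrite normrM ger0_norm ?invr_ge0// ler_pdivrMl ?ltr0n//.
  apply: le_trans (ler_norm_sum _ _ _) _; apply: le_trans (_ : \sum_(h < K) D * K%:R * dev gam s <= _).
    apply: ler_sum => h _; rewrite distrC /zeta.
    by apply: (Zb_lip p (fun t => mphi _) (fun y t => phiD y _) D1) => //; [exact: emp_ge0|exact: sum_emp].
  by rewrite sumr_const card_ord -[X in X <= _]mulr_natl.
pose kap (s : S) := L * expR (L * D) * (D * K%:R) * dev gam s.
have eK s u : `|e s u - 1| <= kap s.
  apply: le_trans (expR_sub1_le _) _; rewrite normrM ger0_norm//.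
  have h1 := zD s u; have h2 := wmean_sub1 (Ponce p n) mwO wOD D1 (cons_tuple u s).
  set z := `|1 - _| in h1 h2 *.
  have z0 : 0 <= z by exact: normr_ge0.
  have -> : kap s = L * (D * K%:R * dev gam s) * expR (L * D) by rewrite /kap; ring.
  apply: ler_pM; [by rewrite mulr_ge0|exact: expR_ge0|by apply: ler_pM|].
  by rewrite ler_expR; apply: ler_pM.
have eE s u : (DL D L)^-1 <= e s u <= DL D L.
  have eL : expR (L * D) <= DL D L by rewrite /DL ler_peMl// expR_ge0.
  have /andP[h1 h2] := comp_le (Ponce p n) mwO wOD D1 (cons_tuple u s) lL.
  apply/andP; split; last exact: le_trans eL.
  by apply: le_trans h1; rewrite lef_pV2 ?posrE ?expR_gt0.
have omE (y : Y * 'I_K) u t : (DL D L)^-1 <= omO y u t <= DL D L.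
  have /andP[h1 h2] := phiD y.1 (tset y.2 u t); apply/andP; split; last exact: le_trans DD.
  by apply: le_trans h1; rewrite lef_pV2 ?posrE.
have mom u t : measurable_fun setT (fun y : Y * 'I_K => omO y u t).
  exact: (bm_prod_ord (f := fun h y => phi y (tset h u t)) (fun h => bm_phi mphi phiD D1 _)).1.
have ne := nn_ext gam0 a0.
have mxE m (x : m.-tuple _) : mx sp gam omO a e x =
    mass (amul (amul (ext gam a) (comp (Ponce p n) wo l)) (fun s => \prod_j wo (tnth x j) s)).
  rewrite /mass sum_tupleS exchange_big; apply: eq_bigr => s _ /=; rewrite mulr_sumr.
  apply: eq_bigr => u _; rewrite /amul /ext tnth_cons0 tl_cons -/(e s u) !mulrA [a s * _]mulrC.
  congr (_ * _); apply: eq_bigr => j _.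
  by rewrite /wonce tnth_cons0 tl_cons.
have mA : Ex (Po l) (fun m => Ex (iid m (Ponce p n)) (mx sp gam omO a e (m := m))) = mass a.
  have h := mp_mass (mp_UP (Ponce p n) mwO wOD D1 l0) ne.
  rewrite (mass_ext gam1) in h; apply: etrans h.
  apply: etrans (esym (UP_iid (Ponce p n) mwO wOD D1 l (good_mass (R := R) (S := S')) ne)).
  by congr Ex; apply/funext => m; congr Ex; apply/funext => x; exact: mxE.
have UE : @Uonce R k Q d Y p phi n l F0 (ext gam a) = Ex (Po l) (fun m => Ex (iid m (Ponce p n)) (fun x =>
    Lambda (mx sp gam omO a e x))).
  apply: etrans (UP_iid (Ponce p n) mwO wOD D1 l (good_F0 (R := R) (S := S')) ne) _.
  by congr Ex; apply/funext => m; congr Ex; apply/funext => x; rewrite mxE.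
have hev := eval_pois (nu := (p \x unif (enum 'I_K))%E) (sp := sp) gam0 gam1 mom omE D1' a0 A0 eE eK l0 dl01 mA.
rewrite -/(Ponce p n) -UE -/(uF l a) in hev; apply: le_trans hev _.
apply: (lerD _ (lexx (2 / dl * TCP sp (DL D L) l K a))); clear mA UE mxE.
have ek : ell kap a = L * expR (L * D) * (D * K%:R) * ell (@dev R Q gam n) a.
  by rewrite /ell mulr_sumr; apply: eq_bigr => s _; rewrite /kap -!mulrA.
rewrite ek.
have ed0 : 0 <= ell (@dev R Q gam n) a by apply: sumr_ge0 => s _; rewrite mulr_ge0.
clear ek; set ed := ell (@dev R Q gam n) a in ed0 *.
have dA : 0 <= dl * mass a by case/andP: dl01 => h _; rewrite mulr_ge0 ?ltW.
have E00 := ltW E0.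
apply: le_trans (_ : 3 * DL D L * expR (L * DL D L ^+ 2) * (1 + L * expR (L * D) * (D * K%:R)) * (ed + dl * mass a) <= _).
  rewrite -[leRHS]mulrA; apply: ler_pM.
  - by rewrite !mulr_ge0// expR_ge0.
  - by apply: addr_ge0 => //; rewrite !mulr_ge0// expR_ge0.
  - apply: ler_wpM2l; first by rewrite mulr_ge0.
    rewrite ler_expR; apply: le_trans (_ : L * (DL D L ^+ 2 - 1) <= _).
      by apply: ler_wpM2r => //; move: D1' => ?; nra.
    by rewrite ler_wpM2l// lerBlDr lerDl.
  set c := L * _ * _; have c0 : 0 <= c by rewrite /c !mulr_ge0// expR_ge0.
  by have := mulr_ge0 c0 dA; have := mulr_ge0 c0 ed0; lra.
apply: ler_wpM2r; first exact: addr_ge0.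
rewrite /cU lerDl !mulr_ge0// ?expR_ge0// addr_ge0// sqr_ge0.
by [].
Qed.

End once.

Section averaging.
Context {R : realType} {Q : finType} (gam : Q -> R) (n K : nat).
Hypotheses (gam0 : forall z, 0 <= gam z) (gam1 : \sum_z gam z = 1).
Variables (D L : R).
Hypothesis D1 : 1 <= D.
Local Notation S := (n.+1.-tuple Q).
Local Notation sp := (@spin Q n).
Local Notation lnq := (ln (#|Q|%:R : R)).
Local Notation P := (P0 gam (n := n)).

Let V0 : (0 < #|'I_n.+1|)%N. Proof. by rewrite card_ord. Qed.

(** The linear part of the bound is evaluated at the prior, as M and the pins preserve linear
    functionals. The total correlations are summed over t < T and do not grow with T, so they are
    divided by T in the average. *)
Lemma avg_bound M BM (G : (S -> R) -> R) (B c1 c2 dl l1 l2 : R) K1 K2 T : isop M BM -> mp M -> good G ->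
  0 <= l1 <= L -> 0 <= l2 <= L -> 0 <= c2 ->
  (forall a, nn a -> G a <= B * mass a + c1 * (ell (@dev R Q gam n) a + dl * mass a) +
     c2 * (TCP sp D l1 K1 a + TCP sp D l2 K2 a)) ->
  \sum_(t < T) M (iter t (pin sp) G) P <=
    T%:R * (B + c1 * (ell (@dev R Q gam n) P + dl)) + c2 * ((cT D L K1 + cT D L K2) * lnq).
Proof.
move=> hM mM gG l1L l2L c20 hG.
have P00 : nn P by exact: P0_ge0.
have l10 : 0 <= l1 by case/andP: l1L.
have l20 : 0 <= l2 by case/andP: l2L.
have ip := isop_pin (R := R) sp V0.
have mpn : mp (R := R) (pin sp) by exact: mp_pin.
have g1 := good_TCP sp D1 K1 l10; have g2 := good_TCP sp D1 K2 l20.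
pose W (a : S -> R) := ell (fun s : S => B + c1 * (dev gam s + dl)) a.
have WE a : W a = B * mass a + c1 * (ell (@dev R Q gam n) a + dl * mass a).
  rewrite /W /ell /mass mulrDr !mulr_sumr -!big_split /=; apply: eq_bigr => s _; ring.
have gW : good W by exact: good_ell.
have gR := goodD gW (goodZ c2 (goodD g1 g2)).
apply: le_trans (_ : \sum_(t < T) (W P + c2 * (M (iter t (pin sp) (TCP sp D l1 K1)) P +
    M (iter t (pin sp) (TCP sp D l2 K2)) P)) <= _).
  apply: ler_sum => t _.
  have it := isop_comp hM (isop_iter t ip); have mt := mp_comp hM (isop_iter t ip) mM (mp_iter t ip mpn).
  have h := op_le it gG gR _ P00.
  apply: le_trans (h _) _; first by move=> a a0; rewrite WE; exact: hG.
  rewrite (op_D it gW (goodZ c2 (goodD g1 g2)) P00) (op_Z c2 it (goodD g1 g2) P00).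
  by rewrite (op_D it g1 g2 P00) /W (mt _ _ P00).
rewrite big_split /= sumr_const card_ord -[W P *+ T]mulr_natl -mulr_sumr big_split /=.
apply: lerD; first by rewrite WE mass_P0// !mulr1.
apply: ler_wpM2l => //.
have h1 := TCP_sum sp D1 K1 T l1L hM mM P00; have h2 := TCP_sum sp D1 K2 T l2L hM mM P00.
have m1 : mass P = 1 := mass_P0 gam1 n.
rewrite m1 mulr1 in h1 h2; rewrite mulrDl; exact: lerD.
Qed.

End averaging.

Lemma ln_nat_ge0 {R : realType} (m : nat) : 0 <= ln (m%:R : R).
Proof.
case: m => [|m]; first by rewrite ln0.
by rewrite ln_ge0// ler1n.
Qed.

Lemma signed_norm {R : realType} (sg x c : R) : `|sg| = 1 -> `|x| <= c -> `|sg * x| <= c.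
Proof. by move=> h1 h2; rewrite normrM h1 mul1r. Qed.

Lemma signed_close {R : realType} (sg u v c : R) : `|sg| = 1 -> 0 <= u - v <= c ->
  sg * u <= sg * v + c /\ sg * v <= sg * u + c.
Proof.
move=> sg1 /andP[h2 h3]; have h4 : `|sg * (u - v)| <= c by apply: signed_norm => //; rewrite ger0_norm.
by move: h4; rewrite ler_norml mulrBr => /andP[]; lra.
Qed.

Lemma signed_gap {R : realType} (sg u v w x la c e dA P1 P2 B cM : R) :
  `|sg * (u - (w + la))| <= c * (e + dA) + P1 -> `|sg * (v - (x + la))| <= c * (e + dA) + P2 ->
  sg * (w - x) <= B + cM * e -> 0 <= cM * dA ->
  sg * (u - v) <= B + (2 * c + cM) * (e + dA) + (P1 + P2).
Proof.
rewrite !ler_norml => /andP[_ h1] /andP[h2 _] h3 h4.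
have -> : sg * (u - v) = sg * (u - (w + la)) - sg * (v - (x + la)) + sg * (w - x) by ring.
have -> : (2 * c + cM) * (e + dA) = 2 * (c * (e + dA)) + cM * e + cM * dA by ring.
move: h1 h2 h3 h4; move: (sg * _) (sg * _) (sg * _) (c * _) (cM * e) (cM * dA) => a1 a2 a3 a4 a5 a6.
lra.
Qed.

(** * Accumulated growth over all sizes *)

Section growth_rate.
Context {R : realType} {k : nat} {Q : finType} {d : measure_display} {Y : measurableType d}.
Local Notation K := k.+1.
Variables (p : probability Y R) (phi : Y -> K.-tuple Q -> R) (D : R) (gam : Q -> R).
Hypotheses (mphi : forall t, measurable_fun setT (fun y => phi y t))
  (phiD : forall y t, D^-1 <= phi y t <= D) (D1 : 1 <= D)
  (gam0 : forall z, 0 <= gam z) (gam1 : \sum_z gam z = 1)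
  (Zgam : Zb p phi gam = 1) (stat : stationary p phi gam).
Variables (dd L dl : R) (T : nat).
Hypotheses (d0 : 0 <= dd) (dL : dd * K%:R <= L) (dl01 : 0 < dl <= 1) (T0 : (0 < T)%N).
Local Notation lnq := (ln (#|Q|%:R : R)).
Local Notation Ph n t := (@Phi R k Q d Y p phi gam n dd t).

Let q0 : 0 <= lnq := ln_nat_ge0 #|Q|.
Let k0 : 0 <= k%:R :> R. Proof. by []. Qed.
Let ddL : 0 <= dd <= L.
Proof. by rewrite d0 (le_trans _ dL)// ler_peMr// ler1n. Qed.
Let dkL : dd * k%:R <= L.
Proof. by apply: le_trans dL; apply: ler_wpM2l => //; rewrite ler_nat. Qed.
Let l4L : 0 <= dd * k%:R / K%:R <= L.
Proof.
rewrite divr_ge0 ?mulr_ge0//= ler_pdivrMr ?ltr0n//; apply: le_trans dkL _.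
by have /andP[h1 h2] := ddL; rewrite ler_peMr ?(le_trans h1 h2)// ler1n.
Qed.
Let L0 : 0 <= L. Proof. by have /andP[] := ddL; exact: le_trans. Qed.
Let cP0 : 0 <= cP D L.
Proof. by rewrite addr_ge0 ?mulr_ge0 ?sqr_ge0// (le_trans ler01). Qed.
Let mwf n s : measurable_fun setT (fun y => @wF R k Q d Y phi n y s).
Proof. exact: (bm_wF mphi phiD D1 s).1. Qed.
Let wfD n y s : D^-1 <= @wF R k Q d Y phi n y s <= D.
Proof. exact: phiD. Qed.
Let rate0 n : 0 <= dd * n.+1%:R / K%:R. Proof. by rewrite divr_ge0// mulr_ge0. Qed.

Lemma Phi_pins n t : 0 <= Ph n 0 - Ph n t <= t%:R * lnq.
Proof.
have V0 : (0 < #|'I_n.+1|)%N by rewrite card_ord.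
have ip := isop_pin (R := R) (@spin Q n) V0.
have mpn : mp (R := R) (pin (@spin Q n)) by exact: mp_pin.
have gF := good_F0 (R := R) (S := n.+1.-tuple Q).
have [B hU] := isop_UP (site n K p) (@mwf n) (@wfD n) D1 (rate0 n).
have mU := mp_UP (site n K p) (@mwf n) (@wfD n) D1 (rate0 n).
have P00 : nn (P0 gam (n := n)) by exact: P0_ge0.
have m1 : mass (P0 gam (n := n)) = 1 := mass_P0 gam1 n.
elim: t => [|t IH]; first by rewrite subrr mul0r lexx.
have it := isop_comp hU (isop_iter t ip); have mt := mp_comp hU (isop_iter t ip) mU (mp_iter t ip mpn).
have gp := op_good ip gF.
have E : Ph n t.+1 = UP (site n K p) (@wF R k Q d Y phi n) (dd * n.+1%:R / K%:R)
    (iter t (pin (@spin Q n)) (pin (@spin Q n) F0)) (P0 gam (n := n)) by rewrite /Phi iterSr.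
have h1 := op_le it gp gF _ P00; have h2 := op_le it gF (goodD gp (goodZ lnq (good_mass (R := R) (S := _)))) _ P00.
rewrite (op_D it gp (goodZ lnq (good_mass (R := R) (S := _))) P00) (op_Z lnq it (good_mass (R := R) (S := _)) P00) in h2.
rewrite (mp_mass mt P00) m1 mulr1 -E in h2; rewrite -E in h1.
have {}h1 : Ph n t.+1 <= Ph n t.
  by apply: h1 => b b0; have /andP[h _] := F0_pin (@spin Q n) V0 b0; rewrite -subr_ge0.
have {}h2 : Ph n t <= Ph n t.+1 + lnq.
  by apply: h2 => b b0; have /andP[_ h] := F0_pin (@spin Q n) V0 b0; rewrite -lerBlDl.
rewrite -natr1 mulrDl mul1r; case/andP: IH => h3 h4; apply/andP; split; first by rewrite subr_ge0 (le_trans h1)// -subr_ge0.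
by move: h2 h4; move: (Ph n 0) (Ph n t) (Ph n t.+1) => a b c; lra.
Qed.

Lemma Phi_0 : 0 <= Ph 0 0 <= L * cP D L.
Proof.
have P00 : nn (P0 gam (n := 0)) by exact: P0_ge0.
have m1 : mass (P0 gam (n := 0)) = 1 := mass_P0 gam1 0.
have r0 := rate0 0.
have rL : 0 <= dd * 1%:R / K%:R <= L.
  rewrite r0 /= ler_pdivrMr ?ltr0n// mulr1.
  by have /andP[h1 h2] := ddL; rewrite (le_trans h2)// ler_peMr// ler1n.
have h := UP_F0 (site 0 K p) (@mwf 0) (@wfD 0) D1 rL P00.
have e : F0 (P0 gam (n := 0)) = 0 by rewrite /F0 m1 Lambda1.
rewrite e m1 add0r [_ * cP D L * 1]mulr1 in h; case/andP: h => h1 h2.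
apply/andP; split; first exact: h1.
by apply: le_trans h2 _; apply: ler_wpM2r => //; case/andP: rL.
Qed.

Variables (sg B cM : R).
Hypotheses (sg1 : `|sg| = 1) (cM0 : 0 <= cM)
  (hB : forall n (a : n.+1.-tuple Q -> R), nn a -> 0 < mass a ->
    sg * (mass a * (uF p phi gam dd a - dd * k%:R / K%:R * xF p phi a)) <=
    B * mass a + cM * ell (@dev R Q gam n) a).

Definition cG : R := 2 * cU (k := k) D L + cM.
Lemma cG_ge0 : 0 <= cG.
Proof. by rewrite addr_ge0// mulr_ge0//; exact: (cU_ge0 D1 ddL). Qed.

(** The terms [Lambda (mass a)] of [eval_once] and [eval_UF] cancel, and what remains is the
    Bethe-type expression bounded in [hB]. Mass 0 is treated apart: both stages vanish there. *)
Lemma Gstep_le n a : nn a ->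
  sg * Gstep p phi gam (n := n) dd a <= B * mass a + cG * (ell (@dev R Q gam n) a + dl * mass a) +
    2 / dl * (TCP (@spin Q n) (DL D L) dd K a + TCP (@spin Q n) (DL D L) (dd * k%:R / K%:R) K a).
Proof.
move=> a0.
have [A0|A0] := eqVneq (mass a) 0.
  have az := mass0_eq a0 A0; rewrite A0 az !mulr0 addr0 /ell big1; last by move=> s _; rewrite mulr0.
  have l40 : 0 <= dd * k%:R / K%:R by case/andP: l4L.
  rewrite (TCP_ge0_0 _ _ _ d0) (TCP_ge0_0 _ _ _ l40) addr0 !mulr0 !addr0 /Gstep.
  have -> : ext gam (fun=> 0) = (fun=> 0) :> (n.+2.-tuple Q -> R) by apply/funext => s; rewrite /ext mulr0.
  have [B1 h1] := isop_UP (Ponce p n) (mwonce mphi phiD D1 (n := n)) (wonceD phiD (n := n)) D1 d0.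
  have [B2 h2] := isop_UP (site n K p) (@mwf n) (@wfD n) D1 l40.
  by rewrite /Uonce /UF (isop_zero h1) (isop_zero h2) subrr mulr0.
have Ap : 0 < mass a by rewrite lt_neqAle eq_sym A0 mass_ge0.
have h1 := eval_once mphi phiD D1 gam0 gam1 stat ddL a0 Ap dl01.
have h2 := eval_UF mphi phiD D1 gam0 gam1 Zgam l4L a0 Ap dl01.
have h3 := hB a0 Ap.
rewrite /Gstep; move: h1 h2 h3.
set u := Uonce _ _ _ _ _; set v := UF _ _ _ _ _; set w := uF _ _ _ _ _; set x := xF _ _ _.
set c := cU _ _; set t1 := TCP _ _ _ _ _; set t2 := TCP _ _ _ _ _; set e := ell _ _.
have [e0 dA] : 0 <= e /\ 0 <= dl * mass a.
  split; first by apply: sumr_ge0 => s _; rewrite mulr_ge0//; exact: dist1_ge0.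
  by apply: mulr_ge0; [case/andP: dl01 => /ltW|exact: ltW].
have cMd := mulr_ge0 cM0 dA.
move=> h1 h2 h3.
have h4 := signed_norm sg1 h1; have h5 := signed_norm sg1 h2.
rewrite mulrBr in h3; rewrite [2 / dl * _]mulrDr; exact: signed_gap h4 h5 h3 cMd.
Qed.

Definition rr (n : nat) : R := n.+1%:R `^ (- 2^-1).

Lemma xn_rr n : @xn R n <= rr n.
Proof.
have n1 : 1 <= n.+1%:R :> R by rewrite ler1n.
apply: le_trans (_ : n.+1%:R `^ (-1) <= _); last by apply: ler_powR => //; lra.
by rewrite powR_inv1// /xn lef_pV2 ?posrE ?ltr0n// ler_nat.
Qed.

Let cc : R := 2 / dl * ((cT (DL D L) L K + cT (DL D L) L K) * lnq).

Lemma step_sum n :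
  \sum_(t < T) sg * (Ph n.+1 t - Ph n t) <=
  T%:R * (B + cG * (#|Q|%:R * rr n + dl)) + cc + T%:R * ((T%:R * lnq + 3 * L * cP D L) * rr n).
Proof.
have [l00 l0L] : 0 <= @al R k n * (dd * n.+2%:R / K%:R) /\ True.
  split=> //; apply: mulr_ge0; first by have /andP[] := @al_lt1 R k n.
  by rewrite divr_ge0// mulr_ge0.
set l0 := al _ * _ in l00.
have [BM hM] := isop_UP (site n K p) (@mwf n) (@wfD n) D1 l00.
have mM := mp_UP (site n K p) (@mwf n) (@wfD n) D1 l00.
have V0 : (0 < #|'I_n.+1|)%N by rewrite card_ord.
have ip := isop_pin (R := R) (@spin Q n) V0.
have P00 : nn (P0 gam (n := n)) by exact: P0_ge0.
have gG : good (fun a => sg * Gstep p phi gam (n := n) dd a).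
  apply: goodZ; apply: goodB.
    apply: (good_ext gam0 gam1).
    exact: (good_UP (Ponce p n) (mwonce mphi phiD D1 (n := n)) (wonceD phiD (n := n)) D1 d0 (good_F0 (R := R) (S := _))).
  have l40 : 0 <= dd * k%:R / K%:R by case/andP: l4L.
  exact: (good_UP (site n K p) (@mwf n) (@wfD n) D1 l40 (good_F0 (R := R) (S := _))).
have c20 : 0 <= 2 / dl by rewrite divr_ge0//; case/andP: dl01 => /ltW.
have h1 := avg_bound gam0 gam1 (DL_ge1 D1 ddL) T hM mM gG ddL l4L c20 (@Gstep_le n).
have dP := ell_dev_P0 gam0 gam1 n.
have T0' : 0 <= T%:R :> R by [].
apply: le_trans (_ : \sum_(t < T) (UP (site n K p) (@wF R k Q d Y phi n) l0
    (iter t (pin (@spin Q n)) (fun a => sg * Gstep p phi gam (n := n) dd a)) (P0 gam (n := n)) +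
    (T%:R * lnq + 3 * L * cP D L) * rr n) <= _).
  apply: ler_sum => t _.
  have it := isop_comp hM (isop_iter t ip).
  have gG' : good (Gstep p phi gam (n := n) dd).
    have := goodZ sg gG; rewrite (_ : (fun a => _) = Gstep p phi gam dd (n := n))//.
    apply/funext => a; rewrite mulrA; have -> : sg * sg = 1; last by rewrite mul1r.
    by have := congr1 (fun z => z ^+ 2) sg1; rewrite real_normK ?num_real// expr2 expr1n.
  have E := op_Z sg it gG' P00; rewrite E.
  have := step_decomp p mphi phiD D1 gam0 gam1 n t d0 dL.
  set U := UF _ _ _ _ _; set a := Phi' _ _ _ _ _ _; set b := Phi _ _ _ _ _ _.
  have -> : Ph n.+1 t = a by [].
  have -> : UP (site n K p) (@wF R k Q d Y phi n) l0 (iter t (pin (@spin Q n)) (Gstep p phi gam dd (n := n)))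
     (P0 gam (n := n)) = U by [].
  move=> h; have h' : `|sg * (a - b - U)| <= (t%:R * lnq + 3 * (dd * k%:R) * cP D L) * @xn R n.
    by rewrite normrM sg1 mul1r.
  have {}h' : sg * (a - b - U) <= (T%:R * lnq + 3 * L * cP D L) * rr n.
    apply: le_trans (ler_norm _) _; apply: le_trans h' _.
    have tT : t%:R <= T%:R :> R by rewrite ler_nat ltnW.
    apply: ler_pM.
    - by rewrite addr_ge0 ?mulr_ge0.
    - by have /andP[/ltW] := @xn01 R n.
    - by apply: lerD; [exact: ler_wpM2r|apply: ler_wpM2r => //; exact: ler_wpM2l].
    - exact: xn_rr.
  by rewrite -lerBlDl -mulrBr; exact: h'.
rewrite big_split /= sumr_const card_ord -[X in _ + X <= _]mulr_natl lerD2r.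
apply: le_trans h1 _; rewrite lerD2r; apply: ler_wpM2l => //; rewrite lerD2l; apply: ler_wpM2l; first exact: cG_ge0.
by rewrite lerD2r.
Qed.

(** In this order: the value at one vertex; pins inserted at the start and removed at the end; the
    decoupling error per vertex, with parameter dl and T pins; and the errors of order n^(-1/2)
    summed over the sizes. *)
Definition Err (N : nat) : R :=
  L * cP D L + 2 * (T%:R * lnq) + N%:R * (cG * dl + cc / T%:R) +
  (cG * #|Q|%:R + (T%:R * lnq + 3 * L * cP D L)) * \sum_(n < N) rr n.

(** The increments are averaged over the number of pins t < T, since total correlations are small
    only on average over t. The sign sg lets one proof give upper bounds on [Phi] (sg = 1) and lower
    bounds (sg = -1). *)
Lemma growth N : sg * Ph N 0 <= N%:R * B + Err N.
Proof.
have Tp : 0 < T%:R :> R by rewrite ltr0n.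
have h1 : \sum_(t < T) sg * Ph N t <= \sum_(t < T) sg * Ph 0 t + N%:R * (T%:R * (B + cG * dl) + cc) +
    T%:R * ((cG * #|Q|%:R + (T%:R * lnq + 3 * L * cP D L)) * \sum_(n < N) rr n).
  elim: N => [|N IH]; first by rewrite big_ord0 !mulr0 mul0r !addr0.
  have := step_sum N; under eq_bigr do rewrite mulrBr; rewrite sumrB lerBlDl.
  move=> h; apply: le_trans h _; rewrite [in leRHS]big_ord_recr /= -[N.+1%:R]natr1.
  apply: le_trans (lerD IH (lexx _)) _; rewrite le_eqVlt; apply/orP; left; apply/eqP.
  by move: cG cc (cP D L) (T%:R * lnq) => c1 c2 c3 c4; ring.
have sgn (u v c : R) := @signed_close R sg u v c sg1.
have h2 : T%:R * (sg * Ph N 0) <= \sum_(t < T) sg * Ph N t + T%:R * (T%:R * lnq).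
  have <- : \sum_(t < T) (sg * Ph N 0) = T%:R * (sg * Ph N 0) by rewrite sumr_const card_ord -[LHS]mulr_natl.
  have <- : \sum_(t < T) (T%:R * lnq) = T%:R * (T%:R * lnq) :> R by rewrite sumr_const card_ord -[LHS]mulr_natl.
  rewrite -big_split /=; apply: ler_sum => t _; have [h _] := sgn _ _ _ (Phi_pins N t).
  by apply: le_trans h _; rewrite lerD2l; apply: ler_wpM2r => //; rewrite ler_nat ltnW.
have h3 : \sum_(t < T) sg * Ph 0 t <= T%:R * (L * cP D L + T%:R * lnq).
  have <- : \sum_(t < T) (L * cP D L + T%:R * lnq) = T%:R * (L * cP D L + T%:R * lnq) by rewrite sumr_const card_ord -[LHS]mulr_natl.
  apply: ler_sum => t _; have [_ h] := sgn _ _ _ (Phi_pins 0 t); apply: le_trans h _.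
  have hL : 0 <= Ph 0 0 - 0 <= L * cP D L by rewrite subr0; exact: Phi_0.
  have [h4 _] := sgn _ _ _ hL; rewrite mulr0 add0r in h4.
  by apply: lerD => //; apply: ler_wpM2r => //; rewrite ler_nat ltnW.
rewrite -(ler_pM2l Tp); apply: le_trans h2 _; apply: le_trans (lerD (le_trans h1 (lerD (lerD h3 (lexx _)) (lexx _))) (lexx _)) _.
have Tn : T%:R != 0 :> R by rewrite gt_eqF.
rewrite /Err; move: (cP D L) (cG) (lnq) (cc) (\sum_(n < N) _) => c1 c2 c3 c4 c5; move: Tn.
move: (T%:R : R) (N%:R : R) (#|Q|%:R : R) => t m q t0.
by rewrite le_eqVlt; apply/orP; left; apply/eqP; field.
Qed.

End growth_rate.

(** * Interpolation *)

Section interpolation.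
Context {R : realType} {k : nat} {Q : finType} {d1 d2 : measure_display}
  {Y : measurableType d1} {Z : measurableType d2}.
Local Notation K := k.+1.
Variables (p : probability Y R) (phi : Y -> K.-tuple Q -> R)
  (r : probability Z R) (psi : Z -> 1.-tuple Q -> R) (D : R) (gam : Q -> R).
Hypotheses (mphi : forall t, measurable_fun setT (fun y => phi y t))
  (phiD : forall y t, D^-1 <= phi y t <= D)
  (mpsi : forall t, measurable_fun setT (fun y => psi y t))
  (psiD : forall y t, D^-1 <= psi y t <= D) (D1 : 1 <= D)
  (gam0 : forall z, 0 <= gam z) (gam1 : \sum_z gam z = 1)
  (Zphi : Zb p phi gam = 1) (Zpsi : Zb r psi gam = 1).
Variables (dd L dl : R) (T : nat) (n : nat).
Hypotheses (d0 : 0 <= dd) (dL : dd * K%:R <= L) (dl01 : 0 < dl <= 1) (T0 : (0 < T)%N).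
Local Notation lnq := (ln (#|Q|%:R : R)).
Local Notation S := (n.+1.-tuple Q).
Local Notation P := (P0 gam (n := n)).

Let q0 : 0 <= lnq := ln_nat_ge0 #|Q|.
Let V0 : (0 < #|'I_n.+1|)%N. Proof. by rewrite card_ord. Qed.
Let ddL : 0 <= dd <= L.
Proof. by rewrite d0 (le_trans _ dL)// ler_peMr// ler1n. Qed.
Let L0 : 0 <= L. Proof. by have /andP[] := ddL; exact: le_trans. Qed.
Let lA : 0 <= dd / K%:R <= L.
Proof.
have [h1 h2] := andP ddL; rewrite divr_ge0//= ler_pdivrMr ?ltr0n//.
by apply: le_trans h2 _; rewrite ler_peMr// ler1n.
Qed.
Let lA0 : 0 <= dd / K%:R. Proof. by case/andP: lA. Qed.
Let mwf s : measurable_fun setT (fun y => @wF R k Q d1 Y phi n y s).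
Proof. exact: (bm_wF mphi phiD D1 s).1. Qed.
Let wfD y s : D^-1 <= @wF R k Q d1 Y phi n y s <= D. Proof. exact: phiD. Qed.
Let mwg s : measurable_fun setT (fun y => @wF R 0 Q d2 Z psi n y s).
Proof. exact: (bm_wF mpsi psiD D1 s).1. Qed.
Let wgD y s : D^-1 <= @wF R 0 Q d2 Z psi n y s <= D. Proof. exact: psiD. Qed.

Lemma iter_UP {d : measure_display} {X : measurableType d} (P' : probability X R) (w : X -> S -> R) l m F a :
  (forall s, measurable_fun setT (fun x => w x s)) -> (forall x s, D^-1 <= w x s <= D) ->
  0 <= l -> good F -> nn a -> iter m.+1 (UP P' w l) F a = UP P' w (m.+1%:R * l) F a.
Proof.
move=> mw wD l0 gF; have [B hB] := isop_UP P' mw wD D1 l0.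
elim: m a => [|m IH] a a0; first by rewrite mul1r.
have l1 : 0 <= m.+1%:R * l by rewrite mulr_ge0.
have E : m.+2%:R * l = l + m.+1%:R * l by rewrite -[m.+2%:R]natr1; ring.
rewrite E (UP_semigroup P' mw wD D1 l0 l1 gF a0) [LHS]/=.
exact: (op_ext hB (op_good (isop_iter m.+1 hB) gF) (good_UP P' mw wD D1 l1 gF) IH a0).
Qed.

Variables (z cM : R).
Hypotheses (cM0 : 0 <= cM)
  (hz : forall a : S -> R, nn a -> 0 < mass a ->
    - (mass a * (xF p phi a - K%:R * xF r psi a)) <= k%:R * z * mass a + cM * ell (@dev R Q gam n) a).

Let A := UF p phi (n := n) (dd / K%:R).
Let C := UF r psi (n := n) dd.
Let c1 := cU (k := k) D L + cU (k := 0) D L + dd / K%:R * cM.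
Let Bz := dd / K%:R * (k%:R * z).

Let hA := isop_UP (site n K p) mwf wfD D1 lA0.
Let hC := isop_UP (site n 1 r) mwg wgD D1 d0.
Let mA := mp_UP (site n K p) mwf wfD D1 lA0.
Let mC := mp_UP (site n 1 r) mwg wgD D1 d0.

Definition Gint (a : S -> R) : R := C F0 a - A F0 a.

Let c10 : 0 <= c1.
Proof.
apply: addr_ge0; last by rewrite mulr_ge0.
by apply: addr_ge0; exact: (cU_ge0 D1 ddL).
Qed.

(** A slice of one-vertex factors at rate dd is compared with a slice of K-vertex factors at rate dd
    / K. The main term is dd / K times the left-hand side of [hz], that is, the part of nabla that
    involves the marginals. *)
Lemma Gint_le a : nn a -> Gint a <= Bz * mass a + c1 * (ell (@dev R Q gam n) a + dl * mass a) +
  2 / dl * (TCP (@spin Q n) (DL D L) (dd / K%:R) K a + TCP (@spin Q n) (DL D L) dd 1 a).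
Proof.
move=> a0; have [BA iA] := hA; have [BC iC] := hC.
have [z0|z0] := eqVneq (mass a) 0.
  have az := mass0_eq a0 z0; rewrite z0 az !mulr0 addr0 /ell big1; last by move=> s _; rewrite mulr0.
  rewrite (TCP_ge0_0 _ _ _ d0) (TCP_ge0_0 _ _ _ lA0) addr0 !mulr0 !addr0 /Gint.
  by rewrite /A /C /UF (isop_zero iA) (isop_zero iC) subrr.
have Ap : 0 < mass a by rewrite lt_neqAle eq_sym z0 mass_ge0.
have h1 := eval_UF mphi phiD D1 gam0 gam1 Zphi lA a0 Ap dl01.
have h2 := eval_UF mpsi psiD D1 gam0 gam1 Zpsi ddL a0 Ap dl01.
have h3 := ler_wpM2l lA0 (hz a0 Ap).
have K0 : K%:R != 0 :> R by rewrite pnatr_eq0.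
have e0 : 0 <= ell (@dev R Q gam n) a.
  by apply: sumr_ge0 => s _; rewrite mulr_ge0//; exact: dist1_ge0.
have dA : 0 <= dl * mass a by apply: mulr_ge0; [case/andP: dl01 => /ltW|exact: ltW].
have h4 : 0 <= dd / K%:R * cM * (dl * mass a) by rewrite mulr_ge0// mulr_ge0.
rewrite /Gint -/A -/C in h1 h2 *.
rewrite [X in _ <= X]mulrDr in h3; rewrite !ler_norml in h1 h2; case/andP: h1 => h1 _; case/andP: h2 => _ h2.
have E : dd / K%:R * - (mass a * (xF p phi a - K%:R * xF r psi a)) =
   mass a * (dd * xF r psi a) - mass a * (dd / K%:R * xF p phi a).
  by move: K0; move: (K%:R : R) => kk K0; field.
rewrite E in h3; rewrite /c1 /Bz; move: h1 h2 h3 h4.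
move: (A F0 a) (C F0 a) (mass a * (dd * _)) (mass a * (dd / K%:R * _)) (Lambda _) => x1 x2 x3 x4 x5.
move: (cU _ _) (cU _ _) (TCP _ _ _ _ _) (TCP _ _ _ _ _) => u1 u2 t1 t2.
move: (ell _ a) (dl * mass a) => e f h1 h2 h3 h4.
move: h1 h2 h3 h4; move: (2 / dl) (dd / K%:R) (mass a) => i1 i2 ma h1 h2 h3 h4.
by lra.
Qed.

Lemma good_Gint : good Gint.
Proof.
apply: goodB.
  exact: (good_UP (site n 1 r) mwg wgD D1 d0 (good_F0 (R := R) (S := S))).
exact: (good_UP (site n K p) mwf wfD D1 lA0 (good_F0 (R := R) (S := S))).
Qed.

(** A discrete interpolation path: the Poisson stages are cut into n + 1 slices, j of the original
    factors and m of the one-vertex factors. *)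
Let psi_j (j m t : nat) := iter j A (iter m C (iter t (pin (@spin Q n)) F0)) P.

(** Commutation brings the exchanged slice next to [F0], so that its effect is evaluated on pinned
    weights. *)
Lemma interpolation_step j m t :
  psi_j j m.+1 t - psi_j j.+1 m t = iter j A (iter m C (iter t (pin (@spin Q n)) Gint)) P.
Proof.
have P00 : nn P by exact: P0_ge0.
have gF := good_F0 (R := R) (S := S).
have [BA iA] := hA; have [BC iC] := hC.
have ip := isop_pin (R := R) (@spin Q n) V0.
have iCm := isop_iter m iC; have iAj := isop_iter j iA; have it := isop_iter t ip.
have cC := central_iter m iC (central_UP (site n 1 r) mwg wgD D1 d0).
have ct := central_iter t ip (central_pin (@spin Q n)).
have iM := isop_comp iAj (isop_comp iCm it).
have gA := op_good iA gF; have gC := op_good iC gF; have gt := op_good it gF.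
have E1 b : nn b -> iter m.+1 C (iter t (pin (@spin Q n)) F0) b = iter m C (iter t (pin (@spin Q n)) (C F0)) b.
  move=> b0; rewrite iterSr.
  exact: (op_ext iCm (op_good iC gt) (op_good it gC) (ct _ _ iC _ gF) b0).
have E2 b : nn b -> A (iter m C (iter t (pin (@spin Q n)) F0)) b = iter m C (iter t (pin (@spin Q n)) (A F0)) b.
  move=> b0; apply: etrans (cC _ _ iA _ gt _ b0) _.
  exact: (op_ext iCm (op_good iA gt) (op_good it gA) (ct _ _ iA _ gF) b0).
have X1 : psi_j j m.+1 t = iter j A (iter m C (iter t (pin (@spin Q n)) (C F0))) P.
  exact: (op_ext iAj (op_good (isop_iter m.+1 iC) gt) (op_good iCm (op_good it gC)) E1 P00).
have X2 : psi_j j.+1 m t = iter j A (iter m C (iter t (pin (@spin Q n)) (A F0))) P.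
  rewrite /psi_j iterSr.
  exact: (op_ext iAj (op_good iA (op_good iCm gt)) (op_good iCm (op_good it gA)) E2 P00).
rewrite X1 X2; exact: (esym (op_B iM gC gA P00)).
Qed.

Definition errI : R := T%:R * lnq + n.+1%:R * (c1 * (#|Q|%:R * @rr R n + dl) +
  2 / dl * ((cT (DL D L) L K + cT (DL D L) L 1) * lnq) / T%:R).

(** The n + 1 exchanges telescope after averaging over t < T; replacing t pins by none costs at most
    T ln q in all, since pins only decrease [Phi]. *)
Lemma interpolation :
  Phi r psi gam n dd 0 <= Phi p phi gam n dd 0 + n.+1%:R * Bz + errI.
Proof.
have P00 : nn P by exact: P0_ge0.
have [BA iA] := hA; have [BC iC] := hC.
have gF := good_F0 (R := R) (S := S).
have ip := isop_pin (R := R) (@spin Q n) V0.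
have c20 : 0 <= 2 / dl by rewrite divr_ge0//; case/andP: dl01 => /ltW.
have Tp : 0 < T%:R :> R by rewrite ltr0n.
set X := T%:R * (Bz + c1 * (#|Q|%:R * @rr R n + dl)) + 2 / dl * ((cT (DL D L) L K + cT (DL D L) L 1) * lnq).
have step j m : \sum_(t < T) (psi_j j m.+1 t - psi_j j.+1 m t) <= X.
  have iM := isop_comp (isop_iter j iA) (isop_iter m iC).
  have mM := mp_comp (isop_iter j iA) (isop_iter m iC) (mp_iter j iA mA) (mp_iter m iC mC).
  under eq_bigr do rewrite interpolation_step.
  apply: le_trans (avg_bound gam0 gam1 (DL_ge1 D1 ddL) T iM mM good_Gint lA ddL c20 Gint_le) _.
  rewrite lerD2r; apply: ler_wpM2l; first exact: ltW.
  rewrite lerD2l; apply: ler_wpM2l => //; rewrite lerD2r; exact: (ell_dev_P0 gam0 gam1 n).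
have all j : (j <= n.+1)%N -> \sum_(t < T) (psi_j 0 n.+1 t - psi_j j (n.+1 - j) t) <= j%:R * X.
  elim: j => [|j IH] jn; first by rewrite subn0 big1 ?mul0r// => t _; rewrite subrr.
  have := step j (n.+1 - j.+1)%N; rewrite -subSn// subSS => h2; have h1 := IH (ltnW jn).
  rewrite -natr1 mulrDl mul1r; apply: le_trans (lerD h1 h2); rewrite -big_split /=.
  by apply: ler_sum => t _; rewrite addrA subrK.
have {}all := all n.+1 (leqnn _); rewrite subnn in all.
have EF t : psi_j n.+1 0 t = Phi p phi gam n dd t.
  have gt := op_good (isop_iter t ip) gF.
  apply: etrans (iter_UP (site n K p) n mwf wfD lA0 gt P00) _.
  have E : n.+1%:R * (dd / K%:R) = dd * n.+1%:R / K%:R by ring.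
  exact: (f_equal (fun l => UP (site n K p) (@wF R k Q d1 Y phi n) l (iter t (pin (@spin Q n)) F0) P) E).
have EY t : psi_j 0 n.+1 t = Phi r psi gam n dd t.
  have gt := op_good (isop_iter t ip) gF.
  apply: etrans (iter_UP (site n 1 r) n mwg wgD d0 gt P00) _.
  have E : n.+1%:R * dd = dd * n.+1%:R / 1%:R by rewrite divr1 mulrC.
  exact: (f_equal (fun l => UP (site n 1 r) (@wF R 0 Q d2 Z psi n) l (iter t (pin (@spin Q n)) F0) P) E).
rewrite (eq_bigr (fun t : 'I_T => Phi r psi gam n dd t - Phi p phi gam n dd t)) in all; last by move=> t _; rewrite EF EY.
have h t : (t < T)%N -> Phi r psi gam n dd 0 - Phi p phi gam n dd 0 - T%:R * lnq <= Phi r psi gam n dd t - Phi p phi gam n dd t.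
  move=> tT; have /andP[_ h1] := Phi_pins r mpsi psiD D1 gam0 gam1 d0 n t.
  have /andP[h2 _] := Phi_pins p mphi phiD D1 gam0 gam1 d0 n t.
  have h3 : t%:R * lnq <= T%:R * lnq by apply: ler_wpM2r => //; rewrite ler_nat ltnW.
  move: h1 h2 h3; move: (Phi r _ _ _ _ 0) (Phi r _ _ _ _ t) (Phi p _ _ _ _ 0) (Phi p _ _ _ _ t) (t%:R * lnq) (T%:R * lnq).
  by move=> u1 u2 u3 u4 u5 u6; lra.
have : T%:R * (Phi r psi gam n dd 0 - Phi p phi gam n dd 0 - T%:R * lnq) <= n.+1%:R * X.
  apply: le_trans all.
  have <- : \sum_(t < T) (Phi r psi gam n dd 0 - Phi p phi gam n dd 0 - T%:R * lnq) = 
     T%:R * (Phi r psi gam n dd 0 - Phi p phi gam n dd 0 - T%:R * lnq) by rewrite sumr_const card_ord -[LHS]mulr_natl.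
  by apply: ler_sum => t _; exact: h.
rewrite -ler_pdivlMl// => {}h.
have E : T%:R^-1 * (n.+1%:R * X) = n.+1%:R * Bz + (errI - T%:R * lnq).
  have Tn : T%:R != 0 :> R by rewrite gt_eqF.
  have dn : dl != 0 by case/andP: dl01 => h0 _; rewrite gt_eqF.
  rewrite /errI /X; move: Tn; move: (T%:R : R) => t t0; move: (cT _ _ _) (cT _ _ _) => f1 f2.
  by field; rewrite ?t0 ?dn.
rewrite E in h; move: h; move: errI (Phi _ _ _ _ _ _) (Phi _ _ _ _ _ _) (n.+1%:R * Bz) (T%:R * lnq) => *.
lra.
Qed.

End interpolation.

(** * Bethe functionals *)

Section laws.
Context {R : realType}.

(** P' is the image of P under T, tested on bounded measurable functions; this form composes with
    products and independent copies by Fubini alone. *)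
Definition lawmap d d' (X : measurableType d) (X' : measurableType d') (T : X -> X')
    (P : probability X R) (P' : probability X' R) : Prop :=
  measurable_fun setT T /\ forall f, bm f -> Ex P (fun x => f (T x)) = Ex P' f.

Lemma lawmap_comp d1 d2 d3 (X1 : measurableType d1) (X2 : measurableType d2) (X3 : measurableType d3)
    (T : X1 -> X2) (U : X2 -> X3) P1 P2 P3 :
  lawmap T P1 P2 -> lawmap U P2 P3 -> lawmap (U \o T) P1 P3.
Proof.
move=> [mT hT] [mU hU]; split; first exact: measurableT_comp mU mT.
by move=> f hf; rewrite -hU// -(hT (fun x => f (U x)))//; exact: bm_comp hf.
Qed.

Lemma lawmap_id d (X : measurableType d) (P : probability X R) : lawmap id P P.
Proof. by []. Qed.

Lemma lawmap_prod d1 d2 d3 d4 (X1 : measurableType d1) (X2 : measurableType d2)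
    (Y1 : measurableType d3) (Y2 : measurableType d4) (T : X1 -> Y1) (U : X2 -> Y2) P1 P2 Q1 Q2 :
  lawmap T P1 Q1 -> lawmap U P2 Q2 ->
  lawmap (fun x => (T x.1, U x.2)) (P1 \x P2)%E (Q1 \x Q2)%E.
Proof.
move=> [mT hT] [mU hU]; have mTU : measurable_fun setT (fun x : X1 * X2 => (T x.1, U x.2)).
  by apply/measurable_fun_pair; [exact: measurableT_comp mT measurable_fst|exact: measurableT_comp mU measurable_snd].
split=> // f hf.
have b1 : bm (fun z : X1 * X2 => f (T z.1, U z.2)) := bm_comp mTU hf.
have b2 : bm (fun z : Y1 * Y2 => f (z.1, z.2)) by move: hf; congr bm; apply/funext => -[].
rewrite (Ex_prod_bm (f := fun x y => f (T x, U y)) _ _ b1).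
have -> : Ex (Q1 \x Q2)%E f = Ex (Q1 \x Q2)%E (fun z => f (z.1, z.2)) by congr Ex; apply/funext => -[].
rewrite (Ex_prod_bm (f := fun x y => f (x, y)) _ _ b2).
have hy x : bm (fun y => f (x, y)) := bm_sec1 (f := fun x y => f (x, y)) b2 x.
rewrite -(hT _ (bm_Ex _ b2)); congr Ex; apply/funext => x.
exact: (hU _ (hy (T x))).
Qed.

Lemma lawmap_fst d1 d2 (X1 : measurableType d1) (X2 : measurableType d2)
    (P1 : probability X1 R) (P2 : probability X2 R) :
  lawmap (@fst X1 X2) (P1 \x P2)%E P1.
Proof.
split=> // f hf.
rewrite (Ex_prod_bm (f := fun x _ => f x) _ _ (bm_comp measurable_fst hf)).
by congr Ex; apply/funext => x; rewrite Ex_cst.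
Qed.

Lemma lawmap_snd d1 d2 (X1 : measurableType d1) (X2 : measurableType d2)
    (P1 : probability X1 R) (P2 : probability X2 R) :
  lawmap (@snd X1 X2) (P1 \x P2)%E P2.
Proof.
split=> // f hf.
rewrite (Ex_prod_bm (f := fun _ x => f x) _ _ (bm_comp measurable_snd hf)).
by rewrite Ex_cst.
Qed.

Lemma lawmap_swap d1 d2 (X1 : measurableType d1) (X2 : measurableType d2)
    (P1 : probability X1 R) (P2 : probability X2 R) :
  lawmap (fun x : X1 * X2 => (x.2, x.1)) (P1 \x P2)%E (P2 \x P1)%E.
Proof.
have mS : measurable_fun setT (fun x : X1 * X2 => (x.2, x.1)).
  by apply/measurable_fun_pair; [exact: measurable_snd|exact: measurable_fst].
split=> // f hf.
have b1 : bm (fun z : X1 * X2 => f (z.2, z.1)) := bm_comp mS hf.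
have b2 : bm (fun z : X2 * X1 => f (z.1, z.2)) by move: hf; congr bm; apply/funext => -[].
rewrite (Ex_prod_bm (f := fun x y => f (y, x)) _ _ b1) (Ex_swap_bm (f := fun x y => f (y, x)) _ _ b1).
rewrite -(Ex_prod_bm (f := fun x y => f (x, y)) _ _ b2).
by congr Ex; apply/funext => -[].
Qed.

Lemma measurable_map_tuple d1 d2 (X1 : measurableType d1) (X2 : measurableType d2) (T : X1 -> X2) m :
  measurable_fun setT T -> measurable_fun setT (fun t : m.-tuple X1 => map_tuple T t).
Proof.
move=> mT; apply/measurable_fun_tnthP => i.
rewrite (_ : _ \o _ = fun t => T (tnth t i)); last by apply/funext => t /=; rewrite tnth_map.
by apply: (measurableT_comp mT); exact: measurable_tnth.
Qed.

Lemma lawmap_iid d1 d2 (X1 : measurableType d1) (X2 : measurableType d2) (T : X1 -> X2) P1 P2 m :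
  lawmap T P1 P2 -> lawmap (fun t => map_tuple T t) (iid m P1) (iid m P2).
Proof.
move=> [mT hT]; split; first exact: measurable_map_tuple.
elim: m => [|m IH] f hf.
  have bf := bm_comp (measurable_map_tuple (m := 0) mT) hf.
  rewrite (Ex_iid0 P1 bf.1) (Ex_iid0 P2 hf.1); congr f; exact: val_inj.
have bf := bm_comp (measurable_map_tuple (m := m.+1) mT) hf.
rewrite (Ex_iidS P1 bf) (Ex_iidS P2 hf) -(hT _ (bm_iid_Ex P2 hf)); congr Ex; apply/funext => x.
have hfx : bm (fun t => f (cons_tuple (T x) t)) by exact: (bm_sec1 (f := fun x t => f (cons_tuple x t)) (bm_tcons hf) (T x)).
rewrite -(IH _ hfx); congr Ex; apply/funext => t; congr f; exact: val_inj.
Qed.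

Lemma lawmap_tnth d (X : measurableType d) (P : probability X R) m (h : 'I_m) :
  lawmap (fun t => tnth t h) (iid m P) P.
Proof. by split=> [|f hf]; [exact: measurable_tnth|exact: Ex_iid_tnth]. Qed.

Lemma Ex_iid_prods d (X : measurableType d) (P : probability X R) m (f : 'I_m -> X -> R) :
  (forall h, bm (f h)) -> Ex (iid m P) (fun t => \prod_h f h (tnth t h)) = \prod_h Ex P (f h).
Proof.
elim: m f => [|m IH] f hf.
  by rewrite big_ord0; under eq_fun do rewrite big_ord0; rewrite Ex_cst.
have b : bm (fun t : m.+1.-tuple X => \prod_h f h (tnth t h)) by apply: bm_prod => h; exact: bm_tnth.
rewrite (Ex_iidS P b) big_ord_recl -(IH (fun h => f (lift ord0 h)))//.
have b' : bm (fun t : m.-tuple X => \prod_h f (lift ord0 h) (tnth t h)).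
  by apply: bm_prod => h; exact: bm_tnth.
have E x : Ex (iid m P) (fun t => \prod_h f h (tnth (cons_tuple x t) h)) =
   Ex (iid m P) (fun t => \prod_h f (lift ord0 h) (tnth t h)) * f ord0 x.
  rewrite mulrC -(ExZ _ (bm_ig _ b')); congr Ex; apply/funext => t.
  rewrite big_ord_recl tnth_cons0; congr (_ * _); apply: eq_bigr => h _.
  by rewrite tnth_consS.
under eq_fun do rewrite E.
by rewrite (ExZ _ (bm_ig _ (hf ord0))) mulrC.
Qed.

Lemma lawmap_sites n m : lawmap id (unif (enum {: m.-tuple 'I_n.+1})) (iid m (unif (enum 'I_n.+1))).
Proof.
split=> // f _.
have bf m' (g : m'.-tuple 'I_n.+1 -> R) : bm g.
  split; first by move=> _ Z _; exact: measurable_tuple_ord.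
  by exists (\sum_i `|g i|) => x; rewrite (bigD1 x)//= lerDl sumr_ge0.
have -> : Ex (unif (enum {: m.-tuple 'I_n.+1})) f = n.+1%:R ^- m * \sum_i f i.
  rewrite Ex_unif; last exact: (enum_neq0 (nseq_tuple m ord0)).
    by rewrite -cardE big_enum card_tuple card_ord natrX.
  exact: (bf m f).1.
elim: m f => [|m IH] f; first by rewrite (Ex_iid0 _ (bf 0 f).1) sum_tuple0 expr0 invr1 mul1r.
rewrite (Ex_iidS _ (bf m.+1 f)).
under [in RHS]eq_fun do rewrite -IH.
rewrite Ex_unif//; last exact: (enum_neq0 (ord0 : 'I_n.+1)).
rewrite size_enum_ord big_enum /= sum_tupleS exprS invfM -mulr_sumr mulrA.
by [].
Qed.

End laws.

Lemma prod_lip {R : realType} m (a b : 'I_m -> R) (M e : R) : 1 <= M -> 0 <= e ->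
  (forall j, `|a j| <= M) -> (forall j, `|b j| <= M) -> (forall j, `|a j - b j| <= e) ->
  `|\prod_j a j - \prod_j b j| <= m%:R * M ^+ m * e.
Proof.
move=> M1 e0; have M0 : 0 <= M by apply: le_trans M1.
elim: m a b => [|m IH] a b ha hb hab; first by rewrite !big_ord0 subrr normr0 !mul0r.
rewrite !big_ord_recl; set A := \prod_i a _; set B := \prod_i b _.
have hB : `|B| <= M ^+ m.
  rewrite normr_prod; apply: le_trans (_ : \prod_(i < m) M <= _).
    by apply: ler_prod => i _; rewrite normr_ge0 /=.
  by rewrite prodr_const card_ord.
have hA : `|A - B| <= m%:R * M ^+ m * e by exact: IH.
have -> : a ord0 * A - b ord0 * B = a ord0 * (A - B) + (a ord0 - b ord0) * B by ring.
apply: le_trans (ler_normD _ _) _; rewrite !normrM.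
apply: le_trans (lerD (ler_pM _ _ (ha ord0) hA) (ler_pM _ _ (hab ord0) hB)) _ => //.
have Mm : 0 <= M ^+ m by rewrite exprn_ge0.
have : e * M ^+ m <= e * (M * M ^+ m) by apply: ler_wpM2l => //; rewrite ler_peMl.
by rewrite -natr1 exprS; lra.
Qed.

(** * Poisson vertex terms and their continuity *)

Section mixed.
Context {R : realType} {Q : finType} (gam : Q -> R).
Hypotheses (gam0 : forall z, 0 <= gam z) (gam1 : \sum_z gam z = 1).
Variable D : R.
Hypothesis D1 : 1 <= D.

Let D0 : 0 < D. Proof. by apply: lt_le_trans D1. Qed.

Definition Vw d (X : measurableType d) (w : X -> Q -> R) m (x : m.-tuple X) : R :=
  \sum_u gam u * \prod_j w (tnth x j) u.

(** The vertex term of the Bethe functional for messages w with arbitrary parameters; [uF] and [uP]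
    are both instances. *)
Definition uw d (X : measurableType d) (P : probability X R) (w : X -> Q -> R) (l : R) : R :=
  Ex (Po l) (fun m => Ex (iid m P) (fun x => Lambda (Vw w x))).

Section one.
Context d (X : measurableType d) (P : probability X R) (w : X -> Q -> R).
Hypotheses (mw : forall u, measurable_fun setT (fun x => w x u)) (wD : forall x u, D^-1 <= w x u <= D).

Lemma bm_gw u : bm (fun x => w x u).
Proof.
split => //; exists D => x; have /andP[h1 h2] := wD x u; rewrite ger0_norm//.
by apply: le_trans h1; rewrite invr_ge0 ltW.
Qed.

Lemma bm_Vw m : bm (fun x : m.-tuple X => Vw w x).
Proof.
apply: bm_sum => u; apply: bmM; first exact: bm_cst.
by apply: bm_prod => j; apply: (bm_tnth j (f := fun x => w x u)); exact: bm_gw.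
Qed.

Lemma Vw_bounds m (x : m.-tuple X) : D^-1 ^+ m <= Vw w x <= D ^+ m.
Proof. by apply: conv_bounds => // u; apply: prod_bounds => // j; exact: wD. Qed.

Lemma eg_Vw : eg (fun m => Ex (iid m P) (fun x => Lambda (@Vw d X w m x))).
Proof.
apply: (@eg_le _ _ 2 (D ^+ 2)) => m.
apply: le_trans (_ : 1 + (D ^+ m) ^+ 2 <= _); last first.
  rewrite exprAC; have : 1 <= (D ^+ 2) ^+ m by apply: exprn_ege1; apply: exprn_ege1.
  lra.
rewrite -(Ex_cst (iid m P) (1 + (D ^+ m) ^+ 2)); apply: Ex_abs_le.
- by apply: bm_ig; apply: bm_Lambda; exact: bm_Vw.
- exact: ig_cst.
move=> x; apply: le_trans (Lambda_bound _) _; rewrite lerD2l.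
have /andP[h1 h2] := Vw_bounds x.
rewrite ler_sqr ?nnegrE ?exprn_ge0 ?(ltW D0)//.
by apply: le_trans h1; rewrite exprn_ge0// invr_ge0 ltW.
Qed.

End one.

Lemma uw_map d d' (X : measurableType d) (X' : measurableType d') (T : X -> X')
    (P : probability X R) (P' : probability X' R) (w : X -> Q -> R) (w' : X' -> Q -> R) l :
  lawmap T P P' -> (forall u, measurable_fun setT (fun x => w' x u)) ->
  (forall x u, D^-1 <= w' x u <= D) -> (forall x u, w x u = w' (T x) u) -> uw P w l = uw P' w' l.
Proof.
move=> hT mw wD E; congr Ex; apply/funext => m.
have [_ hm] := lawmap_iid m hT; rewrite -(hm _ (bm_Lambda (bm_Vw mw wD m))).
congr Ex; apply/funext => x; congr Lambda; apply: eq_bigr => u _; congr (_ * _).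
by apply: eq_bigr => j _; rewrite tnth_map E.
Qed.

Definition cuw (L : R) : R := 3 * L * D ^+ 2 * expR (L * D ^+ 2).

Lemma uw_dist d (X : measurableType d) (P : probability X R) (w w' : X -> Q -> R) (l L e : R) :
  (forall u, measurable_fun setT (fun x => w x u)) -> (forall x u, D^-1 <= w x u <= D) ->
  (forall u, measurable_fun setT (fun x => w' x u)) -> (forall x u, D^-1 <= w' x u <= D) ->
  0 <= l <= L -> 0 <= e -> (forall x u, `|w x u - w' x u| <= e) ->
  `|uw P w l - uw P w' l| <= cuw L * e.
Proof.
move=> mw wD mw' wD' /andP[l0 lL] e0 hw.
have g1 := eg_Vw P mw wD; have g2 := eg_Vw P mw' wD'.
have D20 : 0 <= D ^+ 2 by rewrite sqr_ge0.
have ge : eg (fun m => m%:R * (D ^+ 2 * (D ^+ 2) ^+ m.-1)).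
  apply: egM; first exact: eg_nat.
  apply: egZ; apply: (@eg_le _ _ 1 (D ^+ 2)) => m; rewrite mul1r ger0_norm; last by rewrite exprn_ge0.
  by apply: ler_weXn2l; [exact: exprn_ege1|exact: leq_pred].
rewrite /uw -(ExB (ig_eg l0 g1) (ig_eg l0 g2)).
apply: le_trans (_ : Ex (Po l) (fun m => 3 * e * (m%:R * (D ^+ 2 * (D ^+ 2) ^+ m.-1))) <= _).
  apply: Ex_abs_le; [exact: igB (ig_eg l0 g1) (ig_eg l0 g2)|exact: igZ (ig_eg l0 ge)|move=> m].
  have b1 := bm_Lambda (bm_Vw mw wD m); have b2 := bm_Lambda (bm_Vw mw' wD' m).
  rewrite -(ExB (bm_ig _ b1) (bm_ig _ b2)).
  rewrite -(Ex_cst (iid m P) (3 * e * _)); apply: Ex_abs_le; [exact: bm_ig (bmB b1 b2)|exact: ig_cst|move=> x].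
  have Dm : 1 <= D ^+ m by exact: exprn_ege1.
  have Di : 0 < D^-1 ^+ m by rewrite exprn_gt0// invr_gt0.
  apply: le_trans (Lambda_lip Di (Vw_bounds wD x) (Vw_bounds wD' x)) _.
  have wN (v : X -> Q -> R) u : (forall x u, D^-1 <= v x u <= D) -> forall j, `|v (tnth x j) u| <= D.
    move=> h j; have /andP[h1 h2] := h (tnth x j) u; rewrite ger0_norm//.
    by apply: le_trans h1; rewrite invr_ge0 ltW.
  have hV : `|Vw w x - Vw w' x| <= m%:R * D ^+ m * e.
    rewrite -sumrB; apply: le_trans (ler_norm_sum _ _ _) _.
    apply: le_trans (_ : \sum_u gam u * (m%:R * D ^+ m * e) <= _).
      apply: ler_sum => u _; rewrite -mulrBr normrM ger0_norm//; apply: ler_wpM2l => //.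
      by apply: (prod_lip D1 e0) => // j; exact: wN.
    by rewrite -mulr_suml gam1 mul1r.
  rewrite exprVn invrK.
  have -> : m%:R * (D ^+ 2 * (D ^+ 2) ^+ m.-1) = m%:R * (D ^+ m * D ^+ m).
    by case: m {b1 b2 Dm Di x wN hV} => [|m]; rewrite ?mul0r// -exprS -expr2 exprAC.
  apply: le_trans (ler_wpM2l _ hV) _; first by lra.
  have -> : 3 * e * (m%:R * (D ^+ m * D ^+ m)) = 3 * D ^+ m * (m%:R * D ^+ m * e) by ring.
  apply: ler_wpM2r; first by rewrite !mulr_ge0// (le_trans _ Dm).
  lra.
rewrite (ExZ _ (ig_eg l0 ge)) (Ex_Po_stein (x := fun m => D ^+ 2 * (D ^+ 2) ^+ m) l0); last first.
  by apply: egZ; exact: eg_pow.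
rewrite (ExZ _ (ig_pow l0 D20)) (Ex_Po_pow l0 D20) /cuw.
have -> : 3 * L * D ^+ 2 * expR (L * D ^+ 2) * e = 3 * e * (L * (D ^+ 2 * expR (L * D ^+ 2))) by ring.
have L0 : 0 <= L by exact: le_trans lL.
apply: ler_wpM2l; first by rewrite mulr_ge0.
apply: ler_pM => //; first by rewrite mulr_ge0// expR_ge0.
apply: ler_wpM2l => //; rewrite ler_expR; apply: le_trans (_ : L * (D ^+ 2 - 1) <= _).
  by apply: ler_wpM2r => //; have : 1 <= D ^+ 2 by [exact: exprn_ege1]; lra.
by apply: ler_wpM2l => //; rewrite lerBlDr lerDl.
Qed.

Lemma Lambda_dist d (X : measurableType d) (P : probability X R) (f g : X -> R) (e : R) :
  bm f -> bm g -> (forall x, D^-1 <= f x <= D) -> (forall x, D^-1 <= g x <= D) ->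
  (forall x, `|f x - g x| <= e) ->
  `|Ex P (fun x => Lambda (f x)) - Ex P (fun x => Lambda (g x))| <= (1 + D + D) * e.
Proof.
move=> bf bg fD gD h.
rewrite -(ExB (bm_ig _ (bm_Lambda bf)) (bm_ig _ (bm_Lambda bg))) -(Ex_cst P ((1 + D + D) * e)).
apply: Ex_abs_le; [exact: bm_ig (bmB (bm_Lambda bf) (bm_Lambda bg))|exact: ig_cst|move=> x].
have Di : 0 < D^-1 by rewrite invr_gt0.
apply: le_trans (Lambda_lip Di (fD x) (gD x)) _; rewrite invrK.
by apply: ler_wpM2l => //; move: D1 => ?; lra.
Qed.

End mixed.

Section bethe_functionals.
Context {R : realType} {k : nat} {Q : finType} {d : measure_display} {Y : measurableType d}.
Local Notation K := k.+1.
Variables (p : probability Y R) (phi : Y -> K.-tuple Q -> R) (D : R) (gam : Q -> R).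
Hypotheses (mphi : forall t, measurable_fun setT (fun y => phi y t))
  (phiD : forall y t, D^-1 <= phi y t <= D) (D1 : 1 <= D)
  (gam0 : forall z, 0 <= gam z) (gam1 : \sum_z gam z = 1).

Let D0 : 0 < D. Proof. by apply: lt_le_trans D1. Qed.

(** Parametrized probability vectors. O is either the set of vertices with their marginals or the
    space of laws on the spin values, so one set of functionals covers graph and Bethe side. *)
Definition pmfs d' (O : measurableType d') (g : O -> Q -> R) : Prop :=
  [/\ forall z, measurable_fun setT (fun o => g o z), forall o z, 0 <= g o z & forall o, \sum_z g o z = 1].

Lemma pmfs_le1 d' (O : measurableType d') (g : O -> Q -> R) o z : pmfs g -> g o z <= 1.
Proof. by move=> [_ g0 g1]; rewrite -(g1 o) (bigD1 z)//= lerDl sumr_ge0. Qed.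

Lemma bm_pmfs d' (O : measurableType d') (g : O -> Q -> R) z : pmfs g -> bm (fun o => g o z).
Proof.
move=> hg; split; first by case: hg.
by exists 1 => o; rewrite ger0_norm ?pmfs_le1//; case: hg.
Qed.

Section law.
Context {d' : measure_display} {O : measurableType d'}.
Implicit Types (pi : probability O R) (g : O -> Q -> R).

Definition Zg g (x : Y * K.-tuple O) : R :=
  \sum_t phi x.1 t * \prod_h g (tnth x.2 h) (tnth t h).

Definition zP pi g : R := Ex (p \x iid K pi)%E (fun x => Lambda (Zg g x)).

Definition Wg g (x : Y * 'I_K * K.-tuple O) (u : Q) : R :=
  \sum_t phi x.1.1 (tset x.1.2 u t) * \prod_h g (tnth x.2 h) (tnth t h).

Definition PW pi : probability (Y * 'I_K * K.-tuple O)%type R :=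
  (p \x unif (enum 'I_K) \x iid K pi)%E.

Definition uP pi g (l : R) : R := uw gam (PW pi) (Wg g) l.

Lemma sum_prod_pmfs g (o : K.-tuple O) : pmfs g -> \sum_(t : K.-tuple Q) \prod_h g (tnth o h) (tnth t h) = 1.
Proof.
by move=> [_ _ g1]; rewrite (sum_tuple_prod (fun h => g (tnth o h))) big1.
Qed.

Lemma Zg_bounds g x : pmfs g -> D^-1 <= Zg g x <= D.
Proof.
move=> hg; rewrite /Zg; under eq_bigr do rewrite mulrC.
apply: conv_bounds => [t||t]; [by apply: prodr_ge0 => h _; case: hg|exact: sum_prod_pmfs|exact: phiD].
Qed.

Lemma Wg_bounds g x u : pmfs g -> D^-1 <= Wg g x u <= D.
Proof.
move=> hg; rewrite /Wg; under eq_bigr do rewrite mulrC.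
apply: conv_bounds => [t||t]; [by apply: prodr_ge0 => h _; case: hg|exact: sum_prod_pmfs|exact: phiD].
Qed.

Lemma bm_prod_pmfs g (t : K.-tuple Q) : pmfs g -> bm (fun o : K.-tuple O => \prod_h g (tnth o h) (tnth t h)).
Proof. by move=> hg; apply: bm_prod => h; apply: (bm_tnth h (f := fun o => g o (tnth t h))); exact: bm_pmfs. Qed.

Lemma bm_Zg g : pmfs g -> bm (Zg g).
Proof.
move=> hg; apply: bm_sum => t; apply: bmM; first exact: (bm_comp measurable_fst (bm_phi mphi phiD D1 t)).
exact: (bm_comp measurable_snd (bm_prod_pmfs t hg)).
Qed.

Lemma bm_Wg g u : pmfs g -> bm (fun x => Wg g x u).
Proof.
move=> hg; apply: bm_sum => t; apply: bmM; last exact: (bm_comp measurable_snd (bm_prod_pmfs t hg)).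
apply: (bm_comp (f := fun z : Y * 'I_K => phi z.1 (tset z.2 u t)) measurable_fst).
exact: (bm_prod_ord (f := fun h y => phi y (tset h u t)) (fun h => bm_phi mphi phiD D1 _)).
Qed.

Definition gclose g g' (e : R) := forall o, dist1 (g o) (g' o) <= e.

Lemma prods_close g g' e (o : K.-tuple O) : pmfs g -> pmfs g' -> gclose g g' e ->
  \sum_(t : K.-tuple Q) `|\prod_h g (tnth o h) (tnth t h) - \prod_h g' (tnth o h) (tnth t h)| <= K%:R * e.
Proof.
move=> hg hg' he; apply: le_trans (_ : \sum_(h < K) e <= _).
  apply: le_trans (prod_dist (f := fun h => g (tnth o h)) (g := fun h => g' (tnth o h)) _ _ _ _) _.
  - by case: hg.
  - by case: hg'.
  - by case: hg.
  - by case: hg'.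
  - by apply: ler_sum => h _; exact: he.
by rewrite sumr_const card_ord -[X in X <= _]mulr_natl.
Qed.

Let close (c : K.-tuple Q -> R) g g' e o : (forall t, D^-1 <= c t <= D) -> pmfs g -> pmfs g' -> gclose g g' e ->
  `|\sum_t c t * \prod_h g (tnth o h) (tnth t h) - \sum_t c t * \prod_h g' (tnth o h) (tnth t h)| <= D * (K%:R * e).
Proof.
move=> cD hg hg' he; rewrite -sumrB; apply: le_trans (ler_norm_sum _ _ _) _.
apply: le_trans (ler_wpM2l (ltW D0) (prods_close o hg hg' he)); rewrite mulr_sumr.
apply: ler_sum => t _; rewrite -mulrBr normrM; apply: ler_wpM2r => //.
have /andP[h1 h2] := cD t; rewrite ger0_norm//; by apply: le_trans h1; rewrite invr_ge0 ltW.
Qed.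

Lemma Zg_close g g' e x : pmfs g -> pmfs g' -> gclose g g' e -> `|Zg g x - Zg g' x| <= D * (K%:R * e).
Proof. by move=> hg hg' he; exact: close. Qed.

Lemma Wg_close g g' e x u : pmfs g -> pmfs g' -> gclose g g' e -> `|Wg g x u - Wg g' x u| <= D * (K%:R * e).
Proof. by move=> hg hg' he; apply: close => // t; exact: phiD. Qed.

Lemma zP_dist pi g g' e : pmfs g -> pmfs g' -> gclose g g' e ->
  `|zP pi g - zP pi g'| <= (1 + D + D) * (D * (K%:R * e)).
Proof.
move=> hg hg' he; apply: (Lambda_dist D1 _ (bm_Zg hg) (bm_Zg hg')) => x.
- exact: Zg_bounds.
- exact: Zg_bounds.
- exact: Zg_close.
Qed.

Lemma uP_dist pi g g' e l L : 0 <= l <= L -> 0 <= e -> pmfs g -> pmfs g' -> gclose g g' e ->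
  `|uP pi g l - uP pi g' l| <= cuw D L * (D * (K%:R * e)).
Proof.
move=> lL e0 hg hg' he; apply: (uw_dist gam0 gam1 D1) => //.
- by move=> u; exact: (bm_Wg u hg).1.
- by move=> x u; exact: Wg_bounds.
- by move=> u; exact: (bm_Wg u hg').1.
- by move=> x u; exact: Wg_bounds.
- by rewrite mulr_ge0 ?(ltW D0)// mulr_ge0.
- by move=> x u; exact: Wg_close.
Qed.

(** The mixed term of nabla: one message from pi1 at the distinguished slot, all others from pi. *)
Definition zM d1 (O1 : measurableType d1) (pi1 : probability O1 R) (g1 : O1 -> Q -> R) pi g : R :=
  Ex (pi1 \x PW pi)%E (fun x => Lambda (\sum_u Wg g x.2 u * g1 x.1 u)).

Section zM.
Context d1 (O1 : measurableType d1).

Let hs g (g1 : O1 -> Q -> R) := fun x : O1 * (Y * 'I_K * K.-tuple O) => \sum_u Wg g x.2 u * g1 x.1 u.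

Lemma zM_bounds g (g1 : O1 -> Q -> R) x : pmfs g -> pmfs g1 -> D^-1 <= hs g g1 x <= D.
Proof.
move=> hg [_ g0 g11]; rewrite /hs; under eq_bigr do rewrite mulrC.
by apply: conv_bounds => // u; exact: Wg_bounds.
Qed.

Lemma bm_zM g (g1 : O1 -> Q -> R) : pmfs g -> pmfs g1 -> bm (hs g g1).
Proof.
move=> hg hg1; apply: bm_sum => u; apply: bmM.
  exact: (bm_comp measurable_snd (bm_Wg u hg)).
exact: (bm_comp measurable_fst (bm_pmfs u hg1)).
Qed.

Lemma zM_dist (pi1 : probability O1 R) (g1 g1' : O1 -> Q -> R) pi g e : pmfs g -> pmfs g1 -> pmfs g1' -> 
  (forall o, dist1 (g1 o) (g1' o) <= e) ->
  `|zM pi1 g1 pi g - zM pi1 g1' pi g| <= (1 + D + D) * (D * e).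
Proof.
move=> hg h1 h1' he; apply: (Lambda_dist D1 _ (bm_zM hg h1) (bm_zM hg h1')) => x.
- exact: zM_bounds.
- exact: zM_bounds.
- rewrite /hs -sumrB; apply: le_trans (ler_norm_sum _ _ _) _.
  apply: le_trans (ler_wpM2l (ltW D0) (he x.1)); rewrite /dist1 mulr_sumr.
  apply: ler_sum => u _; rewrite -mulrBr normrM; apply: ler_wpM2r => //.
  have /andP[b1 b2] := Wg_bounds x.2 u hg; rewrite ger0_norm//; apply: le_trans b1.
  by rewrite invr_ge0 ltW.
Qed.

End zM.
End law.
End bethe_functionals.

Section transfer.
Context {R : realType} {k : nat} {Q : finType} {d : measure_display} {Y : measurableType d}.
Local Notation K := k.+1.
Variables (p : probability Y R) (phi : Y -> K.-tuple Q -> R) (D : R) (gam : Q -> R).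
Hypotheses (mphi : forall t, measurable_fun setT (fun y => phi y t))
  (phiD : forall y t, D^-1 <= phi y t <= D) (D1 : 1 <= D)
  (gam0 : forall z, 0 <= gam z) (gam1 : \sum_z gam z = 1).
Context d1 (O : measurableType d1) d2 (O' : measurableType d2) (T : O -> O')
  (pi : probability O R) (pi' : probability O' R) (g : O -> Q -> R) (g' : O' -> Q -> R).
Hypotheses (hT : lawmap T pi pi') (hg' : pmfs g') (E : forall o z, g o z = g' (T o) z).

Lemma zP_map : zP p phi pi g = zP p phi pi' g'.
Proof.
have [_ h] := lawmap_prod (lawmap_id p) (lawmap_iid K hT).
rewrite /zP -(h _ (bm_Lambda (bm_Zg mphi phiD D1 hg'))); congr Ex; apply/funext => x.
congr Lambda; apply: eq_bigr => t _; congr (_ * _); apply: eq_bigr => i _.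
by rewrite tnth_map E.
Qed.

Lemma uP_map l : uP p phi gam pi g l = uP p phi gam pi' g' l.
Proof.
apply: (uw_map gam D1 l (lawmap_prod (lawmap_id (p \x unif (enum 'I_K))%E) (lawmap_iid K hT))).
- by move=> u; exact: (bm_Wg mphi phiD D1 u hg').1.
- by move=> x u; exact: (Wg_bounds phiD).
move=> x u; apply: eq_bigr => t _; congr (_ * _); apply: eq_bigr => i _.
by rewrite tnth_map E.
Qed.

Context d3 (O2 : measurableType d3).
Variables (pi2 : probability O2 R) (g2 : O2 -> Q -> R).
Hypothesis hg2 : pmfs g2.

Lemma zM_map : zM p phi pi g pi2 g2 = zM p phi pi' g' pi2 g2.
Proof.
have hid : lawmap id (PW (k := k) p pi2) (PW p pi2) by exact: lawmap_id.
have h0 := lawmap_prod hT hid; have [_ h] := h0.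
rewrite /zM -(h _ (bm_Lambda (bm_zM mphi phiD D1 hg2 hg'))); congr Ex; apply/funext => x.
by congr Lambda; apply: eq_bigr => u _; rewrite E.
Qed.

End transfer.

(** * Bethe functionals of single-site marginals *)

Section marginals.
Context {R : realType} {k : nat} {Q : finType} {d : measure_display} {Y : measurableType d}.
Local Notation K := k.+1.
Variables (p : probability Y R) (phi : Y -> K.-tuple Q -> R) (D : R) (gam : Q -> R).
Hypotheses (mphi : forall t, measurable_fun setT (fun y => phi y t))
  (phiD : forall y t, D^-1 <= phi y t <= D) (D1 : 1 <= D)
  (gam0 : forall z, 0 <= gam z) (gam1 : \sum_z gam z = 1).
Variables (n : nat) (a : n.+1.-tuple Q -> R).
Hypotheses (a0 : nn a) (A0 : 0 < mass a).
Local Notation V := 'I_n.+1.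
Local Notation uV := (unif (R := R) (enum 'I_n.+1)).
Local Notation m_ := (mu (@spin Q n) a).

Lemma pmfs_mu : pmfs m_.
Proof. by split=> // [v z|v]; [exact: mu_ge0|exact: sum_mu]. Qed.

Lemma xF_zP : xF p phi a = zP p phi uV m_.
Proof.
have [_ h] := lawmap_comp (lawmap_prod (lawmap_sites n K) (lawmap_id p)) (lawmap_swap (iid K uV) p).
by rewrite /xF /zP -(h _ (bm_Lambda (bm_Zg mphi phiD D1 pmfs_mu))).
Qed.

Lemma uF_uP l : uF p phi gam l a = uP p phi gam uV m_ l.
Proof.
have h := lawmap_comp (lawmap_prod (lawmap_sites n K) (lawmap_id (p \x unif (enum 'I_K))%E))
  (lawmap_swap (iid K uV) (p \x unif (enum 'I_K))%E).
apply: (uw_map gam D1 l h) => //.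
- by move=> u; exact: (bm_Wg mphi phiD D1 u pmfs_mu).1.
- by move=> x u; exact: (Wg_bounds phiD _ _ pmfs_mu).
Qed.

Context d1 (O : measurableType d1) (pi : probability O R) (g : O -> Q -> R).
Hypothesis hg : pmfs g.

(* The one-vertex factors of the interpolation: a factor all of whose other
   vertices carry independent messages drawn from pi. *)
Definition psiY (z : Y * 'I_K * K.-tuple O) (t : 1.-tuple Q) : R := Wg phi g z (thead t).

Lemma sum_tuple1 (F : 1.-tuple Q -> R) : \sum_t F t = \sum_u F [tuple u].
Proof. by rewrite sum_tupleS; apply: eq_bigr => u _; rewrite sum_tuple0; congr F; exact: val_inj. Qed.

Lemma xF_zM : xF (PW p pi) psiY a = zM p phi uV m_ pi g.
Proof.
have hid : lawmap id (PW (k := k) p pi) (PW p pi) by exact: lawmap_id.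
have h0 := lawmap_prod (lawmap_comp (lawmap_sites n 1) (lawmap_tnth uV ord0)) hid; have [_ h] := h0.
rewrite /xF /zM -(h _ (bm_Lambda (bm_zM mphi phiD D1 hg pmfs_mu))); congr Ex; apply/funext => x.
congr Lambda; rewrite /dF /dec1 sum_tuple1; apply: eq_bigr => u _; congr (_ * _).
by rewrite /rho big_ord_recl big_ord0 mulr1 tnth0.
Qed.

(** In the one-vertex model the factors at the new vertex ignore the rest of the graph, so the
    growth per vertex is the Bethe vertex term of pi whatever the weights a are. *)
Lemma uF_uPY l : uF (PW p pi) psiY gam l a = uP p phi gam pi g l.
Proof.
have h : lawmap (fun x => x.2.1) (Ponce (k := 0) (PW (k := k) p pi) n) (PW p pi).
  exact: (lawmap_comp (lawmap_snd _ _) (lawmap_fst _ _)).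
apply: (uw_map gam D1 l h).
- by move=> u; exact: (bm_Wg mphi phiD D1 u hg).1.
- by move=> x u; exact: (Wg_bounds phiD).
move=> x u; rewrite /dec1; transitivity (\sum_t Wg phi g x.2.1 u * rho (@spin Q n) a x.1 t).
  apply: eq_bigr => t _; rewrite /omO /psiY; congr (Wg _ _ _ _ * _).
  by rewrite /thead tnth_mktuple (ord1 x.2.2) eqxx.
by rewrite -mulr_sumr sum_rho// mulr1.
Qed.

Lemma mpsiY t : measurable_fun setT (fun z => psiY z t).
Proof. exact: (bm_Wg mphi phiD D1 (thead t) hg).1. Qed.

Lemma psiYD z t : D^-1 <= psiY z t <= D.
Proof. exact: (Wg_bounds phiD). Qed.

Hypothesis mean_g : forall z, Ex pi (fun o => g o z) = gam z.
Hypothesis stat : stationary p phi gam.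

Lemma Ex_prod_pmfs (t : K.-tuple Q) : Ex (iid K pi) (fun o => \prod_h g (tnth o h) (tnth t h)) = \prod_h gam (tnth t h).
Proof.
rewrite (Ex_iid_prods pi (f := fun h o => g o (tnth t h))); last by move=> h; exact: bm_pmfs.
by apply: eq_bigr => h _; exact: mean_g.
Qed.

Lemma Ex_Wg u : Ex (PW p pi) (fun x => Wg phi g x u) = 1.
Proof.
rewrite -(stat u).
pose f (x : Y * 'I_K) (o : K.-tuple O) := \sum_t phi x.1 (tset x.2 u t) * \prod_h g (tnth o h) (tnth t h).
have hf : bm (fun z => f z.1 z.2) := bm_Wg mphi phiD D1 u hg.
rewrite /PW (Ex_prod_bm (f := f) _ _ hf).
pose f' (h : 'I_K) y := \sum_t phi y (tset h u t) * \prod_h gam (tnth t h).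
have E x : Ex (iid K pi) (f x) = f' x.2 x.1.
  rewrite /f Ex_sum; last by move=> t; apply: bm_ig; apply: bmM; [exact: bm_cst|exact: bm_prod_pmfs].
  by apply: eq_bigr => t _; rewrite (ExZ _ (bm_ig _ (bm_prod_pmfs t hg))) Ex_prod_pmfs.
under eq_fun do rewrite E.
have hf' h : bm (f' h).
  by apply: bm_sum => t; apply: bmM; [exact: (bm_phi mphi phiD D1)|exact: bm_cst].
by rewrite (Ex_prod_ord p hf').
Qed.

(** The messages have mean gam, so by stationarity a one-vertex factor has mean 1 for every value of
    its spin. *)
Lemma ZpsiY : Zb (PW p pi) psiY gam = 1.
Proof.
rewrite /Zb.
have -> : (fun y => \sum_(t : 1.-tuple Q) psiY y t * \prod_h gam (tnth t h)) = (fun y => \sum_u gam u * Wg phi g y u).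
  apply/funext => y; rewrite sum_tuple1; apply: eq_bigr => u _.
  by rewrite /psiY big_ord_recl big_ord0 mulr1 mulrC tnth0.
rewrite Ex_sum; last by move=> u; apply: bm_ig; apply: bmZ; exact: (bm_Wg mphi phiD D1).
rewrite -[RHS]gam1; apply: eq_bigr => u _.
by rewrite (ExZ _ (bm_ig _ (bm_Wg mphi phiD D1 u hg))) Ex_Wg mulr1.
Qed.

Lemma stat_psiY : stationary (PW p pi) psiY gam.
Proof.
move=> u; rewrite big_ord_recl big_ord0 addr0 invr1 mul1r /Zb.
have -> : (fun y => \sum_(t : 1.-tuple Q) psiY y (tset ord0 u t) * \prod_h gam (tnth t h)) = (fun y => Wg phi g y u).
  apply/funext => y; transitivity (\sum_(t : 1.-tuple Q) Wg phi g y u * \prod_h gam (tnth t h)).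
    by apply: eq_bigr => t _; rewrite /psiY /thead tnth_mktuple eqxx.
  by rewrite -mulr_sumr (sum_tuple_prod (fun=> gam)) big1 ?mulr1.
exact: Ex_Wg.
Qed.

End marginals.

(** * Moving the mean of the marginals to gamma* *)

Section mean_correction.
Context {R : realType} {Q : finType} (gam : Q -> R) (lo : R).
Hypotheses (lo01 : 0 < lo <= 1) (gamlo : forall z, lo <= gam z) (gam1 : \sum_z gam z = 1).
Variables (n : nat) (a : n.+1.-tuple Q -> R).
Hypotheses (a0 : nn a) (A0 : 0 < mass a).
Local Notation m_ := (mu (@spin Q n) a).
Local Notation dist := (dist1 (amean a) gam).

(** The least admissible contraction must satisfy [(1 - del) * amean a z <= gam z]; as gam is at
    least lo, dist / lo suffices. At the cap 1 all corrected marginals equal gam. *)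
Definition del : R := Num.min 1 (dist / lo).

(* Contracting the marginals towards their mean makes room to move the mean to gam. *)
Definition gfix (v : 'I_n.+1) (z : Q) : R := gam z - (1 - del) * amean a z + (1 - del) * m_ v z.

Let lo0 : 0 < lo. Proof. by case/andP: lo01. Qed.

Lemma del01 : 0 <= del <= 1.
Proof.
by rewrite /del le_min ler01 divr_ge0 ?(ltW lo0) ?dist1_ge0//= ge_min lexx.
Qed.

Let d0 : 0 <= 1 - del. Proof. by have /andP[_] := del01; rewrite subr_ge0. Qed.

Lemma del_ell : mass a * del <= ell (@dev R Q gam n) a / lo.
Proof.
apply: le_trans (_ : mass a * (dist / lo) <= _).
  by apply: ler_wpM2l; [exact: ltW|rewrite ge_min lexx orbT].
by rewrite mulrA ler_pM2r ?invr_gt0//; exact: dist_amean.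
Qed.

(** With e = dist / lo < 1 the mean is at most gam + e lo <= (1 + e) gam, and (1 - e)(1 + e) <=
    1. *)
Lemma amean_del z : (1 - del) * amean a z <= gam z.
Proof.
have am0 : 0 <= amean a z by exact: amean_ge0.
have g0 : 0 <= gam z by apply: le_trans (gamlo z); exact: ltW.
rewrite /del; case: (leP 1 (dist / lo)) => h.
  by rewrite subrr mul0r.
set e := dist / lo in h *.
have e0 : 0 <= e by rewrite divr_ge0 ?dist1_ge0// ltW.
have dE : dist = e * lo by rewrite divfK// gt_eqF.
have : `|amean a z - gam z| <= dist.
  by rewrite /dist1 (bigD1 z)//= lerDl sumr_ge0.
rewrite dE ler_norml => /andP[_ hz].
have h1 : e * lo <= e * gam z by apply: ler_wpM2l.
have h2 : amean a z <= gam z + e * gam z by lra.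
have e1 : 0 <= 1 - e by rewrite subr_ge0 ltW.
apply: le_trans (ler_wpM2l e1 h2) _.
have : 0 <= e ^+ 2 * gam z by rewrite mulr_ge0 ?sqr_ge0.
by lra.
Qed.

Lemma pmfs_gfix : pmfs gfix.
Proof.
split=> // [v z|v].
  by rewrite /gfix addr_ge0 ?subr_ge0 ?amean_del// mulr_ge0//; exact: mu_ge0.
rewrite /gfix big_split /= sumrB -!mulr_sumr gam1 sum_amean// sum_mu//.
by rewrite subrK.
Qed.

Lemma mean_gfix z : Ex (unif (R := R) (enum 'I_n.+1)) (fun v => gfix v z) = gam z.
Proof.
rewrite Ex_unif//; last exact: (enum_neq0 (ord0 : 'I_n.+1)).
have Ei : \sum_(i in 'I_n.+1) gfix i z = \sum_i gfix i z by apply: eq_bigl.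
rewrite size_enum_ord big_enum /= Ei /gfix big_split /= sumr_const card_ord -mulr_sumr.
rewrite -[(_ - _) *+ n.+1]mulr_natl mulrDr mulKf ?pnatr_eq0//.
have -> : n.+1%:R^-1 * ((1 - del) * \sum_(i < n.+1) m_ i z) = (1 - del) * amean a z.
  by rewrite mulrCA amean_mu.
by rewrite subrK.
Qed.

Lemma gfix_close v : dist1 (m_ v) (gfix v) <= 4 * del.
Proof.
have /andP[dl0 dl1] := del01.
(* At the cap this is the trivial bound on the distance of two laws; otherwise dist = del lo with lo
   <= 1. *)
have hd : dist <= 2 * del.
  rewrite /del; case: (leP 1 (dist / lo)) => h.
    rewrite mulr1; apply: le_trans (_ : \sum_z (amean a z + gam z) <= _).
      apply: ler_sum => z _; apply: le_trans (ler_normB _ _) _.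
      rewrite !ger0_norm//; first exact: (le_trans (ltW lo0)).
      exact: amean_ge0.
    by rewrite big_split /= gam1 sum_amean.
  rewrite mulrA ler_pdivlMr// mulrC; apply: ler_wpM2r; first exact: dist1_ge0.
  by case/andP: lo01 => _ ?; lra.
apply: le_trans (_ : \sum_z (del * m_ v z + `|amean a z - gam z| + del * amean a z) <= _).
  apply: ler_sum => z _; rewrite /gfix.
  have -> : m_ v z - (gam z - (1 - del) * amean a z + (1 - del) * m_ v z) =
    del * m_ v z + (amean a z - gam z) - del * amean a z by ring.
  apply: le_trans (ler_normB _ _) _; apply: lerD.
    apply: le_trans (ler_normD _ _) _; rewrite lerD2r ger0_norm// mulr_ge0//; exact: mu_ge0.
  by rewrite ger0_norm// mulr_ge0//; exact: amean_ge0.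
rewrite !big_split /= -!mulr_sumr sum_mu// sum_amean// -/(dist1 _ _).
by lra.
Qed.

End mean_correction.

(** * Error rates *)

Section rates.
Context {R : realType}.

Lemma rr_sqrt n : rr n = (Num.sqrt n.+1%:R)^-1 :> R.
Proof. by rewrite /rr powRN powR12_sqrt. Qed.

Lemma sum_rr N : \sum_(n < N) rr n <= 2 * Num.sqrt N%:R :> R.
Proof.
elim: N => [|N IH]; first by rewrite big_ord0 sqrtr0 mulr0.
rewrite big_ord_recr /= rr_sqrt; apply: le_trans (lerD IH (lexx _)) _.
set a := Num.sqrt N%:R; set b := Num.sqrt N.+1%:R.
have a0 : 0 <= a by exact: sqrtr_ge0.
have b0 : 0 < b by rewrite sqrtr_gt0.
have aa : a ^+ 2 = N%:R by rewrite sqr_sqrtr.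
have bb : b ^+ 2 = N%:R + 1 by rewrite sqr_sqrtr// natr1.
have E : b * b^-1 = 1 by rewrite divff// gt_eqF.
rewrite -(ler_pM2l b0) mulrDr E.
have : 0 <= (b - a) ^+ 2 by exact: sqr_ge0.
rewrite sqrrB mulrCA -[b * (2 * b)]mulrCA -expr2 bb => h; move: h; rewrite aa.
have -> : b * a *+ 2 = 2 * (b * a) by rewrite mulr_natl.
lra.
Qed.

Variable n : nat.
Let x : R := n.+1%:R.
Let x1 : 1 <= x. Proof. by rewrite ler1n. Qed.
Let x0 : 0 < x. Proof. exact: lt_le_trans x1. Qed.

(** [theta] is the number T of pins and [eps] the parameter of the entropy bound. Over about x
    vertices the errors are x eps, x / (eps theta), theta, and theta sqrt x from the pins hitting
    new vertices, all O(x^(7/8)), which is [rate]. *)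
Definition theta : nat := Num.truncn (x `^ (1 / 4)).
Definition eps : R := x `^ (- (1 / 8)).
Definition rate : R := x `^ (7 / 8).

Lemma pow_le_rate (r : R) : r <= 7 / 8 -> x `^ r <= rate.
Proof. by move=> h; apply: ler_powR. Qed.

Lemma rate_ge1 : 1 <= rate.
Proof. by rewrite -(powRr0 x); apply: pow_le_rate; lra. Qed.

Let powD (r s : R) : x `^ r * x `^ s = x `^ (r + s).
Proof. by rewrite powRD//; apply/implyP => _; rewrite gt_eqF. Qed.

Lemma theta_gt0 : (0 < theta)%N.
Proof.
rewrite /theta truncn_gt0//; rewrite -[leLHS](powRr0 x); apply: ler_powR => //; lra.
Qed.

Lemma theta_le : theta%:R <= x `^ (1 / 4).
Proof. by rewrite truncn_le powR_ge0. Qed.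

Lemma theta_ge : x `^ (1 / 4) <= 2 * theta%:R.
Proof.
have h : x `^ (1 / 4) < theta.+1%:R by apply: truncnS_gt.
have : 1 <= theta%:R :> R by rewrite ler1n theta_gt0.
by move: h; rewrite -natr1; lra.
Qed.

Lemma eps01 : 0 < eps <= 1.
Proof.
rewrite powR_gt0//= -(powRr0 x); apply: ler_powR => //; lra.
Qed.

Lemma x_eps : x * eps <= rate.
Proof.
rewrite -[X in X * _](powRr1 (ltW x0)) powD; apply: pow_le_rate; lra.
Qed.

(** 1 + 1/8 - 1/4 = 7/8; the factor 4 contains the 2 lost when x^(1/4) is truncated to an
    integer. *)
Lemma x_over : x * (2 / eps / theta%:R) <= 4 * rate.
Proof.
have t0 : 0 < theta%:R :> R by rewrite ltr0n theta_gt0.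
have /andP[e0 _] := eps01.
rewrite !mulrA ler_pdivrMr// ler_pdivrMr// -[X in X * 2](powRr1 (ltW x0)).
have h := theta_ge; have r0 := rate_ge1.
have : rate * eps * x `^ (1 / 4) <= rate * eps * (2 * theta%:R).
  by apply: ler_wpM2l => //; rewrite mulr_ge0// ltW// (lt_le_trans _ r0).
rewrite /rate /eps !powD; have -> : 7 / 8 - 1 / 8 + 1 / 4 = 1 :> R by field.
rewrite -powD; lra.
Qed.

Lemma theta_rate : theta%:R <= rate.
Proof. by apply: le_trans theta_le _; apply: pow_le_rate; lra. Qed.

Lemma sqrt_rate : Num.sqrt x <= rate.
Proof. by rewrite -powR12_sqrt ?(ltW x0)//; apply: pow_le_rate; lra. Qed.

Lemma sum_rr_rate : \sum_(i < n) rr i <= 2 * rate :> R.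
Proof.
apply: le_trans (sum_rr n) _; apply: ler_wpM2l => //; apply: le_trans sqrt_rate.
by rewrite ler_sqrt// ler_nat.
Qed.

Lemma theta_sum_rr : theta%:R * \sum_(i < n) rr i <= 2 * rate :> R.
Proof.
apply: le_trans (_ : x `^ (1 / 4) * (2 * x `^ (2^-1)) <= _).
  apply: ler_pM => //; first by apply: sumr_ge0 => i _; exact: powR_ge0.
    exact: theta_le.
  apply: le_trans (sum_rr n) _; apply: ler_wpM2l => //; rewrite powR12_sqrt ?(ltW x0)//.
  by rewrite ler_sqrt// ler_nat.
rewrite mulrCA powD; apply: ler_wpM2l => //; apply: pow_le_rate; lra.
Qed.

Lemma x_rr : x * rr n <= rate :> R.
Proof.
rewrite /rr -/x -[X in X * _](powRr1 (ltW x0)) powD; apply: pow_le_rate; lra.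
Qed.

Section errors.
Context {Q : finType} (k : nat) (D L cM : R).
Hypotheses (D1 : 1 <= D) (L0 : 0 <= L) (cM0 : 0 <= cM).
Local Notation lnq := (ln (#|Q|%:R : R)).
Local Notation q := (#|Q|%:R : R).

Let L0L : 0 <= L <= L. Proof. by rewrite L0 lexx. Qed.

Definition cErr : R :=
  L * cP D L + 2 * lnq + cG (k := k) D L cM + 4 * ((cT (DL D L) L k.+1 + cT (DL D L) L k.+1) * lnq) +
  2 * (cG (k := k) D L cM * q + lnq + 3 * L * cP D L).

Let cP0 : 0 <= cP D L.
Proof. by rewrite addr_ge0 ?mulr_ge0 ?sqr_ge0// (le_trans ler01). Qed.
Let q0 : 0 <= lnq := ln_nat_ge0 #|Q|.
Let cG0 : 0 <= cG (k := k) D L cM.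
Proof. by rewrite addr_ge0// mulr_ge0//; exact: (cU_ge0 D1 L0L). Qed.

Lemma Err_rate : Err (k := k) (Q := Q) D L eps theta cM n <= cErr * rate.
Proof.
have r0 : 0 <= rate by exact: le_trans rate_ge1.
have nx : n%:R <= x by rewrite ler_nat.
have c0 : 0 <= (cT (DL D L) L k.+1 + cT (DL D L) L k.+1) * lnq.
  by rewrite mulr_ge0// addr_ge0//; apply: cT_ge0; exact: (DL_ge1 D1 L0L).
rewrite /Err /cErr; set c := _ * lnq in c0 *; have := cG0; have := cP0; set g := cG _ _ _; set cp := cP D L => cp0 g0.
set s := \sum_(i < n) _.
have s0 : 0 <= s by apply: sumr_ge0 => i _; exact: powR_ge0.
have h1 : L * cp <= L * cp * rate by rewrite ler_peMr ?rate_ge1// mulr_ge0.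
have h2 := ler_wpM2r q0 theta_rate.
have h3 : n%:R * (g * eps) <= g * rate.
  rewrite mulrCA; apply: ler_wpM2l => //; apply: le_trans x_eps; apply: ler_wpM2r => //.
  by have /andP[/ltW] := eps01.
have h4 : n%:R * (2 / eps * c / theta%:R) <= 4 * c * rate.
  have -> : n%:R * (2 / eps * c / theta%:R) = c * (n%:R * (2 / eps / theta%:R)) by ring.
  have -> : 4 * c * rate = c * (4 * rate) by ring.
  apply: ler_wpM2l => //; apply: le_trans x_over; apply: ler_wpM2r => //.
  by have /andP[/ltW e0 _] := eps01; rewrite !divr_ge0.
have h5 : (g * q + 3 * L * cp) * s <= (g * q + 3 * L * cp) * (2 * rate).
  by apply: ler_wpM2l; [rewrite addr_ge0 ?mulr_ge0|exact: sum_rr_rate].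
have h6 : lnq * (theta%:R * s) <= lnq * (2 * rate).
  by apply: ler_wpM2l => //; exact: theta_sum_rr.
move: h1 h2 h3 h4 h5 h6.
have -> : L * cp + 2 * (theta%:R * lnq) + n%:R * (g * eps + 2 / eps * c / theta%:R) +
   (g * q + (theta%:R * lnq + 3 * L * cp)) * s = L * cp + 2 * (theta%:R * lnq) + n%:R * (g * eps) +
   n%:R * (2 / eps * c / theta%:R) + (g * q + 3 * L * cp) * s + lnq * (theta%:R * s) by ring.
have -> : (L * cp + 2 * lnq + g + 4 * c + 2 * (g * q + lnq + 3 * L * cp)) * rate =
   L * cp * rate + 2 * (rate * lnq) + g * rate + 4 * c * rate + (g * q + 3 * L * cp) * (2 * rate) + lnq * (2 * rate) by ring.
by move=> h1 h2 h3 h4 h5 h6; rewrite !lerD// ler_wpM2l.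
Qed.

Definition cErrI : R :=
  lnq + (cU (k := k) D L + cU (k := 0) D L + L * cM) * (q + 1) +
  4 * ((cT (DL D L) L k.+1 + cT (DL D L) L 1) * lnq).

Lemma errI_rate dd : 0 <= dd / k.+1%:R <= L ->
  errI (k := k) (Q := Q) D dd L eps theta n cM <= cErrI * rate.
Proof.
move=> /andP[d0 dL].
have r0 : 0 <= rate by exact: le_trans rate_ge1.
have c0 : 0 <= (cT (DL D L) L k.+1 + cT (DL D L) L 1) * lnq.
  by rewrite mulr_ge0// addr_ge0//; apply: cT_ge0; exact: (DL_ge1 D1 L0L).
rewrite /errI /cErrI; set c := _ * lnq in c0 *; set c1 := cU _ _ + _ + _; set c2 := cU _ _ + _ + _.
have u1 : 0 <= cU (k := k) D L by exact: (cU_ge0 D1 L0L).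
have u2 : 0 <= cU (k := 0) D L by exact: (cU_ge0 D1 L0L).
have c12 : c1 <= c2 by rewrite lerD2l; exact: ler_wpM2r.
have c10 : 0 <= c1 by apply: addr_ge0; [exact: addr_ge0|rewrite mulr_ge0].
have h2 := ler_wpM2r q0 theta_rate.
have h3 : x * (q * rr n + eps) <= (q + 1) * rate.
  rewrite mulrDr mulrDl mul1r; apply: lerD; last exact: x_eps.
  by rewrite mulrCA; apply: ler_wpM2l => //; exact: x_rr.
have h4 : x * (2 / eps * c / theta%:R) <= 4 * c * rate.
  have -> : x * (2 / eps * c / theta%:R) = c * (x * (2 / eps / theta%:R)) by ring.
  have -> : 4 * c * rate = c * (4 * rate) by ring.
  by apply: ler_wpM2l => //; exact: x_over.
have h5 : c1 * (x * (q * rr n + eps)) <= c2 * ((q + 1) * rate).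
  apply: ler_pM => //; rewrite mulr_ge0 ?(ltW x0)// addr_ge0 ?mulr_ge0 ?powR_ge0//.
rewrite -/x; have -> : theta%:R * lnq + x * (c1 * (q * rr n + eps) + 2 / eps * c / theta%:R) =
  theta%:R * lnq + c1 * (x * (q * rr n + eps)) + x * (2 / eps * c / theta%:R) by ring.
have -> : (lnq + c2 * (q + 1) + 4 * c) * rate = rate * lnq + c2 * ((q + 1) * rate) + 4 * c * rate by ring.
by apply: lerD => //; exact: lerD.
Qed.

End errors.
End rates.

(** * Upper and lower bounds for the compensated model *)

Section poisson_model.
Context {R : realType} {k : nat} {Q : finType} {d : measure_display} {Y : measurableType d}.
Local Notation K := k.+1.
Variables (p : probability Y R) (phi : Y -> K.-tuple Q -> R) (D : R) (gam : Q -> R) (lo : R).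
Hypotheses (mphi : forall t, measurable_fun setT (fun y => phi y t))
  (phiD : forall y t, D^-1 <= phi y t <= D) (D1 : 1 <= D)
  (lo01 : 0 < lo <= 1) (gamlo : forall z, lo <= gam z) (gam1 : \sum_z gam z = 1)
  (Zgam : Zb p phi gam = 1) (stat : stationary p phi gam).
Variables (dd L : R).
Hypotheses (d0 : 0 <= dd) (dL : dd * K%:R <= L).

Let lo0 : 0 < lo. Proof. by case/andP: lo01. Qed.
Let gam0 z : 0 <= gam z. Proof. by apply: le_trans (gamlo z); exact: ltW. Qed.
Let D0 : 0 < D. Proof. by apply: lt_le_trans D1. Qed.
Let ddL : 0 <= dd <= L.
Proof. by rewrite d0 (le_trans _ dL)// ler_peMr// ler1n. Qed.
Let L0 : 0 <= L. Proof. by have /andP[] := ddL; exact: le_trans. Qed.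
Let dkK : 0 <= dd * k%:R / K%:R <= L.
Proof.
rewrite divr_ge0 ?mulr_ge0//= ler_pdivrMr ?ltr0n//; apply: le_trans (_ : dd * K%:R <= _).
  by apply: ler_wpM2l => //; rewrite ler_nat.
by apply: le_trans dL _; rewrite ler_peMr// ler1n.
Qed.

(** [cM1] and [cM2] are the costs of replacing marginals by corrected ones: Lipschitz constants of
    the functionals, times 4 from [gfix_close], divided by lo from [del_ell]. *)
Definition cM1 : R := (cuw D L * (D * (K%:R * 4)) + L * ((1 + D + D) * (D * (K%:R * 4)))) / lo.
Definition cM2 : R := ((1 + D + D) * (D * (K%:R * 4)) + K%:R * ((1 + D + D) * (D * 4))) / lo.

Lemma cM1_ge0 : 0 <= cM1.
Proof.
have c0 : 0 <= cuw D L by rewrite !mulr_ge0 ?sqr_ge0 ?expR_ge0 ?(ltW D0).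
have D00 := ltW D0.
by rewrite divr_ge0 ?(ltW lo0)// addr_ge0// !mulr_ge0// addr_ge0// addr_ge0.
Qed.

Lemma cM2_ge0 : 0 <= cM2.
Proof.
have D00 := ltW D0.
by rewrite divr_ge0 ?(ltW lo0)// addr_ge0// !mulr_ge0// addr_ge0// addr_ge0.
Qed.

Section site.
Variables (n : nat) (a : n.+1.-tuple Q -> R).
Hypotheses (a0 : nn a) (A0 : 0 < mass a).
Local Notation uV := (unif (R := R) (enum 'I_n.+1)).
Local Notation gf := (gfix gam lo a).

Let del0 : 0 <= del gam lo a.
Proof. by have /andP[] := del01 gam lo01 a. Qed.
Let closem : gclose (mu (@spin Q n) a) gf (4 * del gam lo a).
Proof. by move=> o; exact: gfix_close. Qed.
Let hm : pmfs (mu (@spin Q n) a) := pmfs_mu a0 A0.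
Let hf : pmfs gf := pmfs_gfix lo01 gamlo gam1 a0 A0.

Lemma upper_site B :
  uP p phi gam uV gf dd - dd * k%:R / K%:R * zP p phi uV gf <= B ->
  1 * (mass a * (uF p phi gam dd a - dd * k%:R / K%:R * xF p phi a)) <=
    B * mass a + cM1 * ell (@dev R Q gam n) a.
Proof.
move=> hB; rewrite mul1r (uF_uP p gam mphi phiD D1 a0 A0) (xF_zP p mphi phiD D1 a0 A0).
have e0 : 0 <= 4 * del gam lo a by rewrite mulr_ge0.
have h1 := uP_dist p mphi phiD D1 gam0 gam1 uV ddL e0 hm hf closem.
have h2 := zP_dist p mphi phiD D1 uV hm hf closem.
have /andP[k0 kL] := dkK.
set u := uP _ _ _ _ _ _ in h1 *; set u' := uP _ _ _ _ _ _ in h1 hB *.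
set z := zP _ _ _ _ in h2 *; set z' := zP _ _ _ _ in h2 hB *.
set c := dd * k%:R / K%:R in k0 kL hB *; set e := del _ _ _ in e0 h1 h2 *.
have h3 : u <= u' + cuw D L * (D * (K%:R * (4 * e))).
  by rewrite -lerBlDl; apply: le_trans (ler_norm _) h1.
have h4 : c * (z' - z) <= L * ((1 + D + D) * (D * (K%:R * (4 * e)))).
  apply: le_trans (_ : c * ((1 + D + D) * (D * (K%:R * (4 * e)))) <= _).
    apply: ler_wpM2l => //; apply: le_trans h2; rewrite distrC; exact: ler_norm.
  by apply: ler_wpM2r => //; rewrite !mulr_ge0 ?(ltW D0)// ?addr_ge0 ?(ltW D0)//.
have h5 : u - c * z <= B + cM1 * lo * e.
  rewrite /cM1 divfK ?gt_eqF//.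
  have -> : (cuw D L * (D * (K%:R * 4)) + L * ((1 + D + D) * (D * (K%:R * 4)))) * e =
    cuw D L * (D * (K%:R * (4 * e))) + L * ((1 + D + D) * (D * (K%:R * (4 * e)))) by ring.
  rewrite mulrBr in h4; lra.
apply: le_trans (ler_wpM2l (ltW A0) h5) _.
have h6 := ler_wpM2l cM1_ge0 (del_ell gam lo01 a0 A0).
have h7 := ler_wpM2r (ltW lo0) h6.
have E : cM1 * (ell (@dev R Q gam n) a / lo) * lo = cM1 * ell (@dev R Q gam n) a by rewrite mulrA divfK// gt_eqF.
rewrite E in h7; rewrite mulrDr mulrC lerD2l; apply: le_trans h7.
by rewrite le_eqVlt; apply/orP; left; apply/eqP; rewrite /e; ring.
Qed.

Context d1 (O : measurableType d1) (pi : probability O R) (g : O -> Q -> R).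
Hypothesis hg : pmfs g.

Lemma lower_site :
  0 <= zP p phi uV gf + k%:R * zP p phi pi g - K%:R * zM p phi uV gf pi g ->
  - (mass a * (xF p phi a - K%:R * xF (PW p pi) (psiY phi g) a)) <=
    k%:R * zP p phi pi g * mass a + cM2 * ell (@dev R Q gam n) a.
Proof.
move=> hn; rewrite (xF_zP p mphi phiD D1 a0 A0) (xF_zM p mphi phiD D1 a0 A0 pi hg).
have e0 : 0 <= 4 * del gam lo a by rewrite mulr_ge0.
have h2 := zP_dist p mphi phiD D1 uV hm hf closem.
have h3 := zM_dist p mphi phiD D1 uV pi hg hm hf closem.
set z := zP _ _ _ _ in h2 *; set z' := zP _ _ _ _ in h2 hn *; set y := zP _ _ _ _ in hn *.
set w := zM _ _ _ _ _ _ in h3 *; set w' := zM _ _ _ _ _ _ in h3 hn *.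
set e := del _ _ _ in e0 h2 h3 *.
have h4 : z' - z <= (1 + D + D) * (D * (K%:R * (4 * e))).
  by apply: le_trans h2; rewrite distrC; exact: ler_norm.
have h5 : K%:R * (w - w') <= K%:R * ((1 + D + D) * (D * (4 * e))).
  by apply: ler_wpM2l => //; apply: le_trans h3; exact: ler_norm.
have h6 : - (z - K%:R * w) <= k%:R * y + cM2 * lo * e.
  rewrite /cM2 divfK ?gt_eqF//.
  have -> : ((1 + D + D) * (D * (K%:R * 4)) + K%:R * ((1 + D + D) * (D * 4))) * e =
    (1 + D + D) * (D * (K%:R * (4 * e))) + K%:R * ((1 + D + D) * (D * (4 * e))) by ring.
  rewrite mulrBr in h5; lra.
rewrite -mulrN; apply: le_trans (ler_wpM2l (ltW A0) h6) _.
have h7 := ler_wpM2r (ltW lo0) (ler_wpM2l cM2_ge0 (del_ell gam lo01 a0 A0)).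
have E : cM2 * (ell (@dev R Q gam n) a / lo) * lo = cM2 * ell (@dev R Q gam n) a by rewrite mulrA divfK// gt_eqF.
rewrite E in h7; rewrite mulrDr [mass a * _]mulrC lerD2l; apply: le_trans h7.
by rewrite le_eqVlt; apply/orP; left; apply/eqP; rewrite /e; ring.
Qed.

End site.

Variable N : nat.

Lemma Phi_upper B :
  (forall n (a : n.+1.-tuple Q -> R), nn a -> 0 < mass a ->
    uP p phi gam (unif (enum 'I_n.+1)) (gfix gam lo a) dd -
    dd * k%:R / K%:R * zP p phi (unif (enum 'I_n.+1)) (gfix gam lo a) <= B) ->
  Phi p phi gam N dd 0 <= N%:R * B + cErr (Q := Q) k D L cM1 * rate N.
Proof.
move=> hB.
have := growth mphi phiD D1 gam0 gam1 Zgam stat d0 dL (eps01 N) (theta_gt0 (R := R) N) (normr1 R) cM1_ge0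
  (fun n a a0 A0 => upper_site a0 A0 (hB n a a0 A0)) N.
rewrite mul1r => h; apply: le_trans h _; rewrite lerD2l.
exact: (Err_rate (Q := Q) N k D1 L0 cM1_ge0).
Qed.

Context d1 (O : measurableType d1) (pi : probability O R) (g : O -> Q -> R).
Hypotheses (hg : pmfs g) (mean_g : forall z, Ex pi (fun o => g o z) = gam z).

(** The one-vertex model grows by [uP] per vertex ([growth] with sign -1), and [interpolation]
    transfers the bound to the original factors. Growth from one vertex to N + 1 takes N steps,
    whereas N + 1 slices are exchanged, hence the two prefactors. *)
Lemma Phi_lower :
  (forall n (a : n.+1.-tuple Q -> R), nn a -> 0 < mass a ->
    0 <= zP p phi (unif (enum 'I_n.+1)) (gfix gam lo a) + k%:R * zP p phi pi g -
      K%:R * zM p phi (unif (enum 'I_n.+1)) (gfix gam lo a) pi g) ->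
  N%:R * uP p phi gam pi g dd - N.+1%:R * (dd / K%:R * (k%:R * zP p phi pi g)) -
    (cErrI (Q := Q) k D L cM2 + cErr (Q := Q) 0 D L 0) * rate N <= Phi p phi gam N dd 0.
Proof.
move=> hn.
have mps := mpsiY mphi phiD D1 hg; have psD := psiYD phiD hg.
have Zps := ZpsiY mphi phiD D1 gam1 hg mean_g stat.
have sps := stat_psiY mphi phiD D1 gam1 hg mean_g stat.
have dL1 : dd * 1%:R <= L by rewrite mulr1; case/andP: ddL.
have nm1 : `|(-1 : R)| = 1 by rewrite normrN normr1.
have gY := growth mps psD D1 gam0 gam1 Zps sps d0 dL1 (eps01 N) (theta_gt0 (R := R) N) nm1 (lexx 0)
  (B := - uP p phi gam pi g dd) _ N.
have hI := interpolation mphi phiD mps psD D1 gam0 gam1 Zgam Zps d0 dL (eps01 N) (theta_gt0 (R := R) N)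
  cM2_ge0 (fun a a0 A0 => lower_site a0 A0 hg (hn N a a0 A0)).
have e1 := Err_rate (Q := Q) N 0 D1 L0 (lexx 0).
have dK : 0 <= dd / K%:R <= L.
  have [h1 h2] := andP ddL; rewrite divr_ge0//= ler_pdivrMr ?ltr0n//.
  by apply: le_trans h2 _; rewrite ler_peMr// ler1n.
have e2 := errI_rate (Q := Q) N D1 L0 cM2_ge0 dK.
have {}gY : -1 * Phi (PW p pi) (psiY phi g) gam N dd 0 <= N%:R * - uP p phi gam pi g dd + Err (k := 0) (Q := Q) D L (@eps R N) (@theta R N) 0 N.
  apply: gY => n a a0 A0; rewrite (uF_uPY p gam mphi phiD D1 A0 pi hg) mulr0 mul0r mul0r subr0 mul0r addr0.
  by rewrite mulN1r mulrC mulNr.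
move: gY hI e1 e2; rewrite mulN1r mulrN.
move: (Phi _ _ _ _ _ _) (Phi _ _ _ _ _ _) (Err _ _ _ _ _ _) (errI _ _ _ _ _ _ _) => f1 f2 f3 f4.
move: (cErrI (Q := Q) k D L cM2) (cErr (Q := Q) 0 D L 0) (rate N) (N%:R * _) (N.+1%:R * _) => f5 f6 r f7 f8 h1 h2 h3 h4.
lra.
Qed.

End poisson_model.

(** * The teacher-student model *)

Lemma eg_iter {R : realType} {S : finType} (K : ((S -> R) -> R) -> (S -> R) -> R) B F a :
  isop K B -> good F -> nn a -> eg (fun m => iter m K F a).
Proof.
move=> hK gF a0; have [C C0 hC] := good_grow gF.
apply: (@eg_le _ _ (C * (1 + mass a) ^+ 2) B) => m.
have := op_grow (isop_iter m hK) gF.1 hC a0.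
by move=> h; apply: le_trans h _; rewrite le_eqVlt; apply/orP; left; apply/eqP; ring.
Qed.

Lemma dist_through (R : realType) (u v x y e f : R) : `|u - x| <= e -> `|v - y| <= e -> `|x - y| <= f ->
  `|u - v| <= 2 * e + f.
Proof. by rewrite !ler_norml => /andP[? ?] /andP[? ?] /andP[? ?]; lra. Qed.

(** Revealing the class of the configuration costs at most the logarithm of the number of classes,
    and the bound is proportional to the mass, which M preserves. *)
Lemma op_classes (R : realType) (S I : finType) (tau : S -> I) M B (a : S -> R) : isop M B -> mp M -> nn a ->
  `|M F0 a - \sum_t M F0 (amul a (fun s => (tau s == t)%:R))| <= ln #|I|%:R * mass a.
Proof.
move=> hM mM a0; have gF := good_F0 (R := R) (S := S).
have i0 t : nn (fun s => (tau s == t)%:R : R) by move=> s; exact: ler0n.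
have i1 t : forall s, (fun s => (tau s == t)%:R : R) s <= 1 by move=> s; case: eqP.
have gt t : good (fun b : S -> R => F0 (amul b (fun s => (tau s == t)%:R))).
  exact: (op_good (isop_shift (i0 t) (i1 t) (lexx 1)) gF).
rewrite (eq_bigr (fun t => M (fun b => F0 (amul b (fun s => (tau s == t)%:R))) a)); last first.
  by move=> t _; rewrite (op_shift hM).
rewrite -(op_sum _ hM gt a0).
apply: (op_near hM mM gF (good_sum _ gt) _ a0) => b b0.
have E : mass b = \sum_t mass (amul b (fun s => (tau s == t)%:R)).
  rewrite /mass exchange_big /=; apply: eq_bigr => s _; rewrite /amul -mulr_sumr.
  by rewrite (bigD1 (tau s))//= eqxx big1 ?addr0 ?mulr1// => t /negPf; rewrite eq_sym => ->.
have m0 t : 0 <= mass (amul b (fun s => (tau s == t)%:R)) by apply: mass_ge0; exact: nn_amul.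
apply: norm_between; rewrite /F0 E; apply/andP; split; first exact: Lambda_sum_le.
exact: Lambda_sum_ge.
Qed.

Section teacher_student_model.
Context {R : realType} {k : nat} {Q : finType} {d : measure_display} {Y : measurableType d}.
Local Notation K := k.+1.
Variables (p : probability Y R) (phi : Y -> K.-tuple Q -> R) (D : R) (gam : Q -> R).
Hypotheses (mphi : forall t, measurable_fun setT (fun y => phi y t))
  (phiD : forall y t, D^-1 <= phi y t <= D) (D1 : 1 <= D)
  (gam0 : forall z, 0 <= gam z) (gam1 : \sum_z gam z = 1) (Zgam : Zb p phi gam = 1).
Variable n : nat.
Local Notation S := (n.+1.-tuple Q).
Local Notation P := (site n K p).
Local Notation wf := (@wF R k Q d Y phi n).

Let D0 : 0 < D. Proof. by apply: lt_le_trans D1. Qed.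
Let D21 : 1 <= D ^+ 2. Proof. exact: exprn_ege1. Qed.
Let mwf s : measurable_fun setT (fun y => wf y s).
Proof. exact: (bm_wF mphi phiD D1 s).1. Qed.
Let wfD y s : D^-1 <= wf y s <= D. Proof. exact: phiD. Qed.

(** Division by the mean weight given s makes the product over the factors the teacher-student
    density given s; the compensating weight of this model is identically 1. *)
Definition wT (x : K.-tuple 'I_n.+1 * Y) (s : S) : R := wf x s / zeta p phi s.

Let zb (s : S) : D^-1 <= zeta p phi s <= D.
Proof. by apply: (Zb_bounds p mphi phiD D1); [exact: emp_ge0|exact: sum_emp]. Qed.
Let z0 (s : S) : 0 < zeta p phi s.
Proof. by have /andP[h _] := zb s; apply: lt_le_trans h; rewrite invr_gt0. Qed.

Let mwT s : measurable_fun setT (fun y => wT y s).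
Proof. by apply: measurable_funM. Qed.

Let wTD y s : (D ^+ 2)^-1 <= wT y s <= D ^+ 2.
Proof.
have /andP[h1 h2] := zb s; have /andP[h3 h4] := wfD y s; have zs := z0 s.
have w0 : 0 < wf y s by apply: lt_le_trans h3; rewrite invr_gt0.
rewrite /wT expr2 invfM; apply/andP; split; apply: ler_pM => //.
- by rewrite invr_ge0 ltW.
- by rewrite invr_ge0 ltW.
- by rewrite lef_pV2 ?posrE.
- exact: ltW.
- by rewrite invr_ge0 ltW.
- by rewrite -[leRHS]invrK lef_pV2 ?posrE ?invr_gt0.
Qed.

Lemma wmean_wT (s : S) : wmean P wT s = 1.
Proof.
have b := bm_wF mphi phiD D1 s.
rewrite /wmean /wT; under eq_fun do rewrite mulrC.
by rewrite (ExZ _ (bm_ig P b)) (Ex_wF p mphi phiD D1) mulVf// gt_eqF.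
Qed.

Definition UT (l : R) := UP P wT l.

Lemma UT_iid l : UT l F0 (P0 gam (n := n)) =
  Ex (Po l) (fun m => Ex (iid m P) (fun x => Lambda (\sum_s P0 gam s * \prod_j wT (tnth x j) s))).
Proof.
rewrite /UT (UP_iid P mwT wTD D21 l (good_F0 (R := R) (S := S)) (P0_ge0 gam0 (n := n))).
congr Ex; apply/funext => m; congr Ex; apply/funext => x; congr Lambda; apply: eq_bigr => s _.
by rewrite /amul /comp wmean_wT subrr mulr0 expR0 mulr1.
Qed.

Let K' := chan P wT.
Let iK' : isop K' ((D ^+ 2) ^+ 2) := isop_chan P mwT (fun x s => ltW (gadget_gt0 wTD D21 x s)) (fun x s => (andP (wTD x s)).2) D21.
Let w'0 x s : 0 <= wT x s. Proof. exact: (ltW (gadget_gt0 wTD D21 x s)). Qed.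
Let mpK' : mp K'.
Proof.
move=> c a a0; apply: etrans (chan_ell P mwT w'0 (fun x s => (andP (wTD x s)).2) c a) _.
congr ell; apply/funext => s; rewrite /amul; have := wmean_wT s; rewrite /wmean => ->.
by rewrite mulr1.
Qed.

(** One normalized factor multiplies the mass by a relative weight r of mean 1, so [F0] changes by
    exactly [mass a] times the mean of [Lambda r]. *)
Lemma chanT_F0 a : nn a -> `|K' F0 a - F0 a| <= (1 + (D ^+ 2) ^+ 2) * mass a.
Proof.
move=> a0; have [A0|A0] := eqVneq (mass a) 0.
  by rewrite A0 mulr0 (mass0_eq a0 A0) (isop_zero iK') /F0 /mass big1// Lambda0 subrr normr0.
have Ap : 0 < mass a by rewrite lt_neqAle eq_sym A0 mass_ge0.
pose r x := (\sum_s a s * wT x s) / mass a.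
have rD x : (D ^+ 2)^-1 <= r x <= D ^+ 2.
  have -> : r x = \sum_s (a s / mass a) * wT x s.
    by rewrite /r mulr_suml; apply: eq_bigr => s _; rewrite mulrAC.
  apply: conv_bounds => // [s|]; first by rewrite divr_ge0// ltW.
  by rewrite -mulr_suml divff.
have br : bm r.
  have -> : r = fun x => (mass a)^-1 * \sum_s a s * wT x s by apply/funext => x; rewrite mulrC.
  apply: bmZ; apply: bm_sum => s; apply: bmZ; exact: (bm_gadget mwT wTD D21).
have D20 : 0 < D ^+ 2 by rewrite exprn_gt0.
have r0 x : 0 <= r x by have /andP[h _] := rD x; apply: le_trans h; rewrite invr_ge0 ltW.
have Er : Ex P r = 1.
  have -> : r = fun x => (mass a)^-1 * \sum_s a s * wT x s by apply/funext => x; rewrite mulrC.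
  have bs : bm (fun x => \sum_s a s * wT x s) by apply: bm_sum => s; apply: bmZ; exact: (bm_gadget mwT wTD D21).
  rewrite (ExZ _ (bm_ig P bs)) Ex_sum; last first.
    by move=> s; apply: bm_ig; apply: bmZ; exact: (bm_gadget mwT wTD D21).
  rewrite (eq_bigr a) ?mulVf// => s _.
  rewrite (ExZ _ (bm_ig P (bm_gadget mwT wTD D21 s))).
  by have := wmean_wT s; rewrite /wmean => ->; rewrite mulr1.
have E : K' F0 a = mass a * Ex P (fun x => Lambda (r x)) + Lambda (mass a).
  rewrite -[X in _ + X]mulr1 -Er -(ExZ _ (bm_ig P (bm_Lambda br))) -(ExZ _ (bm_ig P br)).
  rewrite -(ExD (igZ _ (bm_ig P (bm_Lambda br))) (igZ _ (bm_ig P br))).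
  congr Ex; apply/funext => x; rewrite /F0 -LambdaM//; congr Lambda.
  by rewrite /r mulrC divfK.
rewrite E addrK normrM gtr0_norm// mulrC; apply: ler_wpM2r; first exact: ltW.
rewrite -(Ex_cst P (1 + _)); apply: Ex_abs_le; [exact: bm_ig (bm_Lambda br)|exact: ig_cst|move=> x].
apply: le_trans (Lambda_bound _) _; rewrite lerD2l ler_sqr ?nnegrE ?(ltW D20)//.
by have /andP[] := rD x.
Qed.

Definition cTS : R := (1 + (D ^+ 2) ^+ 2) + (2 + D + D).

(* On spins of a single type, zeta is constant and the two models differ by a
   change of the rate of the Poisson number of factors. *)
Lemma type_class (l z : R) (b : S -> R) : 0 <= l -> nn b -> (forall s, b s != 0 -> zeta p phi s = z) ->
  `|UF p phi l F0 b - UT l F0 b| <= cTS * (l * \sum_s b s * `|1 - zeta p phi s|).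
Proof.
move=> l0 b0 hz.
have [B0|B0] := eqVneq (mass b) 0.
  have [B1 h1] := isop_UP P mwf wfD D1 l0; have [B2 h2] := isop_UP P mwT wTD D21 l0.
  rewrite (mass0_eq b0 B0) /UF /UT (isop_zero h1) (isop_zero h2) subrr normr0 big1 ?mulr0//.
  by move=> s _; rewrite mul0r.
have [s0 hs0] : exists s, b s != 0.
  apply: contrapT => /forallNP h; case/eqP: B0; rewrite /mass big1// => s _.
  by apply/eqP; apply: contrapT => /negP; exact: h.
have zz : zeta p phi s0 = z by exact: hz.
have zp : 0 < z by rewrite -zz.
have zD : D^-1 <= z <= D by rewrite -zz.
have gF := good_F0 (R := R) (S := S).
(* On a single type, c m is the constant ratio between the compensated and the teacher-student
   weights with m factors. Pulling it out of [Lambda] leaves c m h m, a change of rate from l to l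
   z, and a term in [Lambda (c m)] that can be integrated explicitly. *)
pose h m := iter m K' F0 b; pose c m := expR (l * (1 - z)) * z ^+ m.
have c0 m : 0 < c m by rewrite mulr_gt0 ?expR_gt0 ?exprn_gt0.
have egh : eg h := eg_iter iK' gF b0.
have UTE : UT l F0 b = Ex (Po l) h.
  rewrite /UT /UP /pois; congr Ex; apply/funext => m; congr (iter _ _ _ _).
  by apply/funext => s; rewrite /amul /comp wmean_wT subrr mulr0 expR0 mulr1.
have UFE : UF p phi l F0 b = Ex (Po l) (fun m => c m * h m + Lambda (c m) * mass b).
  rewrite /UF (UP_iid P mwf wfD D1 l gF b0); congr Ex; apply/funext => m.
  have [_ E] := iter_chan P m mwT w'0 (fun x s => (andP (wTD x s)).2) D21 gF
    (nn_amul b0 (fun s => ltW (c0 m))).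
  transitivity (iter m K' F0 (amul b (fun=> c m))).
    rewrite E; congr Ex; apply/funext => x; congr Lambda; apply: eq_bigr => s _; rewrite /amul.
    have [->|bs] := eqVneq (b s) 0; first by rewrite !mul0r.
    rewrite -!mulrA; congr (_ * _); rewrite /comp /wmean (Ex_wF p mphi phiD D1) (hz s bs); congr (_ * _).
    rewrite /wT [in RHS](eq_bigr (fun j => wf (tnth x j) s * z^-1)); last by move=> j _; rewrite (hz s bs).
    by rewrite big_split/= prodr_const card_ord exprVn mulrCA divff ?mulr1// expf_neq0// gt_eqF.
  rewrite -(op_shift (isop_iter m iK')).
  have FE e : nn e -> F0 (amul e (fun=> c m)) = c m * F0 e + Lambda (c m) * mass e.
    move=> e0; rewrite /F0 -LambdaM ?mass_ge0//; congr Lambda.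
    by rewrite /mass mulr_sumr; apply: eq_bigr => s _; rewrite /amul mulrC.
  have g1 : good (fun e : S -> R => c m * F0 e + Lambda (c m) * mass e).
    by apply: goodD; apply: goodZ => //; exact: good_mass.
  have g0 : good (fun e : S -> R => F0 (amul e (fun=> c m))).
    have nc : nn (fun _ : S => c m) by move=> s; exact: ltW.
    have cm : forall s : S, (fun=> c m) s <= 1 + c m by move=> s; rewrite lerDr.
    have c1 : 1 <= 1 + c m by rewrite lerDl ltW.
    exact: (op_good (isop_shift nc cm c1) gF).
  rewrite (op_ext (isop_iter m iK') g0 g1 (FE _) b0).
  rewrite (op_D (isop_iter m iK') (goodZ _ gF) (goodZ _ (good_mass (R := R) (S := S))) b0).
  rewrite (op_Z _ (isop_iter m iK') gF b0) (op_Z _ (isop_iter m iK') (good_mass (R := R) (S := S)) b0).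
  by rewrite (mp_mass (mp_iter m iK' mpK') b0).
have z00 := ltW zp.
have ec : eg c by apply: egZ; exact: eg_pow.
have lnc m : Lambda (c m) = c m * (l * (1 - z)) + ln z * (c m * m%:R).
  rewrite /Lambda /c lnM ?posrE ?expR_gt0 ?exprn_gt0// expRK lnXn// -mulr_natl; ring.
have eLc : eg (fun m => Lambda (c m)).
  under eq_fun do rewrite lnc; apply: egD; first by apply: egM => //; exact: eg_cst.
  by apply: egZ; apply: egM => //; exact: eg_nat.
have tilt x : eg x -> Ex (Po l) (fun m => c m * x m) = Ex (Po (l * z)) x.
  move=> ex; have -> : (fun m => c m * x m) = (fun m => expR (l * (1 - z)) * (z ^+ m * x m)).
    by apply/funext => m; rewrite /c mulrA.
  have ez : eg (fun m => z ^+ m * x m) by apply: egM => //; exact: eg_pow.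
  rewrite (ExZ _ (ig_eg l0 ez)) (Ex_Po_tilt l0 z00 ex) mulrA -expRD.
  have -> : l * (1 - z) + l * (z - 1) = 0 by ring.
  rewrite expR0; exact: mul1r.
have lz : 0 <= l * z by rewrite mulr_ge0.
have ELc : Ex (Po l) (fun m => Lambda (c m)) = l * (1 - z + Lambda z).
  have E1 : Ex (Po l) (fun m => c m * (l * (1 - z))) = l * (1 - z).
    by rewrite (tilt (fun=> l * (1 - z)) (eg_cst _)) Ex_cst.
  have E2 : Ex (Po l) (fun m => c m * m%:R) = l * z.
    by rewrite (tilt _ (eg_nat (R := R))) Ex_Po_nat.
  have g1 : eg (fun m => c m * (l * (1 - z))) by apply: egM => //; exact: eg_cst.
  have g2 : eg (fun m => c m * m%:R) by apply: egM => //; exact: eg_nat.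
  under eq_fun do rewrite lnc.
  rewrite (ExD (ig_eg l0 g1) (igZ _ (ig_eg l0 g2))) (ExZ _ (ig_eg l0 g2)) E1 E2 /Lambda; ring.
have gch : eg (fun m => c m * h m) by exact: egM.
have gL : eg (fun m => Lambda (c m) * mass b) by apply: egM => //; exact: eg_cst.
(* Both parts are O(l |1 - z|) times the mass: the first because one more factor changes h
   boundedly, the second because [Lambda] is Lipschitz near 1. *)
have E : UF p phi l F0 b - UT l F0 b = (Ex (Po (l * z)) h - Ex (Po l) h) + l * (1 - z + Lambda z) * mass b.
  rewrite UFE UTE (ExD (ig_eg l0 gch) (ig_eg l0 gL)) (tilt _ egh).
  have -> : Ex (Po l) (fun m => Lambda (c m) * mass b) = l * (1 - z + Lambda z) * mass b.
    have -> : (fun m => Lambda (c m) * mass b) = (fun m => mass b * Lambda (c m)) by apply/funext => m; rewrite mulrC.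
    by rewrite (ExZ _ (ig_eg l0 eLc)) ELc mulrC.
  by rewrite addrAC.
have lip m : `|h m.+1 - h m| <= (1 + (D ^+ 2) ^+ 2) * mass b.
  rewrite /h iterSr; apply: (op_near (isop_iter m iK') (mp_iter m iK' mpK') (op_good iK' gF) gF _ b0).
  exact: chanT_F0.
have h1 := Ex_Po_lip lz l0 egh lip.
have mb0 : 0 <= mass b by exact: mass_ge0.
have h2 : `|1 - z + Lambda z| <= (2 + D + D) * `|1 - z|.
  have Di : 0 < D^-1 by rewrite invr_gt0.
  have D11 : D^-1 <= 1 <= D by rewrite D1 invf_le1// D1.
  have := Lambda_lip Di zD D11; rewrite Lambda1 subr0 invrK distrC => hl.
  apply: le_trans (ler_normD _ _) _; rewrite [leRHS](_ : _ = `|1 - z| + (1 + D + D) * `|1 - z|) ?lerD2l//.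
  by ring.
have bz : \sum_s b s * `|1 - zeta p phi s| = mass b * `|1 - z|.
  rewrite /mass mulr_suml; apply: eq_bigr => s _.
  by have [->|bs] := eqVneq (b s) 0; rewrite ?mul0r// hz.
have E3 : `|l * z - l| = l * `|1 - z| by rewrite -{2}[l]mulr1 -mulrBr normrM ger0_norm// distrC.
rewrite E3 in h1; rewrite E bz; apply: le_trans (ler_normD _ _) _.
rewrite /cTS mulrDl; apply: lerD.
  by apply: le_trans h1 _; rewrite le_eqVlt; apply/orP; left; apply/eqP; ring.
rewrite !normrM ger0_norm// (ger0_norm mb0).
have := ler_wpM2l (mulr_ge0 l0 mb0) h2.
by move=> hh; rewrite mulrAC; apply: le_trans hh _; rewrite le_eqVlt; apply/orP; left; apply/eqP; ring.
Qed.

(** The type recorded by integer counts, which makes the number of types at most (n + 2)^q. A count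
    is at most n + 1, so [inord] never falls back to its default. *)
Let tau (s : S) : {ffun Q -> 'I_n.+2} := [ffun z => inord (\sum_i (tnth s i == z))].

Let emp_tau s z : emp s z = n.+1%:R^-1 * (tau s z)%:R :> R.
Proof.
rewrite /emp /tau ffunE inordK ?natr_sum// ltnS.
rewrite -[leqRHS]card_ord -sum1_card; apply: leq_sum => i _; exact: leq_b1.
Qed.

Lemma teacher_student_poisson (l : R) : 0 <= l ->
  `|UF p phi l F0 (P0 gam (n := n)) - UT l F0 (P0 gam (n := n))| <=
  2 * (ln (n.+2 ^ #|Q|)%:R) + cTS * (l * (D * K%:R * (#|Q|%:R * rr n))).
Proof.
move=> l0; set a := P0 gam (n := n).
have a0 : nn a by exact: P0_ge0.
have [B1 h1] := isop_UP P mwf wfD D1 l0; have [B2 h2] := isop_UP P mwT wTD D21 l0.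
have m1 := mp_UP P mwf wfD D1 l0; have m2 := mp_UP P mwT wTD D21 l0.
have c1 := op_classes tau h1 m1 a0; have c2 := op_classes tau h2 m2 a0.
rewrite card_ffun card_ord -/(UF p phi l) -/(UT l) (mass_P0 gam1) mulr1 in c1 c2.
pose b t := amul a (fun s => (tau s == t)%:R).
have bE t s : b t s = a s * (tau s == t)%:R by [].
have b0 t : nn (b t) by move=> s; rewrite bE mulr_ge0.
have cb t : `|UF p phi l F0 (b t) - UT l F0 (b t)| <= cTS * (l * \sum_s b t s * `|1 - zeta p phi s|).
  apply: (@type_class l (Zb p phi (fun z => n.+1%:R^-1 * (t z)%:R)) (b t) l0 (b0 t)) => s.
  rewrite bE; have [<- _|_] := eqVneq (tau s) t; last by rewrite mulr0 eqxx.
  by rewrite /zeta; congr Zb; apply/funext => z; exact: emp_tau.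
have T0 : 0 <= cTS by rewrite addr_ge0// ?addr_ge0// ?exprn_ge0// ltW.
have c3 : `|\sum_t UF p phi l F0 (b t) - \sum_t UT l F0 (b t)| <= cTS * (l * (D * K%:R * (#|Q|%:R * rr n))).
  rewrite -sumrB; apply: le_trans (ler_norm_sum _ _ _) _.
  apply: le_trans (ler_sum _ (fun t _ => cb t)) _.
  rewrite -!mulr_sumr; apply: ler_wpM2l => //; apply: ler_wpM2l => //.
  rewrite exchange_big /=.
  apply: le_trans (_ : \sum_s a s * (D * K%:R * dev gam s) <= _).
    apply: ler_sum => s _; rewrite -mulr_suml (bigD1 (tau s))//= bE eqxx mulr1 big1 ?addr0; last first.
      by move=> t /negPf; rewrite bE eq_sym => ->; rewrite mulr0.
    rewrite ler_wpM2l// distrC -[X in _ - X]Zgam.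
    exact: (Zb_lip p mphi phiD D1 (emp_ge0 _) gam0 (sum_emp _) gam1).
  rewrite (eq_bigr (fun s => D * K%:R * (dev gam s * a s))); last by move=> s _; ring.
  rewrite -mulr_sumr; apply: ler_wpM2l; first by rewrite mulr_ge0// ltW.
  exact: (ell_dev_P0 gam0 gam1 n).
exact: dist_through c1 c2 c3.
Qed.

Lemma measurable_wT s : measurable_fun setT (fun y => wT y s).
Proof. exact: mwT. Qed.

Lemma wT_bounds y s : (D ^+ 2)^-1 <= wT y s <= D ^+ 2.
Proof. exact: wTD. Qed.

End teacher_student_model.

Lemma ln_card_rate (R : realType) (n q : nat) : ln (n.+2 ^ q)%:R <= q%:R * (2 * rate n) :> R.
Proof.
rewrite natrX lnXn ?ltr0n// -[leLHS]mulr_natl; apply: ler_wpM2l => //.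
have s0 : 0 < Num.sqrt n.+2%:R :> R by rewrite sqrtr_gt0 ltr0n.
rewrite -[X in ln X](sqr_sqrtr (ler0n R n.+2)) lnXn// -[leLHS]mulr_natl; apply: ler_wpM2l => //.
apply: le_trans (ln_le_sub1 s0) _; rewrite lerBlDr; apply: le_trans (lerD (sqrt_rate n) (lexx 1)).
rewrite -(ler_pXn2r (n := 2)) ?nnegrE ?addr_ge0 ?sqrtr_ge0// sqrrD !sqr_sqrtr//.
by rewrite -natr1 -addrA lerD2l expr1n lerDr mulrn_wge0// mulr1 sqrtr_ge0.
Qed.

Definition cTSP (R : realType) (k : nat) (Q : finType) (D L : R) : R :=
  4 * #|Q|%:R + cTS D * (L * D * #|Q|%:R).

Lemma teacher_student_rate (R : realType) (k : nat) (Q : finType) (d : measure_display) (Y : measurableType d)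
  (p : probability Y R) (phi : Y -> k.+1.-tuple Q -> R) (D L : R) (gam : Q -> R) :
  (forall t, measurable_fun setT (fun y => phi y t)) -> (forall y t, D^-1 <= phi y t <= D) -> 1 <= D ->
  (forall z, 0 <= gam z) -> \sum_z gam z = 1 -> Zb p phi gam = 1 ->
  forall (n : nat) (dd : R), 0 <= dd -> dd * k.+1%:R <= L ->
  `|UF p phi (dd * n.+1%:R / k.+1%:R) F0 (P0 gam (n := n)) - UT p phi (n := n) (dd * n.+1%:R / k.+1%:R) F0 (P0 gam (n := n))| <=
  cTSP k Q D L * rate n.
Proof.
move=> mphi phiD D1 gam0 gam1 Zgam n dd d0 dL.
have l0 : 0 <= dd * n.+1%:R / k.+1%:R by rewrite divr_ge0// mulr_ge0.
apply: le_trans (teacher_student_poisson mphi phiD D1 gam0 gam1 Zgam n l0) _.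
have D0 : 0 <= D by apply: le_trans D1.
have T0 : 0 <= cTS D by rewrite addr_ge0// ?addr_ge0// ?exprn_ge0.
rewrite /cTSP [leRHS]mulrDl; apply: lerD.
  by have := ln_card_rate R n #|Q|; lra.
rewrite -[leRHS]mulrA; apply: ler_wpM2l => //.
have -> : dd * n.+1%:R / k.+1%:R * (D * k.+1%:R * (#|Q|%:R * rr n)) = dd * D * #|Q|%:R * (n.+1%:R * rr n).
  have K0 : k.+1%:R != 0 :> R by rewrite pnatr_eq0.
  by move: (k.+1%:R : R) K0 => z z0; field.
apply: ler_pM; rewrite ?mulr_ge0 ?powR_ge0//; last exact: x_rr.
apply: ler_wpM2r => //; apply: ler_wpM2r => //; apply: le_trans dL; rewrite ler_peMr// ler1n.
by [].
Qed.

(** * Consequences of the assumptions *)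

Section side.
Context {R : realType} {k : nat} {Q : finType}.
Local Notation K := k.+1.

(** Passes from overwriting slot h by u to the restricted sums in [Zv] and [Zfm]: the overwritten
    coordinate is summed out and contributes 1. *)
Lemma side_sum (f : K.-tuple Q -> R) (g : 'I_K -> Q -> R) (h : 'I_K) (u : Q) : \sum_z g h z = 1 ->
  \sum_t f (tset h u t) * \prod_i g i (tnth t i) =
  \sum_(t : K.-tuple Q | tnth t h == u) f t * \prod_(i | i != h) g i (tnth t i).
Proof.
move=> g1; have th (t : K.-tuple Q) : tnth (tset h u t) h == u by rewrite tnth_mktuple eqxx.
rewrite (partition_big (tset h u) (fun t' => tnth t' h == u))/=; last by move=> t _; exact: th.
apply: eq_bigr => t' ht'; rewrite (eq_bigr (fun t => f t' * \prod_i g i (tnth t i))); last first.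
  by move=> t /eqP ->.
rewrite -mulr_sumr; congr (_ * _).
pose G (i : 'I_K) (z : Q) := g i z * (if i == h then 1 else (z == tnth t' i)%:R).
have E (t : K.-tuple Q) : \prod_i G i (tnth t i) = (tset h u t == t')%:R * \prod_i g i (tnth t i).
  rewrite /G big_split/= mulrC; congr (_ * _); have [<-|ne] := eqVneq (tset h u t) t'.
    rewrite big1// => i _; case: eqP => // /eqP/negPf ih.
    by rewrite tnth_mktuple ih eqxx.
  have [i hi] : exists i, tnth (tset h u t) i != tnth t' i.
    apply: contrapT => /forallNP H; case/eqP: ne; apply/eq_from_tnth => i.
    by apply/eqP; apply: contrapT => /negP; exact: H.
  rewrite tnth_mktuple in hi; rewrite (bigD1 i)//=; have [ih|ih] := eqVneq i h.
    by move: hi; rewrite ih eqxx (eqP ht') eqxx.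
  by rewrite (negPf ih) in hi; rewrite (negPf hi) mul0r.
rewrite big_mkcond /= (eq_bigr (fun t : K.-tuple Q => \prod_i G i (tnth t i))); last first.
  by move=> t _; rewrite E; case: eqP => _; rewrite ?mul1r ?mul0r.
rewrite sum_tuple_prod (bigD1 h)//= /G; under eq_bigr do rewrite eqxx mulr1.
rewrite g1 mul1r; apply: eq_bigr => i ih.
rewrite (negPf ih) (bigD1 (tnth t' i))//= eqxx mulr1 big1 ?addr0// => z /negPf ->.
by rewrite mulr0.
Qed.

Lemma sum_tuple_side (F : K.-tuple Q -> R) (g : Q -> R) (h : 'I_K) :
  \sum_t F t * g (tnth t h) = \sum_u g u * \sum_(t : K.-tuple Q | tnth t h == u) F t.
Proof.
rewrite (partition_big (fun t : K.-tuple Q => tnth t h) xpredT)//=; apply: eq_bigr => u _.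
by rewrite mulr_sumr; apply: eq_bigr => t /eqP ->; rewrite mulrC.
Qed.

(** Expanding the product and keeping the terms of order 0 and 1 in b; everything dropped is
    nonnegative. *)
Lemma prod_add_ge m (a b : 'I_m -> R) : (forall i, 0 <= a i) -> (forall i, 0 <= b i) ->
  \prod_i a i + \sum_h b h * \prod_(i | i != h) a i <= \prod_i (a i + b i).
Proof.
elim: m a b => [|m IH] a b a0 b0; first by rewrite !big_ord0 addr0.
have l0 (i : 'I_m) : (lift ord0 i == ord0) = false by [].
have hn (h : 'I_m) : \prod_(i | i != lift ord0 h) a i = a ord0 * \prod_(i | i != h) a (lift ord0 i).
  rewrite big_mkcond big_ord_recl /=; congr (_ * _); rewrite [RHS]big_mkcond /=.
  by apply: eq_bigr => i _; rewrite (inj_eq lift_inj).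
have h0 : \prod_(i | i != ord0) a i = \prod_i a (lift ord0 i).
  by rewrite big_mkcond big_ord_recl /= mul1r; apply: eq_bigr => i _.
rewrite !big_ord_recl h0 [X in _ + (_ + X)](eq_bigr (fun h => a ord0 * (b (lift ord0 h) * \prod_(i | i != h) a (lift ord0 i)))); last first.
  by move=> h _; rewrite hn mulrCA.
rewrite -mulr_sumr; have := IH (fun i => a (lift ord0 i)) (fun i => b (lift ord0 i)) (fun i => a0 _) (fun i => b0 _).
have s0 : 0 <= \sum_h b (lift ord0 h) * \prod_(i | i != h) a (lift ord0 i).
  by apply: sumr_ge0 => h _; rewrite mulr_ge0// prodr_ge0.
move: s0 (a0 ord0) (b0 ord0); move: (\sum_h _) (\prod_i a _) (\prod_i (_ + _)) (a ord0) (b ord0) => S A B x y s0 x0 y0 h.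
have h1 := ler_wpM2l (addr_ge0 x0 y0) h; apply: le_trans h1.
have := mulr_ge0 y0 s0; lra.
Qed.

End side.

(** * First-order condition at the maximizer *)

Section stationarity.
Context {R : realType} {k : nat} {Q : finType} {d : measure_display} {Y : measurableType d}.
Local Notation K := k.+1.
Variables (p : probability Y R) (phi : Y -> K.-tuple Q -> R) (D : R) (gam : Q -> R).
Hypotheses (mphi : forall t, measurable_fun setT (fun y => phi y t))
  (phiD : forall y t, D^-1 <= phi y t <= D) (D1 : 1 <= D)
  (gam0 : forall z, 0 < gam z) (gam1 : \sum_z gam z = 1)
  (Zmax : forall g : Q -> R, (forall z, 0 <= g z) -> \sum_z g z = 1 -> Zb p phi g <= 1)
  (Zgam : Zb p phi gam = 1).

Let D0 : 0 < D. Proof. by apply: lt_le_trans D1. Qed.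
Let phi0 y t : 0 <= phi y t.
Proof. by have /andP[h _] := phiD y t; apply: le_trans h; rewrite invr_ge0 ltW. Qed.
Let gam00 z : 0 <= gam z. Proof. exact: ltW. Qed.

Let w u := \sum_h Zb p (fun y t => phi y (tset h u t)) gam.

Let bside h u : bm (fun y => \sum_t phi y (tset h u t) * \prod_i gam (tnth t i)).
Proof. by apply: bm_sum => t; apply: bmM; [exact: (bm_phi mphi phiD D1)|exact: bm_cst]. Qed.

Let w0 u : 0 <= w u.
Proof.
apply: sumr_ge0 => h _; apply: Ex_ge0 => y; apply: sumr_ge0 => t _.
by rewrite mulr_ge0// prodr_ge0.
Qed.

Let wE u : w u = Ex p (fun y => \sum_h \sum_(t : K.-tuple Q | tnth t h == u) phi y t * \prod_(i | i != h) gam (tnth t i)).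
Proof.
rewrite /w -Ex_sum; last by move=> h; exact: bm_ig (bside h u).
congr Ex; apply/funext => y; apply: eq_bigr => h _.
exact: (side_sum (phi y) (g := fun=> gam) _ gam1).
Qed.

(* Perturbing the maximizer gam towards the vertex u of the simplex. *)
Let w_le u (e : R) : 0 < e <= 1 -> (1 - e) ^+ k * w u <= K%:R.
Proof.
move=> /andP[e0 e1]; have f0 : 0 <= 1 - e by rewrite subr_ge0.
pose g z := (1 - e) * gam z + e * (z == u)%:R.
have g0 z : 0 <= g z by rewrite addr_ge0// mulr_ge0// ltW.
have g1 : \sum_z g z = 1.
  rewrite big_split/= -!mulr_sumr gam1 (bigD1 u)//= eqxx big1 ?addr0 ?mulr1 ?subrK//.
  by move=> z /negPf ->.
have := Zmax g0 g1.
have bs : bm (fun y => \sum_h \sum_(t : K.-tuple Q | tnth t h == u) phi y t * \prod_(i | i != h) gam (tnth t i)).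
  by apply: bm_sum => h; apply: bm_sum => t; apply: bmM; [exact: (bm_phi mphi phiD D1)|exact: bm_cst].
have : (1 - e) ^+ K + e * (1 - e) ^+ k * w u <= Zb p phi g.
  rewrite -[X in X + _]mulr1 -[X in _ * X + _]Zgam wE /Zb.
  rewrite -(ExZ _ (bm_ig p (bm_Zb mphi phiD D1 gam))) -(ExZ _ (bm_ig p bs)).
  rewrite -(ExD (igZ _ (bm_ig p (bm_Zb mphi phiD D1 gam))) (igZ _ (bm_ig p bs))).
  apply: Ex_le; [|exact: bm_ig (bm_Zb mphi phiD D1 g)|move=> y].
    by apply: bm_ig; apply: bmD; apply: bmZ => //; exact: (bm_Zb mphi phiD D1).
  have E : \sum_h \sum_(t : K.-tuple Q | tnth t h == u) phi y t * \prod_(i | i != h) gam (tnth t i) =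
     \sum_t phi y t * \sum_h (tnth t h == u)%:R * \prod_(i | i != h) gam (tnth t i).
    under [RHS]eq_bigr do rewrite mulr_sumr.
    rewrite [RHS]exchange_big; apply: eq_bigr => h _; rewrite big_mkcond /=.
    by apply: eq_bigr => t _; case: eqP => _; rewrite ?mul1r// mul0r mulr0.
  rewrite E !mulr_sumr -big_split/=; apply: ler_sum => t _.
  rewrite [X in X + _]mulrCA [X in _ + X]mulrCA -mulrDr; apply: ler_wpM2l => //.
  have := @prod_add_ge R K (fun i => (1 - e) * gam (tnth t i)) (fun i => e * (tnth t i == u)%:R)
    (fun i => mulr_ge0 f0 (gam00 _)) (fun i => mulr_ge0 (ltW e0) (ler0n _ _)).
  rewrite -/(g _); apply: le_trans.
  rewrite big_split/= prodr_const card_ord lerD2l mulr_sumr; apply: ler_sum => h _.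
  rewrite big_split/= prodr_const.
  have -> : #|(fun i : 'I_K => i != h)| = k.
    by have := cardC (pred1 h); rewrite card1 card_ord add1n => -[].
  by rewrite le_eqVlt; apply/orP; left; apply/eqP; ring.
move=> h1 h2; have h3 := le_trans h1 h2; clear h1 h2.
have bern : 1 - K%:R * e <= (1 - e) ^+ K.
  elim: K => [|m IH]; first by rewrite mul0r subr0 expr0.
  rewrite exprS -natr1; have := ler_wpM2l f0 IH; have : 0 <= m%:R * e * e by rewrite !mulr_ge0// ltW.
  by move: (_ ^+ m) => x; lra.
rewrite -(ler_pM2l e0); have : e * (1 - e) ^+ k * w u <= K%:R * e by move: h3 bern; move: (_ ^+ K) (_ * w u) => x z; lra.
by rewrite -mulrA [_ * e]mulrC.
Qed.

(** The limit e -> 0 of [w_le], with Bernoulli's inequality for [(1 - e) ^+ k]. *)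
Let w_leK u : w u <= K%:R.
Proof.
have bern e : 0 < e <= 1 -> w u - K%:R <= e * (k%:R * w u).
  move=> he; have := w_le u he; have /andP[e0 e1] := he.
  have f0 : 0 <= 1 - e by rewrite subr_ge0.
  have : 1 - k%:R * e <= (1 - e) ^+ k.
    elim: k => [|m IH]; first by rewrite mul0r subr0 expr0.
    rewrite exprS -natr1; have := ler_wpM2l f0 IH; have : 0 <= m%:R * e * e by rewrite !mulr_ge0// ltW.
    by move: (_ ^+ m) => x; lra.
  move=> h1 h2; have := le_trans (ler_wpM2r (w0 u) h1) h2; lra.
rewrite -subr_le0; apply/ler_addgt0Pl => e e0; rewrite addr0.
have c0 : 0 <= k%:R * w u by rewrite mulr_ge0.
have c1 : 0 < 1 + k%:R * w u + e by rewrite ltr_wpDl// addr_ge0.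
apply: le_trans (bern (e / (1 + k%:R * w u + e)) _) _.
  by rewrite divr_gt0//= ler_pdivrMr// mul1r lerDr addr_ge0.
rewrite mulrAC ler_pdivrMr// ler_pM2l//.
by rewrite -addrA addrCA lerDl addr_ge0// ltW.
Qed.

(** The gam-average of w is K, as every slot contributes [Zb p phi gam] = 1. Since w <= K and gam is
    positive everywhere, w equals K at every u. This is where the lower bound on gamma* enters. *)
Lemma stationary_max : stationary p phi gam.
Proof.
have sw : \sum_u gam u * (K%:R - w u) = 0.
  under eq_bigr do rewrite mulrBr; rewrite sumrB -mulr_suml gam1 mul1r.
  apply/eqP; rewrite subr_eq0; apply/eqP.
  transitivity (\sum_(h < K) Zb p phi gam).
    by rewrite Zgam sumr_const card_ord.
  under [RHS]eq_bigr do rewrite mulr_sumr.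
  rewrite [RHS]exchange_big; apply: eq_bigr => h _ /=.
  transitivity (Ex p (fun y => \sum_u gam u * \sum_t phi y (tset h u t) * \prod_i gam (tnth t i))).
    congr Ex; apply/funext => y.
    under [RHS]eq_bigr do rewrite (side_sum (phi y) (g := fun=> gam) _ gam1).
    rewrite -sum_tuple_side; apply: eq_bigr => t _; rewrite -mulrA; congr (_ * _).
    by rewrite (bigD1 h)//= mulrC.
  rewrite Ex_sum; last by move=> u; apply: bm_ig; apply: bmZ; exact: bside.
  by apply: eq_bigr => u _; rewrite (ExZ _ (bm_ig p (bside h u))).
move=> u; rewrite -/(w u).
have /eqP : gam u * (K%:R - w u) = 0.
  apply/eqP; move/eqP: sw; rewrite psumr_eq0; last by move=> z _; rewrite mulr_ge0// subr_ge0.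
  by move/allP => /(_ u); rewrite mem_index_enum => /(_ isT).
rewrite mulf_eq0 (gt_eqF (gam0 u))/= subr_eq0 => /eqP <-.
by rewrite mulVf// pnatr_eq0.
Qed.

End stationarity.

(** * The given weights, normalized by [xi] *)

Section concrete.
Context {R : realType} {q k : nat} {lo : R} {hlo : 0 < lo < q.+1%:R^-1}.
Local Notation W := (weight k hlo).
Local Notation Q := ('I_q.+1).
Local Notation PS := (pprobability Q R).
Local Notation K := k.+1.
Local Notation pmf := Defs.pmf.

Lemma pmf_ge0 (gam : PS) z : 0 <= pmf gam z.
Proof. exact: fine_ge0. Qed.

Lemma Ex_finite (gam : PS) (f : Q -> R) : Ex (gam : probability Q R) f = \sum_z f z * pmf gam z.
Proof.
have mf (h : Q -> R) : measurable_fun setT h by [].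
have E : f = fun x => \sum_z f z * \1_[set z] x.
  apply/funext => x; rewrite (bigD1 x)//= indicE mem_set// mulr1 big1 ?addr0// => z /eqP zx.
  by rewrite indicE memNset ?mulr0// => /esym.
have bI z : bm (\1_[set z] : Q -> R).
  by split => //; exists 1 => x; rewrite indicE; case: (_ \in _); rewrite ?normr1 ?normr0.
rewrite {1}E Ex_sum; last by move=> z; apply: bm_ig; exact: bmZ.
apply: eq_bigr => z _; rewrite (ExZ _ (bm_ig _ (bI z))); congr (_ * _).
apply: EFin_inj; rewrite -EFin_Ex; last exact: bm_ig.
have mz : measurable ([set z] : set Q) by [].
have := @integral_indic _ _ _ (gam : probability Q R) setT measurableT _ mz.
rewrite setIT => h; apply: etrans h _.
by rewrite /pmf fineK// fin_num_measure.
Qed.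

Lemma sum_pmf (gam : PS) : \sum_z pmf gam z = 1.
Proof.
rewrite -(Ex_cst (gam : probability Q R) 1) Ex_finite.
by apply: eq_bigr => z _; rewrite mul1r.
Qed.

Lemma measurable_pmf z : measurable_fun setT (fun x : PS => pmf x z).
Proof.
apply: measurableT_comp => //.
exact: (measurable_kernel (kprobability (@measurable_id _ PS setT)) [set z]).
Qed.

Definition pmfv (x : PS) (z : Q) : R := pmf x z.

Lemma pmfs_pmf : pmfs pmfv.
Proof. by split; [exact: measurable_pmf|exact: pmf_ge0|exact: sum_pmf]. Qed.

Fact mk_nng (v : Q -> R) i : 0 <= Num.max (v i) 0.
Proof. by rewrite le_max lexx orbT. Qed.

(** The law with probability vector v. Negative entries are cut off so that the definition is total;
    normalization changes nothing when v is a probability vector. *)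
Definition mkPS (v : Q -> R) : PS :=
  mnormalize (msum (fun i => mscale (NngNum (mk_nng v (inord i))) (@dirac _ Q (inord i) R)) q.+1)
    (@dirac _ Q ord0 R).

Lemma pmf_mkPS (v : Q -> R) z : (forall z, 0 <= v z) -> \sum_z v z = 1 -> pmf (mkPS v) z = v z.
Proof.
move=> v0 v1.
have E A : msum (fun i => mscale (NngNum (mk_nng v (inord i))) (@dirac _ Q (inord i) R)) q.+1 A =
    (\sum_z v z * \1_A z)%:E.
  rewrite /msum -sumEFin; apply: eq_bigr => i _ /=.
  by rewrite /mscale /= inord_val diracE indicE (max_idPl (v0 i)).
have E1 : msum (fun i => mscale (NngNum (mk_nng v (inord i))) (@dirac _ Q (inord i) R)) q.+1 setT = 1%:E.
  by rewrite E -v1; congr EFin; apply: eq_bigr => i _; rewrite indicT mulr1.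
have -> : pmf (mkPS v) z = \sum_i v i * \1_[set z] i.
  have h := mnormalizeE (@dirac _ Q ord0 R) [set z] E1 (oner_neq0 _).
  rewrite invr1 mule1 in h; exact: (congr1 fine (etrans h (E _))).
rewrite (bigD1 z)//= indicE mem_set// mulr1 big1 ?addr0// => i /eqP iz.
by rewrite indicE memNset ?mulr0.
Qed.

Section law.
Variable p : probability W R.

Let lo0 : 0 < lo. Proof. by case/andP: hlo. Qed.
Let lo1 : lo <= 1.
Proof.
by have /andP[_ /ltW h] := hlo; apply: le_trans h _; rewrite invf_le1 ?ltr0n// ler1n.
Qed.
Let D1 : 1 <= lo^-1. Proof. by rewrite invf_ge1. Qed.

Let mW t : measurable_fun setT (fun psi : W => psi t). Proof. exact: measurable_weight_fun. Qed.
Let WD (psi : W) t : lo^-1^-1 <= psi t <= lo^-1. Proof. by rewrite invrK; exact: weight_fun_bound. Qed.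

Lemma Zbar_Zb (gam : PS) : Zbar p gam = Zb p (fun psi t => (psi : W) t) (pmfv gam).
Proof.
congr Ex; apply/funext => psi; apply: eq_bigr => t _; congr (_ * _).
by apply: eq_bigr => h _; rewrite tnth_nseq.
Qed.

Lemma Zbar_bounds gam : lo <= Zbar p gam <= lo^-1.
Proof.
rewrite Zbar_Zb; have := Zb_bounds p mW WD D1 (pmf_ge0 gam) (sum_pmf gam).
by rewrite invrK.
Qed.

Let hsup : has_sup (range (Zbar p)).
Proof.
split; first by exists (Zbar p point); exists point.
by exists lo^-1 => _ [g _ <-]; have /andP[] := Zbar_bounds g.
Qed.

Lemma Zbar_le_xi gam : Zbar p gam <= xi p.
Proof. by apply: sup_upper_bound hsup _ _; exists gam. Qed.

Lemma xi_bounds : lo <= xi p <= lo^-1.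
Proof.
apply/andP; split; first by apply: le_trans (Zbar_le_xi point); have /andP[] := Zbar_bounds point.
apply: ge_sup; first by exists (Zbar p point); exists point.
by move=> _ [g _ <-]; have /andP[] := Zbar_bounds g.
Qed.

Lemma xi_gt0 : 0 < xi p.
Proof. by have /andP[h _] := xi_bounds; apply: lt_le_trans h. Qed.

(** After division by [xi] the maximum of [Zb] is 1 and is attained at gamma*. As [xi] lies in
    [lo, 1/lo], the bounds on the weights become lo^2 and lo^(-2), the D used from here on. *)
Definition nphi (psi : W) t : R := psi t / xi p.

Lemma mnphi t : measurable_fun setT (fun psi => nphi psi t).
Proof. by apply: measurable_funM. Qed.

Lemma nphiD (psi : W) t : (lo^-1 ^+ 2)^-1 <= nphi psi t <= lo^-1 ^+ 2.
Proof.
have /andP[h1 h2] := xi_bounds; have /andP[h3 h4] := weight_fun_bound psi t; have x0 := xi_gt0.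
have l0 := ltW lo0; rewrite /nphi expr2 invfM invrK; apply/andP; split; apply: ler_pM => //.
- by rewrite -[leLHS]invrK lef_pV2 ?posrE ?invr_gt0.
- by apply: le_trans h3.
- by rewrite invr_ge0 ltW.
- by rewrite lef_pV2 ?posrE.
Qed.

Lemma D2_ge1 : 1 <= lo^-1 ^+ 2 :> R. Proof. exact: exprn_ege1. Qed.

Lemma Zb_nphi g : Zb p nphi g = Zb p (fun psi t => (psi : W) t) g / xi p.
Proof.
rewrite mulrC /Zb -(ExZ _ (bm_ig p (bm_Zb mW WD D1 g))); congr Ex; apply/funext => psi.
by rewrite mulr_sumr; apply: eq_bigr => t _; rewrite /nphi mulrAC mulrC.
Qed.

Variable gams : PS.
Hypothesis hA : frakA p gams.
Local Notation gam := (pmfv gams).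

Lemma gam_lo z : lo <= gam z. Proof. by case: hA. Qed.
Lemma gam_gt0 z : 0 < gam z. Proof. exact: lt_le_trans (gam_lo z). Qed.

Lemma Zb_gam : Zb p nphi gam = 1.
Proof. by rewrite Zb_nphi -Zbar_Zb; case: hA => _ -> _; rewrite divff// gt_eqF// xi_gt0. Qed.

Lemma stat_gam : stationary p nphi gam.
Proof.
apply: (stationary_max mnphi nphiD D2_ge1 gam_gt0 (sum_pmf gams) _ Zb_gam) => g g0 g1.
rewrite Zb_nphi ler_pdivrMr ?xi_gt0// mul1r; apply: le_trans (Zbar_le_xi (mkPS g)).
rewrite Zbar_Zb le_eqVlt; apply/orP; left; apply/eqP; congr Zb; apply/funext => z.
by rewrite /pmfv pmf_mkPS.
Qed.

End law.
End concrete.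

Lemma Ex_Lambda_scale d (T : measurableType d) (R : realType) (P : probability T R) (c : R) (f : T -> R) :
  0 < c -> bm f -> (forall x, 0 <= f x) ->
  Ex P (fun x => Lambda (c * f x)) = c * Ex P (fun x => Lambda (f x)) + Lambda c * Ex P f.
Proof.
move=> c0 bf f0; rewrite -(ExZ c (bm_ig P (bm_Lambda bf))) -(ExZ (Lambda c) (bm_ig P bf)).
rewrite -(ExD (igZ c (bm_ig P (bm_Lambda bf))) (igZ (Lambda c) (bm_ig P bf))).
by congr Ex; apply/funext => x; rewrite LambdaM.
Qed.

Lemma uw_bound (R : realType) (Q : finType) (gam : Q -> R) (D : R) d (X : measurableType d) (P : probability X R)
  (w : X -> Q -> R) (l L : R) : (forall z, 0 <= gam z) -> \sum_z gam z = 1 -> 1 <= D ->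
  (forall u, measurable_fun setT (fun x => w x u)) -> (forall x u, D^-1 <= w x u <= D) ->
  0 <= l <= L -> `|uw gam P w l| <= 1 + expR (L * D ^+ 2).
Proof.
move=> gam0 gam1 D1 mw wD /andP[l0 lL].
have D0 : 0 < D by apply: lt_le_trans D1.
have D20 : 0 <= D ^+ 2 by rewrite sqr_ge0.
have ge : eg (fun m => 1 + (D ^+ 2) ^+ m) by apply: egD; [exact: eg_cst|exact: eg_pow].
apply: le_trans (_ : Ex (Po l) (fun m => 1 + (D ^+ 2) ^+ m) <= _).
  apply: Ex_abs_le; [exact: ig_eg l0 (eg_Vw gam0 gam1 D1 P mw wD)|exact: ig_eg l0 ge|move=> m].
  rewrite -(Ex_cst (iid m P) (1 + _)); apply: Ex_abs_le.
  - by apply: bm_ig; apply: bm_Lambda; exact: (bm_Vw gam D1 mw wD).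
  - exact: ig_cst.
  move=> x; apply: le_trans (Lambda_bound _) _; rewrite lerD2l exprAC.
  have /andP[h1 h2] := Vw_bounds gam0 gam1 D1 wD x.
  rewrite ler_sqr ?nnegrE ?exprn_ge0 ?(ltW D0)//.
  by apply: le_trans h1; rewrite exprn_ge0// invr_ge0 ltW.
rewrite (ExD (ig_cst _ _) (ig_pow l0 D20)) Ex_cst (Ex_Po_pow l0 D20) lerD2l ler_expR.
by apply: ler_pM => //; [rewrite subr_ge0 exprn_ege1|rewrite lerBlDr lerDl].
Qed.

Lemma lawmap_unif_map d1 d2 (X : measurableType d1) (X' : measurableType d2) (R : realType) (T : X -> X') (s : seq X) :
  measurable_fun setT T -> s != [::] -> lawmap (R := R) T (unif s) (unif (map T s)).
Proof.
move=> mT s0; split=> // f [mf _]; rewrite Ex_unif//; last exact: measurableT_comp mf mT.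
rewrite Ex_unif//; last by case: s s0.
by rewrite size_map big_map.
Qed.

Section side_law.
Context {R : realType} {m : nat} {d d1 d2 : measure_display} {Y : measurableType d} {O1 : measurableType d1} {O2 : measurableType d2}.
Local Notation K := m.+1.
Variables (p : probability Y R) (pi1 : probability O1 R) (pi2 : probability O2 R).
Local Notation X := (Y * 'I_K * K.-tuple O1 * O2)%type.

Definition sel (x : X) : O1 * (Y * 'I_K * O2) := (tnth x.1.2 x.1.1.2, (x.1.1, x.2)).

Lemma bm_sel (f : O1 * (Y * 'I_K * O2) -> R) : bm f -> bm (f \o sel).
Proof.
move=> hf.
have -> : f \o sel = (fun x : X => \sum_h (x.1.1.2 == h)%:R * f (tnth x.1.2 h, (x.1.1, x.2))).
  apply/funext => x; rewrite (bigD1 x.1.1.2)//= eqxx mul1r big1 ?addr0// => i.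
  by rewrite eq_sym => /negPf ->; rewrite mul0r.
have m11 : measurable_fun setT (fun x : X => x.1.1).
  exact: (measurableT_comp measurable_fst measurable_fst).
apply: bm_sum => h; apply: bmM.
  apply: (bm_comp (f := fun u : 'I_K => (u == h)%:R : R)).
    exact: (measurableT_comp measurable_snd m11).
  by split=> //; exists 1 => x; case: eqP => _; rewrite ?normr1// normr0.
apply: bm_comp hf; apply/measurable_fun_pair.
  apply: (measurableT_comp (measurable_tnth h)).
  exact: (measurableT_comp measurable_snd measurable_fst).
by apply/measurable_fun_pair => //; exact: measurable_snd.
Qed.

(** The slot h is independent of the messages, so the h-th of the independent messages is a single
    draw from pi1, independent of everything else. This identifies the mixed term of [nabla] with
    [zM]. *)
Lemma Ex_sel (f : O1 * (Y * 'I_K * O2) -> R) : bm f ->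
  Ex (p \x unif (enum 'I_K) \x iid K pi1 \x pi2)%E (f \o sel) =
  Ex (pi1 \x (p \x unif (enum 'I_K) \x pi2))%E f.
Proof.
move=> hf; set nu := (p \x unif (enum 'I_K))%E.
pose F (z : Y * 'I_K * K.-tuple O1) (o : O2) := f (tnth z.2 z.1.2, (z.1, o)).
have bF : bm (fun x : X => F x.1 x.2) := bm_sel hf.
have E1 : Ex (nu \x iid K pi1 \x pi2)%E (f \o sel) = Ex (nu \x iid K pi1)%E (fun z => Ex pi2 (F z)).
  exact: (Ex_prod_bm (f := F) _ _ bF).
pose H (y : Y * 'I_K) (o1 : O1) := Ex pi2 (fun o => f (o1, (y, o))).
have mS : measurable_fun setT (fun z : (Y * 'I_K) * O1 * O2 => (z.1.2, (z.1.1, z.2))).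
  apply/measurable_fun_pair; first exact: (measurableT_comp measurable_snd measurable_fst).
  apply/measurable_fun_pair; last exact: measurable_snd.
  exact: (measurableT_comp measurable_fst measurable_fst).
have bf1 : bm (fun z : (Y * 'I_K) * O1 * O2 => f (z.1.2, (z.1.1, z.2))) := bm_comp mS hf.
have bH : bm (fun z => H z.1 z.2).
  exact: (bm_Ex (f := fun (z : (Y * 'I_K) * O1) o => f (z.2, (z.1, o))) pi2 bf1).
have b2 : bm (fun z : (Y * 'I_K) * K.-tuple O1 => H z.1 (tnth z.2 z.1.2)) := bm_Ex (f := F) pi2 bF.
rewrite E1 (Ex_prod_bm (f := fun y o => H y (tnth o y.2)) _ _ b2).
transitivity (Ex nu (fun y => Ex pi1 (H y))).
  congr Ex; apply/funext => y; exact: (Ex_iid_tnth pi1 y.2 (bm_sec1 (f := H) bH y)).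
rewrite (Ex_swap_bm (f := H) _ _ bH).
have b3 : bm (fun z : O1 * (Y * 'I_K * O2) => f (z.1, z.2)) by move: hf; congr bm; apply/funext => -[].
have -> : f = (fun z => f (z.1, z.2)) by apply/funext => -[].
rewrite (Ex_prod_bm (f := fun x y => f (x, y)) _ _ b3); congr Ex; apply/funext => o1.
have b4 : bm (fun z : Y * 'I_K * O2 => f (o1, (z.1, z.2))).
  by have := bm_sec1 (f := fun x y => f (x, y)) b3 o1; congr bm; apply/funext => -[].
have -> : (fun y : Y * 'I_K * O2 => f (o1, y)) = (fun z => f (o1, (z.1, z.2))) by apply/funext => -[].
by rewrite (Ex_prod_bm (f := fun x y => f (o1, (x, y))) _ _ b4).
Qed.

End side_law.

(** * The Bethe functional and nabla in normalized weights *)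

Section concrete_functionals.
Context {R : realType} {q k : nat} {lo : R} {hlo : 0 < lo < q.+1%:R^-1}.
Local Notation W := (weight k hlo).
Local Notation Q := ('I_q.+1).
Local Notation PS := (pprobability Q R).
Local Notation K := k.+1.
Local Notation pmf := Defs.pmf.
Variables (p : probability W R) (gams : PS).
Hypothesis hA : frakA p gams.
Local Notation gam := (pmfv gams).
Local Notation D := (lo^-1 ^+ 2).
Local Notation phi := (nphi p).
Local Notation x := (xi p).

Let x0 : 0 < x := xi_gt0 p.
Let xn : x != 0. Proof. by rewrite gt_eqF. Qed.
Let D1 : 1 <= D := D2_ge1 (hlo := hlo).
Let D0 : 0 < D. Proof. exact: lt_le_trans D1. Qed.
Let mphi := mnphi p.
Let phiD := nphiD p.
Let hg := @pmfs_pmf R q.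
Let gam0 z : 0 <= gam z := pmf_ge0 gams z.
Let gam1 : \sum_z gam z = 1 := sum_pmf gams.
Let stat := stat_gam hA.
Let K0 : K%:R != 0 :> R. Proof. by rewrite pnatr_eq0. Qed.

Lemma Zf_Zg (z : W * K.-tuple PS) : Zf z.1 z.2 = x * Zg phi pmfv z.
Proof.
rewrite /Zg mulr_sumr; apply: eq_bigr => t _; rewrite /nphi mulrA; congr (_ * _).
by rewrite mulrC divfK.
Qed.

Lemma side_Wg (psi : W) h (g : K.-tuple PS) u :
  \sum_(tau : K.-tuple Q | tnth tau h == u) psi tau * \prod_(h' < K | h' != h) pmf (tnth g h') (tnth tau h') =
  x * Wg phi pmfv ((psi, h), g) u.
Proof.
rewrite -(side_sum (fun t => psi t) (g := fun i => pmfv (tnth g i)) _ (sum_pmf _)).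
rewrite /Wg mulr_sumr; apply: eq_bigr => t _; rewrite /nphi mulrA; congr (_ * _).
by rewrite mulrC divfK.
Qed.

Lemma Zfm_Wg (psi : W) h (g g' : K.-tuple PS) :
  Zfm psi h g g' = x * \sum_u Wg phi pmfv ((psi, h), g') u * pmfv (tnth g h) u.
Proof.
rewrite /Zfm (eq_bigr (fun tau => (psi tau * \prod_(h' < K | h' != h) pmf (tnth g' h') (tnth tau h')) * pmfv (tnth g h) (tnth tau h))); last first.
  by move=> tau _; rewrite mulrAC.
rewrite sum_tuple_side mulr_sumr; apply: eq_bigr => u _.
by rewrite side_Wg mulrCA [_ * pmfv _ _]mulrC mulrCA.
Qed.

Section mean.
Variables (pi : probability PS R).
Hypothesis hpi : mean_eq gams pi.

Let hmean z : Ex pi (fun o => pmfv o z) = gam z. Proof. exact: hpi. Qed.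

Lemma Ex_Zg : Ex (p \x iid K pi)%E (Zg phi pmfv) = 1.
Proof.
pose f (y : W) (o : K.-tuple PS) := \sum_t phi y t * \prod_h pmfv (tnth o h) (tnth t h).
have bf : bm (fun z => f z.1 z.2) := bm_Zg mphi phiD D1 hg.
apply: etrans (Ex_prod_bm (f := f) p (iid K pi) bf) _.
rewrite -(Zb_gam hA) /Zb; congr Ex; apply/funext => y.
rewrite /f Ex_sum; last by move=> t; apply: bm_ig; apply: bmM; [exact: bm_cst|exact: bm_prod_pmfs].
by apply: eq_bigr => t _; rewrite (ExZ _ (bm_ig _ (bm_prod_pmfs t hg))) (Ex_prod_pmfs hg hmean).
Qed.

Let Zg0 z : 0 <= Zg phi pmfv z.
Proof. by have /andP[h _] := Zg_bounds phiD z hg; apply: le_trans h; rewrite invr_ge0 ltW. Qed.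

Lemma Ex_Lambda_Zf : Ex (p \x iid K pi)%E (fun z => Lambda (Zf z.1 z.2)) = x * zP p phi pi pmfv + Lambda x.
Proof.
rewrite (_ : (fun z => _) = (fun z => Lambda (x * Zg phi pmfv z))); last first.
  by apply/funext => z; rewrite Zf_Zg.
by rewrite (Ex_Lambda_scale _ x0 (bm_Zg mphi phiD D1 hg) Zg0) Ex_Zg mulr1.
Qed.

Lemma bm_Lambda_Zf : bm (fun z : W * K.-tuple PS => Lambda (Zf z.1 z.2)).
Proof.
rewrite (_ : (fun z => _) = (fun z => Lambda (x * Zg phi pmfv z))); last first.
  by apply/funext => z; rewrite Zf_Zg.
by apply: bm_Lambda; apply: bmZ; exact: (bm_Zg mphi phiD D1 hg).
Qed.

(** The factor xi pulled out of the weights contributes d ln xi through the vertex term and -(d k /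
    K) ln xi through the edge term, in total (d / K) ln xi. *)
Definition betheR (d : R) : R := uP p phi gam pi pmfv d - d * k%:R / K%:R * zP p phi pi pmfv + d / K%:R * ln x.

Let Xt := (W * 'I_K * K.-tuple PS)%type.

Lemma Zv_Vw m (y : m.-tuple Xt) : Zv gams y = x ^+ m * Vw gam (Wg phi pmfv) y.
Proof.
rewrite /Zv /Vw mulr_sumr; apply: eq_bigr => u _; rewrite mulrCA; congr (_ * _).
rewrite -[m in x ^+ m]card_ord -prodr_const -big_split/=; apply: eq_bigr => a _.
by case: (tnth y a) => -[psi h] g; rewrite side_Wg.
Qed.

Let P : probability Xt R := PW (k := k) p pi.
Let mWg u : measurable_fun setT (fun z : Xt => Wg phi pmfv z u) := (bm_Wg mphi phiD D1 u hg).1.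
Let WgD (z : Xt) u : D^-1 <= Wg phi pmfv z u <= D := Wg_bounds phiD z u hg.
Let bV m : bm (fun y : m.-tuple Xt => Vw gam (Wg phi pmfv) y) := bm_Vw gam D1 mWg WgD m.

Lemma Ex_Vw m : Ex (iid m P) (fun y => Vw gam (Wg phi pmfv) y) = 1.
Proof.
have bw u := bm_Wg mphi phiD D1 u hg.
have bp u : bm (fun y : m.-tuple Xt => \prod_j Wg phi pmfv (tnth y j) u).
  by apply: bm_prod => j; apply: (bm_tnth j (f := fun z => Wg phi pmfv z u)); exact: bw.
rewrite /Vw Ex_sum; last by move=> u; apply: bm_ig; apply: bmZ; exact: bp.
rewrite -[RHS]gam1; apply: eq_bigr => u _; rewrite (ExZ _ (bm_ig _ (bp u))).
rewrite (Ex_iid_prod P m (f := fun z => Wg phi pmfv z u) (bw u)).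
by rewrite (Ex_Wg mphi phiD D1 hg hmean stat) expr1n mulr1.
Qed.

Lemma Ex_Lambda_Zv m : (\int[iid m P]_y ((x ^+ m)^-1 * Lambda (Zv gams y))%:E)%E =
  (Ex (iid m P) (fun y => Lambda (Vw gam (Wg phi pmfv) y)) + m%:R * ln x)%:E.
Proof.
have xm : 0 < x ^+ m by rewrite exprn_gt0.
have V0 (y : m.-tuple Xt) : 0 <= Vw gam (Wg phi pmfv) y.
  have /andP[h _] := Vw_bounds gam0 gam1 D1 WgD y; apply: le_trans h.
  by rewrite exprn_ge0// invr_ge0 ltW.
(* The normalization by [xi p ^+ d'] in [bethe] cancels the scale of Zv, up to m ln x times a
   quantity of mean 1. *)
have E : (fun y : m.-tuple Xt => (x ^+ m)^-1 * Lambda (Zv gams y)) =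
   (fun y => Lambda (Vw gam (Wg phi pmfv) y) + m%:R * ln x * Vw gam (Wg phi pmfv) y).
  apply/funext => y; rewrite Zv_Vw LambdaM// mulrDr mulKf ?gt_eqF// mulrA; congr (_ + _ * _).
  by rewrite /Lambda mulKf ?gt_eqF// lnXn// mulr_natl.
have b1 := bm_Lambda (bV m).
transitivity (\int[iid m P]_y (Lambda (Vw gam (Wg phi pmfv) y) + m%:R * ln x * Vw gam (Wg phi pmfv) y)%:E)%E.
  by apply: eq_integral => y _; congr EFin; exact: (congr1 (fun f => f y) E).
rewrite EFin_Ex; last by apply: bm_ig; apply: bmD b1 (bmZ _ (bV m)).
by rewrite (ExD (bm_ig _ b1) (igZ _ (bm_ig _ (bV m)))) (ExZ _ (bm_ig _ (bV m))) Ex_Vw mulr1.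
Qed.

Lemma bethe_betheR d : 0 <= d -> bethe p gams d pi = (betheR d)%:E.
Proof.
move=> d0; rewrite /bethe; under eq_integral do rewrite Ex_Lambda_Zv.
have e1 := eg_Vw gam0 gam1 D1 P mWg WgD.
have e2 : eg (fun m => m%:R * ln x) by apply: egM; [exact: eg_nat|exact: eg_cst].
rewrite EFin_Ex; last exact: ig_eg d0 (egD e1 e2).
rewrite EFin_Ex; last exact: bm_ig bm_Lambda_Zf.
rewrite Ex_Lambda_Zf -EFinM -EFinB; congr EFin.
rewrite (ExD (ig_eg d0 e1) (ig_eg d0 e2)).
have -> : Ex (Po d) (fun m => m%:R * ln x) = ln x * d.
  by under eq_fun do rewrite mulrC; rewrite (ExZ _ (ig_eg d0 (@eg_nat R))) Ex_Po_nat.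
rewrite /betheR -/(uw gam P (Wg phi pmfv) d) -/(uP p phi gam pi pmfv d) /Lambda.
move: (uP _ _ _ _ _ _) (zP _ _ _ _) => u z.
have -> : K%:R - 1 = k%:R :> R by rewrite -natr1 addrK.
have Kk : K%:R = k%:R + 1 :> R by rewrite natr1.
move: (ln x) (k%:R : R) (K%:R : R) K0 Kk x0 xn => l kk KK h e; rewrite e in h *; move: x => y _ hy.
by field; rewrite h hy.
Qed.

Lemma betheR_bound d L : 0 <= d -> d * K%:R <= L -> `|uP p phi gam pi pmfv d| <= 1 + expR (L * D ^+ 2) /\
  `|betheR d| <= (1 + expR (L * D ^+ 2)) + L * (1 + D ^+ 2) + L * (2 * lo^-1).
Proof.
move=> d0 dL; have dL1 : d <= L by apply: le_trans dL; rewrite ler_peMr// ler1n.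
have dd : 0 <= d <= L by rewrite d0.
have L0 : 0 <= L by apply: le_trans dL1.
have h1 : `|uP p phi gam pi pmfv d| <= 1 + expR (L * D ^+ 2) := uw_bound P gam0 gam1 D1 mWg WgD dd.
split=> //; apply: le_trans (ler_normD _ _) _; apply: lerD.
  apply: le_trans (ler_normB _ _) _; apply: lerD => //; rewrite normrM; apply: ler_pM => //.
    rewrite ger0_norm; last by rewrite divr_ge0// mulr_ge0.
    rewrite ler_pdivrMr ?ltr0n//; apply: ler_pM => //; by rewrite ler_nat.
  rewrite -(Ex_cst (p \x iid K pi)%E (1 + _)); apply: Ex_abs_le.
  - by apply: bm_ig; apply: bm_Lambda; exact: (bm_Zg mphi phiD D1 hg).
  - exact: ig_cst.
  move=> z; apply: le_trans (Lambda_bound _) _; rewrite lerD2l ler_sqr ?nnegrE ?(ltW D0)//.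
  by have /andP[] := Zg_bounds phiD z hg.
rewrite normrM; apply: ler_pM => //.
  rewrite ger0_norm; last by rewrite divr_ge0.
  by rewrite ler_pdivrMr ?ltr0n//; apply: le_trans dL1 _; rewrite ler_peMr// ler1n.
have /andP[l1 l2] := xi_bounds p; apply: le_trans (ln_abs_le x0) _.
rewrite [2 * _]mulrDl mul1r; apply: lerD => //.
by rewrite lef_pV2 ?posrE//; have /andP[] := hlo.
Qed.

End mean.

(** Each of the three partition sums has mean xi, so rescaling adds [Lambda x] to each mean; these
    terms cancel because 1 + k - K = 0. *)
Lemma nabla_zM (pi1 pi2 : probability PS R) : mean_eq gams pi1 -> mean_eq gams pi2 ->
  nabla p pi1 pi2 = x * (zP p phi pi1 pmfv + k%:R * zP p phi pi2 pmfv - K%:R * zM p phi pi1 pmfv pi2 pmfv).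
Proof.
move=> h1 h2.
pose mu := (p \x unif (enum 'I_K) \x iid K pi1 \x iid K pi2)%E.
have T1 : lawmap (fun y => (y.1.1.1, y.1.2)) mu (p \x iid K pi1)%E.
  exact: (lawmap_comp (lawmap_fst _ (iid K pi2)) (lawmap_prod (lawmap_fst p (unif (enum 'I_K))) (lawmap_id (iid K pi1)))).
have T2 : lawmap (fun y => (y.1.1.1, y.2)) mu (p \x iid K pi2)%E.
  exact: (lawmap_prod (lawmap_comp (lawmap_fst _ (iid K pi1)) (lawmap_fst p (unif (enum 'I_K)))) (lawmap_id (iid K pi2))).
have bM : bm (fun z : PS * (W * 'I_K * K.-tuple PS) => \sum_u Wg phi pmfv z.2 u * pmfv z.1 u) := bm_zM mphi phiD D1 hg hg.
have M0 (z : PS * (W * 'I_K * K.-tuple PS)) : 0 <= \sum_u Wg phi pmfv z.2 u * pmfv z.1 u.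
  have /andP[h _] := zM_bounds phiD z hg hg; apply: le_trans h; by rewrite invr_ge0 ltW.
pose F1 (y : W * 'I_K * K.-tuple PS * K.-tuple PS) := Lambda (Zf y.1.1.1 y.1.2).
pose F2 (y : W * 'I_K * K.-tuple PS * K.-tuple PS) := Lambda (Zf y.1.1.1 y.2).
pose F3 (y : W * 'I_K * K.-tuple PS * K.-tuple PS) := Lambda (Zfm y.1.1.1 y.1.1.2 y.1.2 y.2).
pose G (z : PS * (W * 'I_K * K.-tuple PS)) := Lambda (x * \sum_u Wg phi pmfv z.2 u * pmfv z.1 u).
have F3E : F3 = G \o @sel k _ _ _ W PS (K.-tuple PS).
  by apply/funext => -[[[psi h] g] g']; rewrite /F3 /G /= Zfm_Wg.
have bG : bm G by apply: bm_Lambda; apply: bmZ.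
have b1 : bm F1 := bm_comp T1.1 bm_Lambda_Zf.
have b2 : bm F2 := bm_comp T2.1 bm_Lambda_Zf.
have b3 : bm F3 by rewrite F3E; exact: bm_sel.
have E1 : Ex mu F1 = x * zP p phi pi1 pmfv + Lambda x.
  by rewrite -(Ex_Lambda_Zf h1) -(T1.2 _ bm_Lambda_Zf).
have E2 : Ex mu F2 = x * zP p phi pi2 pmfv + Lambda x.
  by rewrite -(Ex_Lambda_Zf h2) -(T2.2 _ bm_Lambda_Zf).
have E3 : Ex mu F3 = x * zM p phi pi1 pmfv pi2 pmfv + Lambda x.
  rewrite F3E (Ex_sel p pi1 (iid K pi2) bG) (Ex_Lambda_scale _ x0 bM M0); congr (_ + _).
  rewrite -[RHS]mulr1; congr (_ * _).
  have bt u : bm (fun z : PS * (W * 'I_K * K.-tuple PS) => pmfv z.1 u * Wg phi pmfv z.2 u).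
    apply: bmM; first exact: (bm_comp measurable_fst (bm_pmfs u hg)).
    exact: (bm_comp measurable_snd (bm_Wg mphi phiD D1 u hg)).
  transitivity (\sum_u Ex (pi1 \x PW (k := k) p pi2)%E (fun z => pmfv z.1 u * Wg phi pmfv z.2 u)).
    rewrite -Ex_sum; last by move=> u; exact: bm_ig.
    by congr Ex; apply/funext => z; apply: eq_bigr => u _; rewrite mulrC.
  rewrite -[RHS]gam1; apply: eq_bigr => u _.
  rewrite (Ex_prod_bm (f := fun o z => pmfv o u * Wg phi pmfv z u) _ _ (bt u)).
  transitivity (Ex pi1 (fun o => pmfv o u)); last exact: h1.
  congr Ex; apply/funext => o; rewrite (ExZ _ (bm_ig _ (bm_Wg mphi phiD D1 u hg))).
  by rewrite (Ex_Wg mphi phiD D1 hg h2 stat) mulr1.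
have -> : nabla p pi1 pi2 = Ex mu (fun y => F1 y + (K%:R - 1) * F2 y - K%:R * F3 y).
  by congr Ex; apply/funext => -[[[psi h] g] g'].
rewrite (ExB (igD (bm_ig mu b1) (igZ _ (bm_ig mu b2))) (igZ _ (bm_ig mu b3))).
rewrite (ExD (bm_ig mu b1) (igZ _ (bm_ig mu b2))) (ExZ _ (bm_ig mu b2)) (ExZ _ (bm_ig mu b3)) E1 E2 E3.
have -> : K%:R - 1 = k%:R :> R by rewrite -natr1 addrK.
have -> : K%:R = k%:R + 1 :> R by rewrite natr1.
by move: (zP _ _ pi1 _) (zP _ _ pi2 _) (zM _ _ _ _ _ _) => u v w; ring.
Qed.

Section site.
Variables (n : nat) (a : n.+1.-tuple Q -> R).
Hypotheses (a0 : nn a) (A0 : 0 < mass a).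
Local Notation uV := (unif (R := R) (enum 'I_n.+1)).
Local Notation gf := (gfix gam lo a).

Let lo01 : 0 < lo <= 1.
Proof.
have /andP[l0 /ltW h] := hlo; rewrite l0; apply: le_trans h _.
by rewrite invf_le1 ?ltr0n// ler1n.
Qed.
Let hf : pmfs gf := pmfs_gfix lo01 (gam_lo hA) gam1 a0 A0.
Let T (v : 'I_n.+1) : PS := mkPS (gf v).

(** The law of the corrected marginal at a random vertex. Its mean is exactly gamma*, so it competes
    in the supremum defining [bethe_sup] and is admissible in the condition on nabla. *)
Definition pi_site : probability PS R := unif (map (fun v => mkPS (gf v)) (enum 'I_n.+1)).

Let hT : lawmap T uV pi_site.
Proof. by apply: lawmap_unif_map => //; exact: (enum_neq0 (ord0 : 'I_n.+1)). Qed.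

Let gfT v z : gf v z = pmfv (T v) z.
Proof. by case: hf => _ g0 g1; rewrite /pmfv pmf_mkPS. Qed.

Lemma mean_pi_site : mean_eq gams pi_site.
Proof.
move=> z; apply: etrans (_ : Ex pi_site (fun o => pmfv o z) = _) _ => //.
case: hT => _ h; rewrite -(h _ (bm_pmfs z hg)) -/(gam z).
rewrite -(mean_gfix gam lo a z).
by congr Ex; apply/funext => v; rewrite gfT.
Qed.

Lemma site_upper dd : uP p phi gam uV gf dd - dd * k%:R / K%:R * zP p phi uV gf =
  uP p phi gam pi_site pmfv dd - dd * k%:R / K%:R * zP p phi pi_site pmfv.
Proof.
by rewrite (uP_map p gam mphi phiD D1 hT hg gfT) (zP_map p mphi phiD D1 hT hg gfT).
Qed.

Lemma site_nabla (pi : probability PS R) : mean_eq gams pi ->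
  0 <= zP p phi uV gf + k%:R * zP p phi pi pmfv - K%:R * zM p phi uV gf pi pmfv.
Proof.
move=> h; rewrite (zP_map p mphi phiD D1 hT hg gfT) (zM_map p mphi phiD D1 hT hg gfT pi hg).
have := nabla_zM mean_pi_site h; case: hA => _ _ hn; have := hn _ _ mean_pi_site h.
by move=> h1 h2; rewrite h2 pmulr_rge0 in h1.
Qed.

End site.
End concrete_functionals.

(** * Mutual information *)

Section density.
Context d (T : measurableType d) (R : realType).
Variables (mu nu : probability T R) (rho : T -> R).
Hypotheses (mrho : measurable_fun setT rho) (rho0 : forall x, 0 <= rho x)
  (nuE : forall A, measurable A -> nu A = (\int[mu]_(x in A) (rho x)%:E)%E).

Lemma density_dominates : nu `<< mu.
Proof.
apply/null_content_dominatesP => A mA A0; rewrite nuE//.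
apply: null_set_integral => //; apply: measurable_funTS; exact/measurable_EFinP.
Qed.

(** The Radon-Nikodym derivative and rho have the same integrals over all measurable sets, so they
    agree almost everywhere, and the change of variables carries over to rho. *)
Lemma ge0_integral_density (f : T -> \bar R) : measurable_fun setT f -> (forall x, (0 <= f x)%E) ->
  (\int[nu]_x f x = \int[mu]_x (f x * (rho x)%:E))%E.
Proof.
move=> mf f0; have dom := density_dominates.
have fi := Radon_Nikodym_SigmaFinite.f_integrable dom.
rewrite -(Radon_Nikodym_SigmaFinite.change_of_variables dom f0 measurableT mf).
have mr : measurable_fun setT (EFin \o rho) by exact/measurable_EFinP.
apply: ae_eq_integral => //.
- by apply: emeasurable_funM => //; exact: measurable_int fi.
- exact: emeasurable_funM.
apply: ae_eqe_mul2l; apply: integral_ae_eq => // A _ mA.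
exact: etrans (esym (Radon_Nikodym_SigmaFinite.f_integral dom mA)) (nuE mA).
Qed.

Lemma integral_density (f : T -> R) : measurable_fun setT f ->
  (\int[nu]_x (f x)%:E = \int[mu]_x (f x * rho x)%:E)%E.
Proof.
move=> mf; have mf' : measurable_fun setT (EFin \o f) by exact/measurable_EFinP.
rewrite integralE [RHS]integralE; congr (_ - _)%E.
- rewrite ge0_integral_density//; last exact: measurable_funepos.
  apply: eq_integral => x _; rewrite !funeposE /= -!EFin_max -EFinM maxr_pMl//.
  by rewrite mul0r.
- rewrite ge0_integral_density//; last exact: measurable_funeneg.
  apply: eq_integral => x _; rewrite !funenegE /= -!EFin_max -EFinM maxr_pMl//.
  by rewrite mul0r mulNr.
Qed.

End density.

Section entropy.
Context d (T : measurableType d) (R : realType).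
Variables (mu P1 P2 : probability T R) (r1 r2 : T -> R).
Hypotheses (m1 : measurable_fun setT r1) (m2 : measurable_fun setT r2)
  (r10 : forall x, 0 <= r1 x) (r20 : forall x, 0 < r2 x)
  (E1 : forall A, measurable A -> P1 A = (\int[mu]_(x in A) (r1 x)%:E)%E)
  (E2 : forall A, measurable A -> P2 A = (\int[mu]_(x in A) (r2 x)%:E)%E).

Lemma densities_dominate : P1 `<< P2.
Proof.
apply: null_dominates_trans (density_dominates m1 E1) _.
apply/null_content_dominatesP => A mA A0'; have A0 := etrans (esym (E2 mA)) A0'.
have mrA : measurable_fun A (EFin \o r2) by apply: measurable_funTS; exact/measurable_EFinP.
(* As r2 is positive everywhere, its vanishing almost everywhere on A means that A itself is null
   for mu. *)
have /ae_eq_integral_abs h : (\int[mu]_(x in A) `|(r2 x)%:E| = 0)%E.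
  by rewrite -A0; apply: eq_integral => x _ /=; rewrite ger0_norm// ltW.
have := h mA mrA; case=> N [mN N0 sub].
apply: (subset_measure0 mA mN _ N0) => x Ax; apply: sub => /= hx.
by have := hx Ax; case=> /eqP; rewrite gt_eqF.
Qed.

(** The derivative of P1 with respect to P2 is r1 / r2, P2-almost everywhere and thus P1-almost
    everywhere by domination; integrals against P1 are then rewritten against mu. *)
Lemma relative_entropy_densities : relative_entropy P1 P2 = (\int[mu]_x (r1 x * ln (r1 x / r2 x))%:E)%E.
Proof.
have dom := densities_dominate.
rewrite /relative_entropy asboolT//.
set RN := Radon_Nikodym _ _.
have mr : measurable_fun setT (fun x => r1 x / r2 x).
  have -> : (fun x => r1 x / r2 x) = (fun x => r1 x * expR (- ln (r2 x))).
    by apply/funext => x; rewrite expRN lnK ?posrE.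
  apply: measurable_funM => //; apply: measurableT_comp; first exact: measurable_expR.
  by apply: measurable_funN; exact: measurableT_comp (@measurable_ln R) m2.
have iRN : P2.-integrable setT RN by apply: Radon_Nikodym_integrable; exact: dom.
have ae : ae_eq P2 setT RN (fun x => (r1 x / r2 x)%:E).
  apply: integral_ae_eq => //; first exact/measurable_EFinP.
  move=> A _ mA; rewrite -Radon_Nikodym_integral//= E1//.
  rewrite [RHS]integral_mkcond (ge0_integral_density m2 E2).
  - rewrite integral_mkcond; apply: eq_integral => x _; rewrite !patchE.
    by case: ifP => _; rewrite ?mul0e// -EFinM divfK// gt_eqF.
  - by apply/(measurable_restrictT _ _).1 => //; apply: measurable_funTS; exact/measurable_EFinP.
  - by move=> x; apply: erestrict_ge0 => y _; rewrite lee_fin divr_ge0// ltW.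
have mln (f : T -> R) : measurable_fun setT f -> measurable_fun setT (fun x => ln (f x)).
  by move=> mf; exact: measurableT_comp (@measurable_ln R) mf.
have mfin : measurable_fun setT (fun x => fine (RN x)).
  by apply: measurableT_comp => //; exact: measurable_int iRN.
transitivity (\int[P1]_x (ln (r1 x / r2 x))%:E)%E.
  apply: ae_eq_integral => //; try by apply/measurable_EFinP; exact: mln.
  have := null_dominates_ae_eq measurableT dom ae; apply: filterS => x h /h ->.
  by [].
rewrite (integral_density m1 r10 E1); last exact: mln.
by apply: eq_integral => x _; rewrite mulrC.
Qed.

End entropy.

(** * Densities of the joint law and of the product of its marginals *)

Section graph_law.
Context {R : realType} {q k : nat} {lo : R} {hlo : 0 < lo < q.+1%:R^-1}.
Local Notation W := (weight k hlo).
Local Notation Q := ('I_q.+1).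
Local Notation PS := (pprobability Q R).
Local Notation K := k.+1.
Variables (p : probability W R) (gams : PS) (n : nat) (l : R).
Hypothesis l0 : 0 <= l.
Local Notation gam := (pmfv gams).
Local Notation D := (lo^-1 ^+ 2).
Local Notation phi := (nphi p).
Local Notation S := (n.+1.-tuple Q).
Local Notation G m := (m.-tuple (K.-tuple 'I_n.+1 * W)).
Local Notation graph := (@Defs.graph R q k lo hlo n).
Local Notation P m := (iid m (site n K p)).
Local Notation Pg := (iid n.+1 (gams : probability Q R)).

Let D1 : 1 <= D := D2_ge1 (hlo := hlo).
Let D0 : 0 < D. Proof. exact: lt_le_trans D1. Qed.
Let mphi := mnphi p.
Let phiD := nphiD p.
Let gam0 z : 0 <= gam z := pmf_ge0 gams z.
Let gam1 : \sum_z gam z = 1 := sum_pmf gams.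

Lemma Ex_iid_finite m (f : m.-tuple Q -> R) :
  Ex (iid m (gams : probability Q R)) f = \sum_s (\prod_i gam (tnth s i)) * f s.
Proof.
have bf m' (g : m'.-tuple Q -> R) : bm g.
  split; first by move=> _ Z _; exact: measurable_tuple_ord.
  by exists (\sum_i `|g i|) => x; rewrite (bigD1 x)//= lerDl sumr_ge0.
elim: m f => [|m IH] f; first by rewrite (Ex_iid0 _ (bf _ f).1) sum_tuple0 big_ord0 mul1r.
rewrite (Ex_iidS _ (bf _ f)) Ex_finite sum_tupleS; apply: eq_bigr => z _.
rewrite IH mulr_suml; apply: eq_bigr => s _; rewrite big_ord_recl tnth_cons0.
rewrite [in RHS](eq_bigr (fun i => gam (tnth s i))); last by move=> i _; rewrite tnth_consS.
by rewrite /pmfv; ring.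
Qed.

Lemma measurable_sections d (T : measurableType d) d' (T' : measurableType d') (f : S * T -> T') :
  (forall s, measurable_fun setT (fun t => f (s, t))) -> measurable_fun setT f.
Proof.
move=> h _ B mB; rewrite setTI.
rewrite (_ : _ @^-1` _ = \bigcup_(s in setT) ([set s] `*` ((fun t => f (s, t)) @^-1` B))); last first.
  apply/seteqP; split => [[s t] /= Bt|[s t] [s' _ [/= hs Bt]]]; first by exists s.
  by rewrite /= hs.
apply: fin_bigcup_measurable => // s _; apply: measurableX; first exact: measurable_tuple_ord.
by rewrite -[X in measurable X]setTI; exact: h.
Qed.

Lemma measurable_graph d (T : measurableType d) (f : graph -> T) :
  (forall m, measurable_fun setT (fun x : G m => f (mkgraph x))) -> measurable_fun setT f.
Proof.
move=> h _ B mB; rewrite setTI; suff : graph_measurable (f @^-1` B) by [].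
move=> m; rewrite -[X in measurable X]setTI.
exact: (h m measurableT B mB).
Qed.

Definition mkpair m (y : S * G m) : S * graph := (y.1, mkgraph y.2).

Lemma measurable_mkgraph m : measurable_fun setT (@mkgraph R q k lo hlo n m).
Proof. by move=> _ Y mY; rewrite setTI; exact: mY. Qed.

Fact measurable_mkpair m : measurable_fun setT (@mkpair m).
Proof.
apply/measurable_fun_pair; first exact: measurable_fst.
exact: (measurableT_comp (@measurable_mkgraph m) measurable_snd).
Qed.

HB.instance Definition _ m := @isMeasurableFun.Build _ _ _ _ (@mkpair m) (@measurable_mkpair m).

(** Graphs with m factors form the m-th component of a disjoint union, so the law is a
    Poisson-weighted series of images. Its total mass is 1, so normalizing it only supplies the type
    [probability]. *)
Let base_series : {measure set (S * graph) -> \bar R} :=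
  mseries (fun m => mscale (NngNum (pw_ge0 m l0)) (distribution (Pg \x P m)%E (@mkpair m))) 0.

(* the independent pair of prior spins and a null-model graph, with respect to
   which both laws in the mutual information have explicit densities *)
Definition base : probability (S * graph)%type R := mnormalize base_series (dirac point).

Let series_int (f : S * graph -> \bar R) : measurable_fun setT f -> (forall x, (0 <= f x)%E) ->
  (\int[base_series]_x f x = \int[Po l]_m \int[Pg \x P m]_y f (mkpair y))%E.
Proof.
move=> mf f0; rewrite /base_series ge0_integral_measure_series// (ge0_integral_Po l0); last first.
  by move=> m; apply: integral_ge0.
apply: eq_eseriesr => m _; rewrite ge0_integral_mscale//; congr (_ * _)%E.
by rewrite ge0_integral_distribution.
Qed.

Let series1 : base_series setT = 1%:E.
Proof.
transitivity (\int[base_series]_x (cst 1%E) x)%E; first by rewrite integral_cst// mul1e.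
have c0 (y : S * graph) : (0 <= cst 1%E y :> \bar R)%E by exact: lee01.
rewrite (series_int (measurable_cst _) c0).
rewrite (eq_integral (cst 1%E)) => [|m _]; rewrite integral_cst// mul1e; exact: probability_setT.
Qed.

Lemma ge0_integral_base (f : S * graph -> \bar R) : measurable_fun setT f -> (forall x, (0 <= f x)%E) ->
  (\int[base]_x f x = \int[Po l]_m \int[Pg \x P m]_y f (mkpair y))%E.
Proof.
move=> mf f0; rewrite -(series_int mf f0); apply: eq_measure_integral => A mA _.
apply: etrans (mnormalizeE _ A series1 (oner_neq0 _)) _.
by rewrite invr1 mule1.
Qed.

Definition rho_of m (s : S) (x : G m) : R := \prod_j wT p phi (tnth x j) s.
Definition mix_of m (x : G m) : R := \sum_s P0 gam s * rho_of s x.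

(** [jdens] is the density of the joint law with respect to [base], [mixd] that of the product of
    the marginals. The latter depends on the graph only, as the spins keep their prior law. *)
Definition jdens (y : S * graph) : R := rho_of y.1 (projT2 y.2).
Definition mixd (y : S * graph) : R := mix_of (projT2 y.2).

Let bm_wT (s : S) : bm (fun x => wT p phi x s).
Proof.
split; first exact: (measurable_wT p mphi phiD D1 s).
exists (D ^+ 2) => x; have /andP[h1 h2] := wT_bounds p mphi phiD D1 x s.
by rewrite ger0_norm//; apply: le_trans h1; rewrite invr_ge0 sqr_ge0.
Qed.

Lemma bm_rho_of m s : bm (fun x : G m => rho_of s x).
Proof. by apply: bm_prod => j; exact: (bm_tnth j (bm_wT s)). Qed.

Lemma bm_mix_of m : bm (@mix_of m).
Proof. by apply: bm_sum => s; apply: bmZ; exact: bm_rho_of. Qed.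

Lemma rho_of_bounds m s (x : G m) : (D ^+ 2)^-1 ^+ m <= rho_of s x <= (D ^+ 2) ^+ m.
Proof.
apply: prod_bounds => [|j]; last exact: (wT_bounds p mphi phiD D1).
exact: exprn_ege1.
Qed.

Lemma mix_of_bounds m (x : G m) : (D ^+ 2)^-1 ^+ m <= mix_of x <= (D ^+ 2) ^+ m.
Proof.
by apply: conv_bounds => [s||s]; [exact: P0_ge0|exact: (mass_P0 gam1)|exact: rho_of_bounds].
Qed.

Let low0 m : 0 < (D ^+ 2)^-1 ^+ m. Proof. by rewrite exprn_gt0// invr_gt0 exprn_gt0. Qed.

Lemma rho_of_gt0 m s (x : G m) : 0 < rho_of s x.
Proof. by have /andP[h _] := rho_of_bounds s x; exact: lt_le_trans h. Qed.

Lemma mix_of_gt0 m (x : G m) : 0 < mix_of x.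
Proof. by have /andP[h _] := mix_of_bounds x; exact: lt_le_trans h. Qed.

Lemma measurable_jdens : measurable_fun setT jdens.
Proof.
apply: measurable_sections => s; apply: measurable_graph => m.
exact: (bm_rho_of m s).1.
Qed.

Lemma measurable_mixd : measurable_fun setT mixd.
Proof.
apply: measurable_sections => s; apply: measurable_graph => m.
exact: (bm_mix_of m).1.
Qed.

Lemma Ex_wT s : Ex (site n K p) (fun x => wT p phi x s) = 1.
Proof. exact: (wmean_wT p mphi phiD D1 s). Qed.

Lemma Ex_rho_of m s : Ex (P m) (fun x => rho_of s x) = 1.
Proof. by rewrite /rho_of (Ex_iid_prod _ m (bm_wT s)) Ex_wT expr1n. Qed.

Lemma Ex_spin_rho m (x : G m) : Ex Pg (fun s => rho_of s x) = mix_of x.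
Proof. exact: Ex_iid_finite. Qed.

Let zb (s : S) : 0 < zeta p phi s.
Proof.
have /andP[h _] := Zb_bounds p mphi phiD D1 (emp_ge0 s) (sum_emp s).
by apply: lt_le_trans h; rewrite invr_gt0.
Qed.

Lemma psiG_rho m (x : G m) s : psiG x s = (xi p * zeta p phi s) ^+ m * rho_of s x.
Proof.
have xz : xi p * zeta p phi s != 0 by rewrite mulf_neq0 ?gt_eqF ?xi_gt0.
rewrite -[m in _ ^+ m]card_ord -prodr_const -big_split/=; apply: eq_bigr => j _.
rewrite /wT /wF /nphi -[LHS](divfK xz) mulrC; congr (_ * _).
by rewrite invfM mulrA.
Qed.

(** [psiG] is [rho_of] times a constant given s, the m-th power of the mean factor weight, and this
    constant is precisely the normalizing expectation. *)
Lemma teacher_studentE m s A : measurable A ->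
  (teacher_student p s A = \int[P m]_(x in A) (rho_of s x)%:E)%E.
Proof.
move=> mA; apply: eq_integral => x _; congr EFin.
have c0 : (xi p * zeta p phi s) ^+ m != 0 by rewrite expf_neq0// mulf_neq0 ?gt_eqF ?xi_gt0.
have -> : (\int[null_model p n m]_H psiG H s)%R = (xi p * zeta p phi s) ^+ m.
  transitivity (Ex (P m) (fun x => (xi p * zeta p phi s) ^+ m * rho_of s x)).
    by congr Ex; apply/funext => y; exact: psiG_rho.
  by rewrite (ExZ _ (bm_ig _ (bm_rho_of m s))) Ex_rho_of mulr1.
by rewrite psiG_rho mulrAC divff// mul1r.
Qed.

Let mES (f : S * nat -> \bar R) : measurable_fun setT f.
Proof. by move=> _ Y _; exact: measurable_tuple_ord_nat. Qed.

Lemma spin_nat_swap (f : S -> nat -> \bar R) : (forall s m, (0 <= f s m)%E) ->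
  (\int[Pg]_s \int[Po l]_m f s m = \int[Po l]_m \int[Pg]_s f s m)%E.
Proof.
move=> f0; exact: (@fubini_tonelli _ _ _ _ _ Pg (Po l) (fun y => f y.1 y.2) (mES _) (fun y => f0 y.1 y.2)).
Qed.

Lemma spin_nat_prod (f : S -> nat -> \bar R) : (forall s m, (0 <= f s m)%E) ->
  (\int[Pg \x Po l]_y f y.1 y.2 = \int[Po l]_m \int[Pg]_s f s m)%E.
Proof.
move=> f0; exact: (@fubini_tonelli2 _ _ _ _ _ Pg (Po l) (fun y => f y.1 y.2) (mES _) (fun y => f0 y.1 y.2)).
Qed.

Lemma spin_graph_prod m (f : S * graph -> \bar R) : measurable_fun setT f -> (forall y, (0 <= f y)%E) ->
  (\int[Pg \x P m]_y f (mkpair y) = \int[Pg]_s \int[P m]_x f (s, mkgraph x))%E.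
Proof.
move=> mf f0.
exact: (@fubini_tonelli1 _ _ _ _ _ Pg (P m) _ (measurableT_comp mf (@measurable_mkpair m)) (fun y => f0 _)).
Qed.

Lemma spin_graph_swap m (f : S * graph -> \bar R) : measurable_fun setT f -> (forall y, (0 <= f y)%E) ->
  (\int[Pg \x P m]_y f (mkpair y) = \int[P m]_x \int[Pg]_s f (s, mkgraph x))%E.
Proof.
move=> mf f0.
exact: (@fubini_tonelli2 _ _ _ _ _ Pg (P m) _ (measurableT_comp mf (@measurable_mkpair m)) (fun y => f0 _)).
Qed.

Section joint.
Variable d : R.
Hypothesis hl : d * n.+1%:R / K%:R = l.
Local Notation J := (joint_law p n gams d).

Let measurable_patch (f : S * graph -> R) A : measurable_fun setT f -> measurable A ->
  measurable_fun setT ((EFin \o f) \_ A).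
Proof.
move=> mf mA; apply/(measurable_restrictT _ _).1 => //; apply: measurable_funTS; exact/measurable_EFinP.
Qed.

Let jdens0 y : 0 <= jdens y. Proof. exact: (ltW (rho_of_gt0 _ _)). Qed.
Let mixd0 y : 0 <= mixd y. Proof. exact: (ltW (mix_of_gt0 _)). Qed.

Let patch0 (f : S * graph -> R) A y : (forall y, 0 <= f y) -> (0 <= ((EFin \o f) \_ A) y)%E.
Proof. by move=> f0; apply: erestrict_ge0 => z _; rewrite lee_fin. Qed.

Lemma joint_lawE A : measurable A -> (J A = \int[base]_(x in A) (jdens x)%:E)%E.
Proof.
move=> mA; rewrite integral_mkcond ge0_integral_base; last 2 first.
- exact: (measurable_patch measurable_jdens mA).
- by move=> y; exact: (patch0 _ _ jdens0).
rewrite /joint_law hl.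
transitivity (\int[Po l]_m \int[Pg]_s teacher_student p s ((fun x : G m => (s, mkgraph x)) @^-1` A))%E.
  exact: (spin_nat_prod (fun s m => measure_ge0 (teacher_student p s) ((fun x : G m => (s, mkgraph x)) @^-1` A))).
apply: eq_integral => m _; apply/esym; apply: etrans (spin_graph_prod m (measurable_patch measurable_jdens mA) (fun y => patch0 _ _ jdens0)) _; apply/esym.
apply: eq_integral => s _; rewrite teacher_studentE; last first.
  rewrite -[X in measurable X]setTI.
  suff h : measurable_fun setT (fun x : G m => (s, mkgraph x) : S * graph) by exact: h.
  by apply/measurable_fun_pair => //; exact: measurable_mkgraph.
by rewrite integral_mkcond; apply: eq_integral => x _; rewrite !patchE.
Qed.

Lemma ge0_integral_joint (f : S * graph -> \bar R) : measurable_fun setT f -> (forall x, (0 <= f x)%E) ->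
  (\int[J]_y f y = \int[Po l]_m \int[Pg \x P m]_y (f (mkpair y) * (jdens (mkpair y))%:E))%E.
Proof.
move=> mf f0; rewrite (ge0_integral_density measurable_jdens joint_lawE mf f0) ge0_integral_base//.
- by apply: emeasurable_funM => //; apply/measurable_EFinP; exact: measurable_jdens.
- by move=> y; rewrite mule_ge0// lee_fin.
Qed.

Let mS (f : S -> \bar R) : measurable_fun setT f.
Proof. by move=> _ Y _; exact: measurable_tuple_ord. Qed.

Let m_rhoE : measurable_fun setT (fun y => (jdens y)%:E).
Proof. by apply/measurable_EFinP; exact: measurable_jdens. Qed.

Lemma joint_spin (f : S -> \bar R) : (forall s, (0 <= f s)%E) -> (\int[J]_y f y.1 = \int[Pg]_s f s)%E.
Proof.
move=> f0; have mf1 : measurable_fun setT (fun y : S * graph => f y.1) := measurableT_comp (mS f) measurable_fst.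
rewrite ge0_integral_joint//.
transitivity (\int[Po l]_m \int[Pg]_s f s)%E; last first.
  by rewrite integral_cst// [X in (_ * X)%E](_ : _ = 1%E) ?mule1//; exact: probability_setT.
apply: eq_integral => m _.
pose F (y : S * graph) := (f y.1 * (jdens y)%:E)%E.
have mF : measurable_fun setT F by exact: emeasurable_funM.
have F0 y : (0 <= F y)%E by rewrite mule_ge0// lee_fin.
apply: etrans (spin_graph_prod m mF F0) _; apply: eq_integral => s _; rewrite /F /=.
rewrite ge0_integralZl//.
- by rewrite (EFin_Ex (bm_ig _ (bm_rho_of m s))) Ex_rho_of mule1.
- by apply/measurable_EFinP; exact: (bm_rho_of m s).1.
- by move=> x _; rewrite lee_fin ltW// rho_of_gt0.
Qed.

Lemma joint_graph (f : graph -> \bar R) : measurable_fun setT f -> (forall g, (0 <= f g)%E) ->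
  (\int[J]_y f y.2 = \int[Po l]_m \int[P m]_x (f (mkgraph x) * (mix_of x)%:E))%E.
Proof.
move=> mf f0; have mf1 : measurable_fun setT (fun y : S * graph => f y.2) := measurableT_comp mf measurable_snd.
rewrite ge0_integral_joint//; apply: eq_integral => m _.
pose F (y : S * graph) := (f y.2 * (jdens y)%:E)%E.
have mF : measurable_fun setT F by exact: emeasurable_funM.
have F0 y : (0 <= F y)%E by rewrite mule_ge0// lee_fin.
apply: etrans (spin_graph_swap m mF F0) _; apply: eq_integral => x _; rewrite /F /=.
have bx : bm (fun s : S => rho_of s x).
  by split=> [|]; [move=> _ Z _; exact: measurable_tuple_ord|exists ((D ^+ 2) ^+ m) => s; have /andP[_ h] := rho_of_bounds s x; rewrite gtr0_norm// rho_of_gt0].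
rewrite ge0_integralZl//.
- by rewrite (EFin_Ex (bm_ig _ bx)) Ex_spin_rho.
- by move=> s _; rewrite lee_fin ltW// rho_of_gt0.
Qed.

(** The spin marginal is the prior since [rho_of s] has mean 1 for each s; integrating the spins out
    of the joint density leaves [mix_of] for the graph. *)
Lemma marginals_prodE A : measurable A ->
  ((distribution J fst \x distribution J snd) A = \int[base]_(x in A) (mixd x)%:E)%E.
Proof.
move=> mA; rewrite integral_mkcond ge0_integral_base; last 2 first.
- exact: (measurable_patch measurable_mixd mA).
- by move=> y; exact: (patch0 _ _ mixd0).
pose c (s : S) := (\int[Po l]_m \int[P m]_x ((\1_A (s, mkgraph x))%:E * (mix_of x)%:E))%E.
have c0 s : (0 <= c s)%E.
  apply: integral_ge0 => m _; apply: integral_ge0 => x _.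
  by rewrite mule_ge0// lee_fin// ltW// mix_of_gt0.
transitivity (\int[Pg]_s c s)%E.
  rewrite -(joint_spin c0); apply: etrans (_ : _ = \int[distribution J fst]_s c s)%E _; last first.
    by rewrite ge0_integral_distribution.
  apply: eq_integral => s _ /=; have mx := measurable_xsection s mA.
  have mI : measurable_fun setT (fun g : graph => (\1_(xsection A s) g)%:E : \bar R).
    by apply/measurable_EFinP; exact: measurable_indic.
  have I0 (g : graph) : (0 <= (\1_(xsection A s) g)%:E :> \bar R)%E by rewrite lee_fin.
  transitivity (\int[J]_y (\1_(xsection A s) y.2)%:E)%E.
    have msn : measurable (@snd S graph @^-1` xsection A s).
      by rewrite -[X in measurable X]setTI; exact: measurable_snd.
    have := integral_indic J measurableT msn; rewrite setIT => h; apply: etrans (esym h) _.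
    by apply: eq_integral => y _; rewrite !indicE.
  rewrite (joint_graph mI I0); apply: eq_integral => m _; apply: eq_integral => x _.
  by rewrite !indicE mem_xsection.
rewrite (@spin_nat_swap (fun s m => \int[P m]_x ((\1_A (s, mkgraph x))%:E * (mix_of x)%:E)))%E; last first.
  move=> s m; apply: integral_ge0 => x _.
  by rewrite mule_ge0// lee_fin// ltW// mix_of_gt0.
apply: eq_integral => m _.
apply/esym; apply: etrans (spin_graph_prod m (measurable_patch measurable_mixd mA) (fun y => patch0 _ _ mixd0)) _; apply/esym.
apply: eq_integral => s _; apply: eq_integral => x _.
by rewrite patchE indicE; case: ifP => _; rewrite ?mul1e// mul0e.
Qed.

Lemma mutual_information_base :
  (mutual_information J = \int[base]_y (jdens y * ln (jdens y / mixd y))%:E)%E.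
Proof.
apply: (relative_entropy_densities measurable_jdens measurable_mixd).
- exact: jdens0.
- by move=> y; exact: mix_of_gt0.
- exact: joint_lawE.
- exact: marginals_prodE.
Qed.

End joint.

End graph_law.

(** * A formula for the mutual information *)

Section information.
Context {R : realType} {q k : nat} {lo : R} {hlo : 0 < lo < q.+1%:R^-1}.
Local Notation W := (weight k hlo).
Local Notation Q := ('I_q.+1).
Local Notation PS := (pprobability Q R).
Local Notation K := k.+1.
Variables (p : probability W R) (gams : PS) (n : nat) (l : R).
Hypothesis l0 : 0 <= l.
Local Notation gam := (pmfv gams).
Local Notation D := (lo^-1 ^+ 2).
Local Notation phi := (nphi p).
Local Notation S := (n.+1.-tuple Q).
Local Notation G m := (m.-tuple (K.-tuple 'I_n.+1 * W)).
Local Notation graph := (@Defs.graph R q k lo hlo n).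
Local Notation P m := (iid m (site n K p)).
Local Notation Pg := (iid n.+1 (gams : probability Q R)).
Local Notation base := (base p gams n l0).

Let D1 : 1 <= D := D2_ge1 (hlo := hlo).
Let D0 : 0 < D. Proof. exact: lt_le_trans D1. Qed.
Let mphi := mnphi p.
Let phiD := nphiD p.
Let gam0 z : 0 <= gam z := pmf_ge0 gams z.
Let gam1 : \sum_z gam z = 1 := sum_pmf gams.

Lemma integral_base (F : S * graph -> R) (c b : R) : measurable_fun setT F -> 0 <= b ->
  (forall m (y : S * G m), `|F (mkpair y)| <= c * b ^+ m) ->
  (\int[base]_y (F y)%:E)%E = (Ex (Po l) (fun m => Ex (Pg \x P m)%E (fun y => F (mkpair y))))%:E.
Proof.
move=> mF b0 hF.
have bF m : bm (fun y : S * G m => F (mkpair y)).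
  by split; [exact: (measurableT_comp mF (@measurable_mkpair R q k lo hlo n m))|exists (c * b ^+ m)].
pose Fp (f : S * graph -> R) y := Num.max (f y) 0.
have part (f : S * graph -> R) : measurable_fun setT f -> (forall m (y : S * G m), `|f (mkpair y)| <= c * b ^+ m) ->
    [/\ forall m, bm (fun y : S * G m => Fp f (mkpair y)),
      eg (fun m => Ex (Pg \x P m)%E (fun y => Fp f (mkpair y))) &
    (\int[base]_y (Fp f y)%:E)%E = (Ex (Po l) (fun m => Ex (Pg \x P m)%E (fun y => Fp f (mkpair y))))%:E].
  move=> mf hf.
  have mfp : measurable_fun setT (Fp f) by exact: measurable_maxr.
  have fp0 y : 0 <= Fp f y by rewrite le_max lexx orbT.
  have fb m (y : S * G m) : `|Fp f (mkpair y)| <= c * b ^+ m.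
    rewrite ger0_norm// /Fp ge_max; have := hf m y; rewrite ler_norml => /andP[h1 h2].
    by rewrite h2 (le_trans (normr_ge0 _) (hf m y)).
  have bfp m : bm (fun y : S * G m => Fp f (mkpair y)).
    by split; [exact: (measurableT_comp mfp (@measurable_mkpair R q k lo hlo n m))|exists (c * b ^+ m)].
  have e : eg (fun m => Ex (Pg \x P m)%E (fun y => Fp f (mkpair y))).
    apply: (@eg_le _ _ c b) => m; rewrite -(Ex_cst (Pg \x P m)%E (c * b ^+ m)).
    by apply: Ex_abs_le; [exact: (bm_ig _ (bfp m))|exact: ig_cst|exact: fb].
  split=> //; rewrite (ge0_integral_base p gams l0 (f := fun y => (Fp f y)%:E)).
  - rewrite -EFin_Ex; last exact: ig_eg.
    by apply: eq_integral => m _; rewrite EFin_Ex//; exact: (bm_ig _ (bfp m)).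
  - exact/measurable_EFinP.
  - by move=> y; rewrite lee_fin.
have [b1 e1 i1] := part F mF hF.
have [b2 e2 i2] : [/\ forall m, bm (fun y : S * G m => Fp (fun y => - F y) (mkpair y)),
      eg (fun m => Ex (Pg \x P m)%E (fun y => Fp (fun y => - F y) (mkpair y))) &
    (\int[base]_y (Fp (fun y => - F y) y)%:E)%E = (Ex (Po l) (fun m => Ex (Pg \x P m)%E (fun y => Fp (fun y => - F y) (mkpair y))))%:E].
  by apply: part => [|m y]; [exact: measurable_funN|rewrite normrN].
rewrite integralE.
have -> : (\int[base]_y (fun y => (F y)%:E)^\+ y = \int[base]_y (Fp F y)%:E)%E.
  by apply: eq_integral => y _; rewrite funeposE /= -EFin_max.
have -> : (\int[base]_y (fun y => (F y)%:E)^\- y = \int[base]_y (Fp (fun y => - F y)%R y)%:E)%E.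
  by apply: eq_integral => y _; rewrite funenegE /= -EFin_max.
rewrite i1 i2 -EFinB -(ExB (ig_eg l0 e1) (ig_eg l0 e2)); congr EFin; congr Ex; apply/funext => m.
rewrite -(ExB (bm_ig _ (b1 m)) (bm_ig _ (b2 m))); congr Ex; apply/funext => y.
rewrite /Fp; case: (leP 0 (F (mkpair y))) => h.
  by rewrite (@max_r _ _ (- F (mkpair y))) ?subr0// oppr_le0.
by rewrite (@max_l _ _ (- F (mkpair y))) ?oppr_ge0 ?(ltW h)// sub0r opprK.
Qed.

Definition eF : R := \sum_s P0 gam s * Ex (site n K p) (fun x => Lambda (wT p phi x s)).

Let bw (s : S) : bm (fun x => wT p phi x s).
Proof.
split; first exact: (measurable_wT p mphi phiD D1 s).
exists (D ^+ 2) => x; have /andP[h1 h2] := wT_bounds p mphi phiD D1 x s.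
by rewrite ger0_norm//; apply: le_trans h1; rewrite invr_ge0 sqr_ge0.
Qed.

Let w0 (s : S) x : 0 < wT p phi x s.
Proof.
have /andP[h1 h2] := wT_bounds p mphi phiD D1 x s.
by apply: lt_le_trans h1; rewrite invr_gt0 exprn_gt0.
Qed.

Let level m : Ex (Pg \x P m)%E (fun y : S * G m => jdens p (mkpair y) * ln (jdens p (mkpair y) / mixd p gams (mkpair y))) =
  m%:R * eF - Ex (P m) (fun x : G m => Lambda (mix_of p gams x)).
Proof.
pose f (s : S) (x : G m) := rho_of p s x * ln (rho_of p s x / mix_of p gams x).
have fE s x : f s x = Lambda (rho_of p s x) - rho_of p s x * ln (mix_of p gams x).
  by rewrite /f ln_div ?posrE ?rho_of_gt0 ?mix_of_gt0// mulrBr.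
have bln : bm (fun x : G m => ln (mix_of p gams x)).
  split; first exact: (measurableT_comp (@measurable_ln R) (bm_mix_of p gams n m).1).
  exists ((D ^+ 2) ^+ m + (D ^+ 2) ^+ m) => x; have g0 := mix_of_gt0 p gams x.
  apply: le_trans (ln_abs_le g0) _; have /andP[h1 h2] := mix_of_bounds p gams x.
  have Em : 0 < (D ^+ 2) ^+ m by rewrite exprn_gt0// exprn_gt0.
  apply: lerD => //; rewrite -[leRHS]invrK lef_pV2 ?posrE ?invr_gt0//.
  by rewrite -exprVn.
have bf s : bm (f s).
  rewrite (_ : f s = fun x => Lambda (rho_of p s x) - rho_of p s x * ln (mix_of p gams x)); last first.
    by apply/funext => x; exact: fE.
  apply: bmB; first by apply: bm_Lambda; exact: bm_rho_of.
  by apply: bmM => //; exact: bm_rho_of.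
have bff : bm (fun y : S * G m => f y.1 y.2).
  apply: (@bm_fin R _ (S * G m)%type _ fst (fun s y => f s y.2)) => s.
    by apply: (measurableT_comp (f := fun u : S => (u == s)%:R : R)); [move=> _ Z _; exact: measurable_tuple_ord|exact: measurable_fst].
  exact: (bm_comp measurable_snd (bf s)).
apply: etrans (Ex_prod_bm (f := f) Pg (P m) bff) _.
rewrite Ex_iid_finite.
have E s : Ex (P m) (f s) = m%:R * Ex (site n K p) (fun x => Lambda (wT p phi x s)) -
    Ex (P m) (fun x => rho_of p s x * ln (mix_of p gams x)).
  rewrite (_ : f s = fun x => Lambda (rho_of p s x) - rho_of p s x * ln (mix_of p gams x)); last first.
    by apply/funext => x; exact: fE.
  rewrite (ExB (bm_ig _ (bm_Lambda (bm_rho_of p m s))) (bm_ig _ (bmM (bm_rho_of p m s) bln))); congr (_ - _).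
  by rewrite /rho_of (Ex_iid_Lambda _ m (bw s) (w0 s)) Ex_wT expr1n mulr1.
rewrite (eq_bigr (fun s => m%:R * (P0 gam s * Ex (site n K p) (fun x => Lambda (wT p phi x s))) -
  Ex (P m) (fun x => P0 gam s * (rho_of p s x * ln (mix_of p gams x))))); last first.
  move=> s _; rewrite E mulrBr mulrCA (ExZ _ (bm_ig _ (bmM (bm_rho_of p m s) bln))).
  by [].
rewrite sumrB -mulr_sumr; congr (_ - _).
rewrite -Ex_sum; last by move=> s; apply: bm_ig; apply: bmZ; exact: (bmM (bm_rho_of p m s) bln).
congr Ex; apply/funext => x; rewrite /Lambda {2}/mix_of mulr_suml; apply: eq_bigr => s _.
by rewrite mulrA.
Qed.

(** The logarithm of the quotient of densities splits. Its numerator gives a single-factor entropy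
    per factor, l factors on average; averaging [rho_of] over the spins turns the denominator into
    the mean of [Lambda (mix_of x)], which is [UT]. *)
Lemma mutual_information_formula d : d * n.+1%:R / K%:R = l ->
  (mutual_information (joint_law p n gams d) = (l * eF - UT p phi (n := n) l F0 (P0 gam (n := n)))%:E)%E.
Proof.
move=> hl; rewrite (mutual_information_base p gams l0 hl).
pose F (y : S * graph) := jdens p y * ln (jdens p y / mixd p gams y).
have D20 : 0 < D ^+ 2 by rewrite exprn_gt0.
have mF : measurable_fun setT F.
  have -> : F = fun y => jdens p y * (ln (jdens p y) - ln (mixd p gams y)).
    by apply/funext => y; rewrite /F ln_div ?posrE ?rho_of_gt0 ?mix_of_gt0.
  apply: measurable_funM; first exact: measurable_jdens.
  apply: measurable_funB; apply: (measurableT_comp (@measurable_ln R)); first exact: measurable_jdens.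
  exact: measurable_mixd.
have hF m (y : S * G m) : `|F (mkpair y)| <= 4 * (D ^+ 2 * D ^+ 2) ^+ m.
  have r0 : 0 < jdens p (mkpair y) by exact: rho_of_gt0.
  have g0 : 0 < mixd p gams (mkpair y) by exact: mix_of_gt0.
  have rb : (D ^+ 2)^-1 ^+ m <= jdens p (mkpair y) <= (D ^+ 2) ^+ m by exact: rho_of_bounds.
  have gb : (D ^+ 2)^-1 ^+ m <= mixd p gams (mkpair y) <= (D ^+ 2) ^+ m by exact: mix_of_bounds.
  have Em : 0 < (D ^+ 2) ^+ m by rewrite exprn_gt0.
  have lnb u : 0 < u -> (D ^+ 2)^-1 ^+ m <= u <= (D ^+ 2) ^+ m -> `|ln u| <= (D ^+ 2) ^+ m + (D ^+ 2) ^+ m.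
    move=> u0 /andP[h1 h2]; apply: le_trans (ln_abs_le u0) _; apply: lerD => //.
    by rewrite -[leRHS]invrK lef_pV2 ?posrE ?invr_gt0// -exprVn.
  rewrite /F normrM gtr0_norm// ln_div ?posrE// exprMn.
  have -> : 4 * ((D ^+ 2) ^+ m * (D ^+ 2) ^+ m) = (D ^+ 2) ^+ m * (((D ^+ 2) ^+ m + (D ^+ 2) ^+ m) + ((D ^+ 2) ^+ m + (D ^+ 2) ^+ m)).
    by move: ((D ^+ 2) ^+ m) => e; ring.
  apply: ler_pM => //; [exact: ltW|by case/andP: rb|].
  by apply: le_trans (ler_normB _ _) _; apply: lerD; exact: lnb.
have DD0 : 0 <= D ^+ 2 * D ^+ 2 by rewrite mulr_ge0// ltW.
rewrite (integral_base mF DD0 hF); congr EFin.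
rewrite (_ : (fun m => _) = (fun m => m%:R * eF - Ex (P m) (fun x : G m => Lambda (mix_of p gams x)))); last first.
  by apply/funext => m; exact: level.
have e1 : eg (fun m => m%:R * eF) by apply: egM; [exact: eg_nat|exact: eg_cst].
have e2 : eg (fun m => Ex (P m) (fun x : G m => Lambda (mix_of p gams x))).
  apply: (@eg_le _ _ 2 ((D ^+ 2) ^+ 2)) => m.
  have Dm : 0 <= (D ^+ 2) ^+ m by rewrite exprn_ge0// ltW.
  apply: le_trans (_ : 1 + ((D ^+ 2) ^+ m) ^+ 2 <= _); last first.
    rewrite exprAC; have : 1 <= ((D ^+ 2) ^+ 2) ^+ m by do 3! apply: exprn_ege1.
    lra.
  rewrite -(Ex_cst (P m) (1 + _)); apply: Ex_abs_le; [exact: (bm_ig _ (bm_Lambda (bm_mix_of p gams n m)))|exact: ig_cst|].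
  move=> x; apply: le_trans (Lambda_bound _) _; rewrite lerD2l ler_sqr ?nnegrE//; last exact: (ltW (mix_of_gt0 _ _ _)).
  by have /andP[] := mix_of_bounds p gams x.
rewrite (ExB (ig_eg l0 e1) (ig_eg l0 e2)); congr (_ - _).
  have -> : (fun m => m%:R * eF) = (fun m => eF * m%:R) by apply/funext => m; rewrite mulrC.
  by rewrite (ExZ _ (ig_eg l0 (@eg_nat R))) Ex_Po_nat// mulrC.
by rewrite (UT_iid p mphi phiD D1 gam0).
Qed.

End information.

(** * Proof of the theorem *)

Section edge_entropy.
Context {R : realType} {k : nat} {Q : finType} {d : measure_display} {Y : measurableType d}.
Local Notation K := k.+1.
Variables (p : probability Y R) (phi : Y -> K.-tuple Q -> R) (D : R) (gam : Q -> R).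
Hypotheses (mphi : forall t, measurable_fun setT (fun y => phi y t))
  (phiD : forall y t, D^-1 <= phi y t <= D) (D1 : 1 <= D)
  (gam0 : forall z, 0 <= gam z) (gam1 : \sum_z gam z = 1) (Zgam : Zb p phi gam = 1).

Let D0 : 0 < D. Proof. by apply: lt_le_trans D1. Qed.

Definition edge (g : Q -> R) : R := \sum_t Ex p (fun y => Lambda (phi y t)) * \prod_h g (tnth t h).

Let edge_term t : `|Ex p (fun y => Lambda (phi y t))| <= 1 + D ^+ 2.
Proof.
rewrite -(Ex_cst p (1 + D ^+ 2)); apply: Ex_abs_le; [exact: (bm_ig _ (bm_Lambda (bm_phi mphi phiD D1 t)))|exact: ig_cst|].
move=> y; apply: le_trans (Lambda_bound _) _; have /andP[h1 h2] := phiD y t.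
rewrite lerD2l ler_sqr ?nnegrE ?(ltW D0)//; apply: le_trans h1; by rewrite invr_ge0 ltW.
Qed.

Let edge_lip f g : (forall z, 0 <= f z) -> (forall z, 0 <= g z) -> \sum_z f z = 1 -> \sum_z g z = 1 ->
  `|edge f - edge g| <= (1 + D ^+ 2) * (K%:R * dist1 f g).
Proof.
move=> f0 g0 f1 g1; rewrite /edge -sumrB; apply: le_trans (ler_norm_sum _ _ _) _.
apply: le_trans (_ : (1 + D ^+ 2) * \sum_(t : K.-tuple Q) `|\prod_h f (tnth t h) - \prod_h g (tnth t h)| <= _).
  by rewrite mulr_sumr; apply: ler_sum => t _; rewrite -mulrBr normrM ler_wpM2r.
apply: ler_wpM2l; first by rewrite addr_ge0// sqr_ge0.
apply: le_trans (prod_dist (f := fun=> f) (g := fun=> g) _ _ _ _) _ => //.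
by rewrite sumr_const card_ord -[X in X <= _]mulr_natl.
Qed.

Let edge_bound g : (forall z, 0 <= g z) -> \sum_z g z = 1 -> `|edge g| <= 1 + D ^+ 2.
Proof.
move=> g0 g1; apply: le_trans (ler_norm_sum _ _ _) _.
have s1 : \sum_(t : K.-tuple Q) \prod_h g (tnth t h) = 1 by rewrite (sum_tuple_prod (fun=> g)) big1.
rewrite -[leRHS]mulr1 -[X in _ <= _ * X]s1 mulr_sumr; apply: ler_sum => t _.
rewrite normrM [X in _ * X]ger0_norm; last by apply: prodr_ge0.
by apply: ler_wpM2r => //; apply: prodr_ge0.
Qed.

Definition cE : R := (D * (1 + D ^+ 2) + 1) * (D * K%:R) + (1 + D ^+ 2) * K%:R + (D * (D * K%:R)).

Lemma cE_ge0 : 0 <= cE.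
Proof. by rewrite /cE !addr_ge0// !mulr_ge0// ?addr_ge0 ?mulr_ge0 ?addr_ge0 ?sqr_ge0// ltW. Qed.

Lemma edge_site n (s : n.+1.-tuple Q) :
  Ex (site n K p) (fun x => Lambda (wT p phi x s)) = (zeta p phi s)^-1 * edge (emp s) - ln (zeta p phi s).
Proof.
have /andP[z1 z2] := Zb_bounds p mphi phiD D1 (emp_ge0 s) (sum_emp s).
have z0 : 0 < zeta p phi s by apply: lt_le_trans z1; rewrite invr_gt0.
have zi : 0 < (zeta p phi s)^-1 by rewrite invr_gt0.
have w0 x : 0 <= wF phi x s by exact: (wF_ge0 phiD D1).
rewrite (_ : (fun x => _) = (fun x => Lambda ((zeta p phi s)^-1 * wF phi x s))); last first.
  by apply/funext => x; rewrite mulrC.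
rewrite (Ex_Lambda_scale _ zi (bm_wF mphi phiD D1 s) w0) (Ex_wF p mphi phiD D1); congr (_ * _ + _).
  rewrite (Ex_site p (f := fun i y => Lambda (phi y (spt (@spin Q n) i s)))); last first.
    by move=> i; apply: bm_Lambda; exact: bm_phi.
  exact: (avg_spt (fun t => Ex p (fun y => Lambda (phi y t)))).
by rewrite /Lambda mulrAC mulVf ?gt_eqF// mul1r lnV.
Qed.

(** By [edge_site] the entropy of one normalized factor is a smooth function of the type alone, and
    at the type gam, where zeta would be 1, it equals [edge gam]. *)
Lemma edge_close n (s : n.+1.-tuple Q) :
  `|Ex (site n K p) (fun x => Lambda (wT p phi x s)) - edge gam| <= cE * dev gam s.
Proof.
rewrite edge_site; have ez := Zb_lip p mphi phiD D1 (emp_ge0 s) gam0 (sum_emp s) gam1.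
have ee := edge_lip (emp_ge0 s) gam0 (sum_emp s) gam1.
have eb := edge_bound (emp_ge0 s) (sum_emp s).
have /andP[z1 z2] := Zb_bounds p mphi phiD D1 (emp_ge0 s) (sum_emp s).
rewrite Zgam in ez; move: ez ee eb z1 z2; rewrite -/(zeta p phi s) -/(dev gam s).
set e := dev gam s; have : 0 <= e by exact: dist1_ge0.
move: (zeta p phi s) (edge (emp s)) (edge gam) e => z A B e e0 ez ee eb z1 z2.
have z0 : 0 < z by apply: lt_le_trans z1; rewrite invr_gt0.
have iz : z^-1 <= D by rewrite -[leRHS]invrK lef_pV2 ?posrE ?invr_gt0.
have i1 : `|z^-1 - 1| <= D * (D * K%:R * e).
  rewrite (_ : z^-1 - 1 = - (z^-1 * (z - 1))); last by rewrite mulrBr mulVf ?gt_eqF// mulr1 opprB.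
  by rewrite normrN normrM gtr0_norm ?invr_gt0//; apply: ler_pM => //; rewrite invr_ge0 ltW.
have l1 : `|ln z| <= D * (D * K%:R * e).
  have h1 := ln_le_sub1 z0; have zi : 0 < z^-1 by rewrite invr_gt0.
  have h2 := ln_le_sub1 zi; rewrite lnV// in h2.
  have h3 : D * K%:R * e <= D * (D * K%:R * e) by rewrite ler_peMl// !mulr_ge0// ltW.
  move: ez i1 h3; rewrite !ler_norml => /andP[? ?] /andP[? ?] ?; lra.
have -> : z^-1 * A - ln z - B = (z^-1 - 1) * A + (A - B) - ln z by ring.
apply: le_trans (ler_normB _ _) _.
apply: le_trans (lerD (ler_normD _ _) (lexx _)) _; rewrite normrM.
apply: le_trans (lerD (lerD (ler_pM _ _ i1 eb) ee) l1) _ => //.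
have : 0 <= D * K%:R * e by rewrite !mulr_ge0// ltW.
rewrite /cE; move: (1 + D ^+ 2) => c; move: (K%:R : R) => kk h.
rewrite -subr_ge0 [leRHS](_ : _ = D * kk * e)//; ring.
Qed.

Lemma edge_rate n : `|\sum_s P0 gam (n := n) s * Ex (site n K p) (fun x => Lambda (wT p phi x s)) - edge gam| <=
  cE * (#|Q|%:R * rr n).
Proof.
have -> : edge gam = \sum_s P0 gam (n := n) s * edge gam.
  by rewrite -mulr_suml -/(mass _) (mass_P0 gam1) mul1r.
rewrite -sumrB; apply: le_trans (ler_norm_sum _ _ _) _.
apply: le_trans (_ : \sum_s cE * (dev gam s * P0 gam (n := n) s) <= _).
  apply: ler_sum => s _; rewrite -mulrBr normrM ger0_norm ?P0_ge0// mulrC mulrA ler_wpM2r ?P0_ge0//.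
  exact: edge_close.
rewrite -mulr_sumr; apply: ler_wpM2l; last exact: ell_dev_P0.
exact: cE_ge0.
Qed.

End edge_entropy.

Lemma rate_arith (R : realType) (U P nb b a1 a3 c1 c2 c3 c4 B c5 : R) :
  `|P - U| <= a3 -> a3 <= c3 -> P <= nb + a1 -> a1 <= c1 -> nb + b <= P + (c2 + c4) -> c4 <= c5 ->
  B <= c5 -> `|b| <= B -> 0 <= c1 -> 0 <= c2 -> `|U - (nb + b)| <= c1 + c2 + c3 + c5.
Proof. by rewrite !ler_norml => /andP[? ?] ? ? ? ? ? ? /andP[? ?] ? ?; lra. Qed.

(** * Combination of the bounds *)

Section final.
Context {R : realType} {q k : nat} {lo : R} {hlo : 0 < lo < q.+1%:R^-1}.
Local Notation W := (weight k hlo).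
Local Notation Q := ('I_q.+1).
Local Notation PS := (pprobability Q R).
Local Notation K := k.+1.
Variables (p : probability W R) (gams : PS).
Hypothesis hA : frakA p gams.
Variables (d L : R).
Hypotheses (d0 : 0 <= d) (dL : d * K%:R <= L).
Local Notation gam := (pmfv gams).
Local Notation D := (lo^-1 ^+ 2).
Local Notation phi := (nphi p).
Local Notation x := (xi p).

Let lo01 : 0 < lo <= 1.
Proof.
have /andP[l0 /ltW h] := hlo; rewrite l0; apply: le_trans h _.
by rewrite invf_le1 ?ltr0n// ler1n.
Qed.
Let x0 : 0 < x := xi_gt0 p.
Let D1 : 1 <= D := D2_ge1 (hlo := hlo).
Let mphi := mnphi p.
Let phiD := nphiD p.
Let gam0 z : 0 <= gam z := pmf_ge0 gams z.
Let gam1 : \sum_z gam z = 1 := sum_pmf gams.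
Let L0 : 0 <= L. Proof. by apply: le_trans dL; rewrite mulr_ge0. Qed.
Let dkL : d / K%:R <= L.
Proof.
rewrite ler_pdivrMr ?ltr0n//; apply: le_trans (_ : L * 1 <= _); last by apply: ler_wpM2l => //; rewrite ler1n.
by rewrite mulr1; apply: le_trans dL; rewrite ler_peMr// ler1n.
Qed.

Definition cb : R := (1 + expR (L * D ^+ 2)) + L * (1 + D ^+ 2) + L * (2 * lo^-1).

Let betheS := [set betheR p gams pi d | pi in mean_eq gams].

Let mean_dirac : mean_eq gams (@dirac _ PS gams R).
Proof. by move=> z; exact: (Ex_dirac gams (measurable_pmf z)). Qed.

Let betheS0 : betheS !=set0.
Proof. by exists (betheR p gams (@dirac _ PS gams R) d); exists (@dirac _ PS gams R). Qed.

Let betheSub : has_ubound betheS.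
Proof.
exists cb => _ [pi _ <-]; have [_ h] := betheR_bound p gams pi d0 dL.
exact: le_trans (ler_norm _) h.
Qed.

Lemma bethe_supE : bethe_sup p gams d = (sup betheS)%:E.
Proof.
rewrite /bethe_sup -(ereal_sup_EFin betheSub betheS0); congr ereal_sup; apply/seteqP; split.
  by move=> _ [pi hpi <-]; rewrite (bethe_betheR hA hpi d0); exists (betheR p gams pi d) => //; exists pi.
by move=> _ [_ [pi hpi <-] <-]; exists pi => //; rewrite (bethe_betheR hA hpi d0).
Qed.

Let sup_bound : `|sup betheS| <= cb.
Proof.
rewrite ler_norml; apply/andP; split.
  apply: le_trans (ub_le_sup betheSub (_ : betheS (betheR p gams (@dirac _ PS gams R) d))); last by exists (@dirac _ PS gams R).
  have [_] := betheR_bound p gams (@dirac _ PS gams R) d0 dL; rewrite ler_norml => /andP[h _]; exact: h.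
apply: ge_sup => // _ [pi _ <-]; have [_ h] := betheR_bound p gams pi d0 dL.
exact: le_trans (ler_norm _) h.
Qed.

(** Absolute values make the constants visibly nonnegative, so that the error terms can be added
    without sign considerations. *)
Definition cP1 : R := `|cErr (Q := Q) k D L (cM1 (k := k) D lo L)|.
Definition cP2 : R := `|cErrI (Q := Q) k D L (cM2 (k := k) D lo) + cErr (Q := Q) 0 D L 0|.
Definition cP3 : R := `|cTSP k Q D L|.
Definition cU1 : R := cP1 + cP2 + cP3 + (cb + L * (2 * lo^-1)).

(** The limit per vertex of [Phi], which is built from the normalized weights: the Bethe supremum
    without its contribution of ln xi. *)
Let b_ := sup betheS - d / K%:R * ln x.

Let lnx : `|d / K%:R * ln x| <= L * (2 * lo^-1).
Proof.
rewrite normrM; apply: ler_pM => //; first by rewrite ger0_norm// divr_ge0.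
have /andP[l1 l2] := xi_bounds p; apply: le_trans (ln_abs_le x0) _.
rewrite [2 * _]mulrDl mul1r; apply: lerD => //.
by rewrite lef_pV2 ?posrE//; have /andP[] := hlo.
Qed.

Let b_bound : `|b_| <= cb + L * (2 * lo^-1).
Proof. by apply: le_trans (ler_normB _ _) _; exact: lerD. Qed.

Lemma bethe_rate n : `|UT p phi (n := n) (d * n.+1%:R / K%:R) F0 (P0 gam (n := n)) - n.+1%:R * b_| <= cU1 * rate n.
Proof.
have h3 := teacher_student_rate mphi phiD D1 gam0 gam1 (Zb_gam hA) n d0 dL.
have up : Phi p phi gam n d 0 <= n%:R * b_ + cErr (Q := Q) k D L (cM1 (k := k) D lo L) * rate n.
  apply: (Phi_upper mphi phiD D1 lo01 (gam_lo hA) gam1 (Zb_gam hA) (stat_gam hA) d0 dL n (B := b_)) => m a a0 A0.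
  rewrite (site_upper hA a0 A0) /b_ lerBrDr.
  by apply: (ub_le_sup betheSub); exists (pi_site (lo := lo) gams a) => //; exact: (mean_pi_site hA a0 A0).
have r1 := @rate_ge1 R n; have r0 : 0 <= rate n :> R by apply: le_trans r1.
have cu0 : 1 + expR (L * D ^+ 2) <= cb.
  by rewrite /cb -addrA lerDl addr_ge0// !mulr_ge0// ?addr_ge0 ?sqr_ge0// ?mulr_ge0 ?invr_ge0//; case/andP: lo01 => /ltW.
(* [Phi_lower] holds for each pi with the same error, so the supremum can be taken. It supplies one
   vertex term fewer than edge terms; cb bounds the missing [uP]. *)
have low : n.+1%:R * b_ <= Phi p phi gam n d 0 + (cP2 + cb) * rate n.
  have N0 : 0 < n.+1%:R :> R by rewrite ltr0n.
  rewrite -ler_pdivlMl// /b_ lerBlDr; apply: ge_sup => // _ [pi hpi <-].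
  have [hu _] := betheR_bound p gams pi d0 dL.
  have := Phi_lower mphi phiD D1 lo01 (gam_lo hA) gam1 (Zb_gam hA) (stat_gam hA) d0 dL n (@pmfs_pmf R q) hpi
    (fun m a a0 A0 => site_nabla hA a0 A0 hpi).
  rewrite /betheR lerD2r ler_pdivlMl//.
  have c2 : (cErrI (Q := Q) k D L (cM2 (k := k) D lo) + cErr (Q := Q) 0 D L 0) * rate n <= cP2 * rate n.
    by apply: ler_wpM2r => //; exact: ler_norm.
  have cr : cb <= cb * rate n.
    rewrite ler_peMr//; apply: le_trans cu0; by rewrite addr_ge0// expR_ge0.
  have hu2 : uP p phi gam pi pmfv d <= cb by apply: le_trans (ler_norm _) (le_trans hu cu0).
  rewrite -natr1 (mulrDl cP2); move: c2 cr hu2.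
  move: (Phi _ _ _ _ _ _) (uP _ _ _ _ _ _) (zP _ _ _ _) (_ * rate n) (cP2 * rate n) (cb * rate n) => P u z c2 c2' cb'.
  move=> h1 h2 h4; rewrite !mulrDl !mul1r.
  have -> : d * k%:R / K%:R * z = d / K%:R * (k%:R * z) by ring.
  by move: (d / K%:R * _) => w ?; rewrite mulrBr; lra.
have c1 : cErr (Q := Q) k D L (cM1 (k := k) D lo L) * rate n <= cP1 * rate n.
  by apply: ler_wpM2r => //; exact: ler_norm.
have c3 : cTSP k Q D L * rate n <= cP3 * rate n by apply: ler_wpM2r => //; exact: ler_norm.
have cbb : cb + L * (2 * lo^-1) <= (cb + L * (2 * lo^-1)) * rate n.
  by rewrite ler_peMr//; apply: le_trans b_bound.
have cbL : cb * rate n <= (cb + L * (2 * lo^-1)) * rate n.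
  by apply: ler_wpM2r => //; rewrite lerDl; apply: le_trans lnx.
have p10 : 0 <= cP1 * rate n by rewrite mulr_ge0// normr_ge0.
have p20 : 0 <= cP2 * rate n by rewrite mulr_ge0// normr_ge0.
have -> : cU1 * rate n = cP1 * rate n + cP2 * rate n + cP3 * rate n + (cb + L * (2 * lo^-1)) * rate n.
  by rewrite /cU1 !mulrDl.
have Nb : n.+1%:R * b_ = n%:R * b_ + b_ by rewrite -natr1 mulrDl mul1r.
rewrite Nb (mulrDl cP2) in low; rewrite Nb.
exact: (rate_arith h3 c3 up c1 low cbL cbb b_bound p10 p20).
Qed.

Lemma edge_formula : (\int[p \x iid K (gams : probability Q R)]_y (Lambda (weight_fun y.1 y.2))%:E)%E =
  (x * edge p phi gam + Lambda x)%:E.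
Proof.
have bt : bm (fun y : W * K.-tuple Q => phi y.1 y.2).
  apply: (@bm_fin R _ (W * K.-tuple Q)%type _ snd (fun t y => phi y.1 t)) => t.
    by apply: (measurableT_comp (f := fun u : K.-tuple Q => (u == t)%:R : R)); [move=> _ Z _; exact: measurable_tuple_ord|exact: measurable_snd].
  exact: (bm_comp measurable_fst (bm_phi mphi phiD D1 t)).
have pp (y : W * K.-tuple Q) : 0 <= phi y.1 y.2.
  have /andP[h _] := phiD y.1 y.2; apply: le_trans h.
  by rewrite invr_ge0 exprn_ge0// invr_ge0; case/andP: lo01 => /ltW.
transitivity (\int[p \x iid K (gams : probability Q R)]_y (Lambda (x * phi y.1 y.2))%:E)%E.
  by apply: eq_integral => y _; rewrite /nphi mulrC divfK// gt_eqF.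
rewrite EFin_Ex; last by apply: bm_ig; apply: bm_Lambda; apply: bmZ.
congr EFin; rewrite (Ex_Lambda_scale _ x0 bt pp).
have fin (F : W -> K.-tuple Q -> R) : (forall t, bm (F ^~ t)) -> bm (fun y => F y.1 y.2) ->
    Ex (p \x iid K (gams : probability Q R))%E (fun y => F y.1 y.2) = \sum_t Ex p (F ^~ t) * \prod_h gam (tnth t h).
  move=> bF b2; rewrite (Ex_prod_bm (f := F) _ _ b2) (Ex_swap_bm (f := F) _ _ b2) Ex_iid_finite.
  by apply: eq_bigr => t _; rewrite mulrC.
rewrite (fin (fun y t => Lambda (phi y t))).
- rewrite (fin (fun y t => phi y t) (bm_phi mphi phiD D1) bt); congr (_ + _).
  rewrite -[RHS]mulr1 -[X in _ = _ * X](Zb_gam hA) /Zb Ex_sum; last first.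
    by move=> t; apply: bm_ig; apply: bmM; [exact: (bm_phi mphi phiD D1)|exact: bm_cst].
  congr (_ * _); apply: eq_bigr => t _; rewrite mulrC -(ExZ _ (bm_ig p (bm_phi mphi phiD D1 t))).
  by congr Ex; apply/funext => y; rewrite mulrC.
- by move=> t; apply: bm_Lambda; exact: (bm_phi mphi phiD D1).
- exact: bm_Lambda.
Qed.

Definition cF : R := cU1 + L * (cE (k := k) D * #|Q|%:R).

Lemma information_rate n :
  (`| (n.+1%:R^-1)%:E * mutual_information (joint_law p n gams d)
        - ((d / (K%:R * x))%:E * \int[p \x iid K gams]_y (Lambda (weight_fun y.1 y.2))%:E
           - bethe_sup p gams d) | <= (cF * n.+1%:R `^ (- (1 / 8)))%:E)%E.
Proof.
have N0 : 0 < n.+1%:R :> R by rewrite ltr0n.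
have l0 : 0 <= d * n.+1%:R / K%:R by rewrite divr_ge0// mulr_ge0.
rewrite (mutual_information_formula p gams l0 erefl) bethe_supE edge_formula -!EFinM -!EFinB abse_EFin lee_fin.
have hb := bethe_rate n; have he := edge_rate mphi phiD D1 gam0 gam1 (Zb_gam hA) n.
rewrite -/(eF p gams n) in he.
have K0 : K%:R != 0 :> R by rewrite pnatr_eq0.
have xn : x != 0 by rewrite gt_eqF.
set r := n.+1%:R `^ _.
have rE : rate n = n.+1%:R * r :> R.
  have -> : n.+1%:R * r = n.+1%:R `^ 1 * r by rewrite (powRr1 (ltW N0)).
  rewrite /rate /r -powRD; last by apply/implyP => _; rewrite gt_eqF.
  by congr (_ `^ _); field.
have rrr : rr n <= r :> R by apply: ler_powR; [rewrite ler1n|lra].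
set U := UT _ _ _ _ _ in hb *; set e := eF _ _ _ in he *; set f := edge _ _ _ in he *.
(* The summand d / (K x) * Lambda x = d / K * ln x of the edge term cancels the correction in [b_];
   what is left are the errors of the factor entropy and of the free entropy. *)
have -> : n.+1%:R^-1 * (d * n.+1%:R / K%:R * e - U) - (d / (K%:R * x) * (x * f + Lambda x) - sup betheS) =
  d / K%:R * (e - f) - n.+1%:R^-1 * (U - n.+1%:R * b_).
  rewrite /b_ /Lambda; move: (ln x) (sup betheS) => lx s.
  by move: (n.+1%:R : R) (K%:R : R) x N0 K0 xn => NN KK y /lt0r_neq0 NN0 KK0 y0; field; rewrite NN0 KK0 y0.
apply: le_trans (ler_normB _ _) _; rewrite /cF mulrDl addrC; apply: lerD.
  rewrite normrM gtr0_norm ?invr_gt0// ler_pdivrMl// mulrCA -rE; exact: hb.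
rewrite normrM ger0_norm ?divr_ge0// -[leRHS]mulrA; apply: ler_pM => //; first by rewrite divr_ge0.
apply: le_trans he _; rewrite -mulrA; apply: ler_wpM2l; first exact: cE_ge0.
exact: ler_wpM2l.
Qed.

End final.

Theorem theorem2p6 (R : realType) (q k : nat) (lo : R)
    (hlo : 0 < lo < q.+1%:R^-1) (d_up : R) (hd_up : 0 < d_up) :
  exists rho c : R, [/\ 0 < rho, 0 < c &
    forall (p : probability (weight k hlo) R) (gams : pprobability 'I_q.+1 R),
      frakA p gams ->
    forall d : R, 0 <= d <= d_up ->
    forall n : nat,
    (`| (n.+1%:R^-1)%:E * mutual_information (joint_law p n gams d)
        - ((d / (k.+1%:R * xi p))%:E *
             \int[p \x iid k.+1 gams]_x (Lambda (weight_fun x.1 x.2))%:E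
           - bethe_sup p gams d) |
     <= (c * n.+1%:R `^ (- rho))%:E)%E].
Proof.
(* [d_up * k.+1%:R] bounds d times the arity for all admissible d, so the constant depends on q, k,
   lo and d_up alone. Adding 1 to its absolute value makes it positive. *)
pose c0 := @cF R q k lo (d_up * k.+1%:R).
exists (1 / 8), (1 + `|c0|); split; [lra|by rewrite ltr_pwDl|].
move=> p gams hA d /andP[d0 dd] n.
have dL : d * k.+1%:R <= d_up * k.+1%:R by rewrite ler_wpM2r.
apply: le_trans (information_rate hA d0 dL n) _.
rewrite lee_fin ler_wpM2r ?powR_ge0//; apply: le_trans (ler_norm _) _.
by rewrite lerDr.
Qed.
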